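(* Let $N \geq 1$ and $p \in (1,\infty)$. (1) There exists a constant $C = C(N,p) > 0$ such that for all $0 \leq r < s < t \leq 1$ and all $f \in \mathscr{S}(\mathbb{R}^N)$, $$[f]_{\dot W^{s,p}(\mathbb{R}^N)} \leq C \left(\frac{1}{(s-r)^{1/p}}\, [f]_{\dot{F}^{r}_{p,2}(\mathbb{R}^N)} + \frac{1}{(t-s)^{1/p}}\, [f]_{\dot{F}^{t}_{p,2}(\mathbb{R}^N)} \right).$$ (2) Let $\Lambda > 1$. There exists a constant $C = C(N,p,\Lambda) > 0$ such that the following holds: let $s \in [1-\frac{1}{2\Lambda}, 1)$, let $\bar{r} \in (0,s)$ be such that $1-\bar{r}=\Lambda (1-s)$, and let $r \in [0,\bar{r}]$. Then for every $f \in \mathscr{S}(\mathbb{R}^N)$, $$[f]_{\dot{F}^{r}_{p,2}(\mathbb{R}^N)} \leq C \left(\|f\|_{L^p(\mathbb{R}^N)} + (1-s)^{1/p} [f]_{\dot W^{s,p}(\mathbb{R}^N)}\right).$$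
   Context: $\mathscr{S}(\mathbb{R}^N)$ is the space of Schwartz functions on $\mathbb{R}^N$, and $\mathcal{F}f(\xi)=\int_{\mathbb{R}^N} f(x)e^{-ix\cdot\xi}\,dx$ is the Fourier transform. Littlewood-Paley projections: fix once and for all a real-valued $\eta \in \mathscr{S}(\mathbb{R}^N)$ with $\eta(-z)=\eta(z)$ and $\mathcal{F}\eta(\xi)=\mathcal{F}\eta_0(\xi)-\mathcal{F}\eta_0(2\xi)$, where $\eta_0$ is a Schwartz function with $\mathcal{F}\eta_0(\xi)=1$ for $|\xi|\le 1$ and $\mathcal{F}\eta_0(\xi)=0$ for $|\xi|\ge 2$. For $j \in \mathbb{Z}$ put $\Delta_j f := f * [2^{jN}\eta(2^j\,\cdot)]$. (Constants may depend on this fixed choice of $\eta$.) Homogeneous Triebel-Lizorkin seminorm: for $s\in\mathbb{R}$, $p,q\in(1,\infty)$, $$[f]_{\dot{F}^{s}_{p,q}(\mathbb{R}^N)} := \left(\int_{\mathbb{R}^N} \Big(\sum_{j \in \mathbb{Z}} 2^{jsq} |\Delta_j f(x)|^q\Big)^{p/q} dx\right)^{1/p}.$$ Gagliardo seminorm: for $s\in(0,1)$, $p\in(1,\infty)$, $$[f]_{\dot W^{s,p}(\mathbb{R}^N)} := \left(\int_{\mathbb{R}^N}\int_{\mathbb{R}^N} \frac{|f(x)-f(y)|^p}{|x-y|^{N+sp}}\, dx\, dy\right)^{1/p}.$$ *)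

(* Defs.v *)
From HB Require Import structures.
From mathcomp Require Import all_boot all_order all_algebra.
From mathcomp Require Import all_classical all_reals all_analysis.
From mathcomp Require Import complex.

Set Implicit Arguments.
Unset Strict Implicit.
Unset Printing Implicit Defensive.

Import Order.TTheory GRing.Theory Num.Theory.
Import numFieldNormedType.Exports.
Import ComplexField.Normc.

Local Open Scope classical_set_scope.
Local Open Scope ring_scope.
Local Open Scope complex_scope.

(* The sigma-algebra on 'rV[R]_n generated by the coordinates is the Borel
   sigma-algebra of R^n. *)
Section measurable_rV.
Context {R : realType}.
Variable n : nat.

Definition rV_coord (i : 'I_n) (x : 'rV[R]_n) : measurableTypeR R := x 0 i.

Let rV_set0 : g_sigma_preimage rV_coord set0.
Proof. exact: sigma_algebra0. Qed.

Let rV_setC A : g_sigma_preimage rV_coord A -> g_sigma_preimage rV_coord (~` A).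
Proof. exact: sigma_algebraC. Qed.

Let rV_bigcup (F : (set 'rV[R]_n)^nat) :
  (forall i, g_sigma_preimage rV_coord (F i)) ->
  g_sigma_preimage rV_coord (\bigcup_i (F i)).
Proof. exact: sigma_algebra_bigcup. Qed.

HB.instance Definition _ := @isMeasurable.Build default_measure_display
  'rV[R]_n (g_sigma_preimage rV_coord) rV_set0 rV_setC rV_bigcup.

Lemma measurable_rV_coord (i : 'I_n) :
  measurable_fun [set: 'rV[R]_n] (rV_coord i).
Proof.
move=> _ Y mY; rewrite setTI; apply: sub_sigma_algebra => /=.
rewrite -bigcup_seq/=; exists i => /=; first by rewrite mem_index_enum.
by exists Y => //; rewrite setTI.
Qed.

Lemma measurable_fun_rVP d (T : measurableType d) (f : T -> 'rV[R]_n) :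
  (forall i, measurable_fun [set: T] (rV_coord i \o f)) ->
  measurable_fun [set: T] f.
Proof.
move=> mf _ Y mY.
suff : g_sigma_preimage (fun i => rV_coord i \o f) `<=` measurable.
  by apply; rewrite g_sigma_preimage_comp; exists Y.
apply: smallest_sub; first exact: sigma_algebra_measurable.
rewrite -bigcup_seq; apply: bigcup_sub => i _ A [B mB <-].
exact: mf.
Qed.

End measurable_rV.

Section lebesgue_rV_step.
Context {R : realType}.
Variable n : nat.
Variable mu : {sigma_finite_measure set 'rV[R]_n -> \bar R}.
Local Open Scope ereal_scope.

Definition rV_cons (p : measurableTypeR R * 'rV[R]_n) : 'rV[R]_n.+1 :=
  row_mx (p.1)%:M p.2.

Definition rV_uncons (x : 'rV[R]_n.+1) : measurableTypeR R * 'rV[R]_n :=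
  (x 0%R ord0, \row_i x 0%R (lift ord0 i)).

Lemma rV_cons0 p : rV_cons p 0%R ord0 = p.1.
Proof.
have -> : ord0 = lshift n (ord0 : 'I_1) by exact/val_inj.
by apply: etrans (row_mxEl _ _ _ _) _; rewrite mxE.
Qed.

Lemma rV_consS p (i : 'I_n) : rV_cons p 0%R (lift ord0 i) = p.2 0%R i.
Proof.
have -> : lift ord0 i = rshift 1 i by exact/val_inj.
exact: row_mxEr.
Qed.

Lemma rV_consK : cancel rV_cons rV_uncons.
Proof.
move=> [a v]; rewrite /rV_uncons rV_cons0; congr pair.
by apply/rowP => i; rewrite mxE rV_consS.
Qed.

Lemma measurable_rV_cons : measurable_fun [set: _] rV_cons.
Proof.
apply: measurable_fun_rVP => i.
have [j ->|->] := unliftP ord0 i.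
  rewrite (_ : _ \o _ = rV_coord j \o snd); last first.
    by apply/funext => p /=; rewrite /rV_coord rV_consS.
  apply: measurableT_comp => //; exact: measurable_rV_coord.
rewrite (_ : _ \o _ = fst) //.
by apply/funext => p /=; rewrite /rV_coord rV_cons0.
Qed.

Lemma measurable_rV_uncons : measurable_fun [set: _] rV_uncons.
Proof.
apply/measurable_fun_pairP; split.
  exact: (measurable_rV_coord (ord0 : 'I_n.+1)).
apply: measurable_fun_rVP => i.
rewrite (_ : _ \o _ = rV_coord (lift ord0 i)); last first.
  by apply/funext => x /=; rewrite /rV_coord /= mxE.
exact: measurable_rV_coord.
Qed.

Definition lebesgue_rVS : set 'rV[R]_n.+1 -> \bar R :=
  pushforward (@lebesgue_measure R \x mu) rV_cons.

Let lebesgue_rVS0 : lebesgue_rVS set0 = 0.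
Proof. by rewrite /lebesgue_rVS /pushforward preimage_set0 measure0. Qed.

Let lebesgue_rVS_ge0 A : 0 <= lebesgue_rVS A.
Proof. exact: (measure_ge0 (@lebesgue_measure R \x mu)). Qed.

Let lebesgue_rVS_sigma_additive : semi_sigma_additive lebesgue_rVS.
Proof.
move=> F mF tF mUF; rewrite /lebesgue_rVS /pushforward preimage_bigcup.
have mcons A : measurable A -> measurable (rV_cons @^-1` A).
  by move=> mA; rewrite -[X in measurable X]setTI; exact: measurable_rV_cons.
apply: measure_semi_sigma_additive.
- by move=> k; exact: mcons.
- apply/trivIsetP => /= i j _ _ ij; rewrite -preimage_setI.
  by move/trivIsetP : tF => /(_ _ _ _ _ ij) ->//; rewrite preimage_set0.
- by rewrite -preimage_bigcup; exact: mcons.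
Qed.

HB.instance Definition _ := isMeasure.Build _ _ _
  lebesgue_rVS lebesgue_rVS0 lebesgue_rVS_ge0 lebesgue_rVS_sigma_additive.

Let lebesgue_rVS_sigma_finite : sigma_finite [set: _] lebesgue_rVS.
Proof.
have /sigma_finiteP[F [TF ndF Foo]] := sigma_finiteT (@lebesgue_measure R).
have /sigma_finiteP[G [TG ndG Goo]] := sigma_finiteT mu.
exists (fun k => rV_uncons @^-1` (F k `*` G k)).
  rewrite -preimage_bigcup (_ : \bigcup_k (F k `*` G k) = setT) ?preimage_setT//.
  rewrite -setXTT TF TG predeqE => -[x y]; split.
    by move=> [k _ []/= ? ?]; split; exists k.
  move=> [/= [k _ Fkx] [l _ Gly]]; exists (maxn k l) => //; split.
  - by move: x Fkx; exact/subsetPset/ndF/leq_maxl.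
  - by move: y Gly; exact/subsetPset/ndG/leq_maxr.
move=> k; have [mF Fk] := Foo k; have [mG Gk] := Goo k; split.
  rewrite -[X in measurable X]setTI; apply: measurable_rV_uncons => //.
  exact: measurableX.
rewrite /lebesgue_rVS /pushforward -comp_preimage.
rewrite (_ : _ \o _ = id) ?preimage_id//; last first.
  by apply/funext => p /=; rewrite rV_consK.
by rewrite product_measure1E// lte_mul_pinfty// ge0_fin_numE.
Qed.

HB.instance Definition _ := Measure_isSigmaFinite.Build _ _ _
  lebesgue_rVS lebesgue_rVS_sigma_finite.

End lebesgue_rV_step.

(* Lebesgue measure on R^n, characterized by its values on measurable boxes
   (lebesgue_rV_box). *)
Fixpoint lebesgue_rV (R : realType) (n : nat) :
    {sigma_finite_measure set 'rV[R]_n -> \bar R} :=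
  match n with
  | 0 => dirac (0 : 'rV[R]_0)
  | n'.+1 => lebesgue_rVS (lebesgue_rV R n')
  end.

Lemma lebesgue_rV_box (R : realType) (n : nat)
    (A : 'I_n -> set (measurableTypeR R)) :
  (forall i, measurable (A i)) ->
  lebesgue_rV R n [set x | forall i, A i (x 0 i)] =
  (\prod_(i < n) lebesgue_measure (A i))%E.
Proof.
elim: n A => [|n IH] A mA.
  by rewrite big_ord0 /= diracE mem_set//= => -[].
rewrite big_ord_recl -IH//= /lebesgue_rVS /pushforward.
rewrite (_ : _ @^-1` _ = A ord0 `*`
    [set x : 'rV[R]_n | forall i, A (lift ord0 i) (x 0 i)]); last first.
  apply/seteqP; split=> -[a v] /=.
    move=> H; split; first by have := H ord0; rewrite rV_cons0.
    by move=> i; have := H (lift ord0 i); rewrite rV_consS.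
  move=> [H0 H] i; have [j ->|->] := unliftP ord0 i.
    by rewrite rV_consS; exact: H.
  by rewrite rV_cons0.
rewrite product_measure1E//.
rewrite (_ : mkset _ = \bigcap_(i in [set: 'I_n]) (rV_coord i @^-1` A (lift ord0 i))).
  apply: fin_bigcap_measurable => // i _.
  by rewrite -[X in measurable X]setTI; exact: measurable_rV_coord.
by apply/seteqP; split=> x /= H i; [move=> _|]; exact: H.
Qed.

Section function_spaces.
Context {R : realType} {N : nat}.
Implicit Types (f g : 'rV[R]_N -> R[i]) (x y xi : 'rV[R]_N).

Local Notation mu := (lebesgue_rV R N).

Definition dotv x y : R := \sum_(i < N) x 0 i * y 0 i.

(* The Euclidean norm; the library norm `|x| on 'rV[R]_N is the sup norm. *)
Definition enorm x : R := Num.sqrt (\sum_(i < N) x 0 i ^+ 2).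

(* The iterated partial derivative along the list of coordinates [s]; every
   multi-index is represented by at least one list. *)
Definition partials (s : seq 'I_N) (u : 'rV[R]_N -> R) : 'rV[R]_N -> R :=
  foldr (fun i (v : 'rV[R]_N -> R) x => 'D_(delta_mx 0 i) v x) u s.

Definition schwartz_real (u : 'rV[R]_N -> R) : Prop :=
  (forall s x, differentiable (partials s u) x) /\
  (forall s (k : nat), exists M : R, forall x,
     (1 + enorm x) ^+ k * `|partials s u x| <= M).

(* Schwartz functions are complex-valued; R[i] carries no normed module
   structure over R in the library, hence the componentwise definitions. *)
Definition schwartz f : Prop :=
  schwartz_real (fun x => complex.Re (f x)) /\
  schwartz_real (fun x => complex.Im (f x)).

Definition cintegral f : R[i] :=
  (\int[mu]_x complex.Re (f x)) +i* (\int[mu]_x complex.Im (f x)).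

Definition cis (theta : R) : R[i] := cos theta +i* sin theta.

Definition fourier f xi : R[i] := cintegral (fun x => f x * cis (- dotv x xi)).

Definition convolution f g x : R[i] := cintegral (fun y => f (x - y) * g y).

(* The admissible real-valued functions eta generating the projections. *)
Definition littlewood_paley (eta : 'rV[R]_N -> R) : Prop :=
  [/\ schwartz_real eta,
      forall z, eta (- z) = eta z &
      exists eta0 : 'rV[R]_N -> R[i],
      [/\ schwartz eta0,
          forall xi, enorm xi <= 1 -> fourier eta0 xi = 1,
          forall xi, 2 <= enorm xi -> fourier eta0 xi = 0 &
          forall xi, fourier (fun x => (eta x)%:C) xi =
            fourier eta0 xi - fourier eta0 (2 *: xi)]].

Definition LP_projection (eta : 'rV[R]_N -> R) (j : int) f : 'rV[R]_N -> R[i] :=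
  convolution f
    (fun z => ((2 : R) ^ (j * N%:Z) * eta ((2 : R) ^ j *: z))%:C).

(* With values in [0, +oo]. *)
Definition triebel_lizorkin (eta : 'rV[R]_N -> R) (s p q : R) f : \bar R :=
  ((\int[mu]_x ((\esum_(j in [set: int])
      (2 `^ (j%:~R * s * q)
        * normc (LP_projection eta j f x) `^ q)%:E)
    `^ (p / q))) `^ (1 / p))%E.

(* With values in [0, +oo]. The integrand is 0 on the diagonal, because
   division by 0 yields 0. *)
Definition gagliardo (s p : R) f : \bar R :=
  ((\int[mu]_y \int[mu]_x
      (normc (f x - f y) `^ p
        / enorm (x - y) `^ (N%:R + s * p))%:E) `^ (1 / p))%E.

Definition LpNorm (p : R) f : \bar R :=
  Lnorm mu p%:E (fun x => (normc (f x))%:E).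

End function_spaces.

(* Main.v *)
(** Both inequalities rest on the two-sided L^p square function estimates for
    dyadic families of dilated kernels psi_(a 2^i) of mean zero, with constants
    that do not depend on the number of scales. For 1 < p < 2 these come from
    the almost orthogonality of different scales at p = 2 and a
    Calderon-Zygmund weak type bound for matrix kernels; p > 2 is dual.

    (1) Splitting f into its pieces at the scale 1/|h| gives
    |f(. + h) - f|_p <= C |h|^r [f]_F^r for every r in [0, 1], uniformly in r.
    Inserting r at infinity and t near the origin in the Gagliardo integral
    produces the factors 1/(s - r) and 1/(t - s).

    (2) The pieces of frequency at most c are controlled, with weight 2^j
    instead of 2^(jr), by c^p times the average of |f(. + h) - f|_p^p over
    |h| ~ 1/c. Since |f(. + h) - f|_p <= 2 |f(. + h/2) - f|_p, all scales
    from 1/c down to 2^(-1/(1 - s))/c contribute comparably to [f]_W^p, so that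
    this average is at most C (1 - s) c^(-sp) [f]_W^p. Cutting the
    positive frequencies into blocks of length 1/(1 - s) leaves a geometric
    series, because 1 - r >= Lambda (1 - s) with Lambda > 1; frequencies below
    1 are controlled by |f|_p. *)

Require Import Defs.
From HB Require Import structures.
From mathcomp Require Import all_boot all_order all_algebra.
From mathcomp Require Import all_classical all_reals all_analysis.
From mathcomp Require Import measurable_realfun complex.
From mathcomp Require Import ring lra zify.

Set Implicit Arguments.
Unset Strict Implicit.
Unset Printing Implicit Defensive.

Import Order.TTheory GRing.Theory Num.Theory.
Import numFieldNormedType.Exports.

Local Open Scope classical_set_scope.
Local Open Scope ring_scope.

(** * Lebesgue measure on row vectors *)

Section affine_substitution.
Context {R : realType}.
Local Notation leb := (@lebesgue_measure R).

(** The weights in (1) force the pieces of f themselves to survive on the right-hand side. Hence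
    [eta] is written as the sum of its convolutions with its three neighbouring dilates, and the
    difference in h falls on the outer copy: it gains 2^j |h| <= (2^j |h|)^r at low frequencies and
    costs only a multiple of (2^j |h|)^r >= 1 at high ones, with no constant depending on r. In (2)
    the weight 2^j stands for one derivative. With F the convolution of f with a bump at scale 1/c,
    the error f - F pays at most c for 2^j, and on F the weight is traded for the gradient of F by
    kernels made of first moments of [eta]. These act at frequencies 2^j / theta with 0 < theta <=
    1, which is why the dyadic families start at an arbitrary a. Sums stay finite until Fatou's
    lemma or monotone convergence removes the truncation. The functions in between are bounded and
    integrable, so that quantities may be absorbed by subtraction, and continuous where the
    Calderon-Zygmund argument would otherwise call for a differentiation theorem. *)

Definition affine1 (c b : R) (x : measurableTypeR R) : measurableTypeR R :=
  c * x + b.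

Lemma measurable_affine1 c b : measurable_fun setT (affine1 c b).
Proof. by apply: measurable_funD => //; apply: measurable_funM. Qed.

(** Packages the pushforward as an object of type [measure], of which only the values matter
    below. *)
Lemma pushforward_measureE (f : measurableTypeR R -> measurableTypeR R) :
  measurable_fun setT f ->
  exists nu : {measure set (measurableTypeR R) -> \bar R},
    forall A, nu A = leb (f @^-1` A).
Proof. by move=> mf; unshelve eexists (pushforward leb f). Qed.

(** Lebesgue measure is determined by its values on half-open intervals, so the rescaled pushforward
    is compared with it only there. A negative c turns []u, v]] into an interval that is open at the
    other end, of the same length up to the factor. *)
Lemma lebesgue_measure_affine1 (c b : R) (c0 : c != 0) A : measurable A ->
  leb A = (`|c|%:E * leb (affine1 c b @^-1` A))%E.
Proof.
move=> mA.
have [nu nuE] := pushforward_measureE (measurable_affine1 c b).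
pose nu' : {measure set (measurableTypeR R) -> \bar R} :=
  mscale (NngNum (normr_ge0 c)) nu.
have nu'E B : nu' B = (`|c|%:E * leb (affine1 c b @^-1` B))%E.
  by rewrite /nu'/= /mscale/= nuE.
rewrite -nu'E; apply: lebesgue_measure_unique => // _ [[u v]] _ <-.
rewrite nu'E.
have [c1|c1] := ltP 0 c.
  have -> : affine1 c b @^-1` [set` `]u, v]] = [set` `](u - b) / c, (v - b) / c]].
    apply/seteqP; split => x /=; rewrite /affine1 !in_itv/= ltr_pdivrMr// ler_pdivlMr//;
    by rewrite ltrBlDr lerBrDr [x * c]mulrC.
  rewrite !lebesgue_measure_itv/= !lte_fin ltr_pM2r ?invr_gt0// ltrD2r gtr0_norm//.
  case: ifPn => _; last by rewrite mule0.
  by rewrite -EFinB -EFinM; congr EFin; field.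
have c2 : c < 0 by rewrite lt_neqAle c0.
have -> : affine1 c b @^-1` [set` `]u, v]] = [set` `[(v - b) / c, (u - b) / c[].
  apply/seteqP; split => x /=; rewrite /affine1 !in_itv/= ltr_ndivlMr// ler_ndivrMr//;
  by rewrite lerBrDr ltrBlDr [x * c]mulrC andbC.
rewrite !lebesgue_measure_itv/= !lte_fin ltr_nM2r ?invr_lt0// ltrD2r ltr0_norm//.
case: ifPn => _; last by rewrite mule0.
by rewrite -EFinB -EFinM; congr EFin; field.
Qed.

Lemma ge0_integral_affine1 (c b : R) (F : measurableTypeR R -> \bar R) : c != 0 ->
  measurable_fun setT F -> (forall x, 0 <= F x)%E ->
  (\int[leb]_x F x = `|c|%:E * \int[leb]_x F (c * x + b)%R)%E.
Proof.
move=> c0 mF F0.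
have mp := measurable_affine1 c b.
have [nu nuE] := pushforward_measureE mp.
have -> : (\int[leb]_x F (c * x + b)%R = \int[nu]_y F y)%E.
  have := @ge0_integral_pushforward _ _ _ _ _ _ mp leb setT F measurableT mF
    (fun y _ => F0 y).
  rewrite preimage_setT => <-.
  by apply: eq_measure_integral => A mA _; rewrite [RHS]nuE.
rewrite -(@ge0_integral_mscale _ _ _ nu setT measurableT (NngNum (normr_ge0 c)) F)//.
apply: eq_measure_integral => A mA _.
have := lebesgue_measure_affine1 b c0 mA; rewrite -nuE => H; exact: H.
Qed.

End affine_substitution.

Section measurable_rV_operations.
Context {R : realType} {n : nat} d (T : measurableType d).
Implicit Types f g : T -> 'rV[R]_n.

Lemma measurable_rVE f (i : 'I_n) : measurable_fun setT f ->
  measurable_fun setT (fun x => f x 0 i : R).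
Proof. by move=> mf; exact: (measurableT_comp (measurable_rV_coord i) mf). Qed.

Lemma measurable_rVP f : (forall i, measurable_fun setT (fun x => f x 0 i : R)) ->
  measurable_fun setT f.
Proof. by move=> mf; apply: measurable_fun_rVP. Qed.

Lemma measurable_rVD f g : measurable_fun setT f -> measurable_fun setT g ->
  measurable_fun setT (fun x => f x + g x).
Proof.
move=> mf mg; apply: measurable_rVP => i.
rewrite (_ : (fun x => _) = (fun x => f x 0 i) \+ (fun x => g x 0 i)); last first.
  by apply/funext => x; rewrite mxE.
by apply: measurable_funD; exact: measurable_rVE.
Qed.

Lemma measurable_rVZ f (c : T -> R) : measurable_fun setT f -> measurable_fun setT c ->
  measurable_fun setT (fun x => c x *: f x).
Proof.
move=> mf mc; apply: measurable_rVP => i.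
rewrite (_ : (fun x => _) = c \* (fun x => f x 0 i)); last first.
  by apply/funext => x; rewrite mxE.
by apply: measurable_funM => //; exact: measurable_rVE.
Qed.

Lemma measurable_rVB f g : measurable_fun setT f -> measurable_fun setT g ->
  measurable_fun setT (fun x => f x - g x).
Proof.
move=> mf mg; apply: measurable_rVP => i.
rewrite (_ : (fun x => _) = (fun x => f x 0 i) \- (fun x => g x 0 i)); last first.
  by apply/funext => x; rewrite !mxE.
by apply: measurable_funB; exact: measurable_rVE.
Qed.

End measurable_rV_operations.

Lemma measurable_scale_rV (R : realType) n (c : R) :
  measurable_fun setT (fun x : 'rV[R]_n => c *: x).
Proof.
apply: measurable_rVP => i.
rewrite (_ : (fun x => _) = (fun x : 'rV[R]_n => c * x 0 i)); last first.
  by apply/funext => x; rewrite mxE.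
by apply: measurable_funM; [exact: measurable_cst|exact: (measurable_rV_coord i)].
Qed.

Section lebesgue_rV_integral.
Context {R : realType}.
Local Notation leb := (@lebesgue_measure R).

Lemma integral_rV_cons n (F : 'rV[R]_n.+1 -> \bar R) :
  measurable_fun setT F -> (forall x, 0 <= F x)%E ->
  (\int[lebesgue_rV R n.+1]_x F x =
   \int[leb]_a \int[lebesgue_rV R n]_v F (rV_cons (a, v)))%E.
Proof.
move=> mF F0.
have mc := @measurable_rV_cons R n.
have := @ge0_integral_pushforward _ _ _ _ _ _ mc (leb \x lebesgue_rV R n)%E setT F
  measurableT mF (fun y _ => F0 y).
by rewrite preimage_setT fubini_tonelli1//=; exact: measurableT_comp.
Qed.

Lemma measurable_integral_rV_cons n (F : 'rV[R]_n.+1 -> \bar R) :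
  measurable_fun setT F -> (forall x, 0 <= F x)%E ->
  measurable_fun setT (fun a => \int[lebesgue_rV R n]_v F (rV_cons (a, v)))%E.
Proof.
move=> mF F0.
apply: (@measurable_fun_fubini_tonelli_F _ _ _ _ _ (lebesgue_rV R n)
  (fun p => F (rV_cons p))) => //.
exact: measurableT_comp mF (@measurable_rV_cons R n).
Qed.

Lemma rV_consDZ n (c a b : R) (v w : 'rV[R]_n) :
  rV_cons (c * a + b, c *: v + w) = c *: rV_cons (a, v) + rV_cons (b, w).
Proof.
apply/rowP => i; have [j ->|->] := unliftP ord0 i.
  by rewrite [RHS]mxE [X in _ = X + _]mxE !rV_consS /= 2!mxE.
by rewrite [RHS]mxE [X in _ = X + _]mxE !rV_cons0.
Qed.

Lemma rV_consE n (x : 'rV[R]_n.+1) : x = rV_cons (rV_uncons x).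
Proof.
apply/rowP => i; have [j ->|->] := unliftP ord0 i.
  by rewrite rV_consS /= mxE.
by rewrite rV_cons0.
Qed.

(** Induction on the dimension: Tonelli splits off the first coordinate, whose substitution
    contributes one factor |c|, and [rV_consDZ] matches the affine map with the splitting. *)
Lemma ge0_integral_affine n (c : R) (b : 'rV[R]_n) (F : 'rV[R]_n -> \bar R) :
  c != 0 -> measurable_fun setT F -> (forall x, 0 <= F x)%E ->
  (\int[lebesgue_rV R n]_x F x =
   (`|c| ^+ n)%:E * \int[lebesgue_rV R n]_x F (c *: x + b)%R)%E.
Proof.
move=> c0; elim: n b F => [|n IH] b F mF F0.
  rewrite expr0 mul1e; apply: eq_integral => x _; congr F.
  by apply/rowP => -[].
have maff : measurable_fun setT (fun x : 'rV[R]_n.+1 => c *: x + b).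
  apply: measurable_rVD; last exact: measurable_cst.
  by apply: measurable_rVZ; [exact: measurable_id|exact: measurable_cst].
rewrite integral_rV_cons// integral_rV_cons//; last exact: measurableT_comp.
rewrite (@ge0_integral_affine1 _ c (rV_uncons b).1
  (fun a => \int[lebesgue_rV R n]_v F (rV_cons (a, v)))%E c0); first last.
- by move=> x; apply: integral_ge0.
- exact: measurable_integral_rV_cons.
rewrite exprS EFinM -muleA; congr (_ * _)%E.
rewrite -ge0_integralZl_EFin//; first last.
- apply: (@measurable_integral_rV_cons n (fun x => F (c *: x + b))) => //.
  exact: measurableT_comp.
- by move=> x _; apply: integral_ge0.
apply: eq_integral => a _; rewrite (IH (rV_uncons b).2)//; last first.
  apply: (measurableT_comp mF); apply: measurableT_comp (@measurable_rV_cons R n) _.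
  exact: measurable_pair1.
by congr (_ * _)%E; apply: eq_integral => v _; rewrite rV_consDZ -rV_consE.
Qed.

(** Reduces the integrals of cube indicators, of the Fejer kernel and of the majorant of [decay] to
    dimension one. *)
Lemma integral_prod_rV n (u : measurableTypeR R -> R) :
  measurable_fun setT u -> (forall x, 0 <= u x) ->
  (\int[lebesgue_rV R n]_x (\prod_(i < n) u (x 0 i))%:E =
   \prod_(i < n) \int[leb]_a (u a)%:E)%E.
Proof.
move=> mu u0.
have mP m : measurable_fun setT (fun x : 'rV[R]_m => \prod_(i < m) u (x 0 i)).
  under eq_fun do rewrite -(big_map (fun i => u (_ 0 i)) xpredT id)/=.
  rewrite (_ : (fun x => _) = (fun x : 'rV[R]_m => \prod_(i < m) u (x 0 i))); last first.
    by apply/funext => x; rewrite big_map.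
  elim: (index_enum _) => [|i r IHr].
    by under eq_fun do rewrite big_nil; exact: measurable_cst.
  under eq_fun do rewrite big_cons.
  by apply: measurable_funM => //; apply: measurableT_comp mu _; exact: measurable_rV_coord.
elim: n => [|n IH].
  under eq_integral do rewrite big_ord0.
  by rewrite integral_dirac//= !big_ord0 diracT mul1e.
rewrite integral_rV_cons//; first last.
- by move=> x; rewrite lee_fin; apply: prodr_ge0 => i _; exact: u0.
- by apply/measurable_EFinP => //; exact: mP.
rewrite big_ord_recl -IH.
rewrite -ge0_integralZr//; first last.
- by apply: integral_ge0 => x _; rewrite lee_fin; apply: prodr_ge0 => i _; exact: u0.
- by move=> x _; rewrite lee_fin.
- by apply/measurable_EFinP => //; exact: mP.
apply: eq_integral => a _.
rewrite -ge0_integralZl//; first last.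
- by rewrite lee_fin.
- by move=> x _; rewrite lee_fin; apply: prodr_ge0 => i _; exact: u0.
- by apply/measurable_EFinP => //; exact: mP.
apply: eq_integral => v _; rewrite -EFinM big_ord_recl rV_cons0/=.
by congr (_ * _)%:E; apply: eq_bigr => i _; rewrite rV_consS.
Qed.

End lebesgue_rV_integral.

Section measurability_rules.
Context {R : realType} d (T : measurableType d).
Implicit Types f g : T -> R.

Lemma measurable_fun_normr f : measurable_fun setT f ->
  measurable_fun setT (fun x => `|f x|).
Proof. by move=> mf; exact: measurableT_comp. Qed.

Lemma measurable_fun_powR f p : measurable_fun setT f ->
  measurable_fun setT (fun x => f x `^ p).
Proof. by move=> mf; exact: (measurableT_comp (measurable_powR p) mf). Qed.

Lemma measurable_fun_sqrt f : measurable_fun setT f ->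
  measurable_fun setT (fun x => Num.sqrt (f x)).
Proof.
move=> mf; apply: (measurableT_comp _ mf).
by apply: continuous_measurable_fun; exact: sqrt_continuous.
Qed.

Lemma measurable_fun_bigsum I (r : seq I) (P : pred I) (F : I -> T -> R) :
  (forall i, measurable_fun setT (F i)) ->
  measurable_fun setT (fun x => \sum_(i <- r | P i) F i x).
Proof.
move=> mF; elim: r => [|i r IHr].
  by under eq_fun do rewrite big_nil; exact: measurable_cst.
under eq_fun do rewrite big_cons; case: (P i) => //.
exact: measurable_funD.
Qed.

Lemma measurable_fun_bigprod I (r : seq I) (P : pred I) (F : I -> T -> R) :
  (forall i, measurable_fun setT (F i)) ->
  measurable_fun setT (fun x => \prod_(i <- r | P i) F i x).
Proof.
move=> mF; elim: r => [|i r IHr].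
  by under eq_fun do rewrite big_nil; exact: measurable_cst.
under eq_fun do rewrite big_cons; case: (P i) => //.
exact: measurable_funM.
Qed.

Lemma measurable_fun_bool (b : T -> bool) : measurable_fun setT b ->
  measurable_fun setT (fun x => (b x)%:R : R).
Proof.
move=> mb; rewrite (_ : (fun x => _) = (fun c : bool => c%:R : R) \o b)//.
exact: measurableT_comp.
Qed.

End measurability_rules.

(** Decomposes a function by its head symbol until hypotheses or coordinate projections remain;
    differences and sums are tried as vector-valued before they are tried as real-valued. *)
Ltac msr := solve [repeat first
  [ assumption
  | exact: measurable_cst | exact: measurable_id
  | exact: measurable_scale_rV | exact: measurable_fst | exact: measurable_snd
  | match goal with
    | H : measurable_fun _ ?k |- measurable_fun _ (fun x => ?k _) =>
        apply: (measurableT_comp H)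
    | H : forall _, measurable_fun _ _ |- _ => apply: H
    | |- measurable_fun _ (fun x => EFin _) => apply/measurable_EFinP
    | |- measurable_fun _ (fun x => `|_|) => apply: measurable_fun_normr
    | |- measurable_fun _ (fun x => _ `^ _) => apply: measurable_fun_powR
    | |- measurable_fun _ (fun x => Num.sqrt _) => apply: measurable_fun_sqrt
    | |- measurable_fun _ (fun x => @GRing.scale _ _ _ _) => apply: measurable_rVZ
    | |- measurable_fun _ (fun x => _ * _) => apply: measurable_funM
    | |- measurable_fun _ (fun x => _ ^+ _) => apply: measurable_funX
    | |- measurable_fun _ (fun x => _ - _) =>
        first [apply: measurable_rVB | apply: measurable_funB]
    | |- measurable_fun _ (fun x => _ + _) =>
        first [apply: measurable_rVD | apply: measurable_funD]
    | |- measurable_fun _ (fun x => - _) => apply: measurable_funN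
    | |- measurable_fun _ (fun x => (nat_of_bool _)%:R) => apply: measurable_fun_bool
    | |- measurable_fun _ (fun x => (_ < _)%R) => apply: measurable_fun_ltr
    | |- measurable_fun _ (fun x => (_ <= _)%R) => apply: measurable_fun_ler
    | |- measurable_fun _ (fun x => fun_of_matrix _ _ _) => apply: measurable_rVE
    | |- measurable_fun _ (fun x => \sum_(_ <- _ | _) _) => apply: measurable_fun_bigsum => ?
    | |- measurable_fun _ (fun x => \prod_(_ <- _ | _) _) => apply: measurable_fun_bigprod => ?
    end ]].

Section real_integral.
Context {R : realType} d (T : measurableType d) (m : {measure set T -> \bar R}).
Implicit Types f g : T -> R.

(** Keeps the integral of a real function as an extended real: for nonnegative integrands, the only
    ones it is applied to, no integrability has to be carried along. *)
Definition nint f : \bar R := (\int[m]_x (f x)%:E)%E.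

Lemma nint_ge0 f : (forall x, 0 <= f x) -> (0 <= nint f)%E.
Proof. by move=> f0; apply: integral_ge0 => x _; rewrite lee_fin. Qed.

Lemma le_nint f g : measurable_fun setT f -> measurable_fun setT g ->
  (forall x, 0 <= f x) -> (forall x, f x <= g x) -> (nint f <= nint g)%E.
Proof.
move=> mf mg f0 fg; apply: ge0_le_integral => //.
- by move=> x _; rewrite lee_fin.
- exact/measurable_EFinP.
- exact/measurable_EFinP.
- by move=> x _; rewrite lee_fin.
Qed.

Lemma nintZ c f : measurable_fun setT f -> 0 <= c -> (forall x, 0 <= f x) ->
  (nint (fun x => c * f x)%R = c%:E * nint f)%E.
Proof.
move=> mf c0 f0; rewrite /nint; under eq_integral do rewrite EFinM.
by rewrite ge0_integralZl_EFin// => [x _|]; [rewrite lee_fin|exact/measurable_EFinP].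
Qed.

Lemma nintD f g : measurable_fun setT f -> measurable_fun setT g ->
  (forall x, 0 <= f x) -> (forall x, 0 <= g x) ->
  (nint (fun x => f x + g x)%R = nint f + nint g)%E.
Proof.
move=> mf mg f0 g0; rewrite /nint; under eq_integral do rewrite EFinD.
by rewrite ge0_integralD//; do ?[by move=> x _; rewrite lee_fin|exact/measurable_EFinP].
Qed.

Lemma nint_sum I (r : seq I) (P : pred I) (F : I -> T -> R) :
  (forall i, measurable_fun setT (F i)) -> (forall i x, 0 <= F i x) ->
  (nint (fun x => \sum_(i <- r | P i) F i x)%R = \sum_(i <- r | P i) nint (F i))%E.
Proof.
move=> mF F0; elim: r => [|i r IHr].
  rewrite big_nil /nint; under eq_integral do rewrite big_nil.
  exact: integral0.
rewrite big_cons; under [nint _]eq_integral do rewrite big_cons.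
case: (P i) => //; rewrite -IHr -nintD//; first by msr.
by move=> x; apply: sumr_ge0 => j _.
Qed.

Lemma integrable_nintP f : measurable_fun setT f ->
  m.-integrable setT (EFin \o f) <-> (nint (fun x => `|f x|)%R < +oo)%E.
Proof.
move=> mf; split=> [/integrableP[_]|h]; first by [].
by apply/integrableP; split => //; exact/measurable_EFinP.
Qed.

Lemma integrable_measurable f : m.-integrable setT (EFin \o f) -> measurable_fun setT f.
Proof. by move/measurable_int/measurable_EFinP. Qed.

Lemma le_integrableR f g : measurable_fun setT f -> (forall x, `|f x| <= g x) ->
  m.-integrable setT (EFin \o g) -> m.-integrable setT (EFin \o f).
Proof.
move=> mf fg ig; apply: le_integrable ig => //; first exact/measurable_EFinP.
by move=> x _; rewrite lee_fin (le_trans (fg x))// ler_norm.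
Qed.

Lemma integrableRD f g : m.-integrable setT (EFin \o f) ->
  m.-integrable setT (EFin \o g) -> m.-integrable setT (EFin \o (fun x => f x + g x)).
Proof.
move=> If Ig; rewrite (_ : _ \o _ = (EFin \o f) \+ (EFin \o g))%E//.
exact: integrableD.
Qed.

Lemma integrableRZ c f : m.-integrable setT (EFin \o f) ->
  m.-integrable setT (EFin \o (fun x => c * f x)).
Proof.
move=> If; rewrite (_ : _ \o _ = (fun x => c%:E * (EFin \o f) x)%E)//.
exact: integrableZl.
Qed.

Lemma integrableR_norm f : m.-integrable setT (EFin \o f) ->
  m.-integrable setT (EFin \o (fun x => `|f x|)).
Proof.
move=> If; have mf := integrable_measurable If.
have H := (integrable_nintP mf).1 If.
apply/integrable_nintP; first by msr.
by under eq_fun do rewrite normr_id.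
Qed.

Lemma integrableR_sum I (r : seq I) (P : pred I) (F : I -> T -> R) :
  (forall i, m.-integrable setT (EFin \o F i)) ->
  m.-integrable setT (EFin \o (fun x => \sum_(i <- r | P i) F i x)).
Proof.
move=> IF; elim: r => [|i r IHr].
  rewrite (_ : _ \o _ = cst 0%E); first exact: integrable0.
  by apply/funext => x /=; rewrite big_nil.
rewrite (_ : _ \o _ = EFin \o (fun x => (if P i then F i x else 0) +
   \sum_(j <- r | P j) F j x)); last first.
  by apply/funext => x /=; rewrite big_cons; case: ifP; rewrite ?add0r.
apply: integrableRD => //; case: (P i) => //; exact: integrable0.
Qed.

Lemma Rintegral_sum I (r : seq I) (P : pred I) (F : I -> T -> R) :
  (forall i, m.-integrable setT (EFin \o F i)) ->
  \int[m]_x (\sum_(i <- r | P i) F i x) = \sum_(i <- r | P i) \int[m]_x (F i x).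
Proof.
move=> IF; elim: r => [|i r IHr].
  by rewrite big_nil; under eq_Rintegral do rewrite big_nil; rewrite Rintegral_cst ?mul0r.
under eq_Rintegral do rewrite big_cons.
rewrite big_cons; case: (P i) => //; rewrite RintegralD ?IHr//.
exact: integrableR_sum.
Qed.

Lemma abs_Rintegral_le f : measurable_fun setT f ->
  (`|\int[m]_x f x|%:E <= nint (fun x => `|f x|%R))%E.
Proof.
move=> mf; have mE : measurable_fun setT (EFin \o f) by exact/measurable_EFinP.
apply: le_trans (le_abse_integral m measurableT mE).
rewrite /Rintegral; case: (\int[m]_x _)%E => [r|/=|/=] //=; by rewrite normr0 leey.
Qed.

Lemma nint_Rintegral f : (forall x, 0 <= f x) -> m.-integrable setT (EFin \o f) ->
  (\int[m]_x f x)%:E = nint f.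
Proof. by move=> f0 If; rewrite fineK//; exact: integrable_fin_num. Qed.

Lemma dominated_Rintegral (u : nat -> T -> R) f g :
  (forall n, measurable_fun setT (u n)) -> measurable_fun setT f ->
  (forall x, u n x @[n --> \oo] --> f x) ->
  m.-integrable setT (EFin \o g) -> (forall n x, `|u n x| <= g x) ->
  \int[m]_x u n x @[n --> \oo] --> \int[m]_x f x.
Proof.
move=> mu' mf uf Ig ug.
have If : m.-integrable setT (EFin \o f).
  apply: le_integrableR Ig => // x; apply: (cvgr_to_le (cvg_norm (uf x))).
  by apply: nearW => n; exact: ug.
apply: fine_cvg; rewrite fineK; last exact: integrable_fin_num.
apply: (@dominated_cvg _ _ _ m setT measurableT
  (fun n x => (u n x)%:E) (EFin \o f) (EFin \o g)) => //.
- by move=> n; apply/measurable_EFinP.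
- by move=> x _; apply: cvg_EFin; [apply: nearW => n|exact: uf].
- by move=> n x _; rewrite lee_fin.
Qed.

End real_integral.

Arguments nint {R d T} m f.

Section fubini_real.
Context {R : realType} d1 d2 (T1 : measurableType d1) (T2 : measurableType d2).
Variables (m1 : {sigma_finite_measure set T1 -> \bar R}).
Variables (m2 : {sigma_finite_measure set T2 -> \bar R}).
Implicit Types F : T1 -> T2 -> R.

Lemma measurable_uncurry1 F x : measurable_fun setT (fun p => F p.1 p.2) ->
  measurable_fun setT (F x).
Proof.
move=> mF; rewrite (_ : F x = (fun p => F p.1 p.2) \o pair x)//.
by apply: measurableT_comp => //; exact: measurable_pair1.
Qed.

Lemma measurable_uncurry2 F y : measurable_fun setT (fun p => F p.1 p.2) ->
  measurable_fun setT (F^~ y).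
Proof.
move=> mF; rewrite (_ : F^~ y = (fun p => F p.1 p.2) \o pair^~ y)//.
by apply: measurableT_comp => //; exact: measurable_pair2.
Qed.

Lemma measurable_uncurry_comp F d (T : measurableType d) (a : T -> T1) (b : T -> T2) :
  measurable_fun setT (fun p => F p.1 p.2) -> measurable_fun setT a ->
  measurable_fun setT b -> measurable_fun setT (fun t => F (a t) (b t)).
Proof.
move=> mF ma mb.
rewrite (_ : (fun t => _) = (fun p => F p.1 p.2) \o (fun t => (a t, b t)))//.
by apply: measurableT_comp => //; exact/measurable_fun_pairP.
Qed.

Lemma measurable_nint F : measurable_fun setT (fun p => F p.1 p.2) ->
  (forall x y, 0 <= F x y) -> measurable_fun setT (fun x => nint m2 (F x)).
Proof.
move=> mF F0.
apply: (@measurable_fun_fubini_tonelli_F _ _ _ _ _ m2 (fun p => (F p.1 p.2)%:E)).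
  exact/measurable_EFinP.
by move=> p; rewrite lee_fin.
Qed.

Lemma measurable_Rintegral F : measurable_fun setT (fun p => F p.1 p.2) ->
  measurable_fun setT (fun x => \int[m2]_y F x y).
Proof.
move=> mF; rewrite /Rintegral; apply: measurableT_comp; first exact: fine_measurable.
pose Fe := fun p => (F p.1 p.2)%:E.
have mFe : measurable_fun setT Fe by exact/measurable_EFinP.
rewrite (_ : (fun x => _) = (fun x => \int[m2]_y Fe^\+ (x, y)) \-
    (fun x => \int[m2]_y Fe^\- (x, y)))%E; last first.
  apply/funext => x; rewrite [LHS]integralE.
  by congr (_ - _)%E; apply: eq_integral => y _; rewrite ?funeposE ?funenegE.
apply: emeasurable_funB.
  by apply: measurable_fun_fubini_tonelli_F => //; exact: measurable_funepos.
by apply: measurable_fun_fubini_tonelli_F => //; exact: measurable_funeneg.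
Qed.

Lemma tonelli F : measurable_fun setT (fun p => F p.1 p.2) ->
  (forall x y, 0 <= F x y) ->
  (\int[m1]_x nint m2 (F x) = \int[m2]_y nint m1 (F^~ y))%E.
Proof.
move=> mF F0; rewrite /nint.
apply: (@fubini_tonelli _ _ _ _ _ m1 m2 (fun p => (F p.1 p.2)%:E)).
  exact/measurable_EFinP.
by move=> p; rewrite /= lee_fin.
Qed.

(** The slices are integrable at every point and not merely almost everywhere, which holds for the
    kernels in use and lets [fine] be removed pointwise. *)
Lemma Rfubini F : measurable_fun setT (fun p => F p.1 p.2) ->
  (\int[m1]_x nint m2 (fun y => `|F x y|%R) < +oo)%E ->
  (forall x, m2.-integrable setT (EFin \o F x)) ->
  (forall y, m1.-integrable setT (EFin \o F^~ y)) ->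
  \int[m1]_x \int[m2]_y F x y = \int[m2]_y \int[m1]_x F x y.
Proof.
move=> mF fin I2 I1.
pose Fe := fun p => (F p.1 p.2)%:E.
have mFe : measurable_fun setT Fe by exact/measurable_EFinP.
have IF : (m1 \x m2)%E.-integrable setT Fe.
  by apply/(integrable12ltyP _ _ mFe); exact: fin.
rewrite /Rintegral; congr fine.
have E2 x : (fine (\int[m2]_y (F x y)%:E))%:E = (\int[m2]_y (F x y)%:E)%E.
  by rewrite fineK//; exact: (integrable_fin_num measurableT (I2 x)).
have E1 y : (fine (\int[m1]_x (F x y)%:E))%:E = (\int[m1]_x (F x y)%:E)%E.
  by rewrite fineK//; exact: (integrable_fin_num measurableT (I1 y)).
under eq_integral do rewrite E2.
under [RHS]eq_integral do rewrite E1.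
exact: (Fubini IF).
Qed.

End fubini_real.

(** * Convolutions *)

Section convolution.
Context {R : realType} {N : nat}.
Local Notation V := 'rV[R]_N.
Local Notation mu := (lebesgue_rV R N).
Implicit Types f g h k l : V -> R.

Lemma nint_affine c b f : c != 0 -> measurable_fun setT f -> (forall x, 0 <= f x) ->
  (nint mu f = (`|c| ^+ N)%:E * nint mu (fun x => f (c *: x + b))%R)%E.
Proof.
by move=> c0 mf f0; apply: ge0_integral_affine => //; exact/measurable_EFinP.
Qed.

Lemma nint_shift b f : measurable_fun setT f -> (forall x, 0 <= f x) ->
  nint mu (fun x => f (x - b)) = nint mu f.
Proof.
move=> mf f0; rewrite [RHS](@nint_affine 1 (- b)) ?oner_eq0//.
by rewrite normr1 expr1n mul1e; under [in RHS]eq_fun do rewrite scale1r.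
Qed.

Lemma nint_reflect b f : measurable_fun setT f -> (forall x, 0 <= f x) ->
  nint mu (fun y => f (b - y)) = nint mu f.
Proof.
move=> mf f0; rewrite [RHS](@nint_affine (-1) b) ?oppr_eq0 ?oner_eq0//.
rewrite normrN normr1 expr1n mul1e; congr (nint _ _).
by apply/funext => x; rewrite scaleN1r addrC.
Qed.

Lemma integrable_affine c b f : c != 0 -> mu.-integrable setT (EFin \o f) ->
  mu.-integrable setT (EFin \o (fun x => f (c *: x + b))).
Proof.
move=> c0 If; have mf := integrable_measurable If.
have ma : measurable_fun setT (fun x : V => f (c *: x + b)) by msr.
apply/integrable_nintP => //.
rewrite (@nint_affine c^-1 (- (c^-1 *: b))) ?invr_eq0//; last by msr.
under eq_fun do rewrite scalerDr scalerA mulfV// scale1r scalerN scalerA mulfV// scale1r subrK.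
by rewrite lte_mul_pinfty ?lee_fin//; exact/integrable_nintP.
Qed.

Lemma Rintegral_affine c b f : c != 0 -> mu.-integrable setT (EFin \o f) ->
  \int[mu]_x f x = `|c| ^+ N * \int[mu]_x f (c *: x + b).
Proof.
move=> c0 If.
have pos g : (forall x, 0 <= g x) -> mu.-integrable setT (EFin \o g) ->
    \int[mu]_x g x = `|c| ^+ N * \int[mu]_x g (c *: x + b).
  move=> g0 Ig; apply: EFin_inj; rewrite EFinM !nint_Rintegral//.
    apply: nint_affine => //; exact: integrable_measurable Ig.
  exact: integrable_affine.
have I1 := integrableR_norm If.
have I2 := integrableRD I1 If.
have fE x : f x = (`|f x| + f x) - `|f x| by rewrite addrAC subrr add0r.
under eq_Rintegral do rewrite fE.
under [in RHS]eq_Rintegral do rewrite fE.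
rewrite RintegralB// RintegralB//; first last.
- exact: (@integrable_affine c b (fun x => `|f x|)).
- exact: (@integrable_affine c b (fun x => `|f x| + f x)).
rewrite mulrBr -(pos (fun x => `|f x| + f x)) -?(pos (fun x => `|f x|))// => x.
by rewrite -lerBlDr sub0r -normrN ler_norm.
Qed.

Lemma Rintegral_shift b f : mu.-integrable setT (EFin \o f) ->
  \int[mu]_x f (x - b) = \int[mu]_x f x.
Proof.
move=> If; rewrite [RHS](@Rintegral_affine 1 (- b)) ?oner_eq0//.
rewrite normr1 expr1n mul1r; by under [in RHS]eq_Rintegral do rewrite scale1r.
Qed.

Lemma Rintegral_reflect b f : mu.-integrable setT (EFin \o f) ->
  \int[mu]_x f (b - x) = \int[mu]_x f x.
Proof.
move=> If; rewrite [RHS](@Rintegral_affine (-1) b) ?oppr_eq0 ?oner_eq0//.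
rewrite normrN normr1 expr1n mul1r.
by under [in RHS]eq_Rintegral do rewrite scaleN1r addrC.
Qed.

(** The working class: stable under sums, bounded multipliers, affine changes of variable and
    convolution, and contained in every L^p with p >= 1. All intermediate integrals are therefore
    finite. *)
Definition bL1 f := [/\ measurable_fun setT f, exists M, forall x, `|f x| <= M &
  mu.-integrable setT (EFin \o f)].

Lemma bL1_bound f : bL1 f -> exists M, 0 < M /\ forall x, `|f x| <= M.
Proof.
move=> [_ [M fM] _]; exists (`|M| + 1); split; first by rewrite ltr_wpDl.
by move=> x; rewrite (le_trans (fM x))// (le_trans (ler_norm _))// lerDl.
Qed.

Lemma bL1_nint f : bL1 f -> (nint mu (fun x => `|f x|)%R < +oo)%E.
Proof. by case=> mf _ If; exact/integrable_nintP. Qed.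

Lemma bL1_dominated f g : measurable_fun setT f -> bL1 g ->
  (forall x, `|f x| <= `|g x|) -> bL1 f.
Proof.
move=> mf [mg [M gM] Ig] fg; split => //.
  by exists M => x; rewrite (le_trans (fg x)).
apply: (le_integrableR (g := fun x => `|g x|)) => //.
exact: integrableR_norm.
Qed.

Lemma bL1_norm f : bL1 f -> bL1 (fun x => `|f x|).
Proof.
move=> Hf; have [mf _ _] := Hf; apply: bL1_dominated Hf _; first by msr.
by move=> x; rewrite normr_id.
Qed.

Lemma bL1D f g : bL1 f -> bL1 g -> bL1 (fun x => f x + g x).
Proof.
move=> [mf [M fM] If] [mg [M' gM] Ig]; split; first by msr.
  by exists (M + M') => x; rewrite (le_trans (ler_normD _ _))// lerD.
exact: integrableRD.
Qed.

Lemma bL1Z c f : bL1 f -> bL1 (fun x => c * f x).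
Proof.
move=> [mf [M fM] If]; split; first by msr.
  by exists (`|c| * M) => x; rewrite normrM ler_wpM2l.
exact: integrableRZ.
Qed.

Lemma bL1B f g : bL1 f -> bL1 g -> bL1 (fun x => f x - g x).
Proof.
move=> Hf Hg; rewrite (_ : (fun x => _) = (fun x => f x + (-1) * g x)).
  by apply: bL1D => //; exact: bL1Z.
by apply/funext => x; rewrite mulN1r.
Qed.

Lemma bL1M f g M : bL1 f -> measurable_fun setT g -> (forall x, `|g x| <= M) ->
  bL1 (fun x => g x * f x).
Proof.
move=> Hf mg gM; have [mf _ _] := Hf.
apply: bL1_dominated (bL1Z M Hf) _; first by msr.
by move=> x; rewrite !normrM ler_wpM2r// (le_trans (gM x))// ler_norm.
Qed.

Lemma bL10 : bL1 (fun=> 0).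
Proof.
by split; [exact: measurable_cst|exists 0 => x; rewrite normr0|exact: integrable0].
Qed.

Lemma bL1_sum I (r : seq I) (P : pred I) (F : I -> V -> R) : (forall i, bL1 (F i)) ->
  bL1 (fun x => \sum_(i <- r | P i) F i x).
Proof.
move=> HF; elim: r => [|i r IHr].
  by under eq_fun do rewrite big_nil; exact: bL10.
by under eq_fun do rewrite big_cons; case: (P i) => //; exact: bL1D.
Qed.

Lemma bL1_affine c b f : c != 0 -> bL1 f -> bL1 (fun x => f (c *: x + b)).
Proof.
move=> c0 [mf [M fM] If]; split; first by msr.
  by exists M.
exact: integrable_affine.
Qed.

Lemma bL1_shift b f : bL1 f -> bL1 (fun x => f (x - b)).
Proof.
move=> Hf; have := @bL1_affine 1 (- b) f (oner_neq0 _) Hf.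
by under eq_fun do rewrite scale1r.
Qed.

Lemma bL1_reflect b f : bL1 f -> bL1 (fun x => f (b - x)).
Proof.
move=> Hf; have := @bL1_affine (-1) b f _ Hf.
under eq_fun do rewrite scaleN1r addrC; apply; by rewrite oppr_eq0 oner_eq0.
Qed.

Definition conv k g x : R := \int[mu]_y (k (x - y) * g y).

Definition flip k x : R := k (- x).

Lemma bL1_flip k : bL1 k -> bL1 (flip k).
Proof.
move=> Hk; have := bL1_reflect 0 Hk.
by under eq_fun do rewrite sub0r.
Qed.

Lemma measurable_conv_integrand k g : measurable_fun setT k -> measurable_fun setT g ->
  measurable_fun setT (fun p : V * V => k (p.1 - p.2) * g p.2).
Proof. by move=> mk mg; msr. Qed.

Lemma measurable_conv k g : measurable_fun setT k -> measurable_fun setT g ->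
  measurable_fun setT (conv k g).
Proof.
move=> mk mg.
have H := measurable_conv_integrand mk mg.
exact: (@measurable_Rintegral _ _ _ V V mu (fun x y : V => k (x - y) * g y) H).
Qed.

Lemma bL1_conv_integrand k g x : bL1 k -> bL1 g -> bL1 (fun y => k (x - y) * g y).
Proof.
move=> Hk Hg; have [M kM] : exists M, forall y, `|k (x - y)| <= M.
  by have [_ [M kM] _] := Hk; exists M.
by have [mk _ _] := bL1_reflect x Hk; exact: bL1M Hg mk kM.
Qed.

Lemma abs_conv_le k g x : measurable_fun setT k -> measurable_fun setT g ->
  (`|conv k g x|%:E <= nint mu (fun y => `|k (x - y)| * `|g y|)%R)%E.
Proof.
move=> mk mg; rewrite /conv; apply: le_trans (abs_Rintegral_le _ _) _.
  by msr.
by under eq_fun do rewrite normrM.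
Qed.

Lemma nint_conv_integrand k g : measurable_fun setT k -> measurable_fun setT g ->
  (forall x, 0 <= k x) -> (forall x, 0 <= g x) ->
  (\int[mu]_x nint mu (fun y => k (x - y) * g y)%R = nint mu k * nint mu g)%E.
Proof.
move=> mk mg k0 g0; rewrite tonelli; first last.
- by move=> x y; exact: mulr_ge0.
- exact: measurable_conv_integrand.
rewrite /nint -ge0_integralZl//; first last.
- exact: nint_ge0.
- by move=> x _; rewrite lee_fin.
- exact/measurable_EFinP.
apply: eq_integral => y _; rewrite -[LHS]/(nint mu (fun x => k (x - y) * g y)).
under eq_fun do rewrite mulrC.
rewrite nintZ//; last by msr.
by rewrite nint_shift// muleC.
Qed.

Lemma nint_conv_le k g : measurable_fun setT k -> measurable_fun setT g ->
  (nint mu (fun x => `|conv k g x|)%R <=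
   nint mu (fun x => `|k x|)%R * nint mu (fun x => `|g x|)%R)%E.
Proof.
move=> mk mg; rewrite -nint_conv_integrand//; try by msr.
apply: ge0_le_integral => //.
- by apply/measurable_EFinP; apply: measurable_fun_normr; exact: measurable_conv.
- apply: (@measurable_nint _ _ _ V V mu (fun x y : V => `|k (x - y)| * `|g y|)) => //; msr.
- by move=> x _; exact: abs_conv_le.
Qed.

Lemma bL1_conv k g : bL1 k -> bL1 g -> bL1 (conv k g).
Proof.
move=> Hk Hg; have [mk _ _] := Hk; have [mg _ _] := Hg.
have [M [M0 kM]] := bL1_bound Hk.
split; first exact: measurable_conv.
  exists (M * fine (nint mu (fun y => `|g y|))) => x; rewrite -lee_fin EFinM fineK; last first.
    by rewrite ge0_fin_numE ?bL1_nint// nint_ge0.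
  apply: le_trans (abs_conv_le _ mk mg) _; rewrite -nintZ ?(ltW M0)//; try by msr.
  apply: le_nint; try by msr.
  - by move=> y; rewrite mulr_ge0.
  - by move=> y; rewrite ler_wpM2r.
apply/integrable_nintP; first exact: measurable_conv.
apply: le_lt_trans (nint_conv_le mk mg) _.
have : (nint mu (fun x => `|k x|)%R \is a fin_num) by rewrite ge0_fin_numE ?bL1_nint// nint_ge0.
have : (nint mu (fun x => `|g x|)%R \is a fin_num) by rewrite ge0_fin_numE ?bL1_nint// nint_ge0.
by move=> /fineK <- /fineK <-; rewrite -EFinM ltey.
Qed.

Lemma conv_sumr I (r : seq I) (P : pred I) k (g : I -> V -> R) x :
  bL1 k -> (forall i, bL1 (g i)) ->
  conv k (fun y => \sum_(i <- r | P i) g i y) x = \sum_(i <- r | P i) conv k (g i) x.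
Proof.
move=> Hk Hg; rewrite -Rintegral_sum; last first.
  by move=> i; have [] := bL1_conv_integrand x Hk (Hg i).
by apply: eq_Rintegral => y _; rewrite mulr_sumr.
Qed.

Lemma convDr k g h x : bL1 k -> bL1 g -> bL1 h ->
  conv k (fun y => g y + h y) x = conv k g x + conv k h x.
Proof.
move=> Hk Hg Hh; rewrite -RintegralD//.
- by apply: eq_Rintegral => y _; rewrite mulrDr.
- by have [] := bL1_conv_integrand x Hk Hg.
- by have [] := bL1_conv_integrand x Hk Hh.
Qed.

Lemma convBr k g h x : bL1 k -> bL1 g -> bL1 h ->
  conv k (fun y => g y - h y) x = conv k g x - conv k h x.
Proof.
move=> Hk Hg Hh; rewrite -RintegralB//.
- by apply: eq_Rintegral => y _; rewrite mulrBr.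
- by have [] := bL1_conv_integrand x Hk Hg.
- by have [] := bL1_conv_integrand x Hk Hh.
Qed.

Lemma convZr k c g x : bL1 k -> bL1 g -> conv k (fun y => c * g y) x = c * conv k g x.
Proof.
move=> Hk Hg; rewrite -RintegralZl//; last by have [] := bL1_conv_integrand x Hk Hg.
by apply: eq_Rintegral => y _; rewrite mulrCA.
Qed.

Lemma convDl k l g x : bL1 k -> bL1 l -> bL1 g ->
  conv (fun y => k y + l y) g x = conv k g x + conv l g x.
Proof.
move=> Hk Hl Hg; rewrite -RintegralD//.
- by apply: eq_Rintegral => y _; rewrite mulrDl.
- by have [] := bL1_conv_integrand x Hk Hg.
- by have [] := bL1_conv_integrand x Hl Hg.
Qed.

Lemma convBl k l g x : bL1 k -> bL1 l -> bL1 g ->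
  conv (fun y => k y - l y) g x = conv k g x - conv l g x.
Proof.
move=> Hk Hl Hg; rewrite -RintegralB//.
- by apply: eq_Rintegral => y _; rewrite mulrBl.
- by have [] := bL1_conv_integrand x Hk Hg.
- by have [] := bL1_conv_integrand x Hl Hg.
Qed.

Lemma convC k g : bL1 k -> bL1 g -> conv k g = conv g k.
Proof.
move=> Hk Hg; apply/funext => x; rewrite /conv -(Rintegral_reflect x).
  by apply: eq_Rintegral => y _; rewrite opprB addrC subrK mulrC.
by have [] := bL1_conv_integrand x Hk Hg.
Qed.

(** Fubini; a bound for h reduces absolute integrability to that of the convolution of |k| with
    |g|. *)
Lemma conv_adjoint k g h : bL1 k -> bL1 g -> bL1 h ->
  \int[mu]_x (conv k g x * h x) = \int[mu]_x (g x * conv (flip k) h x).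
Proof.
move=> Hk Hg Hh; have [mk _ _] := Hk; have [mg _ _] := Hg; have [mh _ _] := Hh.
have I2 x : bL1 (fun y => k (x - y) * g y * h x).
  under eq_fun do rewrite mulrC; apply: bL1Z; exact: bL1_conv_integrand.
have I1 y : bL1 (fun x => k (x - y) * g y * h x).
  have [M [M0 kM]] := bL1_bound (bL1_shift y Hk).
  under eq_fun do rewrite mulrAC mulrC; apply: bL1Z.
  by have [m _ _] := bL1_shift y Hk; exact: bL1M Hh m kM.
transitivity (\int[mu]_x \int[mu]_y (k (x - y) * g y * h x)).
  apply: eq_Rintegral => x _; rewrite RintegralZr//.
  by have [] := bL1_conv_integrand x Hk Hg.
rewrite Rfubini.
- apply: eq_Rintegral => y _; rewrite -RintegralZl//; last first.
    by have [] := bL1_conv_integrand y (bL1_flip Hk) Hh.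
  by apply: eq_Rintegral => x _; rewrite /flip opprB mulrCA mulrA.
- by msr.
- have [M [M0 hM]] := bL1_bound Hh.
  apply: (@le_lt_trans _ _ (\int[mu]_x nint mu (fun y => `|M * k (x - y)| * `|g y|)%R)%E).
    apply: ge0_le_integral => //.
    + by move=> x _; exact: nint_ge0.
    + apply: (@measurable_nint _ _ _ V V mu (fun x y : V => `|k (x - y) * g y * h x|)) => //.
      by msr.
    + apply: (@measurable_nint _ _ _ V V mu (fun x y : V => `|M * k (x - y)| * `|g y|)) => //.
      by msr.
    + move=> x _; apply: le_nint; try by msr.
        by [].
      move=> y; rewrite !normrM (gtr0_norm M0) mulrC mulrA ler_wpM2r// ler_wpM2r//.
  rewrite (nint_conv_integrand (k := fun z => `|M * k z|) (g := fun z => `|g z|))//; try by msr.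
  have H1 : (nint mu (fun x => `|M * k x|)%R < +oo)%E by exact/bL1_nint/bL1Z.
  have H2 := bL1_nint Hg.
  by rewrite lte_mul_pinfty ?nint_ge0// ge0_fin_numE// nint_ge0.
- by move=> x; have [] := I2 x.
- by move=> y; have [] := I1 y.
Qed.

Lemma convA k l g : bL1 k -> bL1 l -> bL1 g -> conv k (conv l g) = conv (conv k l) g.
Proof.
move=> Hk Hl Hg; apply/funext => x.
have Hkx := bL1_reflect x Hk.
transitivity (\int[mu]_y (conv l g y * k (x - y))).
  by apply: eq_Rintegral => y _; rewrite mulrC.
rewrite (conv_adjoint (h := fun y => k (x - y)))//.
apply: eq_Rintegral => z _; rewrite mulrC; congr (_ * _).
rewrite [RHS]/conv -(Rintegral_shift z); last first.
  by have [] := bL1_conv_integrand (x - z) Hk Hl.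
apply: eq_Rintegral => y _; rewrite mulrC /flip !opprB; congr (k _ * _).
by rewrite addrA subrK.
Qed.

End convolution.

(** * Dyadic averages *)

Section coordinatewise_continuity.
Context {R : realType} {N : nat}.
Local Notation V := 'rV[R]_N.
Local Notation mu := (lebesgue_rV R N).
Implicit Types (f g k : V -> R) (x y z : V).

(** Preferred to the Euclidean norm because it bounds sums over coordinates directly. The Euclidean
    norm comes back only where the definitions impose it: Schwartz decay, the support of the Fourier
    transform and the Gagliardo weight. *)
Definition l1norm (x : V) : R := \sum_(i < N) `|x 0 i|.

Lemma l1norm_ge0 x : 0 <= l1norm x.
Proof. exact: sumr_ge0. Qed.

Lemma l1normN x : l1norm (- x) = l1norm x.
Proof. by apply: eq_bigr => i _; rewrite mxE normrN. Qed.

Lemma l1normD x y : l1norm (x + y) <= l1norm x + l1norm y.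
Proof. by rewrite -big_split/=; apply: ler_sum => i _; rewrite mxE ler_normD. Qed.

Lemma l1normZ (c : R) x : l1norm (c *: x) = `|c| * l1norm x.
Proof. by rewrite mulr_sumr; apply: eq_bigr => i _; rewrite mxE normrM. Qed.

Lemma l1norm_distrC x y : l1norm (x - y) = l1norm (y - x).
Proof. by rewrite -l1normN opprB. Qed.

Lemma ler_coord_l1norm x i : `|x 0 i| <= l1norm x.
Proof. by rewrite /l1norm (bigD1 i)//= lerDl sumr_ge0. Qed.

Lemma measurable_l1norm : measurable_fun setT l1norm.
Proof.
apply: measurable_fun_bigsum => i; apply: measurable_fun_normr.
exact: measurable_rV_coord.
Qed.

Lemma measurable_fun_l1norm d (T : measurableType d) (h : T -> V) :
  measurable_fun setT h -> measurable_fun setT (fun t => l1norm (h t)).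
Proof. by move=> mh; exact: measurableT_comp measurable_l1norm mh. Qed.

Definition coord_cvg (u : nat -> V) (x : V) :=
  forall i, u n 0 i @[n --> \oo] --> x 0 i.

(** Sequential continuity along coordinatewise limits: exactly what dominated convergence delivers
    for convolutions, without the topology of ['rV[R]_N]. *)
Definition scont f := forall u x, coord_cvg u x -> f (u n) @[n --> \oo] --> f x.

Lemma coord_cvg_affine u x c b : coord_cvg u x ->
  coord_cvg (fun n => c *: u n + b) (c *: x + b).
Proof.
move=> ux i; rewrite (_ : (fun n => _) = (fun n => c * u n 0 i + b 0 i)); last first.
  by apply/funext => n; rewrite !mxE.
rewrite !mxE; apply: cvgD; last exact: cvg_cst.
by apply: cvgM; [exact: cvg_cst|exact: ux].
Qed.

Lemma scont_affine f c b : scont f -> scont (fun x => f (c *: x + b)).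
Proof. by move=> cf u x ux; apply: cf; exact: coord_cvg_affine. Qed.

Lemma scont_shift f b : scont f -> scont (fun x => f (x - b)).
Proof.
move=> cf; have := @scont_affine f 1 (- b) cf.
by under eq_fun do rewrite scale1r.
Qed.

Lemma scontD f g : scont f -> scont g -> scont (fun x => f x + g x).
Proof. by move=> cf cg u x ux; apply: cvgD; [exact: cf|exact: cg]. Qed.

Lemma scontB f g : scont f -> scont g -> scont (fun x => f x - g x).
Proof. by move=> cf cg u x ux; apply: cvgB; [exact: cf|exact: cg]. Qed.

Lemma scontM f g : scont f -> scont g -> scont (fun x => f x * g x).
Proof. by move=> cf cg u x ux; apply: cvgM; [exact: cf|exact: cg]. Qed.

Lemma scont_cst c : scont (fun=> c).
Proof. by move=> u x ux; exact: cvg_cst. Qed.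

Lemma scontZ c f : scont f -> scont (fun x => c * f x).
Proof. by move=> cf; apply: scontM => //; exact: scont_cst. Qed.

Lemma scont_sum I (r : seq I) (P : pred I) (F : I -> V -> R) :
  (forall i, scont (F i)) -> scont (fun x => \sum_(i <- r | P i) F i x).
Proof.
move=> cF; elim: r => [|i r IHr].
  by under eq_fun do rewrite big_nil; exact: scont_cst.
by under eq_fun do rewrite big_cons; case: (P i) => //; exact: scontD.
Qed.

Lemma scont_comp (phi : R -> R) f : continuous phi -> scont f -> scont (phi \o f).
Proof. by move=> cphi cf u x ux; apply: (cvg_comp _ _ (cf _ _ ux)); exact: cphi. Qed.

Lemma scont_sqrt f : scont f -> scont (fun x => Num.sqrt (f x)).
Proof. by move=> cf; exact: (scont_comp (@sqrt_continuous R) cf). Qed.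

Lemma scont_sqr f : scont f -> scont (fun x => f x ^+ 2).
Proof. by move=> cf; under eq_fun do rewrite expr2; exact: scontM. Qed.

(** Away from 0 this is continuity of exp and ln; a limit equal to 0 is treated by hand, as it
    occurs wherever a square function vanishes. *)
Lemma cvg_powR (u : nat -> R) (x a : R) : 0 < a -> (forall n, 0 <= u n) ->
  u n @[n --> \oo] --> x -> u n `^ a @[n --> \oo] --> x `^ a.
Proof.
move=> a0 u0 ux.
have x0 : 0 <= x by apply: (cvgr_to_ge ux); exact: nearW.
move: x0; rewrite le_eqVlt => /predU1P[x0|x0].
  rewrite -x0 powR0 ?gt_eqF//; apply/cvgr0Pnorm_lt => e e0.
  have e'0 : 0 < e `^ a^-1 by exact: powR_gt0.
  rewrite -x0 in ux; move/cvgr0Pnorm_lt : ux => /(_ _ e'0).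
  apply: filterS => n; rewrite ger0_norm// ger0_norm ?powR_ge0// => ue.
  have := gt0_ltr_powR a0 (u0 n) (powR_ge0 _ _) ue.
  by rewrite -powRrM mulVf ?gt_eqF// powRr1// ltW.
rewrite {2}/powR gt_eqF//.
have : expR (a * ln (u n)) @[n --> \oo] --> expR (a * ln x).
  apply: (cvg_comp (fun n => a * ln (u n)) expR); last exact: continuous_expR.
  apply: cvgM; first exact: cvg_cst.
  by apply: (cvg_comp _ _ ux); exact: continuous_ln.
apply: cvg_trans; apply: near_eq_cvg.
have : \forall n \near \oo, 0 < u n by exact: (cvgr_gt x).
by apply: filterS => n un; rewrite /powR gt_eqF.
Qed.

Lemma scont_powR f a : 0 < a -> (forall x, 0 <= f x) -> scont f ->
  scont (fun x => f x `^ a).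
Proof. by move=> a0 f0 cf u x ux; apply: cvg_powR => //; exact: cf. Qed.

Lemma scont_conv k g : scont k -> measurable_fun setT k -> (exists M, forall x, `|k x| <= M) ->
  mu.-integrable setT (EFin \o g) -> scont (conv k g).
Proof.
move=> ck mk [M kM] Ig u x ux; have mg := integrable_measurable Ig.
apply: (@dominated_Rintegral _ _ _ mu _ _ (fun y => M * `|g y|)).
- by move=> n; msr.
- by msr.
- by move=> y; apply: (scontM (@scont_shift k y ck) (@scont_cst (g y))).
- exact/integrableRZ/integrableR_norm.
- by move=> n y; rewrite normrM ler_wpM2r.
Qed.

End coordinatewise_continuity.

Section dyadic_cells.
Context {R : realType} {N : nat}.
Local Notation V := 'rV[R]_N.
Local Notation mu := (lebesgue_rV R N).
Implicit Types (f g : V -> R) (x y z : V).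

(** Labels the half-open cube of side 1/r that contains x, so r is an inverse length. The labels are
    countable, whence the measurability of everything that is constant on cells. *)
Definition cell (r : R) (x : V) : 'rV[int]_N := \row_i Num.floor (r * x 0 i).
Definition same_cell r x y := cell r x == cell r y.

Lemma cellE r x i : cell r x 0 i = Num.floor (r * x 0 i).
Proof. by rewrite mxE. Qed.

Lemma cell_fiberE r (c : 'rV[int]_N) : 0 < r -> [set x | cell r x = c] =
  [set x | forall i, [set` `[(c 0 i)%:~R / r, (c 0 i + 1)%:~R / r[] (x 0 i)].
Proof.
move=> r0; apply/seteqP; split=> x /= H.
  move=> i; rewrite -H cellE in_itv/= ler_pdivrMr// ltr_pdivlMr// mulrC.
  by rewrite floor_le floorD1_gt.
apply/rowP => i; rewrite cellE; apply/eqP; rewrite floor_eq.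
by have := H i; rewrite in_itv/= ler_pdivrMr// ltr_pdivlMr// mulrC.
Qed.

Lemma measurable_cell_fiber r (c : 'rV[int]_N) : 0 < r -> measurable [set x | cell r x = c].
Proof.
move=> r0.
have -> : [set x : V | cell r x = c] = \bigcap_(i in [set: 'I_N]) (rV_coord i @^-1`
    [set` `[(c 0 i)%:~R / r, (c 0 i + 1)%:~R / r[]).
  rewrite cell_fiberE//.
  by apply/seteqP; split=> x /= H i; [move=> _|]; exact: H.
apply: fin_bigcap_measurable => // i _.
by rewrite -[X in measurable X]setTI; exact: measurable_rV_coord.
Qed.

Lemma measure_cell_fiber r (c : 'rV[int]_N) : 0 < r ->
  mu [set x | cell r x = c] = ((r^-1) ^+ N)%:E.
Proof.
move=> r0; rewrite cell_fiberE//.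
rewrite (lebesgue_rV_box (A := fun i => [set` `[(c 0 i)%:~R / r, (c 0 i + 1)%:~R / r[]))//.
under eq_bigr => i _.
  rewrite lebesgue_measure_itv/= lte_fin ltr_pM2r ?invr_gt0// ltr_int ltrDl ltr01 -EFinB.
  rewrite -mulrBl -intrB addrAC subrr add0r mul1r; over.
by rewrite prodEFin prodr_const card_ord.
Qed.

Lemma countable_rowint : countable [set: 'rV[int]_N].
Proof. exact: countableP. Qed.

Lemma measurable_cell_fun r (F : 'rV[int]_N -> R) : 0 < r ->
  measurable_fun setT (fun x => F (cell r x)).
Proof.
move=> r0 _ Y mY; rewrite setTI.
rewrite (_ : _ @^-1` Y = \bigcup_c ([set x | cell r x = c] `&` [set x : V | Y (F c)])).
  apply: countable_bigcupT_measurable; first exact: countable_rowint.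
  move=> c; apply: measurableI; first exact: measurable_cell_fiber.
  have [h|h] := pselect (Y (F c)).
    by rewrite (_ : mkset _ = setT)//; apply/seteqP; split.
  by rewrite (_ : mkset _ = set0)//; apply/seteqP; split.
by apply/seteqP; split=> x /= => [h|[c _ [<-]]//]; exists (cell r x).
Qed.

Lemma measurable_same_cell r : 0 < r ->
  measurable_fun setT (fun p : V * V => (same_cell r p.1 p.2)%:R : R).
Proof.
move=> r0; pose A := \bigcup_c ([set x : V | cell r x = c] `*` [set x : V | cell r x = c]).
rewrite (_ : (fun p => _) = \1_A).
  apply/measurable_indic/countable_bigcupT_measurable; first exact: countable_rowint.
  by move=> c; apply: measurableX; exact: measurable_cell_fiber.
apply/funext => -[x y]; rewrite indicE /=; congr (_%:R); congr nat_of_bool.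
apply/idP/idP => [/eqP h|/set_mem[c _ [/= <- /esym/eqP//]]].
by apply/mem_set; exists (cell r x).
Qed.

Lemma same_cell_sym r x y : same_cell r x y = same_cell r y x.
Proof. by rewrite /same_cell eq_sym. Qed.

Lemma same_cell_coord r x y i : 0 < r -> same_cell r x y -> `|x 0 i - y 0 i| <= r^-1.
Proof.
move=> r0 /eqP/rowP/(_ i); rewrite !cellE => h.
rewrite -(ler_pM2l r0) mulfV ?gt_eqF// -[X in X * _](gtr0_norm r0) -normrM mulrBr.
have := floor_le (r * x 0 i); have := floorD1_gt (r * x 0 i).
have := floor_le (r * y 0 i); have := floorD1_gt (r * y 0 i); rewrite -h intrD.
by move=> h1 h2 h3 h4; rewrite ler_norml; apply/andP; split; lra.
Qed.

Lemma same_cell_l1norm r x y : 0 < r -> same_cell r x y -> l1norm (x - y) <= N%:R / r.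
Proof.
move=> r0 h; apply: (@le_trans _ _ (\sum_(i < N) r^-1)).
  by apply: ler_sum => i _; rewrite !mxE same_cell_coord.
by rewrite sumr_const card_ord mulr_natl.
Qed.

(** The cells are nested because floor(2 u) determines floor(u). *)
Lemma same_cell_double r x y : 0 < r -> same_cell (r * 2) x y -> same_cell r x y.
Proof.
move=> r0 /eqP/rowP h; apply/eqP/rowP => i; have := h i; rewrite !cellE => {}h.
apply/eqP; rewrite floor_eq; set n := Num.floor (r * y 0 i).
have h1 : n%:~R <= r * y 0 i by exact: floor_le.
have h2 : r * y 0 i < (n + 1)%:~R by exact: floorD1_gt.
have h3 : (n * 2)%:~R <= r * 2 * x 0 i.
  by rewrite -floor_ge_int h floor_ge_int intrM; lra.
have h4 : r * 2 * x 0 i < ((n + 1) * 2)%:~R.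
  by rewrite -floor_lt_int h floor_lt_int intrM; lra.
by move: h3 h4; rewrite !intrM => h3 h4; apply/andP; split; lra.
Qed.

(** The kernel of the conditional expectation onto the cells. It is symmetric and has mass 1, so
    [avg] is self-adjoint and no sum over cubes is ever written. *)
Definition avg_ker r (x y : V) : R := r ^+ N * (same_cell r x y)%:R.
Definition avg r g x : R := \int[mu]_y (avg_ker r x y * g y).

Lemma avg_ker_ge0 r x y : 0 < r -> 0 <= avg_ker r x y.
Proof. by move=> r0; rewrite mulr_ge0// exprn_ge0// ltW. Qed.

Lemma avg_kerC r x y : avg_ker r x y = avg_ker r y x.
Proof. by rewrite /avg_ker same_cell_sym. Qed.

Lemma measurable_avg_ker r : 0 < r ->
  measurable_fun setT (fun p : V * V => avg_ker r p.1 p.2).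
Proof.
by move=> r0; apply: measurable_funM; [exact: measurable_cst|exact: measurable_same_cell].
Qed.

Lemma measurable_avg_kerx r x : 0 < r -> measurable_fun setT (avg_ker r x).
Proof.
move=> r0; exact: (measurable_uncurry1 (F := avg_ker r) x (measurable_avg_ker r0)).
Qed.

Lemma nint_avg_ker r x : 0 < r -> nint mu (avg_ker r x) = 1%E.
Proof.
move=> r0; rewrite /avg_ker nintZ//; first last.
- by rewrite exprn_ge0// ltW.
- exact: (measurable_uncurry1 (F := fun x y => (same_cell r x y)%:R) x (measurable_same_cell r0)).
rewrite (_ : (fun y => _) = \1_[set y | cell r y = cell r x]); last first.
  apply/funext => y; rewrite indicE; congr (_%:R); congr nat_of_bool.
  apply/idP/idP => [/eqP h|/set_mem/= h]; first by apply/mem_set; rewrite /= h.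
  by rewrite /same_cell h.
rewrite /nint integral_indic// ?setIT ?setTI; last exact: measurable_cell_fiber.
by rewrite [X in (_ * X)%E](measure_cell_fiber (cell r x) r0) -EFinM -exprMn mulfV ?gt_eqF// expr1n.
Qed.

Lemma bL1_avg_ker r x : 0 < r -> bL1 (avg_ker r x).
Proof.
move=> r0; have m := measurable_avg_kerx x r0; split => //.
  exists (r ^+ N) => y; rewrite ger0_norm ?avg_ker_ge0// ler_piMr ?exprn_ge0 ?(ltW r0)//.
  by case: same_cell.
apply/integrable_nintP => //; under eq_fun do rewrite ger0_norm ?avg_ker_ge0//.
by rewrite nint_avg_ker// ltry.
Qed.

Lemma Rintegral_avg_ker r x : 0 < r -> \int[mu]_y avg_ker r x y = 1.
Proof. by move=> r0; rewrite /Rintegral -/(nint mu (avg_ker r x)) nint_avg_ker. Qed.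

Lemma bL1_avg_integrand r g x : 0 < r -> bL1 g -> bL1 (fun y => avg_ker r x y * g y).
Proof.
move=> r0 Hg; have [m [M h] _] := bL1_avg_ker x r0; exact: bL1M Hg m h.
Qed.

Lemma measurable_avg r g : 0 < r -> measurable_fun setT g -> measurable_fun setT (avg r g).
Proof.
move=> r0 mg; apply: (@measurable_Rintegral _ _ _ V V mu (fun x y => avg_ker r x y * g y)).
by apply: measurable_funM; [exact: measurable_avg_ker|msr].
Qed.

Lemma avg_cell r g x y : same_cell r x y -> avg r g x = avg r g y.
Proof. by move=> /eqP h; rewrite /avg /avg_ker /same_cell h. Qed.

Lemma avg_mulr r (s g : V -> R) x : 0 < r -> bL1 g -> measurable_fun setT s ->
  (exists M, forall y, `|s y| <= M) ->
  (forall y z, same_cell r y z -> s y = s z) -> avg r (fun y => s y * g y) x = s x * avg r g x.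
Proof.
move=> r0 Hg ms [M sM] hs; rewrite -RintegralZl//; last first.
  by have [] := bL1_avg_integrand x r0 Hg.
apply: eq_Rintegral => y _; rewrite mulrCA; rewrite /avg_ker.
case: (boolP (same_cell r x y)) => [h|_]; last by rewrite mulr0 !mul0r !mulr0.
by rewrite (hs _ _ h).
Qed.

Lemma le_avg r g h x : 0 < r -> bL1 g -> bL1 h ->
  (forall y, same_cell r x y -> g y <= h y) -> avg r g x <= avg r h x.
Proof.
move=> r0 Hg Hh gh; apply: le_Rintegral => //.
- by have [] := bL1_avg_integrand x r0 Hg.
- by have [] := bL1_avg_integrand x r0 Hh.
move=> y _; rewrite /avg_ker.
case: (boolP (same_cell r x y)) => [/gh h'|_]; last by rewrite mulr0 !mul0r.
by rewrite ler_wpM2l// mulr1 exprn_ge0// ltW.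
Qed.

Lemma avg_ge_cst r g x c : 0 < r -> bL1 g ->
  (forall y, same_cell r x y -> c <= g y) -> c <= avg r g x.
Proof.
move=> r0 Hg cg; have <- : \int[mu]_y (avg_ker r x y * c) = c.
  rewrite RintegralZr ?Rintegral_avg_ker ?mul1r//.
  by have [] := bL1_avg_ker x r0.
apply: le_Rintegral => //.
- under eq_fun do rewrite mulrC; apply: integrableRZ.
  by have [] := bL1_avg_ker x r0.
- by have [] := bL1_avg_integrand x r0 Hg.
move=> y _; rewrite /avg_ker.
case: (boolP (same_cell r x y)) => [/cg h'|_]; last by rewrite mulr0 !mul0r.
by rewrite ler_wpM2l// mulr1 exprn_ge0// ltW.
Qed.

Lemma avgZ r c g x : 0 < r -> bL1 g -> avg r (fun y => c * g y) x = c * avg r g x.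
Proof.
move=> r0 Hg; rewrite -RintegralZl//; last by have [] := bL1_avg_integrand x r0 Hg.
by apply: eq_Rintegral => y _; rewrite mulrCA.
Qed.

Lemma avg_sum I (s : seq I) (P : pred I) r (F : I -> V -> R) x : 0 < r ->
  (forall i, bL1 (F i)) ->
  avg r (fun y => \sum_(i <- s | P i) F i y) x = \sum_(i <- s | P i) avg r (F i) x.
Proof.
move=> r0 HF; rewrite -Rintegral_sum; last first.
  by move=> i; have [] := bL1_avg_integrand x r0 (HF i).
by apply: eq_Rintegral => y _; rewrite mulr_sumr.
Qed.

Lemma abs_avg_le r g x : 0 < r -> bL1 g -> `|avg r g x| <= avg r (fun y => `|g y|) x.
Proof.
move=> r0 Hg; apply: le_trans (le_normr_Rintegral _ _) _ => //.
  by have [] := bL1_avg_integrand x r0 Hg.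
rewrite le_eqVlt; apply/orP; left; apply/eqP; apply: eq_Rintegral => y _.
by rewrite normrM (ger0_norm (avg_ker_ge0 _ _ r0)).
Qed.

(** A cell of side 1/r has 2^N times the measure of the cells of half its side: the origin of the
    powers of 2^N in the Calderon-Zygmund bounds. *)
Lemma avg_double r g x : 0 < r -> bL1 g -> (forall y, 0 <= g y) ->
  avg (r * 2) g x <= 2 ^+ N * avg r g x.
Proof.
move=> r0 Hg g0; have r20 : 0 < r * 2 by rewrite mulr_gt0.
rewrite -RintegralZl//; last by have [] := bL1_avg_integrand x r0 Hg.
apply: le_Rintegral => //.
- by have [] := bL1_avg_integrand x r20 Hg.
- by have [] := bL1Z (2 ^+ N) (bL1_avg_integrand x r0 Hg).
move=> y _; rewrite mulrA ler_wpM2r// /avg_ker mulrA -exprMn [2 * r]mulrC.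
rewrite ler_wpM2l ?exprn_ge0 ?(ltW r20)// ler_nat.
by case: (boolP (same_cell (r * 2) x y)) => // /(same_cell_double r0) ->.
Qed.

(** Self-adjointness of the average against a factor that the average does not change. *)
Lemma nint_avg_mul r (s g : V -> R) : 0 < r -> measurable_fun setT s ->
  bL1 g -> (forall y, 0 <= s y) -> (forall y, 0 <= g y) ->
  (forall y z, same_cell r y z -> s y = s z) ->
  nint mu (fun x => s x * avg r g x) = nint mu (fun x => s x * g x).
Proof.
move=> r0 ms Hg s0 g0 hs; have [mg _ _] := Hg.
have mk := measurable_avg_ker r0.
have mk1 x := measurable_avg_kerx x r0.
have mF : measurable_fun setT (fun p : V * V => s p.1 * (avg_ker r p.1 p.2 * g p.2)).
  by apply: measurable_funM; [msr|apply: measurable_funM => //; msr].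
transitivity (\int[mu]_x nint mu (fun y => s x * (avg_ker r x y * g y))%R)%E.
  apply: eq_integral => x _; rewrite EFinM nint_Rintegral; first last.
  - by have [] := bL1_avg_integrand x r0 Hg.
  - by move=> y; rewrite mulr_ge0// avg_ker_ge0.
  rewrite nintZ//; first by apply: measurable_funM.
  by move=> y; rewrite mulr_ge0// avg_ker_ge0.
rewrite (tonelli mu mu (F := fun x y => s x * (avg_ker r x y * g y)))//; last first.
  by move=> x y; rewrite mulr_ge0// mulr_ge0// avg_ker_ge0.
apply: eq_integral => y _.
rewrite (_ : (fun x => _) = (fun x => (s y * g y) * avg_ker r y x)); last first.
  apply/funext => x; rewrite avg_kerC /avg_ker.
  case: (boolP (same_cell r y x)) => [h|_]; last by rewrite !mulr0 ?mul0r ?mulr0.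
  by rewrite (hs _ _ h); ring.
rewrite nintZ//.
- by rewrite nint_avg_ker// mule1.
- exact: mulr_ge0.
- by move=> x; exact: avg_ker_ge0.
Qed.

Lemma bL1_avg r g : 0 < r -> bL1 g -> bL1 (avg r g).
Proof.
move=> r0 Hg; have [mg _ _] := Hg.
have mA := measurable_avg r0 mg.
have [M [M0 gM]] := bL1_bound Hg.
split => //.
  exists M => x; apply: le_trans (abs_avg_le x r0 Hg) _.
  have := @avg_ge_cst r (fun y => (-1) * `|g y|) x (- M) r0 (bL1Z _ (bL1_norm Hg)).
  rewrite avgZ ?mulN1r ?lerN2; [apply|by []|exact: bL1_norm].
  by move=> y _; rewrite mulN1r lerN2.
apply/integrable_nintP => //.
apply: (@le_lt_trans _ _ (nint mu (fun x => 1 * avg r (fun y => `|g y|) x)%R)).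
  apply: le_nint => //; try by msr.
    by under eq_fun do rewrite mul1r; apply: measurable_avg => //; msr.
  by move=> x; rewrite mul1r abs_avg_le.
rewrite (nint_avg_mul (s := fun=> 1))//; last exact: bL1_norm.
by under eq_fun do rewrite mul1r; exact: bL1_nint.
Qed.

Lemma avg_adjoint r g h : 0 < r -> bL1 g -> bL1 h ->
  \int[mu]_x (h x * avg r g x) = \int[mu]_x (g x * avg r h x).
Proof.
move=> r0 Hg Hh; have [mg _ _] := Hg; have [mh _ _] := Hh.
have mk := measurable_avg_ker r0.
have [M [M0 hM]] := bL1_bound Hh.
have [M' [M'0 gM]] := bL1_bound Hg.
transitivity (\int[mu]_x \int[mu]_y (h x * (avg_ker r x y * g y))).
  apply: eq_Rintegral => x _; rewrite RintegralZl//.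
  by have [] := bL1_avg_integrand x r0 Hg.
rewrite Rfubini.
- apply: eq_Rintegral => y _; rewrite -RintegralZl//; last first.
    by have [] := bL1_avg_integrand y r0 Hh.
  by apply: eq_Rintegral => x _; rewrite avg_kerC; ring.
- by apply: measurable_funM; [msr|apply: measurable_funM => //; msr].
- apply: (@le_lt_trans _ _ (\int[mu]_x nint mu (fun y => (M' * `|h x|) * avg_ker r x y)%R)%E).
    apply: ge0_le_integral => //.
    + by move=> x _; exact: nint_ge0.
    + apply: (@measurable_nint _ _ _ V V mu (fun x y => `|h x * (avg_ker r x y * g y)|)) => //.
      apply: measurable_fun_normr.
      by apply: measurable_funM; [msr|apply: measurable_funM => //; msr].
    + apply: (@measurable_nint _ _ _ V V mu (fun x y => (M' * `|h x|) * avg_ker r x y)) => //.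
        by apply: measurable_funM => //; msr.
      by move=> x y; rewrite mulr_ge0 ?avg_ker_ge0// mulr_ge0// ltW.
    + move=> x _; apply: le_nint => //.
      * have m := measurable_avg_kerx x r0; msr.
      * have m := measurable_avg_kerx x r0; msr.
      * move=> y; rewrite 2!normrM (ger0_norm (avg_ker_ge0 _ _ r0)).
        rewrite (_ : M' * _ * _ = `|h x| * (avg_ker r x y * M')); last by ring.
        by rewrite ler_wpM2l// ler_wpM2l// avg_ker_ge0.
  rewrite (eq_integral (fun x => (M' * `|h x|)%:E)); last first.
    move=> x _; rewrite nintZ ?nint_avg_ker ?mule1//.
    + exact: measurable_avg_kerx.
    + by rewrite mulr_ge0// ltW.
    + by move=> y; exact: avg_ker_ge0.
  rewrite -/(nint mu (fun x => M' * `|h x|)) nintZ ?(ltW M'0)//; last by msr.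
  by rewrite lte_mul_pinfty ?lee_fin ?(ltW M'0)//; exact: bL1_nint.
- by move=> x; have [] := bL1Z (h x) (bL1_avg_integrand x r0 Hg).
- move=> y; have [_ _] := bL1Z (g y) (bL1_avg_integrand y r0 Hh).
  by apply: eq_integrable => // x _ /=; rewrite avg_kerC; congr EFin; ring.
Qed.

(** Continuity in place of Lebesgue differentiation. If g x > lam, then either some cell around x
    lies in the set where g is at least the midpoint c of lam and g x, and its average exceeds lam,
    or every cell contains a point with g < c; such points converge to x. *)
Lemma le_of_avg_le r g x lam : 0 < r -> bL1 g -> scont g ->
  (forall k, avg (r * 2 ^+ k) g x <= lam) -> g x <= lam.
Proof.
move=> r0 Hg cg Hle; rewrite leNgt; apply/negP => glam.
pose c := (lam + g x) / 2.
have rk0 k : 0 < r * 2 ^+ k by rewrite mulr_gt0// exprn_gt0.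
have [[k hk]|hk] := pselect (exists k, forall y, same_cell (r * 2 ^+ k) x y -> c <= g y).
  have := avg_ge_cst (rk0 k) Hg hk; rewrite leNgt => /negP; apply.
  by apply: le_lt_trans (Hle k) _; rewrite /c; lra.
have {}hk k : exists y, same_cell (r * 2 ^+ k) x y /\ g y < c.
  apply: contrapT => h; apply: hk; exists k => y hy; rewrite leNgt; apply/negP => hlt.
  by apply: h; exists y.
have [u hu] := choice hk.
have ux : coord_cvg u x.
  move=> i; apply/cvgrPdist_le => e e0.
  have : (fun k : nat => (r * 2 ^+ k)^-1 : R) @ \oo --> (0 : R).
    rewrite (_ : (fun k => _) = (fun k => r^-1 * (2^-1) ^+ k)); last first.
      by apply/funext => k; rewrite invfM exprVn.
    rewrite -[X in _ --> X](mulr0 r^-1); apply: cvgM; first exact: cvg_cst.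
    by apply: cvg_expr; rewrite ger0_norm ?invr_ge0// invf_lt1 ?ltr1n.
  move=> /cvgr0Pnorm_le/(_ _ e0); apply: filterS => k.
  rewrite ger0_norm; last by rewrite invr_ge0 ltW.
  by apply: le_trans; exact: same_cell_coord (rk0 k) (hu k).1.
have := cg _ _ ux; move=> /cvgr_to_le/(_ (nearW _ (fun k => ltW (hu k).2))).
by rewrite leNgt => /negP; apply; rewrite /c; lra.
Qed.

End dyadic_cells.

Section euclidean_norm_of_families.
Context {R : realType} (I : finType).
Implicit Types a b : I -> R.

Definition vnorm a : R := Num.sqrt (\sum_i a i ^+ 2).

Lemma vnorm_ge0 a : 0 <= vnorm a.
Proof. exact: sqrtr_ge0. Qed.

Lemma sumsq_ge0 a : 0 <= \sum_i a i ^+ 2.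
Proof. by apply: sumr_ge0 => i _; exact: sqr_ge0. Qed.

Lemma sqr_vnorm a : vnorm a ^+ 2 = \sum_i a i ^+ 2.
Proof. by rewrite sqr_sqrtr// sumsq_ge0. Qed.

Lemma ler_vnorm a i : `|a i| <= vnorm a.
Proof.
rewrite -sqrtr_sqr; apply: ler_wsqrtr; rewrite (bigD1 i)//= lerDl.
by apply: sumr_ge0 => j _; exact: sqr_ge0.
Qed.

(** With A and B the two norms, the arithmetic-geometric mean inequality with weights B/A and A/B is
    summed over i. *)
Lemma cauchy_schwarz a b : \sum_i a i * b i <= vnorm a * vnorm b.
Proof.
have [a0|a0] := eqVneq (vnorm a) 0.
  rewrite a0 mul0r big1// => i _; apply/eqP; rewrite mulf_eq0; apply/orP; left.
  by rewrite -normr_le0 (le_trans (ler_vnorm a i))// a0.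
have [b0|b0] := eqVneq (vnorm b) 0.
  rewrite b0 mulr0 big1// => i _; apply/eqP; rewrite mulf_eq0; apply/orP; right.
  by rewrite -normr_le0 (le_trans (ler_vnorm b i))// b0.
set A := vnorm a in a0 *; set B := vnorm b in b0 *.
have A0 : 0 < A by rewrite lt_neqAle eq_sym a0 vnorm_ge0.
have B0 : 0 < B by rewrite lt_neqAle eq_sym b0 vnorm_ge0.
apply: (@le_trans _ _ (\sum_i (B / A / 2 * a i ^+ 2 + A / B / 2 * b i ^+ 2))).
  apply: ler_sum => i _.
  have : 0 <= (B * a i - A * b i) ^+ 2 / (2 * A * B).
    by rewrite divr_ge0 ?sqr_ge0// !mulr_ge0// ltW.
  rewrite (_ : _ / _ = (B / A / 2 * a i ^+ 2 + A / B / 2 * b i ^+ 2) - a i * b i).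
    by rewrite subr_ge0.
  by field; rewrite a0 b0.
rewrite big_split/= -!mulr_sumr -!sqr_vnorm -/A -/B.
rewrite (_ : _ + _ = A * B)//; by field; rewrite a0 b0.
Qed.

Lemma vnorm_triangle a b : vnorm (fun i => a i + b i) <= vnorm a + vnorm b.
Proof.
rewrite -(ler_pXn2r (ltn0Sn 1)) ?nnegrE ?addr_ge0 ?vnorm_ge0//.
rewrite sqrrD !sqr_vnorm.
under eq_bigr do rewrite sqrrD; rewrite !big_split/= lerD2r lerD2l.
by rewrite -mulr2n lerMn2r/= cauchy_schwarz.
Qed.

Lemma vnorm_le_sum a : vnorm a <= \sum_i `|a i|.
Proof.
rewrite -(ler_pXn2r (ltn0Sn 1)) ?nnegrE ?vnorm_ge0 ?sumr_ge0//.
rewrite sqr_vnorm [X in _ <= X]expr2 mulr_suml; apply: ler_sum => i _.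
by rewrite -real_normK ?num_real// expr2 ler_wpM2l// (bigD1 i)//= lerDl sumr_ge0.
Qed.

End euclidean_norm_of_families.

Section vector_fields.
Context {R : realType} {N : nat} (I : finType).
Local Notation V := 'rV[R]_N.
Local Notation mu := (lebesgue_rV R N).
Implicit Types g : I -> V -> R.

(** The square function when g is a family of frequency pieces. *)
Definition vabs g (x : V) : R := vnorm (g^~ x).

Lemma measurable_vabs g : (forall i, measurable_fun setT (g i)) ->
  measurable_fun setT (vabs g).
Proof.
move=> mg; apply: measurable_fun_sqrt; apply: measurable_fun_bigsum => i.
by apply: measurable_funX; exact: mg.
Qed.

Lemma bL1_vabs g : (forall i, bL1 (g i)) -> bL1 (vabs g).
Proof.
move=> Hg; have H : bL1 (fun x => \sum_i `|g i x|).
  by apply: bL1_sum => i; exact: bL1_norm.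
apply: bL1_dominated H _; first by apply: measurable_vabs => i; have [] := Hg i.
move=> x; rewrite ger0_norm ?vnorm_ge0// ger0_norm ?sumr_ge0//; exact: vnorm_le_sum.
Qed.

Lemma scont_vabs g : (forall i, scont (g i)) -> scont (vabs g).
Proof.
move=> cg; apply: scont_sqrt; apply: scont_sum => i; apply: scont_sqr; exact: cg.
Qed.

(** Minkowski's inequality: multiplied by the length a of the averaged vector, the left-hand side is
    the average of a scalar product with a constant vector of length a, and Cauchy-Schwarz applies
    under the average. *)
Lemma vabs_avg_le r g x : 0 < r -> (forall i, bL1 (g i)) ->
  vabs (fun i => avg r (g i)) x <= avg r (vabs g) x.
Proof.
move=> r0 Hg; set a := vabs _ x.
have G0 : 0 <= avg r (vabs g) x.
  apply: Rintegral_ge0 => y _; rewrite mulr_ge0 ?vnorm_ge0//; exact: avg_ker_ge0.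
have [a0|a0] := eqVneq a 0; first by rewrite a0.
have {}a0 : 0 < a by rewrite lt_neqAle eq_sym a0 vnorm_ge0.
rewrite -(ler_pM2l a0) -expr2 sqr_vnorm.
under eq_bigr do rewrite expr2 -avgZ//.
rewrite -(avg_sum _ _ _ r0); last by move=> i; exact: bL1Z.
rewrite -avgZ//; last exact: bL1_vabs.
apply: le_avg => //.
- by apply: bL1_sum => i; exact: bL1Z.
- by apply: bL1Z; exact: bL1_vabs.
by move=> y _; exact: cauchy_schwarz.
Qed.

End vector_fields.

Section dilations.
Context {R : realType} {N : nat}.
Local Notation V := 'rV[R]_N.
Local Notation mu := (lebesgue_rV R N).
Implicit Types (k : V -> R) (c : R).

(** Normalised to preserve the integral; with c = 2^j it turns [eta] into the kernel of the j-th
    projection. *)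
Definition dil c k (x : V) : R := c ^+ N * k (c *: x).

Lemma measurable_dil c k : measurable_fun setT k -> measurable_fun setT (dil c k).
Proof. by move=> mk; rewrite /dil; msr. Qed.

Lemma nint_dil c k : 0 < c -> measurable_fun setT k -> (forall x, 0 <= k x) ->
  nint mu (dil c k) = nint mu k.
Proof.
move=> c0 mk k0; rewrite /dil nintZ ?exprn_ge0 ?(ltW c0)//; last by msr.
rewrite [RHS](@nint_affine _ _ c 0) ?gt_eqF// gtr0_norm//.
by under [in RHS]eq_fun do rewrite addr0.
Qed.

Lemma nint_norm_dil c k : 0 < c -> measurable_fun setT k ->
  nint mu (fun x => `|dil c k x|) = nint mu (fun x => `|k x|).
Proof.
move=> c0 mk; rewrite -(@nint_dil c (fun x => `|k x|))//; last by msr.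
by congr nint; apply/funext => x; rewrite normrM ger0_norm// exprn_ge0// ltW.
Qed.

Lemma Rintegral_dil c k : 0 < c -> mu.-integrable setT (EFin \o k) ->
  \int[mu]_x dil c k x = \int[mu]_x k x.
Proof.
move=> c0 Ik.
have h : (fun x : V => k (c *: x + 0)) = (fun x => k (c *: x)).
  by apply/funext => x; rewrite addr0.
have Ik' := @integrable_affine _ _ c 0 k (lt0r_neq0 c0) Ik.
have := Rintegral_affine 0 (lt0r_neq0 c0) Ik.
by rewrite h in Ik' *; rewrite RintegralZl// gtr0_norm.
Qed.

Lemma bL1_dil c k : 0 < c -> bL1 k -> bL1 (dil c k).
Proof.
move=> c0 Hk; apply: bL1Z; have := @bL1_affine _ _ c 0 k (lt0r_neq0 c0) Hk.
by under eq_fun do rewrite addr0.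
Qed.

Lemma scont_dil c k : scont k -> scont (dil c k).
Proof.
move=> ck; apply: scontZ; have := @scont_affine _ _ k c 0 ck.
by under eq_fun do rewrite addr0.
Qed.

Lemma dilM c c' k : dil c (dil c' k) = dil (c * c') k.
Proof. by apply/funext => x; rewrite /dil mulrA -exprMn scalerA [c' * c]mulrC. Qed.

Lemma nint_ball_fin (M : R) : (nint mu (fun u => (l1norm u <= M)%R%:R)%R < +oo)%E.
Proof.
pose A := [set` `[- M, M]] : set (measurableTypeR R).
have mA : measurable A by exact: measurable_itv.
have mb : measurable_fun setT (fun u : V => (l1norm u <= M)%R%:R : R).
  apply: measurable_fun_bool; apply: measurable_fun_ler.
    exact: measurable_l1norm.
  exact: measurable_cst.
have [M0|M0] := leP 0 M; last first.
  rewrite (_ : (fun u => _) = (fun=> 0)).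
    by rewrite /nint integral0 ltry.
  by apply/funext => u; rewrite leNgt (lt_le_trans M0)// l1norm_ge0.
apply: (@le_lt_trans _ _ (\int[mu]_x (\prod_(i < N) \1_A (x 0 i))%:E)%E).
  apply: ge0_le_integral => //.
  - exact/measurable_EFinP.
  - apply/measurable_EFinP; apply: measurable_fun_bigprod => i.
    have m1 : measurable_fun setT (\1_A : measurableTypeR R -> R) by exact: measurable_indic.
    by apply: (measurableT_comp m1); exact: measurable_rV_coord.
  move=> x _; rewrite lee_fin; case: (boolP (_ <= M)) => [h|_]; last first.
    by apply: prodr_ge0 => i _; rewrite indicE.
  rewrite big1// => i _; rewrite indicE mem_set//= /A /= in_itv/= -ler_norml.
  exact: le_trans (ler_coord_l1norm x i) h.
rewrite (@integral_prod_rV R N (\1_A : measurableTypeR R -> R)); first last.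
- by move=> x; rewrite indicE.
- exact: measurable_indic.
have fA : lebesgue_measure A \is a fin_num.
  rewrite ge0_fin_numE//; apply: (@le_lt_trans _ _ (lebesgue_measure [set` `[- M, M]])) => //.
  by rewrite lebesgue_measure_itv/=; case: ifPn => _; rewrite ?ltry// -EFinB ltry.
have E : (\int[@lebesgue_measure R]_a (\1_A a)%:E = (fine (lebesgue_measure A))%:E)%E.
  by rewrite integral_indic// ?setIT ?setTI fineK.
under eq_bigr do rewrite E.
by rewrite prodEFin ltry.
Qed.

End dilations.

Lemma Rintegral_le_bound (R : realType) d (T : measurableType d)
    (m : {measure set T -> \bar R}) (f : T -> R) (c : R) :
  measurable_fun setT f -> (nint m (fun x => `|f x|)%R <= c%:E)%E ->
  `|\int[m]_x f x| <= c.
Proof. by move=> mf h; rewrite -lee_fin; exact: le_trans (abs_Rintegral_le _ mf) h. Qed.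

(** * Calderon-Zygmund decomposition *)

Section stopping_time.
Context {R : realType} {N : nat}.
Local Notation V := 'rV[R]_N.
Local Notation mu := (lebesgue_rV R N).
Variables (G : V -> R) (r0 lam : R).
Hypotheses (HG : bL1 G) (cG : scont G) (G0 : forall x, 0 <= G x).
Hypotheses (r0_gt0 : 0 < r0) (lam0 : 0 < lam) (E0 : forall x, avg r0 G x <= lam).

Definition scale k : R := r0 * 2 ^+ k.

Lemma scale_gt0 k : 0 < scale k.
Proof. by rewrite mulr_gt0// exprn_gt0. Qed.

Lemma scaleS k : scale k.+1 = scale k * 2.
Proof. by rewrite /scale exprSr mulrA. Qed.

(** k is the first generation whose average of G exceeds lam. The set of points stopped at k is a
    union of cells of generation k, the maximal Calderon-Zygmund cubes. *)
Definition stopped k (x : V) : bool :=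
  (lam < avg (scale k) G x) && [forall l : 'I_k, avg (scale l) G x <= lam].
Definition stop k (x : V) : R := (stopped k x)%:R.

Lemma stop_ge0 k x : 0 <= stop k x. Proof. exact: ler0n. Qed.
Lemma stop_le1 k x : stop k x <= 1. Proof. by rewrite /stop; case: stopped. Qed.
Lemma abs_stop k x : `|stop k x| <= 1. Proof. by rewrite ger0_norm ?stop_ge0 ?stop_le1. Qed.

Lemma measurable_stop k : measurable_fun setT (stop k).
Proof.
have [mG _ _] := HG.
rewrite (_ : stop k = fun x => (lam < avg (scale k) G x)%R%:R *
    \prod_(l < k) (avg (scale l) G x <= lam)%R%:R); last first.
  apply/funext => x; rewrite /stop /stopped; case: ltP => _; last by rewrite mul0r.
  rewrite mul1r; case: (boolP [forall l : 'I_k, _]) => [/forallP h|].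
    by rewrite big1// => l _; rewrite h.
  rewrite negb_forall => /existsP[l /negbTE hl].
  by rewrite (bigD1 l)//= hl mul0r.
have mA l : measurable_fun setT (avg (scale l) G) by apply: measurable_avg => //; exact: scale_gt0.
apply: measurable_funM.
  by apply: measurable_fun_bool; apply: measurable_fun_ltr => //; exact: measurable_cst.
apply: measurable_fun_bigprod => l.
by apply: measurable_fun_bool; apply: measurable_fun_ler => //; exact: measurable_cst.
Qed.

Lemma same_cell_le k l (x y : V) : (l <= k)%N -> same_cell (scale k) x y -> same_cell (scale l) x y.
Proof.
elim: k => [|k IHk]; first by rewrite leqn0 => /eqP ->.
rewrite leq_eqVlt => /predU1P[->//|]; rewrite ltnS => lk h; apply: IHk => //.
by apply: same_cell_double; [exact: scale_gt0|rewrite -scaleS].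
Qed.

Lemma stopped_cell k (x y : V) : same_cell (scale k) x y -> stopped k x = stopped k y.
Proof.
move=> h; rewrite /stopped (avg_cell G h); congr (_ && _).
by apply: eq_forallb => l; rewrite (avg_cell G (same_cell_le (ltnW (ltn_ord l)) h)).
Qed.

Lemma stop_cell k (x y : V) : same_cell (scale k) x y -> stop k x = stop k y.
Proof. by move=> h; rewrite /stop (stopped_cell h). Qed.

Lemma stopped_uniq k l x : stopped k x -> stopped l x -> k = l.
Proof.
wlog kl : k l / (k < l)%N.
  move=> H hk hl; case: (ltngtP k l) => // h; first exact: H.
  by apply/esym; apply: H.
move=> /andP[h _] /andP[_ /forallP/(_ (Ordinal kl))/=].
by rewrite leNgt h.
Qed.

Definition stop_before n (x : V) : R := \sum_(k < n) stop k x.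

(** The stopping generation is unique, so a sum weighted by [stop] collapses to at most one term.
    Quantifying over F inside the alternatives lets one case analysis serve every weighted sum at
    the same x. *)
Lemma stop_beforeP n x :
  (exists k : 'I_n, stopped k x /\ forall F : nat -> R,
     \sum_(l < n) stop l x * F l = F k) \/
  ((forall k : 'I_n, ~~ stopped k x) /\ forall F : nat -> R, \sum_(l < n) stop l x * F l = 0).
Proof.
have [/existsP[k hk]|] := boolP [exists k : 'I_n, stopped k x].
  left; exists k; split => // F; rewrite (bigD1 k)//= big1 ?addr0.
    by rewrite /stop hk mul1r.
  move=> l lk; rewrite /stop; case: (boolP (stopped l x)) => [hl|_]; last by rewrite mul0r.
  by move: lk; rewrite -(inj_eq val_inj)/= (stopped_uniq hl hk) eqxx.
rewrite negb_exists => /forallP h; right; split => // F.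
by rewrite big1// => l _; rewrite /stop (negbTE (h l)) mul0r.
Qed.

Lemma stop_before01 n x : 0 <= stop_before n x <= 1.
Proof.
rewrite /stop_before; under eq_bigr do rewrite -[stop _ _]mulr1.
case: (stop_beforeP n x) => [[k [_ /(_ (fun=> 1))/= ->]]|[_ /(_ (fun=> 1))/= ->]];
by rewrite ?lexx ?ler01.
Qed.

Lemma measurable_stop_before n : measurable_fun setT (stop_before n).
Proof. by apply: measurable_fun_bigsum => k; exact: measurable_stop. Qed.

Lemma bL1_stop_mul k (g : V -> R) : bL1 g -> bL1 (fun x => stop k x * g x).
Proof. by move=> Hg; exact: bL1M Hg (measurable_stop k) (abs_stop k). Qed.

Lemma bL1_avg_scale k (g : V -> R) : bL1 g -> bL1 (avg (scale k) g).
Proof. by apply: bL1_avg; exact: scale_gt0. Qed.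

(** The parent cell did not stop, so its average is at most lam; generation 0 cannot stop by
    [E0]. *)
Lemma avg_stopped_le k x : stopped k x -> avg (scale k) G x <= 2 ^+ N * lam.
Proof.
case: k => [|k] /andP[h1 /forallP h2].
  by move: h1; rewrite /scale expr0 mulr1 ltNge E0.
rewrite scaleS; apply: le_trans (avg_double x (scale_gt0 k) HG G0) _.
by rewrite ler_pM2l ?exprn_gt0//; exact: (h2 ord_max).
Qed.

(** On a stopped cube the average of G exceeds lam, so the part of G below lam / 2 carries at most
    half of the integral and is absorbed. The truncation is what later makes the weak type bound
    summable over levels. *)
Lemma nint_stop_G k : (nint mu (fun x => stop k x * G x)%R <=
   (2 : R)%:E * nint mu (fun x => stop k x * ((lam / 2 < G x)%R%:R * G x))%R)%E.
Proof.
have [mG _ _] := HG.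
have ms := measurable_stop k.
have [mA _ _] := bL1_avg_scale k HG.
have A0 x : 0 <= avg (scale k) G x.
  by apply: Rintegral_ge0 => y _; rewrite mulr_ge0// avg_ker_ge0// scale_gt0.
have mI : measurable_fun setT (fun x => (lam / 2 < G x)%R%:R : R).
  by apply: measurable_fun_bool; apply: measurable_fun_ltr => //; exact: measurable_cst.
set a := nint mu (fun x => stop k x * G x).
have afin : a \is a fin_num.
  rewrite ge0_fin_numE; last by apply: nint_ge0 => x; rewrite mulr_ge0 ?stop_ge0.
  have := bL1_nint (bL1_stop_mul k HG); congr (nint _ _ < _)%E.
  by apply/funext => x; rewrite ger0_norm ?mulr_ge0 ?stop_ge0.
have aE : a = nint mu (fun x => stop k x * avg (scale k) G x).
  by rewrite (nint_avg_mul (scale_gt0 k) ms HG (stop_ge0 k) G0 (@stop_cell k)).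
(* The finite number a is added on both sides, and on the right it is read as the integral of the
   averages. The claim is then pointwise: 2 G <= lam < average where G <= lam / 2. *)
rewrite -(leeD2rE _ _ afin) {3}aE /a -nintD//; try by msr.
- rewrite -nintZ//; try by msr.
    rewrite -nintD//; try by msr.
    + apply: le_nint; try by msr.
        by move=> x; rewrite addr_ge0// mulr_ge0 ?stop_ge0.
      move=> x; rewrite /stop; case: (boolP (stopped k x)) => [/andP[h _]|_]; last first.
        by rewrite !mul0r mulr0 addr0.
      rewrite !mul1r; case: ltP => h2; first by rewrite mul1r; have := A0 x; lra.
      by rewrite mul0r mulr0 add0r; apply: le_trans (ltW h); move: h2; lra.
    + by move=> x; rewrite !mulr_ge0// ?stop_ge0.
    + by move=> x; rewrite mulr_ge0 ?stop_ge0.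
  by move=> x; rewrite mulr_ge0 ?stop_ge0// mulr_ge0.
- by move=> x; rewrite mulr_ge0 ?stop_ge0.
- by move=> x; rewrite mulr_ge0 ?stop_ge0.
Qed.

Lemma nint_stop k : (lam%:E * nint mu (stop k) <= nint mu (fun x => stop k x * G x)%R)%E.
Proof.
have ms := measurable_stop k.
have [mA _ _] := bL1_avg_scale k HG.
have <- : nint mu (fun x => stop k x * avg (scale k) G x) = nint mu (fun x => stop k x * G x).
  exact: (nint_avg_mul (scale_gt0 k) ms HG (stop_ge0 k) G0 (@stop_cell k)).
rewrite -nintZ ?(ltW lam0)//.
apply: le_nint; try by msr.
  by move=> x; rewrite mulr_ge0 ?stop_ge0 ?(ltW lam0).
move=> x; rewrite /stop; case: (boolP (stopped k x)) => [/andP[h _]|_]; last first.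
  by rewrite mul0r mulr0.
by rewrite mulr1 mul1r ltW.
Qed.

Lemma nint_stop_before_G n : (nint mu (fun x => stop_before n x * G x)%R <=
   (2 : R)%:E * nint mu (fun x => (lam / 2 < G x)%R%:R * G x)%R)%E.
Proof.
have [mG _ _] := HG.
have ms := measurable_stop.
have mS := measurable_stop_before n.
have mI : measurable_fun setT (fun x => (lam / 2 < G x)%R%:R : R).
  by apply: measurable_fun_bool; apply: measurable_fun_ltr => //; exact: measurable_cst.
under eq_fun do rewrite mulr_suml.
rewrite nint_sum; first last.
- by move=> k x; rewrite mulr_ge0// stop_ge0.
- by move=> k; have mk := ms k; msr.
apply: (@le_trans _ _ (\sum_(k < n) ((2 : R)%:E *
  nint mu (fun x => stop k x * ((lam / 2 < G x)%R%:R * G x))%R))%E).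
  by apply: lee_sum => k _; exact: nint_stop_G.
rewrite -ge0_sume_distrr; last first.
  by move=> k _; apply: nint_ge0 => x; rewrite mulr_ge0 ?stop_ge0// mulr_ge0.
apply: lee_wpmul2l => //.
rewrite -nint_sum; first last.
- by move=> k x; rewrite mulr_ge0 ?stop_ge0// mulr_ge0.
- by move=> k; have mk := ms k; msr.
apply: le_nint.
- by apply: measurable_fun_bigsum => k; have mk := ms k; msr.
- by msr.
- by move=> x; apply: sumr_ge0 => k _; rewrite mulr_ge0 ?stop_ge0// mulr_ge0.
move=> x; rewrite -mulr_suml; have /andP[_ h] := stop_before01 n x.
by rewrite ler_piMl// mulr_ge0.
Qed.

(** A point with G > lam stops at some generation, by continuity of G; hence the part of the
    integral over such points that is still unstopped tends to 0 by dominated convergence. Paying e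
    allows one to work with finitely many generations. *)
Lemma nint_stop_before_cpl : forall e : R, 0 < e -> exists n,
  (nint mu (fun x => (1 - stop_before n x) * G x ^+ 2)%R <=
   nint mu (fun x => (G x <= lam)%R%:R * G x ^+ 2)%R + e%:E)%E.
Proof.
have [mG [M gM] IG] := HG.
have mI : measurable_fun setT (fun x => (lam < G x)%R%:R : R).
  by apply: measurable_fun_bool; apply: measurable_fun_ltr => //; exact: measurable_cst.
have mJ : measurable_fun setT (fun x => (G x <= lam)%R%:R : R).
  by apply: measurable_fun_bool; apply: measurable_fun_ler => //; exact: measurable_cst.
have ms := measurable_stop_before.
have cpl0 n x : 0 <= 1 - stop_before n x <= 1.
  by have /andP[? ?] := stop_before01 n x; apply/andP; split; lra.
pose u n x := (1 - stop_before n x) * ((lam < G x)%R%:R * G x ^+ 2).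
have u0 n x : 0 <= u n x.
  by rewrite /u mulr_ge0 ?mulr_ge0 ?sqr_ge0//; case/andP: (cpl0 n x).
have mu' n : measurable_fun setT (u n) by have := ms n => m; rewrite /u; msr.
have Ig : mu.-integrable setT (EFin \o (fun x => M * G x)) by exact: integrableRZ.
have ug n x : `|u n x| <= M * G x.
  rewrite ger0_norm//; have /andP[h1 h2] := cpl0 n x.
  have := gM x; rewrite ger0_norm// => h3.
  apply: (@le_trans _ _ (1 * (1 * (M * G x)))); last by rewrite !mul1r.
  apply: ler_pM => //; first by rewrite mulr_ge0 ?sqr_ge0.
  apply: ler_pM => //; [exact: sqr_ge0|by case: ltP|].
  by rewrite expr2 ler_wpM2r.
have cvg0 : \int[mu]_x u n x @[n --> \oo] --> (0 : R).
  have -> : (0 : R) = \int[mu]_x (fun=> 0) x by rewrite /Rintegral integral0.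
  apply: (dominated_Rintegral (g := fun x => M * G x)) => // x.
  apply: cvg_near_cst.
  have [Gx|Gx] := leP (G x) lam.
    by apply: nearW => n; rewrite /u ltNge Gx mul0r mulr0.
  have [k hk] : exists k, stopped k x.
    apply: contrapT => h.
    suff : G x <= lam by rewrite leNgt Gx.
    apply: (le_of_avg_le r0_gt0 HG cG) => k.
    elim/ltn_ind: k => k IHk; rewrite leNgt; apply/negP => hk; apply: h; exists k.
    by rewrite /stopped hk; apply/forallP => l; exact: IHk.
  exists k.+1 => // n /= kn; rewrite /u.
  rewrite (_ : stop_before n x = 1) ?subrr ?mul0r//.
  rewrite /stop_before; under eq_bigr do rewrite -[stop _ _]mulr1.
  case: (stop_beforeP n x) => [[l [_ /(_ (fun=> 1))/= ->//]]|[h _]].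
  by have := h (Ordinal kn); rewrite /= hk.
move=> e e0.
move/cvgr0Pnorm_le : cvg0 => /(_ _ e0)[n _ /(_ n (leqnn n))/= hn].
exists n.
apply: (@le_trans _ _ (nint mu (fun x => (G x <= lam)%R%:R * G x ^+ 2)%R + nint mu (u n))%E).
  have m1 := mu' n; have m2 := ms n.
  rewrite -nintD//; try by msr.
    apply: le_nint; try by msr.
      by move=> x; rewrite mulr_ge0 ?sqr_ge0//; case/andP: (cpl0 n x).
    move=> x; have /andP[h1 h2] := cpl0 n x; rewrite /u; case: leP => Gx.
      by rewrite mul0r mulr0 addr0 ler_wpM2r ?sqr_ge0.
    by rewrite mul0r add0r mul1r.
  by move=> x; rewrite mulr_ge0 ?sqr_ge0.
apply: leeD2l; rewrite -nint_Rintegral//; last exact: le_integrableR Ig.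
by rewrite lee_fin; apply: le_trans hn; exact: ler_norm.
Qed.

End stopping_time.

Section vector_singular_integrals.
Context {R : realType} {N : nat} (I J : finType).
Local Notation V := 'rV[R]_N.
Local Notation mu := (lebesgue_rV R N).
Variable K : J -> I -> V -> R.
Hypothesis HK : forall j i, bL1 (K j i).
Implicit Types g h : I -> V -> R.

Definition vconv g j (x : V) : R := \sum_i conv (K j i) (g i) x.

Definition kernel_diff (x y : V) : R :=
  \sum_j \sum_i `|K j i (x - y) - K j i x|.

Lemma bL1_vconv g j : (forall i, bL1 (g i)) -> bL1 (vconv g j).
Proof. by move=> Hg; apply: bL1_sum => i; exact: bL1_conv. Qed.

Lemma kernel_diff_ge0 x y : 0 <= kernel_diff x y.
Proof. by do 2 apply: sumr_ge0 => ? _. Qed.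

Lemma measurable_kernel_diff : measurable_fun setT (fun p : V * V => kernel_diff p.1 p.2).
Proof.
apply: measurable_fun_bigsum => j; apply: measurable_fun_bigsum => i.
by have [m _ _] := HK j i; msr.
Qed.

(** The integrand of Hormander's condition. The sum over all matrix entries dominates every operator
    norm; for the kernels used below one index set is a singleton and the scales sum
    geometrically. *)
Definition far_diff (x y : V) : R := (2 * l1norm y <= l1norm x)%R%:R * kernel_diff x y.

Lemma far_diff_ge0 x y : 0 <= far_diff x y.
Proof. by rewrite mulr_ge0 ?kernel_diff_ge0. Qed.

Lemma measurable_far_diff : measurable_fun setT (fun p : V * V => far_diff p.1 p.2).
Proof.
apply: measurable_funM; last exact: measurable_kernel_diff.
apply: measurable_fun_bool; apply: measurable_fun_ler.
  apply: measurable_funM; first exact: measurable_cst.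
  exact: measurable_fun_l1norm.
exact: measurable_fun_l1norm.
Qed.

Lemma kernel_diff_bound : exists M, forall x y, `|kernel_diff x y| <= M.
Proof.
have /choice[M hM] : forall ji : J * I, exists M, 0 < M /\ forall x, `|K ji.1 ji.2 x| <= M.
  by move=> ji; exact: bL1_bound.
exists (\sum_j \sum_i (M (j, i) + M (j, i))) => x y; rewrite ger0_norm ?kernel_diff_ge0//.
apply: ler_sum => j _; apply: ler_sum => i _.
by apply: le_trans (ler_normB _ _) _; apply: lerD; exact: (hM (j, i)).2.
Qed.

Lemma far_diff_bound : exists M, forall x y, `|far_diff x y| <= M.
Proof.
have [M hM] := kernel_diff_bound; exists M => x y; apply: le_trans (hM x y).
by rewrite /far_diff normrM normr_nat ler_piMl// lern1 leq_b1.
Qed.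

(** * Weak type bound for matrix kernels *)

Section weak_type.
Variables (A1 A2 : R).
Hypotheses (A1_ge0 : 0 <= A1) (A2_ge0 : 0 <= A2).
Hypothesis L2_bound : forall h, (forall i, bL1 (h i)) ->
  (nint mu (fun x => \sum_j vconv h j x ^+ 2)%R <=
   A2%:E * nint mu (fun x => \sum_i h i x ^+ 2)%R)%E.
Hypothesis hormander : forall y, (nint mu (far_diff^~ y) <= A1%:E)%E.

Variables (g : I -> V -> R) (r0 lam : R).
Hypotheses (Hg : forall i, bL1 (g i)) (cg : forall i, scont (g i)).
Local Notation G := (vabs g).
Hypotheses (r0_gt0 : 0 < r0) (lam0 : 0 < lam) (E0 : forall x, avg r0 G x <= lam).

Local Notation rk := (scale r0).
Local Notation st := (stop G r0 lam).
Local Notation stb := (stopped G r0 lam).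
Local Notation S := (stop_before G r0 lam).

Let HG : bL1 G. Proof. exact: bL1_vabs. Qed.
Let cG : scont G. Proof. exact: scont_vabs. Qed.
Let G0 x : 0 <= G x. Proof. exact: vnorm_ge0. Qed.
Let rk0 k : 0 < rk k. Proof. exact: scale_gt0. Qed.
Let mst k : measurable_fun setT (st k). Proof. exact: measurable_stop. Qed.

Let ball_ker k : V -> R := dil (rk k) (fun u => (l1norm u <= 3 * N%:R)%R%:R).
(** Stands for the union of the enlarged stopped cubes: X is at least 1 close to a stopped point,
    and its integral is [ball_mass] times the measure of the stopped set. *)
Let X k x : R := \int[mu]_z (ball_ker k (x - z) * st k z).

Let mball : measurable_fun setT (fun u : V => (l1norm u <= 3 * N%:R)%R%:R : R).
Proof.
apply: measurable_fun_bool; apply: measurable_fun_ler; first exact: measurable_l1norm.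
exact: measurable_cst.
Qed.

Definition ball_mass : R := fine (nint mu (fun u => (l1norm u <= 3 * N%:R)%R%:R)%R).

Let ball_ker_ge0 k x : 0 <= ball_ker k x.
Proof. by rewrite mulr_ge0// exprn_ge0// ltW. Qed.

Let bL1_ball k : bL1 (ball_ker k).
Proof.
apply: bL1_dil => //; split => //.
  by exists 1 => x; rewrite normr_nat lern1 leq_b1.
apply/integrable_nintP => //; under eq_fun do rewrite ger0_norm//.
exact: nint_ball_fin.
Qed.

Let IX k x : mu.-integrable setT (EFin \o (fun z => ball_ker k (x - z) * st k z)).
Proof.
have Hb := bL1_reflect x (bL1_ball k).
have [_ _] := bL1M Hb (mst k) (@abs_stop _ _ G r0 lam k).
by apply: eq_integrable => // z _ /=; rewrite mulrC.
Qed.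

Let X_ge0 k x : 0 <= X k x.
Proof. by apply: Rintegral_ge0 => z _; rewrite mulr_ge0 ?ball_ker_ge0 ?stop_ge0. Qed.

Let measurable_X k : measurable_fun setT (X k).
Proof. by have [mb _ _] := bL1_ball k; exact: measurable_conv. Qed.

Let nint_X k : nint mu (X k) = (ball_mass%:E * nint mu (st k))%E.
Proof.
have [mb _ _] := bL1_ball k; have ms := mst k.
rewrite /ball_mass fineK; last by rewrite ge0_fin_numE ?nint_ball_fin// nint_ge0.
rewrite -(@nint_dil _ _ (rk k) (fun u => (l1norm u <= 3 * N%:R)%R%:R))// -/(ball_ker k).
rewrite -nint_conv_integrand//.
apply: eq_integral => x _; rewrite nint_Rintegral//.
by move=> z; rewrite mulr_ge0 ?ball_ker_ge0 ?stop_ge0.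
Qed.

(** The cell of z has l1 diameter at most N / r and mass 1 under its averaging kernel; the radius 3
    N / r of [ball_ker] is 2 N / r for the distance to z plus N / r for the cell. *)
Let X_ge1 k x z : stb k z -> l1norm (x - z) <= 2 * N%:R / rk k -> 1 <= X k x.
Proof.
move=> hz hxz; rewrite -(Rintegral_avg_ker z (rk0 k)).
apply: le_Rintegral => //; first by have [] := bL1_avg_ker z (rk0 k).
move=> w _; rewrite /avg_ker; case: (boolP (same_cell (rk k) z w)) => [h|_]; last first.
  by rewrite mulr0 mulr_ge0 ?ball_ker_ge0 ?stop_ge0.
rewrite mulr1 -(stop_cell G lam r0_gt0 h) /stop hz mulr1 /ball_ker /dil.
rewrite (_ : (l1norm _ <= _)) ?mulr1// l1normZ gtr0_norm// mulrC -ler_pdivlMr//.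
rewrite (_ : x - w = (x - z) + (z - w)); last by rewrite addrA subrK.
apply: le_trans (l1normD _ _) _; have := same_cell_l1norm (rk0 k) h; lra.
Qed.

Let farw n x : R := \prod_(k < n) (X k x < 1)%R%:R.

Let farw01 n x : 0 <= farw n x <= 1.
Proof.
apply/andP; split; first by apply: prodr_ge0 => k _.
by apply: prodr_ile1 => k _; rewrite ler0n lern1 leq_b1.
Qed.

Let farw_cases n x : (1 <= \sum_(k < n) X k x) \/ (farw n x = 1 /\ forall k : 'I_n, X k x < 1).
Proof.
have [/forallP h|] := boolP [forall k : 'I_n, X k x < 1].
  by right; split => //; rewrite /farw big1// => k _; rewrite h.
rewrite negb_forall => /existsP[k]; rewrite -leNgt => hk; left.
rewrite (bigD1 k) //=; apply: (le_trans hk); rewrite lerDl.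
by apply: sumr_ge0 => l _; exact: X_ge0.
Qed.

(** The bad part of generation k; its mean over each cell of that generation is zero. *)
Let bad k i x : R := st k x * (g i x - avg (rk k) (g i) x).

Let bL1_bad k i : bL1 (bad k i).
Proof. by apply: bL1_stop_mul => //; apply: bL1B => //; exact: bL1_avg. Qed.

(** Self-adjointness moves the average from g onto the kernel, where the mean zero of the bad part
    appears as a difference K (x - z) - K (x - y) between points y and z of one cell. *)
Let conv_bad k j i x : conv (K j i) (bad k i) x =
  \int[mu]_z (st k z * g i z * avg (rk k) (fun y => K j i (x - z) - K j i (x - y)) z).
Proof.
have HKx := bL1_reflect x (HK j i).
have H1 : bL1 (fun y => st k y * K j i (x - y)) by exact: bL1_stop_mul.
have [M [M0 gM]] := bL1_bound (Hg i); have [mg _ _] := Hg i.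
have I1 : bL1 (fun y => K j i (x - y) * (st k y * g i y)).
  by apply: bL1_conv_integrand => //; exact: bL1_stop_mul.
have I2 : bL1 (fun y => K j i (x - y) * (st k y * avg (rk k) (g i) y)).
  by apply: bL1_conv_integrand => //; apply: bL1_stop_mul => //; exact: bL1_avg.
transitivity (\int[mu]_y (K j i (x - y) * (st k y * g i y)) -
   \int[mu]_y (K j i (x - y) * (st k y * avg (rk k) (g i) y))).
  rewrite -RintegralB//; [|by case: I1|by case: I2].
  by apply: eq_Rintegral => y _; rewrite /bad; ring.
have -> : \int[mu]_y (K j i (x - y) * (st k y * avg (rk k) (g i) y)) =
    \int[mu]_z (g i z * avg (rk k) (fun y => st k y * K j i (x - y)) z).
  rewrite -avg_adjoint//; apply: eq_Rintegral => y _; ring.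
have I3 : bL1 (fun z => g i z * avg (rk k) (fun y => st k y * K j i (x - y)) z).
  by apply: bL1M (bL1_avg (rk0 k) H1) mg gM.
rewrite -RintegralB//; [|by case: I1|by case: I3].
apply: eq_Rintegral => z _.
have ms := mst k.
rewrite (avg_mulr z (rk0 k) HKx ms); first last.
- by move=> ? ?; exact: stop_cell.
- by exists 1; exact: abs_stop.
rewrite (_ : avg _ (fun y => K j i (x - z) - _) z =
   K j i (x - z) - avg (rk k) (fun y => K j i (x - y)) z); first by ring.
rewrite /avg; under eq_Rintegral do rewrite mulrBr.
rewrite RintegralB//; first last.
- by have [] := bL1_avg_integrand z (rk0 k) HKx.
- have [] := bL1Z (K j i (x - z)) (bL1_avg_ker z (rk0 k)) => _ _.
  by apply: eq_integrable => // y _ /=; rewrite mulrC.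
congr (_ - _); rewrite RintegralZr ?Rintegral_avg_ker ?mul1r//.
by have [] := bL1_avg_ker z (rk0 k).
Qed.

Let avg_far k x z : R := avg (rk k) (fun y => far_diff (x - z) (y - z)) z.

Let bL1_avg_far_integrand k x z : bL1 (fun y => avg_ker (rk k) z y * far_diff (x - z) (y - z)).
Proof.
have [M hM] := far_diff_bound.
have mf : measurable_fun setT (fun y : V => far_diff (x - z) (y - z)).
  have m : measurable_fun setT (far_diff (x - z)).
    exact: (measurable_uncurry1 (F := far_diff) _ measurable_far_diff).
  by msr.
have := bL1M (bL1_avg_ker z (rk0 k)) mf (fun y => hM (x - z) (y - z)).
by congr bL1; apply/funext => y; rewrite mulrC.
Qed.

Let avg_far_ge0 k x z : 0 <= avg_far k x z.
Proof. by apply: Rintegral_ge0 => y _; rewrite mulr_ge0 ?avg_ker_ge0 ?far_diff_ge0. Qed.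

Let measurable_avg_far k : measurable_fun setT (fun p : V * V => avg_far k p.1 p.2).
Proof.
apply: (@measurable_Rintegral _ _ _ (V * V)%type V mu (fun (p : V * V) (y : V) =>
  avg_ker (rk k) p.2 y * far_diff (p.1 - p.2) (y - p.2))).
apply: measurable_funM.
  apply: (measurable_uncurry_comp (F := avg_ker (rk k)) (measurable_avg_ker (rk0 k))).
    by apply: (measurableT_comp measurable_snd); exact: measurable_fst.
  exact: measurable_snd.
have m12 : measurable_fun setT (fun p : (V * V) * V => p.1.2).
  by apply: (measurableT_comp measurable_snd); exact: measurable_fst.
have m11 : measurable_fun setT (fun p : (V * V) * V => p.1.1).
  by apply: (measurableT_comp measurable_fst); exact: measurable_fst.
apply: (measurable_uncurry_comp (F := far_diff) measurable_far_diff).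
  exact: measurable_rVB.
by apply: measurable_rVB => //; exact: measurable_snd.
Qed.

(** Since X k x < 1, the point x is farther than 2 N / r from every stopped z, hence at least twice
    as far from z as any y in the cell of z. All kernel differences are therefore of the kind that
    [far_diff] records. *)
Let sum_conv_bad_le n x : farw n x = 1 -> (forall k : 'I_n, X k x < 1) ->
  ((\sum_j `|\sum_(k < n) vconv (bad k) j x|)%:E <=
   \sum_(k < n) nint mu (fun z => st k z * G z * avg_far k x z)%R)%E.
Proof.
move=> _ hX; have [mG _ _] := HG.
have mav k : measurable_fun setT (avg_far k x).
  exact: (measurable_uncurry1 (F := avg_far k) x (measurable_avg_far k)).
apply: (@le_trans _ _ (\sum_(k < n) \sum_j \sum_i (`|conv (K j i) (bad k i) x|)%:E)%E).
  rewrite [leRHS](_ : _ = (\sum_(k < n) \sum_j \sum_i `|conv (K j i) (bad k i) x|)%:E); last first.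
    rewrite -sumEFin; apply: eq_bigr => k _; rewrite -sumEFin; apply: eq_bigr => j _.
    by rewrite -sumEFin.
  rewrite lee_fin [leRHS]exchange_big/=; apply: ler_sum => j _.
  apply: le_trans (ler_norm_sum _ _ _) _; apply: ler_sum => k _.
  exact: ler_norm_sum.
apply: lee_sum => k _.
have ms := mst k.
pose F j i z := st k z * G z * avg (rk k) (fun y => `|K j i (x - z) - K j i (x - y)|) z.
have HKx j i := bL1_reflect x (HK j i).
have mF j i : measurable_fun setT (F j i).
  apply: measurable_funM; first by msr.
  apply: (@measurable_Rintegral _ _ _ V V mu (fun z y =>
    avg_ker (rk k) z y * `|K j i (x - z) - K j i (x - y)|)).
  apply: measurable_funM; first exact: measurable_avg_ker.
  by have [m _ _] := HK j i; msr.
have F0 j i z : 0 <= F j i z.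
  rewrite mulr_ge0 ?mulr_ge0 ?stop_ge0//; apply: Rintegral_ge0 => y _.
  by rewrite mulr_ge0// avg_ker_ge0.
apply: (@le_trans _ _ (\sum_j \sum_i nint mu (F j i))%E).
  apply: lee_sum => j _; apply: lee_sum => i _; have [mg _ _] := Hg i.
  have mA : measurable_fun setT (fun z : V => avg (rk k) (fun y => K j i (x - z) - K j i (x - y)) z).
    apply: (@measurable_Rintegral _ _ _ V V mu (fun z y =>
      avg_ker (rk k) z y * (K j i (x - z) - K j i (x - y)))).
    apply: measurable_funM; first exact: measurable_avg_ker.
    by have [m _ _] := HK j i; msr.
  rewrite conv_bad; apply: le_trans (abs_Rintegral_le _ _) _.
    by apply: measurable_funM => //; apply: measurable_funM.
  apply: le_nint => //.
    by apply: measurable_fun_normr; apply: measurable_funM => //; apply: measurable_funM.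
  move=> z; rewrite 2!normrM (ger0_norm (stop_ge0 _ _ _ _ _)).
  have hz : bL1 (fun y => K j i (x - z) - K j i (x - y)) \/ True by right.
  apply: ler_pM => //; first by rewrite mulr_ge0 ?stop_ge0.
    by rewrite ler_wpM2l ?stop_ge0//; exact: ler_vnorm (g^~ z) i.
  apply: le_trans (le_normr_Rintegral _ _) _ => //.
    have [M [M0 hM]] := bL1_bound (HK j i).
    have [m _ _] := HKx j i.
    have mm : measurable_fun setT (fun y : V => K j i (x - z) - K j i (x - y)) by msr.
    have [] := bL1M (bL1_avg_ker z (rk0 k)) mm (M := M + M) _.
      by move=> y; apply: le_trans (ler_normB _ _) _; apply: lerD.
    by move=> _ _; apply: eq_integrable => // y _ /=; rewrite mulrC.
  rewrite le_eqVlt; apply/orP; left; apply/eqP; apply: eq_Rintegral => y _.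
  by rewrite normrM (ger0_norm (avg_ker_ge0 _ _ (rk0 k))).
under eq_bigr do rewrite -nint_sum//.
rewrite -nint_sum; first last.
- by move=> j z; apply: sumr_ge0.
- by move=> j; apply: measurable_fun_bigsum.
apply: le_nint.
- by do 2 apply: measurable_fun_bigsum => ?.
- by have m := mav k; msr.
- by move=> z; do 2 apply: sumr_ge0 => ? _.
move=> z; rewrite /F; under eq_bigr do rewrite -mulr_sumr; rewrite -mulr_sumr.
have [hz|hz] := boolP (stb k z); last by rewrite /stop (negbTE hz) !mul0r.
rewrite ler_wpM2l ?mulr_ge0 ?stop_ge0//.
have II j i : mu.-integrable setT (EFin \o (fun y => avg_ker (rk k) z y *
    `|K j i (x - z) - K j i (x - y)|)).
  have [M [M0 hM]] := bL1_bound (HK j i).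
  have [m _ _] := HKx j i.
  have mm : measurable_fun setT (fun y : V => `|K j i (x - z) - K j i (x - y)|) by msr.
  have [] := bL1M (bL1_avg_ker z (rk0 k)) mm (M := M + M) _.
    by move=> y; rewrite normr_id; apply: le_trans (ler_normB _ _) _; apply: lerD.
  by move=> _ _; apply: eq_integrable => // y _ /=; rewrite mulrC.
rewrite /avg; under eq_bigr do rewrite -Rintegral_sum//.
rewrite -Rintegral_sum; last by move=> j; exact: integrableR_sum.
apply: le_Rintegral => //.
- by apply: integrableR_sum => j; exact: integrableR_sum.
- by have [] := bL1_avg_far_integrand k x z.
move=> y _; under eq_bigr do rewrite -mulr_sumr; rewrite -mulr_sumr.
rewrite /avg_ker; case: (boolP (same_cell _ z y)) => [h|_]; last by rewrite mulr0 !mul0r.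
have hfar : 2 * l1norm (y - z) <= l1norm (x - z).
  apply: (@le_trans _ _ (2 * (N%:R / rk k))).
    by rewrite ler_pM2l// l1norm_distrC; exact: same_cell_l1norm.
  rewrite mulrA leNgt; apply/negP => /ltW h2.
  by have := X_ge1 hz h2; rewrite leNgt hX.
rewrite ler_wpM2l ?mulr1 ?exprn_ge0 ?(ltW (rk0 k))// /far_diff hfar mul1r.
rewrite /kernel_diff; apply: ler_sum => j _; apply: ler_sum => i _.
rewrite distrC (_ : x - z - (y - z) = x - y)//.
by rewrite opprB addrA subrK.
Qed.

(** Integrate in x first: after translation by z, Hormander's condition applies to the displacement
    y - z, and the averaging kernel has mass 1. *)
Let nint_avg_far k : (\int[mu]_x nint mu (fun z => st k z * G z * avg_far k x z)%R <=
  A1%:E * nint mu (fun z => st k z * G z)%R)%E.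
Proof.
have ms := mst k; have [mG _ _] := HG.
have mav := measurable_avg_far k.
have sG0 z : 0 <= st k z * G z by rewrite mulr_ge0 ?stop_ge0.
have msG : measurable_fun setT (fun z : V => st k z * G z) by msr.
rewrite (tonelli mu mu (F := fun x z => st k z * G z * avg_far k x z)); first last.
- by move=> x z; rewrite mulr_ge0.
- apply: measurable_funM; last exact: mav.
  exact: (measurableT_comp msG measurable_snd).
rewrite -nintZ//.
apply: ge0_le_integral => //.
- by move=> z _; apply: nint_ge0 => x; rewrite mulr_ge0.
- apply: (@measurable_nint _ _ _ V V mu (fun z x => st k z * G z * avg_far k x z)).
    apply: measurable_funM; first exact: (measurableT_comp msG measurable_fst).
    exact: (measurable_uncurry_comp (F := avg_far k) mav measurable_snd measurable_fst).
  by move=> z x; rewrite mulr_ge0.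
- by apply/measurable_EFinP; apply: measurable_funM => //; exact: measurable_cst.
move=> z _; have mz : measurable_fun setT (avg_far k ^~ z).
  exact: (measurable_uncurry2 (F := avg_far k) z mav).
rewrite nintZ// [A1 * _]mulrC (EFinM _ A1); apply: lee_wpmul2l; first by rewrite lee_fin.
have mk := measurable_avg_ker (N := N) (rk0 k).
have mkz := measurable_avg_kerx z (rk0 k).
have mfar : measurable_fun setT (fun p : V * V => far_diff (p.1 - z) (p.2 - z)).
  by apply: (measurable_uncurry_comp (F := far_diff) measurable_far_diff); msr.
apply: (@le_trans _ _ (\int[mu]_x nint mu (fun y => avg_ker (rk k) z y *
    far_diff (x - z) (y - z))%R)%E).
  rewrite le_eqVlt; apply/orP; left; apply/eqP; apply: eq_integral => x _.
  rewrite nint_Rintegral//; last by have [] := bL1_avg_far_integrand k x z.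
  by move=> y; rewrite mulr_ge0 ?avg_ker_ge0 ?far_diff_ge0.
rewrite (tonelli mu mu (F := fun x y => avg_ker (rk k) z y * far_diff (x - z) (y - z))); first last.
- by move=> x y; rewrite mulr_ge0 ?avg_ker_ge0 ?far_diff_ge0.
- by apply: measurable_funM => //; msr.
apply: (@le_trans _ _ (nint mu (fun y => A1 * avg_ker (rk k) z y)%R)).
  apply: ge0_le_integral => //.
  - by move=> y _; apply: nint_ge0 => x; rewrite mulr_ge0 ?avg_ker_ge0 ?far_diff_ge0.
  - apply: (@measurable_nint _ _ _ V V mu (fun y x => avg_ker (rk k) z y * far_diff (x - z) (y - z))).
      apply: measurable_funM; first by msr.
      by apply: (measurable_uncurry_comp (F := far_diff) measurable_far_diff); msr.
    by move=> y x; rewrite mulr_ge0 ?avg_ker_ge0 ?far_diff_ge0.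
  - by apply/measurable_EFinP; apply: measurable_funM => //; exact: measurable_cst.
  move=> y _.
  have my : measurable_fun setT (far_diff^~ (y - z)).
    exact: (measurable_uncurry2 (F := far_diff) _ measurable_far_diff).
  rewrite nintZ; first last.
  - by move=> x; exact: far_diff_ge0.
  - exact: avg_ker_ge0.
  - by apply: (measurable_uncurry_comp (F := far_diff) measurable_far_diff); msr.
  rewrite [A1 * _]mulrC (EFinM _ A1); apply: lee_wpmul2l; first by rewrite lee_fin avg_ker_ge0.
  rewrite (nint_shift z my); last by move=> x; exact: far_diff_ge0.
  exact: hormander.
rewrite nintZ//; last by move=> y; exact: avg_ker_ge0.
by rewrite nint_avg_ker// mule1.
Qed.

Let good n i x : R := g i x - \sum_(k < n) bad k i x.

Let bL1_good n i : bL1 (good n i).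
Proof. by apply: bL1B => //; apply: bL1_sum => k; exact: bL1_bad. Qed.

Let vconv_split n j x :
  vconv g j x = \sum_(k < n) vconv (bad k) j x + vconv (good n) j x.
Proof.
rewrite /vconv exchange_big/= -big_split/=; apply: eq_bigr => i _.
have Hs : bL1 (fun y => \sum_(k < n) bad k i y) by apply: bL1_sum => k; exact: bL1_bad.
rewrite -(conv_sumr _ _ x (HK j i)); last by move=> k; exact: bL1_bad.
rewrite -(convDr x (HK j i) Hs (bL1_good n i)); congr (conv _ _ x).
by apply/funext => y; rewrite /good addrC subrK.
Qed.

(** On a stopped cell the good part is the average of g, whose length is at most the average of G;
    elsewhere it is g itself. *)
Let sumsq_good_le n x : \sum_i good n i x ^+ 2 <=
  S n x * (2 ^+ N * lam) ^+ 2 + (1 - S n x) * G x ^+ 2.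
Proof.
have hS : S n x = \sum_(l < n) st l x * 1 by apply: eq_bigr => l _; rewrite mulr1.
case: (stop_beforeP G r0 lam n x) => [[k [hk h]]|[hk h]].
  rewrite hS (h (fun=> 1)) mul1r subrr mul0r addr0.
  rewrite (eq_bigr (fun i => avg (rk k) (g i) x ^+ 2)); last first.
    move=> i _; rewrite /good /bad (h (fun l => g i x - avg (rk l) (g i) x)).
    by rewrite opprB addrC subrK.
  rewrite -(sqr_vnorm (fun i => avg (rk k) (g i) x)).
  rewrite lerXn2r// ?nnegrE ?vnorm_ge0//.
    by rewrite mulr_ge0 ?exprn_ge0// ltW.
  apply: le_trans (vabs_avg_le x (rk0 k) Hg) _.
  exact: (avg_stopped_le HG G0 r0_gt0 E0 hk).
rewrite hS (h (fun=> 1)) mul0r subr0 add0r mul1r.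
rewrite sqr_vnorm; apply: ler_sum => i _.
by rewrite /good /bad (h (fun l => g i x - avg (rk l) (g i) x)) subr0.
Qed.

(** If the transform of g exceeds 2 lam at x, then x is near a stopped cube, or the bad part is at
    least lam there, or the good part is at least lam. The three terms are the Chebyshev bounds for
    these events. *)
Let indicator_le n x : ((2 * lam < vabs (vconv g) x)%R%:R%:E <=
  \sum_(k < n) (X k x)%:E +
  (lam^-1)%:E * \sum_(k < n) nint mu (fun z => st k z * G z * avg_far k x z)%R +
  (lam ^- 2 * \sum_j vconv (good n) j x ^+ 2)%:E)%E.
Proof.
have Y0 : (0 <= \sum_(k < n) nint mu (fun z => st k z * G z * avg_far k x z)%R)%E.
  by apply: sume_ge0 => k _; apply: nint_ge0 => z; rewrite mulr_ge0 ?mulr_ge0 ?stop_ge0.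
have L0 : (0 <= (lam^-1)%:E :> \bar R)%E by rewrite lee_fin invr_ge0 ltW.
have Q0 : (0 <= (lam ^- 2 * \sum_j vconv (good n) j x ^+ 2)%:E)%E.
  by rewrite lee_fin mulr_ge0 ?sumsq_ge0// invr_ge0 exprn_ge0// ltW.
have X0 : (0 <= \sum_(k < n) (X k x)%:E)%E by apply: sume_ge0 => k _; rewrite lee_fin.
have [hlt|_] := boolP (2 * lam < _)%R; last first.
  by apply: adde_ge0 => //; apply: adde_ge0 => //; exact: mule_ge0.
case: (farw_cases n x) => [h|[h1 h2]].
  apply: (@le_trans _ _ (\sum_(k < n) (X k x)%:E)%E); first by rewrite sumEFin lee_fin.
  by rewrite -addeA leeDl// adde_ge0// mule_ge0.
have hb := sum_conv_bad_le h1 h2.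
set b := \sum_j `|\sum_(k < n) vconv (bad k) j x| in hb.
have : 2 * lam < b + vnorm (vconv (good n) ^~ x).
  apply: lt_le_trans hlt _; rewrite /vabs.
  rewrite (_ : (vconv g)^~ x = fun j => (\sum_(k < n) vconv (bad k) j x) + vconv (good n) j x); last first.
    by apply/funext => j; exact: vconv_split.
  apply: le_trans (vnorm_triangle _ _) _; apply: lerD => //; exact: vnorm_le_sum.
have [hbl|hbl] := leP lam b => hsum.
  apply: (@le_trans _ _ ((lam^-1)%:E * b%:E)%E).
    by rewrite -EFinM lee_fin mulrC ler_pdivlMr ?mul1r.
  apply: (@le_trans _ _ ((lam^-1)%:E * \sum_(k < n) nint mu (fun z => st k z * G z * avg_far k x z)%R)%E).
    exact: lee_wpmul2l.
  by rewrite -addeA addeC -addeA leeDl// adde_ge0.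
apply: (@le_trans _ _ (lam ^- 2 * \sum_j vconv (good n) j x ^+ 2)%:E).
  rewrite lee_fin -(sqr_vnorm ((vconv (good n))^~ x)) mulrC -expr_div_n.
  by rewrite -[leLHS](expr1n _ 2) lerXn2r// ?nnegrE ?ler01 ?divr_ge0 ?vnorm_ge0 ?(ltW lam0)//
    ler_pdivlMr// mul1r; move: hsum hbl; lra.
by rewrite addeC leeDl// adde_ge0// mule_ge0.
Qed.

Let nint_stop_le k : (nint mu (st k) <= (lam^-1)%:E * nint mu (fun z => st k z * G z)%R)%E.
Proof.
have := nint_stop HG G0 r0_gt0 lam0 k.
rewrite -(@lee_pmul2l _ (lam^-1)%:E)// ?lte_fin ?invr_gt0//.
by rewrite muleA -EFinM mulVf ?gt_eqF// mul1e.
Qed.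

Let sum_nint_stop_G n : (\sum_(k < n) nint mu (fun z => st k z * G z)%R =
  nint mu (fun z => S n z * G z)%R)%E.
Proof.
have [mG _ _] := HG.
rewrite -nint_sum; first last.
- by move=> k z; rewrite mulr_ge0 ?stop_ge0.
- by move=> k; have m := mst k; msr.
by congr nint; apply/funext => z; rewrite mulr_suml.
Qed.

Let weak_type_n n : (nint mu (fun x => (2 * lam < vabs (vconv g) x)%R%:R)%R <=
  (lam^-1 * (ball_mass + A1 + A2 * (2 ^+ N) ^+ 2))%:E * nint mu (fun z => S n z * G z)%R +
  (lam ^- 2 * A2)%:E * nint mu (fun x => (1 - S n x) * G x ^+ 2)%R)%E.
Proof.
have [mG _ _] := HG.
have mS : measurable_fun setT (S n) by exact: measurable_stop_before.
have mX := measurable_X.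
have mV h : (forall i, bL1 (h i)) -> forall j, measurable_fun setT (vconv h j).
  by move=> Hh j; have [] := bL1_vconv j Hh.
have mvg := mV _ Hg; have mvgood := mV _ (bL1_good n).
have mvabs : measurable_fun setT (vabs (vconv g)) by exact: measurable_vabs.
have Linv : 0 <= lam^-1 by rewrite invr_ge0 ltW.
have mY k : measurable_fun setT (fun x => nint mu (fun z => st k z * G z * avg_far k x z)%R).
  apply: (@measurable_nint _ _ _ V V mu (fun x z => st k z * G z * avg_far k x z)).
    have ms := mst k; have mav := measurable_avg_far k.
    apply: measurable_funM; last exact: mav.
    have msG : measurable_fun setT (fun z : V => st k z * G z) by msr.
    exact: (measurableT_comp msG measurable_snd).
  by move=> x z; rewrite mulr_ge0 ?mulr_ge0 ?stop_ge0.
have Y0 k x : (0 <= nint mu (fun z => st k z * G z * avg_far k x z)%R)%E.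
  by apply: nint_ge0 => z; rewrite mulr_ge0 ?mulr_ge0 ?stop_ge0.
have S01 x := stop_before01 G r0 lam n x.
have bm0 : 0 <= ball_mass by rewrite fine_ge0// nint_ge0.
set Q := nint mu (fun z => S n z * G z)%R.
have Q0 : (0 <= Q)%E by apply: nint_ge0 => z; rewrite mulr_ge0//; case/andP: (S01 z).
have hst : (\sum_(k < n) nint mu (st k) <= (lam^-1)%:E * Q)%E.
  rewrite /Q -sum_nint_stop_G ge0_sume_distrr; last first.
    by move=> k _; apply: nint_ge0 => z; rewrite mulr_ge0 ?stop_ge0.
  by apply: lee_sum => k _; exact: nint_stop_le.
have hX : (\int[mu]_x \sum_(k < n) (X k x)%:E <= (lam^-1 * ball_mass)%:E * Q)%E.
  rewrite ge0_integral_sum//; first last.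
  - by move=> k x _; rewrite lee_fin.
  - by move=> k; exact/measurable_EFinP.
  rewrite (eq_bigr (fun k : 'I_n => ball_mass%:E * nint mu (st k))%E); last first.
    by move=> k _; exact: nint_X.
  rewrite -ge0_sume_distrr; last by move=> k _; apply: nint_ge0 => z; exact: stop_ge0.
  rewrite mulrC EFinM -muleA; apply: lee_wpmul2l => //; by rewrite lee_fin.
have hY : (\int[mu]_x \sum_(k < n) nint mu (fun z => st k z * G z * avg_far k x z)%R <=
    A1%:E * Q)%E.
  rewrite ge0_integral_sum//.
  rewrite /Q -sum_nint_stop_G ge0_sume_distrr; last first.
    by move=> k _; apply: nint_ge0 => z; rewrite mulr_ge0 ?stop_ge0.
  by apply: lee_sum => k _; exact: nint_avg_far.
(* The good part is at most 2^N lam on the stopped set, whose measure is at most Q / lam; one power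
   of lam remains. *)
have hG : (nint mu (fun x => \sum_j vconv (good n) j x ^+ 2)%R <=
   (A2 * (2 ^+ N) ^+ 2 * lam)%:E * Q +
   A2%:E * nint mu (fun x => (1 - S n x) * G x ^+ 2)%R)%E.
  apply: le_trans (L2_bound (bL1_good n)) _.
  have hS : nint mu (S n) = (\sum_(k < n) nint mu (st k))%E.
    by rewrite -nint_sum// => k x; exact: stop_ge0.
  apply: (@le_trans _ _ (A2%:E * ((((2 ^+ N) ^+ 2 * lam)%:E * Q) +
      nint mu (fun x => (1 - S n x) * G x ^+ 2)%R))%E); last first.
    rewrite ge0_muleDr.
    - by rewrite muleA -EFinM mulrA.
    - by rewrite mule_ge0// lee_fin mulr_ge0 ?(ltW lam0)// exprn_ge0// exprn_ge0.
    - by apply: nint_ge0 => x; rewrite mulr_ge0 ?sqr_ge0// subr_ge0; case/andP: (S01 x).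
  apply: lee_wpmul2l; first by rewrite lee_fin.
  apply: (@le_trans _ _ (nint mu (fun x => (2 ^+ N * lam) ^+ 2 * S n x +
       (1 - S n x) * G x ^+ 2)%R)).
    have mgood i : measurable_fun setT (good n i) by have [] := bL1_good n i.
    apply: le_nint; try by msr.
      by move=> x; exact: sumsq_ge0.
    by move=> x; rewrite mulrC sumsq_good_le.
  rewrite nintD; try by msr.
  - apply: leeD2r; rewrite nintZ//.
    + rewrite hS; apply: (@le_trans _ _ (((2 ^+ N * lam) ^+ 2)%:E * ((lam^-1)%:E * Q))%E).
        by apply: lee_wpmul2l => //; rewrite lee_fin sqr_ge0.
      rewrite muleA -EFinM (_ : (_ * lam) ^+ 2 / lam = (2 ^+ N) ^+ 2 * lam)//.
      by field; rewrite gt_eqF.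
    + exact: sqr_ge0.
    + by move=> x; case/andP: (S01 x).
  - by move=> x; rewrite mulr_ge0 ?sqr_ge0//; case/andP: (S01 x).
  - by move=> x; rewrite mulr_ge0 ?sqr_ge0// subr_ge0; case/andP: (S01 x).
apply: (@le_trans _ _ (\int[mu]_x (\sum_(k < n) (X k x)%:E +
  (lam^-1)%:E * \sum_(k < n) nint mu (fun z => st k z * G z * avg_far k x z)%R +
  (lam ^- 2 * \sum_j vconv (good n) j x ^+ 2)%:E))%E).
  apply: ge0_le_integral => //.
  - by apply/measurable_EFinP; apply: measurable_fun_bool;
      apply: measurable_fun_ltr => //; exact: measurable_cst.
  - apply: emeasurable_funD.
      apply: emeasurable_funD.
        by apply: emeasurable_sum => k; exact/measurable_EFinP.
      by apply: emeasurable_funM; [exact: measurable_cst|exact: emeasurable_sum].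
    by apply/measurable_EFinP; msr.
have mXe : measurable_fun setT (fun x => \sum_(k < n) (X k x)%:E)%E.
  by apply: emeasurable_sum => k; exact/measurable_EFinP.
have mYe : measurable_fun setT (fun x => \sum_(k < n)
    nint mu (fun z => st k z * G z * avg_far k x z)%R)%E by exact: emeasurable_sum.
have Ye0 x : (0 <= \sum_(k < n) nint mu (fun z => st k z * G z * avg_far k x z)%R)%E.
  exact: sume_ge0.
have Xe0 x : (0 <= \sum_(k < n) (X k x)%:E)%E by apply: sume_ge0 => k _; rewrite lee_fin.
rewrite ge0_integralD//; first last.
- by apply/measurable_EFinP; msr.
- by move=> x _; rewrite lee_fin mulr_ge0 ?sumsq_ge0// invr_ge0 exprn_ge0// ltW.
- by apply: emeasurable_funD => //; apply: emeasurable_funM => //; exact: measurable_cst.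
- by move=> x _; rewrite adde_ge0// mule_ge0// lee_fin.
rewrite ge0_integralD//; first last.
- by apply: emeasurable_funM => //; exact: measurable_cst.
- by move=> x _; rewrite mule_ge0// lee_fin.
rewrite ge0_integralZl//.
rewrite -[X in (_ + _ + X <= _)%E]/(nint mu (fun x => lam ^- 2 * \sum_j vconv (good n) j x ^+ 2)).
rewrite nintZ; first last.
- by move=> x; exact: sumsq_ge0.
- by rewrite invr_ge0 exprn_ge0// ltW.
- by msr.
apply: (@le_trans _ _ ((lam^-1 * ball_mass)%:E * Q + (lam^-1)%:E * (A1%:E * Q) +
  (lam ^- 2)%:E * ((A2 * (2 ^+ N) ^+ 2 * lam)%:E * Q +
   A2%:E * nint mu (fun x => (1 - S n x) * G x ^+ 2)%R))%E).
  apply: leeD; first (apply: leeD => //).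
    by apply: lee_wpmul2l => //; rewrite lee_fin.
  by apply: lee_wpmul2l => //; rewrite lee_fin invr_ge0 exprn_ge0// ltW.
rewrite [X in (_ + X <= _)%E]ge0_muleDr; first last.
- apply: mule_ge0; first by rewrite lee_fin.
  by apply: nint_ge0 => x; rewrite mulr_ge0 ?sqr_ge0// subr_ge0; case/andP: (S01 x).
- by apply: mule_ge0 => //; rewrite lee_fin !mulr_ge0 ?exprn_ge0// ltW.
rewrite addeA; apply: leeD; last by rewrite muleA -EFinM.
rewrite !muleA -!EFinM.
rewrite -[X in (X + _ <= _)%E]ge0_muleDl; first last.
- by rewrite lee_fin mulr_ge0.
- by rewrite lee_fin mulr_ge0.
rewrite -ge0_muleDl; first last.
- by rewrite lee_fin !mulr_ge0 ?invr_ge0 ?exprn_ge0 ?(ltW lam0)// exprn_ge0.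
- by rewrite adde_ge0// lee_fin mulr_ge0.
rewrite -!EFinD le_eqVlt; apply/orP; left; apply/eqP; congr (_%:E * _)%E.
by field; rewrite gt_eqF.
Qed.

(** Large values of G enter linearly and small ones quadratically. Against lam^(p-1) the first term
    is integrable near lam = 0 because p > 1, and the second near infinity because p < 2. *)
Lemma weak_type : (nint mu (fun x => (2 * lam < vabs (vconv g) x)%R%:R)%R <=
  (lam^-1 * (2 * (ball_mass + A1 + A2 * (2 ^+ N) ^+ 2)))%:E *
    nint mu (fun x => (lam / 2 < G x)%R%:R * G x)%R +
  (lam ^- 2 * A2)%:E * nint mu (fun x => (G x <= lam)%R%:R * G x ^+ 2)%R)%E.
Proof.
have bm0 : 0 <= ball_mass by rewrite fine_ge0// nint_ge0.
have c0 : 0 <= lam ^- 2 * A2 by rewrite mulr_ge0// invr_ge0 exprn_ge0// ltW.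
apply/lee_addgt0Pr => e e0.
pose e' := e / (lam ^- 2 * A2 + 1).
have e'0 : 0 < e' by rewrite divr_gt0// ltr_wpDl.
have [n hn] := nint_stop_before_cpl lam HG cG G0 r0_gt0 e'0.
apply: le_trans (weak_type_n n) _.
rewrite -addeA; apply: leeD.
  rewrite [(lam^-1 * (2 * _))%R](_ : _ = (lam^-1 * (ball_mass + A1 + A2 * (2 ^+ N) ^+ 2)) * 2); last by ring.
  rewrite (EFinM _ 2) -muleA; apply: lee_wpmul2l.
    by rewrite lee_fin mulr_ge0 ?invr_ge0 ?(ltW lam0)// !addr_ge0// mulr_ge0// exprn_ge0// exprn_ge0.
  exact: nint_stop_before_G.
apply: (@le_trans _ _ ((lam ^- 2 * A2)%:E * (nint mu (fun x => (G x <= lam)%R%:R * G x ^+ 2)%R + e'%:E))%E).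
  by apply: lee_wpmul2l => //; rewrite lee_fin.
rewrite ge0_muleDr//; first last.
- by rewrite lee_fin ltW.
- by apply: nint_ge0 => x; rewrite mulr_ge0 ?sqr_ge0.
apply: leeD => //; rewrite -EFinM lee_fin /e' mulrCA ler_piMr ?(ltW e0)//.
by rewrite ler_pdivrMr ?mul1r ?lerDl// ltr_wpDl.
Qed.

End weak_type.
End vector_singular_integrals.

(** * Geometric sums *)

Section geometric_sums.
Context {R : realType}.
Implicit Types c T Y : R.

Lemma sum_geometric_le n c T : 0 <= c < 1 -> 0 <= T ->
  \sum_(k < n) T * c ^+ k <= T / (1 - c).
Proof.
move=> /andP[c0 c1] T0; rewrite -mulr_sumr; apply: ler_wpM2l => //.
have h : 0 < 1 - c by rewrite subr_gt0.
rewrite -[leRHS]mul1r ler_pdivlMr// mulrC.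
have -> : (1 - c) * (\sum_(k < n) c ^+ k) = 1 - c ^+ n.
  by rewrite -opprB mulNr -subrX1 opprB.
by rewrite lerBlDr lerDl exprn_ge0.
Qed.

(** The terms decrease, so those below Y form a geometric series whose first term is at most Y:
    neither T nor n enters the bound. *)
Lemma sum_geometric_trunc n c T Y : 0 <= c < 1 -> 0 <= T -> 0 <= Y ->
  \sum_(k < n) (T * c ^+ k <= Y)%R%:R * (T * c ^+ k) <= Y / (1 - c).
Proof.
move=> cc; have /andP[c0 c1] := cc.
elim: n T => [|n IHn] T T0 Y0; first by rewrite big_ord0 divr_ge0// subr_ge0 ltW.
have [TY|TY] := leP T Y.
  apply: (@le_trans _ _ (\sum_(k < n.+1) T * c ^+ k)).
    apply: ler_sum => k _; rewrite ler_piMl ?lern1 ?leq_b1//.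
    by rewrite mulr_ge0// exprn_ge0.
  apply: le_trans (sum_geometric_le _ cc T0) _.
  by rewrite ler_wpM2r// invr_ge0 subr_ge0 ltW.
have hT : (T <= Y) = false by rewrite leNgt TY.
rewrite big_ord_recl expr0 mulr1 hT mul0r add0r.
apply: le_trans (IHn (T * c) _ Y0); last by rewrite mulr_ge0.
by apply: ler_sum => k _; rewrite lift0 exprS (mulrA T).
Qed.

(** Reversing the order of the terms turns growth into decay. *)
Lemma sum_geometric_trunc_up n c T Y : 1 < c -> 0 <= T -> 0 <= Y ->
  \sum_(k < n) (T * c ^+ k <= Y)%R%:R * (T * c ^+ k) <= Y / (1 - c^-1).
Proof.
move=> c1 T0 Y0; have c0 : 0 < c by rewrite (lt_trans _ c1).
rewrite (reindex_inj rev_ord_inj)/=.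
apply: le_trans (@sum_geometric_trunc n c^-1 (T * c ^+ n.-1) Y _ _ Y0); last 2 first.
- by rewrite invr_ge0 ltW//= invf_lt1.
- by rewrite mulr_ge0// exprn_ge0// ltW.
apply: ler_sum => -[k kn] _ /=.
have -> : T * c ^+ (n - k.+1) = T * c ^+ n.-1 * c^-1 ^+ k.
  rewrite -mulrA; congr (_ * _); rewrite exprVn -exprB ?unitfE ?gt_eqF//.
    by rewrite -subn1 -subnDA add1n.
  by rewrite -ltnS (leq_trans kn)// leqSpred.
by [].
Qed.

Lemma powR_geometric (B x a : R) k : 0 <= B -> 0 <= x ->
  (B * x ^+ k) `^ a = B `^ a * (x `^ a) ^+ k.
Proof.
move=> B0 x0; rewrite powRM ?exprn_ge0//; congr (_ * _).
by rewrite -powR_mulrn// powRAC powR_mulrn// powR_ge0.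
Qed.

Lemma powR_lt1 (x a : R) : 0 < x < 1 -> 0 < a -> x `^ a < 1.
Proof.
move=> /andP[x0 x1] a0; rewrite /powR gt_eqF// -expR0 ltr_expR.
by rewrite pmulr_rlt0// ln_lt0// x0.
Qed.

End geometric_sums.

(** Fatou's lemma in the form in which truncations are removed: a bound that holds eventually passes
    to the pointwise limit. *)
Lemma nint_le_lim (R : realType) d (T : measurableType d) (m : {measure set T -> \bar R})
    (u : nat -> T -> R) (f : T -> R) (C : \bar R) :
  (forall n, measurable_fun setT (u n)) -> (forall n x, 0 <= u n x) ->
  (forall x, u n x @[n --> \oo] --> f x) ->
  (\forall n \near \oo, nint m (u n) <= C)%E -> (nint m f <= C)%E.
Proof.
move=> mu u0 uf [M _ hC].
have fE x : limn_einf (fun n => (u n x)%:E) = (f x)%:E.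
  have h : (u n x)%:E @[n --> \oo] --> (f x)%:E.
    by apply: cvg_EFin; [apply: nearW|exact: uf].
  by rewrite is_cvg_limn_einfE; [exact/cvg_lim|apply/cvg_ex; exists (f x)%:E].
rewrite /nint; under eq_integral do rewrite -fE.
apply: le_trans (fatou _ _ _ _) _ => //.
- by move=> n; exact/measurable_EFinP.
- by move=> n x _; rewrite lee_fin.
apply: (@le_trans _ _ (limn_einf (fun=> C))); last first.
  have cC : (fun _ : nat => C) @ \oo --> C by exact: cvg_cst.
  by rewrite is_cvg_limn_einfE; [rewrite (cvg_lim _ cC)|apply/cvg_ex; exists C].
rewrite 2!limn_einf_lim. apply: lee_lim; [exact: is_cvg_einfs|exact: is_cvg_einfs|].
exists M => // n /= Mn; apply: le_ereal_inf_tmp => _ [k /= nk <-].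
apply: le_trans (hC k _); last exact: leq_trans nk.
by apply: ereal_inf_lbound; exists k.
Qed.

(** * Marcinkiewicz interpolation *)

Section strong_type.
Context {R : realType} {N : nat} (I J : finType).
Local Notation V := 'rV[R]_N.
Local Notation mu := (lebesgue_rV R N).
Variable K : J -> I -> V -> R.

Definition Lp_bounded (p C : R) := forall g : I -> V -> R,
  (forall i, bL1 (g i)) -> (forall i, scont (g i)) ->
  (nint mu (fun x => vabs (vconv K g) x `^ p)%R <=
   C%:E * nint mu (fun x => vabs g x `^ p)%R)%E.

Definition L2_bounded (A : R) := forall h : I -> V -> R, (forall i, bL1 (h i)) ->
  (nint mu (fun x => \sum_j vconv K h j x ^+ 2)%R <=
   A%:E * nint mu (fun x => \sum_i h i x ^+ 2)%R)%E.

Definition hormander_bounded (A : R) := forall y, (nint mu (far_diff K ^~ y) <= A%:E)%E.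

(** Between consecutive dyadic levels F is at most 4 lam, whence 4^p. The two quotients are the
    geometric sums of lam^(p-1) over levels lam < 2 G and of lam^(p-2) over levels lam >= G; the
    ratios are admissible exactly for 1 < p < 2. *)
Definition marcinkiewicz_const (p A1 A2 : R) : R :=
  4 `^ p * (2 * (ball_mass (R := R) (N := N) + A1 + A2 * (2 ^+ N) ^+ 2) *
            (2 `^ (p - 1) / (1 - (2^-1) `^ (p - 1))) +
            A2 / (1 - ((2^-1) `^ (p - 2))^-1)).

Hypothesis HK : forall j i, bL1 (K j i).
Hypothesis N0 : (0 < N)%N.
Variables (p A1 A2 : R).
Hypotheses (p1 : 1 < p) (p2 : p < 2) (A1_ge0 : 0 <= A1) (A2_ge0 : 0 <= A2).
Hypotheses (HL2 : L2_bounded A2) (Hh : hormander_bounded A1).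

Variable g : I -> V -> R.
Hypotheses (Hg : forall i, bL1 (g i)) (cg : forall i, scont (g i)).
Local Notation F := (vabs (vconv K g)).
Local Notation G := (vabs g).
Let a := 2 * (ball_mass (R := R) (N := N) + A1 + A2 * (2 ^+ N) ^+ 2).

Let weak_type_all (lam : R) : 0 < lam ->
  (nint mu (fun x => (2 * lam < F x)%R%:R)%R <=
   nint mu (fun x => lam^-1 * a * ((lam / 2 < G x)%R%:R * G x) +
                     lam ^- 2 * A2 * ((G x <= lam)%R%:R * G x ^+ 2))%R)%E.
Proof.
move=> lam0; have HG : bL1 G by exact: bL1_vabs.
have G0 x : 0 <= G x by exact: vnorm_ge0.
have [mG _ _] := HG.
pose m := \int[mu]_x G x.
have m0 : 0 <= m by apply: Rintegral_ge0 => x _; exact: vnorm_ge0.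
(* As r0 <= 1 and N >= 1, averages over cells of side 1 / r0 are at most r0^N m <= r0 m <= lam, so
   the stopping time can start at r0. *)
pose r0 := lam / (lam + m).
have lm : 0 < lam + m by rewrite ltr_pwDl.
have r0_gt0 : 0 < r0 by rewrite divr_gt0.
have r0_le1 : r0 <= 1 by rewrite ler_pdivrMr// mul1r lerDl.
have E0 x : avg r0 G x <= lam.
  apply: (@le_trans _ _ (\int[mu]_y (r0 * G y))).
    apply: le_Rintegral => //.
    - by have [] := bL1_avg_integrand x r0_gt0 HG.
    - by have [] := bL1Z r0 HG.
    move=> y _; rewrite ler_wpM2r// /avg_ker.
    apply: (@le_trans _ _ (r0 ^+ N)).
      by rewrite ler_piMr ?exprn_ge0 ?(ltW r0_gt0)// lern1 leq_b1.
    by rewrite -[leRHS]expr1 ler_wiXn2l// ltW.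
  rewrite RintegralZl//; last by case: HG.
  rewrite -/m /r0 mulrAC ler_pdivrMr// ler_wpM2l ?(ltW lam0)//.
  by rewrite lerDr ltW.
have m1 : measurable_fun setT (fun x => (lam / 2 < G x)%R%:R : R).
  by apply: measurable_fun_bool; apply: measurable_fun_ltr => //; exact: measurable_cst.
have m2 : measurable_fun setT (fun x => (G x <= lam)%R%:R : R).
  by apply: measurable_fun_bool; apply: measurable_fun_ler => //; exact: measurable_cst.
have a0 : 0 <= a.
  rewrite mulr_ge0// addr_ge0//; last by rewrite mulr_ge0// exprn_ge0// exprn_ge0.
  by rewrite addr_ge0// fine_ge0// nint_ge0.
have c1 : 0 <= lam^-1 * a by rewrite mulr_ge0// invr_ge0 ltW.
have c2 : 0 <= lam ^- 2 * A2 by rewrite mulr_ge0// invr_ge0 exprn_ge0// ltW.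
apply: le_trans (weak_type HK A1_ge0 A2_ge0 HL2 Hh Hg cg r0_gt0 lam0 E0) _.
rewrite nintD; first last.
- by move=> x; rewrite mulr_ge0// mulr_ge0// sqr_ge0.
- by move=> x; rewrite mulr_ge0// mulr_ge0.
- by msr.
- by msr.
rewrite nintZ//; [|by msr|by move=> x; rewrite mulr_ge0].
by rewrite nintZ//; [msr|move=> x; rewrite mulr_ge0 ?sqr_ge0].
Qed.

(** The dyadic layer cake: the weak type bounds at the levels B 2^-k, each weighted by the p-th
    power of the values that F takes there. *)
Let layers (B : R) n x : R := \sum_(k < n) (4 * (B * 2^-1 ^+ k)) `^ p *
  ((B * 2^-1 ^+ k)^-1 * a * ((B * 2^-1 ^+ k / 2 < G x)%R%:R * G x) +
   (B * 2^-1 ^+ k) ^- 2 * A2 * ((G x <= B * 2^-1 ^+ k)%R%:R * G x ^+ 2)).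

Let a0 : 0 <= a.
Proof.
rewrite mulr_ge0// addr_ge0//; last by rewrite mulr_ge0// exprn_ge0// exprn_ge0.
by rewrite addr_ge0// fine_ge0// nint_ge0.
Qed.

Let layers_le (B : R) n x : 0 < B ->
  layers B n x <= marcinkiewicz_const p A1 A2 * G x `^ p.
Proof.
move=> B0; set y := G x.
have y0 : 0 <= y by exact: vnorm_ge0.
have h20 : 0 < 2^-1 :> R by rewrite invr_gt0.
have h21 : 2^-1 < 1 :> R by rewrite invf_lt1 ?ltr1n.
pose c1 := (2^-1 : R) `^ (p - 1); pose c2 := (2^-1 : R) `^ (p - 2).
have c1_0 : 0 < c1 by rewrite powR_gt0.
have c1_1 : c1 < 1 by apply: powR_lt1; [apply/andP|rewrite subr_gt0].
have c2_1 : 1 < c2.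
  rewrite /c2 -[p - 2]opprB powRN invf_gt1 ?powR_gt0//.
  by apply: powR_lt1; [apply/andP|rewrite subr_gt0].
have c2_0 : 0 < c2 by rewrite powR_gt0.
pose lam k : R := B * 2^-1 ^+ k.
have lam0 k : 0 < lam k by rewrite mulr_gt0// exprn_gt0.
have lam1 k : lam k `^ p = lam k * lam k `^ (p - 1).
  by rewrite mulr_powRB1 ?(ltW (lam0 k))// (lt_trans _ p1).
have lam2 k : lam k `^ p = lam k ^+ 2 * lam k `^ (p - 2).
  rewrite lam1 -[in RHS](mulr1 (lam k ^+ 2)) -mulrA mul1r expr2 -mulrA; congr (_ * _).
  rewrite -[in RHS](powRr1 (ltW (lam0 k))) -powRrM mul1r -powRD ?(gt_eqF (lam0 k)) ?implybT//.
  by congr (_ `^ _); ring.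
have geo1 : \sum_(k < n) (lam k `^ (p - 1) <= (2 * y) `^ (p - 1))%R%:R * lam k `^ (p - 1) <=
    (2 * y) `^ (p - 1) / (1 - c1).
  under eq_bigr do rewrite /lam powR_geometric ?(ltW B0)//.
  by apply: sum_geometric_trunc; rewrite ?powR_ge0// (ltW c1_0) c1_1.
have geo2 : \sum_(k < n) (lam k `^ (p - 2) <= y `^ (p - 2))%R%:R * lam k `^ (p - 2) <=
    y `^ (p - 2) / (1 - c2^-1).
  under eq_bigr do rewrite /lam powR_geometric ?(ltW B0)//.
  by apply: sum_geometric_trunc_up; rewrite ?powR_ge0.
have e1 (L w b : R) : L != 0 -> (L * w) * (L^-1 * a * (b * y)) = a * y * (b * w).
  by move=> L0; field.
have e2 (L w b : R) : L != 0 ->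
    (L ^+ 2 * w) * (L ^- 2 * A2 * (b * y ^+ 2)) = A2 * y ^+ 2 * (b * w).
  by move=> L0; field.
have yp1 : y * y `^ (p - 1) = y `^ p by rewrite mulr_powRB1// (lt_trans _ p1).
apply: (@le_trans _ _ (4 `^ p * (a * y *
   (\sum_(k < n) (lam k `^ (p - 1) <= (2 * y) `^ (p - 1))%R%:R * lam k `^ (p - 1)) +
   A2 * y ^+ 2 * (\sum_(k < n) ((0 < y) && (lam k `^ (p - 2) <= y `^ (p - 2)))%R%:R * lam k `^ (p - 2))))).
  rewrite !mulr_sumr -big_split/= mulr_sumr; apply: ler_sum => k _.
  rewrite -/(lam k) -/y powRM ?(ltW (lam0 k))// -mulrA ler_wpM2l ?powR_ge0// mulrDr.
  apply: lerD.
    rewrite {1}lam1 e1 ?gt_eqF//.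
    apply: ler_wpM2l; first by rewrite mulr_ge0.
    apply: ler_wpM2r; first exact: powR_ge0.
    rewrite ler_nat; case: (boolP (lam k / 2 < y)) => // h.
    rewrite (_ : (_ <= _)%R = true)//; apply: ge0_ler_powR.
    - by rewrite subr_ge0 ltW.
    - by rewrite nnegrE ltW.
    - by rewrite nnegrE mulr_ge0.
    - by move: h; rewrite ltr_pdivrMr// => /ltW; rewrite mulrC.
  have [yz|yn] := eqVneq y 0.
    by rewrite yz expr0n/= !(mulr0, mul0r).
  have y1 : 0 < y by rewrite lt_neqAle eq_sym yn.
  rewrite {1}lam2 y1 /= e2 ?gt_eqF//.
  apply: ler_wpM2l; first by rewrite mulr_ge0 ?sqr_ge0.
  apply: ler_wpM2r; first exact: powR_ge0.
  rewrite ler_nat; case: (boolP (y <= lam k)) => // h.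
  rewrite (_ : (_ <= _)%R = true)// -[p - 2]opprB !powRN lef_pV2 ?posrE ?powR_gt0//.
  by apply: ge0_ler_powR; rewrite ?nnegrE ?subr_ge0 ?(ltW p2) ?(ltW (lam0 k)).
rewrite /marcinkiewicz_const -/a -/c1 -/c2 -[leRHS]mulrA ler_wpM2l ?powR_ge0// [leRHS]mulrDl.
apply: lerD.
  apply: (@le_trans _ _ (a * y * ((2 * y) `^ (p - 1) / (1 - c1)))).
    by apply: ler_wpM2l; [exact: mulr_ge0|exact: geo1].
  rewrite powRM// -yp1 le_eqVlt; apply/orP; left; apply/eqP.
  by set w := a; ring.
have [yz|yn] := eqVneq y 0.
  rewrite yz expr0n/= mulr0 mul0r mulr_ge0 ?powR_ge0// divr_ge0// subr_ge0 invf_le1// ltW//.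
have y1 : 0 < y by rewrite lt_neqAle eq_sym yn.
rewrite y1/=.
apply: (@le_trans _ _ (A2 * y ^+ 2 * (y `^ (p - 2) / (1 - c2^-1)))).
  by apply: ler_wpM2l; [rewrite mulr_ge0 ?sqr_ge0|exact: geo2].
rewrite -yp1 (_ : A2 * y ^+ 2 * _ = A2 * (y * (y * y `^ (p - 2)) / (1 - c2^-1))); last by ring.
rewrite (_ : y * y `^ (p - 2) = y `^ (p - 1)).
  by rewrite le_eqVlt; apply/orP; left; apply/eqP; ring.
rewrite -[X in X * _](powRr1 y0) -powRD ?(gt_eqF y1) ?implybT//.
by congr (_ `^ _); ring.
Qed.

Lemma strong_type_lt2_aux : (nint mu (fun x => F x `^ p)%R <=
   (marcinkiewicz_const p A1 A2)%:E * nint mu (fun x => G x `^ p)%R)%E.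
Proof.
have HG : bL1 G by exact: bL1_vabs.
have HF : bL1 F by apply: bL1_vabs => j; exact: bL1_vconv.
have [mG _ _] := HG; have [mF _ _] := HF.
have F0 x : 0 <= F x by exact: vnorm_ge0.
have G0 x : 0 <= G x by exact: vnorm_ge0.
have [B [B0 FB]] := bL1_bound HF.
have p0 : 0 < p by rewrite (lt_trans _ p1).
pose lam k : R := B * 2^-1 ^+ k.
have lam0 k : 0 < lam k by rewrite mulr_gt0// exprn_gt0// invr_gt0.
have mFl c : measurable_fun setT (fun x => (c < F x)%R%:R : R).
  by apply: measurable_fun_bool; apply: measurable_fun_ltr => //; exact: measurable_cst.
have mGl c : measurable_fun setT (fun x => (c < G x)%R%:R : R).
  by apply: measurable_fun_bool; apply: measurable_fun_ltr => //; exact: measurable_cst.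
have mGe c : measurable_fun setT (fun x => (G x <= c)%R%:R : R).
  by apply: measurable_fun_bool; apply: measurable_fun_ler => //; exact: measurable_cst.
have mLay n : measurable_fun setT (layers B n).
  apply: measurable_fun_bigsum => k; have := mGl (B * 2^-1 ^+ k / 2) => m1.
  by have := mGe (B * 2^-1 ^+ k) => m2; msr.
have lay0 k x : 0 <= (B * 2^-1 ^+ k)^-1 * a * ((B * 2^-1 ^+ k / 2 < G x)%R%:R * G x) +
   (B * 2^-1 ^+ k) ^- 2 * A2 * ((G x <= B * 2^-1 ^+ k)%R%:R * G x ^+ 2).
  have hl := lam0 k; rewrite /lam in hl.
  apply: addr_ge0.
    apply: mulr_ge0; last exact: mulr_ge0.
    by apply: mulr_ge0; [rewrite invr_ge0 ltW|exact: a0].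
  apply: mulr_ge0; last by apply: mulr_ge0 => //; exact: sqr_ge0.
  by apply: mulr_ge0 => //; rewrite invr_ge0 exprn_ge0// ltW.
(* Fatou's lemma restricts F to the set where it exceeds 2 lam n; on that set the levels 0, ..., n
   suffice. *)
apply: (@nint_le_lim _ _ _ _ (fun n x => F x `^ p * (2 * lam n < F x)%R%:R)).
- by move=> n; have := mFl (2 * lam n) => m1; msr.
- by move=> n x; rewrite mulr_ge0 ?powR_ge0.
- move=> x; apply: cvg_near_cst.
  have := F0 x; rewrite le_eqVlt => /predU1P[<-|Fx].
    by apply: nearW => n; rewrite powR0 ?mul0r// gt_eqF.
  have : (fun n => 2 * lam n) @ \oo --> (0 : R).
    rewrite (_ : (fun n => _) = (fun n => (2 * B) * 2^-1 ^+ n)); last first.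
      by apply/funext => n; rewrite mulrA.
    rewrite -[X in _ --> X](mulr0 (2 * B)); apply: cvgM; first exact: cvg_cst.
    by apply: cvg_expr; rewrite ger0_norm ?invr_ge0// invf_lt1 ?ltr1n.
  move/(cvgr_lt 0)/(_ _ Fx); apply: filterS => n ->; by rewrite mulr1.
apply: nearW => n.
apply: (@le_trans _ _ (nint mu (layers B n.+1))); last first.
  have C0 x : 0 <= marcinkiewicz_const p A1 A2 * G x `^ p.
    by apply: le_trans (layers_le n.+1 x B0); apply: sumr_ge0 => k _; rewrite mulr_ge0 ?powR_ge0.
  have M0 : 0 <= marcinkiewicz_const p A1 A2.
    rewrite mulr_ge0 ?powR_ge0// addr_ge0//.
      rewrite mulr_ge0// divr_ge0 ?powR_ge0// subr_ge0 ltW//.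
      by apply: powR_lt1; rewrite ?subr_gt0// invr_gt0 ltr0n invf_lt1 ?ltr1n.
    rewrite divr_ge0// subr_ge0 -powRN opprB ltW//.
    by apply: powR_lt1; rewrite ?subr_gt0// invr_gt0 ltr0n invf_lt1 ?ltr1n.
  rewrite -nintZ//; [|by msr|by move=> x; exact: powR_ge0].
  apply: le_nint => //; [by msr| |by move=> x; exact: layers_le].
  by move=> x; apply: sumr_ge0 => k _; rewrite mulr_ge0 ?powR_ge0.
apply: (@le_trans _ _ (nint mu (fun x => \sum_(k < n.+1) (4 * lam k) `^ p * (2 * lam k < F x)%R%:R))).
  apply: le_nint.
  - by have := mFl (2 * lam n) => m1; msr.
  - by apply: measurable_fun_bigsum => k; have := mFl (2 * lam k) => m1; msr.
  - by move=> x; rewrite mulr_ge0 ?powR_ge0.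
  move=> x; case: (boolP (2 * lam n < F x)) => [h|_]; last first.
    by rewrite mulr0; apply: sumr_ge0 => k _; rewrite mulr_ge0 ?powR_ge0.
  rewrite mulr1; have hex : exists k, 2 * lam k < F x by exists n.
  (* The least k with 2 lam k < F x satisfies F x <= 4 lam k: by minimality at k - 1 if k > 0, and
     because F <= B if k = 0. *)
  case: (ex_minnP hex) => k hk kmin.
  have kn : (k < n.+1)%N by rewrite ltnS kmin.
  rewrite (bigD1 (Ordinal kn))//= hk mulr1.
  apply: (@le_trans _ _ ((4 * lam k) `^ p)); last first.
    by rewrite lerDl; apply: sumr_ge0 => l _; rewrite mulr_ge0 ?powR_ge0.
  apply: ge0_ler_powR; rewrite ?nnegrE ?(ltW p0)//; first by rewrite mulr_ge0 ?(ltW (lam0 k)).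
  case: k hk kmin {kn} => [|k] hk kmin.
    rewrite /lam expr0 mulr1; have := FB x; rewrite ger0_norm// => h'.
    by apply: (le_trans h'); rewrite ler_peMl ?(ltW B0)// ler1n.
  have -> : 4 * lam k.+1 = 2 * lam k by rewrite /lam exprS; field.
  by rewrite leNgt; apply/negP => /kmin; rewrite ltnn.
rewrite nint_sum; first last.
- by move=> k x; rewrite mulr_ge0 ?powR_ge0.
- by move=> k; have := mFl (2 * lam k) => m1; msr.
rewrite nint_sum; first last.
- by move=> k x; rewrite mulr_ge0 ?powR_ge0.
- move=> k; have := mGl (B * 2^-1 ^+ k / 2) => m1.
  by have := mGe (B * 2^-1 ^+ k) => m2; msr.
apply: lee_sum => k _; rewrite !nintZ ?powR_ge0//.
- by apply: lee_wpmul2l; [rewrite lee_fin powR_ge0|exact: weak_type_all].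
- have := mGl (B * 2^-1 ^+ k / 2) => m1.
  by have := mGe (B * 2^-1 ^+ k) => m2; msr.
Qed.

End strong_type.

Lemma absorb_half (R : realType) (X v w : R) : X <= v + w -> w <= X / 2 -> X <= 2 * v.
Proof. lra. Qed.

(** * Duality *)

Section duality.
Context {R : realType} {N : nat}.
Local Notation V := 'rV[R]_N.
Local Notation mu := (lebesgue_rV R N).

Lemma le_Rintegral_bL1 (f g : V -> R) : bL1 f -> bL1 g -> (forall x, f x <= g x) ->
  \int[mu]_x f x <= \int[mu]_x g x.
Proof. by move=> [_ _ If] [_ _ Ig] fg; apply: le_Rintegral. Qed.

Lemma nint_bL1 (f : V -> R) : bL1 f -> (forall x, 0 <= f x) ->
  nint mu f = (\int[mu]_x f x)%:E.
Proof. by move=> [_ _ If] f0; rewrite nint_Rintegral. Qed.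

Lemma bL1_sqr (f : V -> R) : bL1 f -> bL1 (fun x => f x ^+ 2).
Proof. by move=> Hf; have [m [M h] _] := Hf; under eq_fun do rewrite expr2; exact: bL1M Hf m h. Qed.

Lemma bL1_mul (f g : V -> R) : bL1 f -> bL1 g -> bL1 (fun x => f x * g x).
Proof. by move=> Hf Hg; have [m [M h] _] := Hf; exact: bL1M Hg m h. Qed.

Lemma bL1_powR (f : V -> R) p : 1 <= p -> bL1 f -> (forall x, 0 <= f x) ->
  bL1 (fun x => f x `^ p).
Proof.
move=> p1 Hf f0; have [m _ _] := Hf; have [M [M0 h]] := bL1_bound Hf.
have p0 : 0 < p by rewrite (lt_le_trans _ p1).
rewrite (_ : (fun x => _) = (fun x => f x `^ (p - 1) * f x)); last first.
  by apply/funext => x; rewrite mulrC mulr_powRB1.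
apply: (bL1M (M := M `^ (p - 1)) Hf); first by msr.
move=> x; rewrite ger0_norm ?powR_ge0//; apply: ge0_ler_powR.
- by rewrite subr_ge0.
- by rewrite nnegrE.
- by rewrite nnegrE ltW.
- by rewrite (le_trans _ (h x))// ler_norm.
Qed.

Variables (I J : finType) (K : J -> I -> V -> R).
Hypothesis HK : forall j i, bL1 (K j i).

Definition transpose_kernel (i : I) (j : J) : V -> R := flip (K j i).

Let HKT i j : bL1 (transpose_kernel i j). Proof. exact: bL1_flip. Qed.

Lemma vconv_adjoint (g : I -> V -> R) (h : J -> V -> R) :
  (forall i, bL1 (g i)) -> (forall j, bL1 (h j)) ->
  \int[mu]_x (\sum_j vconv K g j x * h j x) =
  \int[mu]_x (\sum_i g i x * vconv transpose_kernel h i x).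
Proof.
move=> Hg Hh.
rewrite Rintegral_sum; last first.
  by move=> j; have [] := bL1_mul (bL1_vconv HK j Hg) (Hh j).
rewrite Rintegral_sum; last first.
  by move=> i; have [] := bL1_mul (Hg i) (bL1_vconv HKT i Hh).
transitivity (\sum_j \sum_i \int[mu]_x (conv (K j i) (g i) x * h j x)).
  apply: eq_bigr => j _; rewrite -Rintegral_sum; last first.
    by move=> i; have [] := bL1_mul (bL1_conv (HK j i) (Hg i)) (Hh j).
  by apply: eq_Rintegral => x _; rewrite mulr_suml.
rewrite exchange_big; apply: eq_bigr => i _.
transitivity (\sum_j \int[mu]_x (g i x * conv (flip (K j i)) (h j) x)).
  by apply: eq_bigr => j _; exact: conv_adjoint.
rewrite -Rintegral_sum; last first.
  by move=> j; have [] := bL1_mul (Hg i) (bL1_conv (bL1_flip (HK j i)) (Hh j)).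
by apply: eq_Rintegral => x _; rewrite mulr_sumr.
Qed.

(** The square norm X of K g is the pairing of g with the transpose applied to K g. Young's
    inequality with weight A and the bound for the transpose give back at most X / 2, which is
    absorbed because X is a real number. *)
Lemma L2_bounded_dual A : 0 < A -> L2_bounded transpose_kernel A -> L2_bounded K A.
Proof.
move=> A0 HT g Hg.
have HF j := bL1_vconv HK j Hg.
have HTF i := bL1_vconv HKT i HF.
have B1 : bL1 (fun x => \sum_j vconv K g j x ^+ 2) by apply: bL1_sum => j; exact: bL1_sqr.
have B2 : bL1 (fun x => \sum_i g i x ^+ 2) by apply: bL1_sum => i; exact: bL1_sqr.
have B3 : bL1 (fun x => \sum_i vconv transpose_kernel (vconv K g) i x ^+ 2).
  by apply: bL1_sum => i; exact: bL1_sqr.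
have := HT _ HF; rewrite !nint_bL1//; try by move=> x; exact: sumsq_ge0.
rewrite -!EFinM !lee_fin.
set X := (X in _ <= _ * X -> _); set Z := (X in X <= _ -> _) => hZ.
set Y := (X in _ <= _ * X).
have hX : X <= A / 2 * Y + (2 * A)^-1 * Z.
  have -> : X = \int[mu]_x (\sum_j vconv K g j x * vconv K g j x).
    by apply: eq_Rintegral => x _; apply: eq_bigr => j _; rewrite expr2.
  rewrite vconv_adjoint// /Y /Z -RintegralZl//; last by case: B2.
  rewrite -[(2 * A)^-1 * _]RintegralZl//; last by case: B3.
  rewrite -RintegralD//; [|by case: (bL1Z (A / 2) B2)|by case: (bL1Z (2 * A)^-1 B3)].
  apply: le_Rintegral_bL1.
  - by apply: bL1_sum => i; exact: bL1_mul.
  - by apply: bL1D; exact: bL1Z.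
  move=> x; rewrite !mulr_sumr -big_split/=; apply: ler_sum => i _.
  set u := g i x; set w := vconv _ _ _ _.
  have : 0 <= (A * u - w) ^+ 2 / (2 * A) by rewrite divr_ge0 ?sqr_ge0// mulr_ge0// ltW.
  rewrite (_ : _ / _ = A / 2 * u ^+ 2 + (2 * A)^-1 * w ^+ 2 - u * w) ?subr_ge0//.
  by field; rewrite gt_eqF.
have hZ' : (2 * A)^-1 * Z <= X / 2.
  apply: (@le_trans _ _ ((2 * A)^-1 * (A * X))).
    by rewrite ler_wpM2l// invr_ge0 mulr_ge0// ltW.
  by rewrite le_eqVlt; apply/orP; left; apply/eqP; field; rewrite gt_eqF.
rewrite (_ : A * Y = 2 * (A / 2 * Y)); last by field.
exact: (absorb_half hX hZ').
Qed.

(** Twice the coefficient of the first term in a b <= (a / e)^p / p + (e b)^q / q, where q = p / (p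
    - 1) and e is chosen so that C e^q / q = 1/2. *)
Definition dual_const (p C : R) : R :=
  2 * (((p / (p - 1) / (2 * C)) `^ ((p - 1) / p)) `^ p)^-1 / p.

Lemma vnormZ (c : R) (T : finType) (b : T -> R) : 0 <= c ->
  vnorm (fun i => c * b i) = c * vnorm b.
Proof.
move=> c0; rewrite /vnorm; under eq_bigr do rewrite exprMn.
by rewrite -mulr_sumr sqrtrM ?sqr_ge0// sqrtr_sqr ger0_norm.
Qed.

(** The test family h = |K g|^(p-2) K g is extremal: |h|^q = |K g|^p. The exponent p - 2 is
    positive, so h is bounded and continuous even where K g vanishes, as the bound for the transpose
    requires. *)
Lemma Lp_bounded_dual p C : 2 < p -> 0 < C ->
  Lp_bounded transpose_kernel (p / (p - 1)) C -> Lp_bounded K p (dual_const p C).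
Proof.
move=> p2 C0 HT g Hg cg; set q := p / (p - 1) in HT *.
have p1 : 1 < p by lra.
have p0 : 0 < p by lra.
have pm : 0 < p - 1 by rewrite subr_gt0.
have p21 : p - 2 = (p - 1) - 1 by ring.
have q1 : 1 <= q by rewrite /q ler_pdivlMr// mul1r lerBlDr lerDl.
have q0 : 0 < q by rewrite (lt_le_trans _ q1).
have pq : p^-1 + q^-1 = 1 by rewrite /q invf_div; field; rewrite gt_eqF.
have HF j := bL1_vconv HK j Hg.
have cF j : scont (vconv K g j).
  apply: scont_sum => i; rewrite convC//; have [mg hg _] := Hg i; have [_ _ IK] := HK j i.
  exact: scont_conv.
pose F := vabs (vconv K g).
have F0 x : 0 <= F x by exact: vnorm_ge0.
have BF : bL1 F by exact: bL1_vabs.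
have sF : scont F by exact: scont_vabs.
have cFp : scont (fun x => F x `^ (p - 2)) by apply: scont_powR; rewrite ?subr_gt0.
have vF x : vnorm (fun j => vconv K g j x) = F x by [].
pose h j x := F x `^ (p - 2) * vconv K g j x.
have [MF [MF0 hMF]] := bL1_bound BF.
have mF : measurable_fun setT F by case: BF.
have Hh j : bL1 (h j).
  apply: (bL1M (M := MF `^ (p - 2)) (HF j)); first by msr.
  move=> x; rewrite ger0_norm ?powR_ge0//; apply: ge0_ler_powR.
  - by rewrite subr_ge0 ltW.
  - by rewrite nnegrE.
  - by rewrite nnegrE ltW.
  - by rewrite (le_trans _ (hMF x))// ler_norm.
have ch j : scont (h j) by exact: scontM.
have HTh i := bL1_vconv HKT i Hh.
have habs x : vabs h x = F x `^ (p - 1).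
  rewrite /vabs /h vnormZ ?powR_ge0// vF mulrC.
  by rewrite p21 mulr_powRB1.
have hq x : vabs h x `^ q = F x `^ p.
  by rewrite habs -powRrM /q mulrC divfK// gt_eqF.
have BX : bL1 (fun x => F x `^ p) by apply: bL1_powR => //; exact: ltW.
have G0 x : 0 <= vabs g x by exact: vnorm_ge0.
have BG : bL1 (vabs g) by exact: bL1_vabs.
have BY : bL1 (fun x => vabs g x `^ p) by apply: bL1_powR => //; exact: ltW.
pose H := vabs (vconv transpose_kernel h).
have H0 x : 0 <= H x by exact: vnorm_ge0.
have BH : bL1 H by exact: bL1_vabs.
have BZ : bL1 (fun x => H x `^ q) by exact: bL1_powR.
have fin f : bL1 f -> (forall x, 0 <= f x) ->
    exists X, nint mu f = X%:E /\ X = \int[mu]_x f x.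
  by move=> Bf f0; exists (\int[mu]_x f x); rewrite nint_bL1.
have [X [EX XE]] := fin _ BX (fun x => powR_ge0 _ _).
have [Y [EY YE]] := fin _ BY (fun x => powR_ge0 _ _).
have [Z [EZ ZE]] := fin _ BZ (fun x => powR_ge0 _ _).
have hZ : Z <= C * X.
  have Ehq : nint mu (fun x => vabs h x `^ q) = nint mu (fun x => F x `^ p).
    by apply: eq_integral => x _; rewrite hq.
  by have := HT _ Hh ch; rewrite Ehq EX EZ -EFinM lee_fin.
suff : X <= dual_const p C * Y.
  by move=> hXY; move: EX EY; rewrite /F => -> ->; rewrite -EFinM lee_fin.
pose e := (q / (2 * C)) `^ ((p - 1) / p).
have e0 : 0 < e by rewrite powR_gt0// divr_gt0// mulr_gt0.
have eq' : e `^ q = q / (2 * C).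
  rewrite /e -powRrM (_ : _ * q = 1) ?powRr1//; first by rewrite ltW// divr_gt0// mulr_gt0.
  by rewrite /q; field; rewrite !gt_eqF.
have hX : X <= (e `^ p)^-1 / p * Y + e `^ q / q * Z.
  have -> : X = \int[mu]_x (\sum_j vconv K g j x * h j x).
    rewrite XE; apply: eq_Rintegral => x _; rewrite /h; under eq_bigr do rewrite mulrCA -expr2.
    rewrite -mulr_sumr -(sqr_vnorm (fun j => vconv K g j x)) vF.
    by rewrite expr2 p21 mulrC -mulrA mulr_powRB1// mulr_powRB1.
  have [_ _ IY] := BY; have [_ _ IZ] := BZ.
  rewrite (vconv_adjoint Hg Hh) YE ZE -(RintegralZl ((e `^ p)^-1 / p) measurableT IY).
  rewrite -(RintegralZl (e `^ q / q) measurableT IZ).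
  rewrite -RintegralD//; [|by case: (bL1Z ((e `^ p)^-1 / p) BY)|by case: (bL1Z (e `^ q / q) BZ)].
  apply: le_Rintegral_bL1.
  - by apply: bL1_sum => i; exact: bL1_mul.
  - by apply: bL1D; exact: bL1Z.
  move=> x; apply: le_trans (cauchy_schwarz _ _) _.
  rewrite -/(vabs g x) -/(H x).
  have := @conjugate_powR R (e^-1 * vabs g x) (e * H x) p q.
  rewrite !mulr_ge0 ?invr_ge0 ?(ltW e0)// => /(_ isT isT p0 q0 pq).
  rewrite !powRM ?invr_ge0 ?(ltW e0)//.
  rewrite (_ : e^-1 * _ * _ = vabs g x * H x); last by field; rewrite gt_eqF.
  have E1 : e^-1 `^ p = (e `^ p)^-1.
    by rewrite -[in LHS](powR_inv1 (ltW e0)) -powRrM mulN1r powRN.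
  rewrite E1; move: (vabs g x `^ p) (H x `^ q) (vabs g x * H x) (e `^ p) (e `^ q).
  move=> a1 a2 a3 a4 a5 h1; rewrite (_ : a4^-1 / p * a1 + a5 / q * a2 = a4^-1 * a1 / p + a5 * a2 / q)//.
  by ring.
have hZ' : e `^ q / q * Z <= X / 2.
  apply: (@le_trans _ _ (e `^ q / q * (C * X))).
    by rewrite ler_wpM2l// divr_ge0 ?powR_ge0// ltW.
  rewrite eq' le_eqVlt; apply/orP; left; apply/eqP; field.
  by rewrite !gt_eqF.
rewrite /dual_const -/q -/e.
have -> : 2 * (e `^ p)^-1 / p * Y = 2 * ((e `^ p)^-1 / p * Y) by ring.
exact: (absorb_half hX hZ').
Qed.

End duality.

Lemma amgm_half (R : realFieldType) (W a b : R) : 0 <= W ->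
  `|a| * (W * `|b|) <= 2^-1 * (W * a ^+ 2) + 2^-1 * (W * b ^+ 2).
Proof.
move=> W0; rewrite -[a ^+ 2]real_normK ?num_real// -[b ^+ 2]real_normK ?num_real//.
rewrite -subr_ge0 (_ : _ - _ = 2^-1 * (W * (`|a| - `|b|) ^+ 2)); last by field.
by rewrite mulr_ge0 ?invr_ge0// mulr_ge0 ?sqr_ge0.
Qed.

(** * Square functions *)

Section littlewood_paley_kernels.
Context {R : realType} {N : nat}.
Local Notation V := 'rV[R]_N.
Local Notation mu := (lebesgue_rV R N).
Implicit Types (psi u v g h : V -> R) (x y z : V).

(** L^1 conditions on mass, first moment and modulus of continuity, together with mean zero. They
    are invariant under reflection and scale exactly under [dil]; almost orthogonality and
    Hormander's condition follow with constants in A alone. *)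
Definition lp_kernel (A : R) psi := [/\ bL1 psi,
  (nint mu (fun x => `|psi x|)%R <= A%:E)%E,
  (nint mu (fun x => l1norm x * `|psi x|)%R <= A%:E)%E,
  (forall z, nint mu (fun x => `|psi (x - z) - psi x|)%R <= (A * l1norm z)%:E)%E &
  \int[mu]_x psi x = 0].

Lemma nint_flip u : measurable_fun setT u -> (forall x, 0 <= u x) ->
  nint mu (fun x => u (- x)) = nint mu u.
Proof.
move=> mu' u0; rewrite -[RHS](nint_reflect 0)//.
by under [in RHS]eq_fun do rewrite sub0r.
Qed.

Lemma lp_kernel_flip A psi : lp_kernel A psi -> lp_kernel A (flip psi).
Proof.
move=> [Hp h1 h2 h3 h4]; have [mp _ Ip] := Hp.
have ml := measurable_l1norm (R := R) (N := N).
split; first exact: bL1_flip.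
- by rewrite (nint_flip (u := fun x => `|psi x|))//; msr.
- apply: le_trans h2; rewrite -(nint_flip (u := fun x => l1norm x * `|psi x|))/=.
  + rewrite le_eqVlt; apply/orP; left; apply/eqP; apply: eq_integral => x _.
    by rewrite /= l1normN.
  + by msr.
  + by move=> x; rewrite mulr_ge0 ?l1norm_ge0.
- move=> z; rewrite -l1normN; apply: le_trans (h3 (- z)).
  rewrite -(nint_flip (u := fun x => `|psi (x - - z) - psi x|))//.
    rewrite le_eqVlt; apply/orP; left; apply/eqP; apply: eq_integral => x _.
    by rewrite /flip /= opprB opprK [z - x]addrC.
  by msr.
have := Rintegral_reflect 0 Ip; rewrite h4 => <-.
by apply: eq_Rintegral => x _; rewrite /flip sub0r.
Qed.

Lemma nint_l1norm_dil r psi : 0 < r -> measurable_fun setT psi ->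
  nint mu (fun x => l1norm x * `|dil r psi x|) =
  ((r^-1)%:E * nint mu (fun x => l1norm x * `|psi x|)%R)%E.
Proof.
move=> r0 mp; have ml := measurable_l1norm (R := R) (N := N).
have mf : measurable_fun setT (fun x => l1norm x * `|psi x|) by msr.
rewrite -(nint_dil r0 mf); last by move=> x; rewrite mulr_ge0 ?l1norm_ge0.
rewrite -nintZ ?invr_ge0 ?(ltW r0)//.
- congr nint; apply/funext => x; rewrite /dil normrM l1normZ (gtr0_norm r0).
  rewrite (ger0_norm (exprn_ge0 N (ltW r0))).
  move: (r ^+ N) => a; rewrite mulrCA [RHS]mulrCA; congr (_ * _).
  by rewrite !mulrA mulVf ?mul1r// gt_eqF.
- exact: measurable_dil.
- by move=> x; rewrite mulr_ge0 ?exprn_ge0 ?(ltW r0)// mulr_ge0 ?l1norm_ge0.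
Qed.

Lemma nint_shift_dil r psi z : 0 < r -> measurable_fun setT psi ->
  nint mu (fun x => `|dil r psi (x - z) - dil r psi x|) =
  nint mu (fun x => `|psi (x - r *: z) - psi x|).
Proof.
move=> r0 mp; have mf : measurable_fun setT (fun x => `|psi (x - r *: z) - psi x|) by msr.
rewrite -(nint_dil r0 mf)//; congr nint; apply/funext => x.
rewrite /dil scalerBr -mulrBr normrM ger0_norm// exprn_ge0// ltW//.
Qed.

(* Cancellation of [u] against the smoothness of [v]. *)
Lemma nint_conv_cancel u v a b : 0 <= b -> bL1 u -> bL1 v -> \int[mu]_x u x = 0 ->
  (nint mu (fun x => l1norm x * `|u x|)%R <= a%:E)%E ->
  (forall z, nint mu (fun x => `|v (x - z) - v x|)%R <= (b * l1norm z)%:E)%E ->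
  (nint mu (fun x => `|conv u v x|)%R <= (a * b)%:E)%E.
Proof.
move=> b0 Hu Hv u0 ha hb; have [mu' _ Iu] := Hu; have [mv _ _] := Hv.
have ml := measurable_l1norm (R := R) (N := N).
have E x : conv u v x = \int[mu]_y (u y * (v (x - y) - v x)).
  rewrite convC// /conv; under [in RHS]eq_Rintegral do rewrite mulrBr.
  rewrite RintegralB//; last 2 first.
  - have [_ _] := bL1_conv_integrand x Hv Hu.
    by apply: eq_integrable => // y _ /=; rewrite mulrC.
  - have [_ _] := bL1Z (v x) Hu.
    by apply: eq_integrable => // y _ /=; rewrite mulrC.
  rewrite RintegralZr// u0 mul0r subr0.
  by apply: eq_Rintegral => y _; rewrite mulrC.
apply: (@le_trans _ _ (\int[mu]_x nint mu (fun y => `|u y| * `|v (x - y) - v x|)%R)%E).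
  apply: ge0_le_integral => //.
  - by apply/measurable_EFinP; apply: measurable_fun_normr; exact: measurable_conv.
  - by apply: (@measurable_nint _ _ _ V V mu (fun x y => `|u y| * `|v (x - y) - v x|)) => //; msr.
  move=> x _; rewrite E; apply: le_trans (abs_Rintegral_le _ _) _; first by msr.
  by under eq_fun do rewrite normrM.
rewrite (tonelli mu mu (F := fun x y => `|u y| * `|v (x - y) - v x|))//; last by msr.
apply: (@le_trans _ _ (nint mu (fun y => b * (l1norm y * `|u y|)))%R).
  apply: ge0_le_integral => //.
  - by move=> y _; apply: nint_ge0.
  - by apply: (@measurable_nint _ _ _ V V mu (fun y x => `|u y| * `|v (x - y) - v x|)) => //; msr.
  - by apply/measurable_EFinP; msr.
  move=> y _; rewrite nintZ//; last by msr.
  rewrite mulrA [_ * `|u y|]mulrC EFinM; apply: lee_wpmul2l; first by rewrite lee_fin.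
  exact: hb.
rewrite nintZ//; first last.
- by move=> y; rewrite mulr_ge0 ?l1norm_ge0.
- by msr.
by rewrite mulrC EFinM; apply: lee_wpmul2l; rewrite ?lee_fin.
Qed.

(** Schur's test: |g h| is split as (g^2 + h^2) / 2 under the double integral with weight |w (x -
    y)|, and either variable integrates the weight to at most c. *)
Lemma pairing_bound w g h c : bL1 w -> bL1 g -> bL1 h -> 0 <= c ->
  (nint mu (fun x => `|w x|)%R <= c%:E)%E ->
  `|\int[mu]_x (g x * conv w h x)| <=
    c / 2 * (\int[mu]_x (g x ^+ 2) + \int[mu]_x (h x ^+ 2)).
Proof.
move=> Hw Hg Hh c0 hc; have [mw _ _] := Hw; have [mg _ _] := Hg; have [mh _ _] := Hh.
apply: Rintegral_le_bound.
  by apply: measurable_funM => //; exact: measurable_conv.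
have G2 : nint mu (fun x => g x ^+ 2) = (\int[mu]_x (g x ^+ 2))%:E.
  by apply: nint_bL1; [exact: bL1_sqr|move=> x; exact: sqr_ge0].
have H2 : nint mu (fun x => h x ^+ 2) = (\int[mu]_x (h x ^+ 2))%:E.
  by apply: nint_bL1; [exact: bL1_sqr|move=> x; exact: sqr_ge0].
have half0 : 0 <= 2^-1 :> R by rewrite invr_ge0.
pose A x y := `|w (x - y)| * g x ^+ 2; pose B x y := `|w (x - y)| * h y ^+ 2.
have A0 x y : 0 <= A x y by rewrite mulr_ge0 ?sqr_ge0.
have B0 x y : 0 <= B x y by rewrite mulr_ge0 ?sqr_ge0.
have mA : measurable_fun setT (fun p : V * V => A p.1 p.2) by rewrite /A; msr.
have mB : measurable_fun setT (fun p : V * V => B p.1 p.2) by rewrite /B; msr.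
have mAx x : measurable_fun setT (A x) by rewrite /A; msr.
have mBx x : measurable_fun setT (B x) by rewrite /B; msr.
have EB : (\int[mu]_x nint mu (B x) = nint mu (fun x => `|w x|)%R * nint mu (fun x => h x ^+ 2)%R)%E.
  rewrite -nint_conv_integrand//; try by msr.
  by move=> x; exact: sqr_ge0.
have EA : (\int[mu]_x nint mu (A x) = nint mu (fun x => `|w x|)%R * nint mu (fun x => g x ^+ 2)%R)%E.
  rewrite /nint -ge0_integralZl//; first last.
  - exact: nint_ge0.
  - by move=> x _; rewrite lee_fin sqr_ge0.
  - by apply/measurable_EFinP; msr.
  apply: eq_integral => x _; rewrite -[LHS]/(nint mu (A x)) /A.
  under eq_fun do rewrite mulrC.
  rewrite nintZ ?sqr_ge0//; last by msr.
  by rewrite (@nint_reflect _ _ x (fun y => `|w y|))//; [rewrite muleC|msr].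
apply: (@le_trans _ _ (\int[mu]_x ((2^-1)%:E * nint mu (A x) + (2^-1)%:E * nint mu (B x)))%E).
  apply: ge0_le_integral => //.
  - by apply/measurable_EFinP; apply: measurable_fun_normr; apply: measurable_funM => //;
      exact: measurable_conv.
  - by apply: emeasurable_funD; apply: emeasurable_funM; (try exact: measurable_cst);
      exact: measurable_nint.
  move=> x _; rewrite normrM EFinM.
  apply: (@le_trans _ _ (`|g x|%:E * nint mu (fun y => `|w (x - y)| * `|h y|)%R)%E).
    by apply: lee_wpmul2l; rewrite ?lee_fin//; exact: abs_conv_le.
  have m1 := mAx x; have m2 := mBx x.
  rewrite -!nintZ//; last by msr.
  rewrite -nintD//; try by msr.
  - apply: le_nint; try by msr.
      by move=> y; rewrite !mulr_ge0.
    by move=> y; exact: amgm_half.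
  - by move=> y; rewrite mulr_ge0.
  - by move=> y; rewrite mulr_ge0.
rewrite ge0_integralD//; first last.
- by apply: emeasurable_funM; [exact: measurable_cst|exact: measurable_nint].
- by move=> x _; rewrite mule_ge0 ?lee_fin// nint_ge0.
- by apply: emeasurable_funM; [exact: measurable_cst|exact: measurable_nint].
- by move=> x _; rewrite mule_ge0 ?lee_fin// nint_ge0.
rewrite !ge0_integralZl//; first last.
- by move=> x _; exact: nint_ge0.
- exact: measurable_nint.
- by move=> x _; exact: nint_ge0.
- exact: measurable_nint.
rewrite EA EB G2 H2.
have Y1 : 0 <= \int[mu]_x (g x ^+ 2) by apply: Rintegral_ge0 => x _; exact: sqr_ge0.
have Y2 : 0 <= \int[mu]_x (h x ^+ 2) by apply: Rintegral_ge0 => x _; exact: sqr_ge0.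
apply: (@le_trans _ _ ((2^-1)%:E * (c%:E * (\int[mu]_x (g x ^+ 2))%R%:E) +
   (2^-1)%:E * (c%:E * (\int[mu]_x (h x ^+ 2))%R%:E))%E).
  by apply: leeD; apply: lee_wpmul2l; rewrite ?lee_fin//; apply: lee_wpmul2r; rewrite ?lee_fin.
rewrite -!EFinM -EFinD lee_fin le_eqVlt; apply/orP; left; apply/eqP.
by move: (\int[mu]_x _) (\int[mu]_x _) => X Y; field.
Qed.

Definition scaled (a : R) n (psi : 'I_n -> V -> R) (i : 'I_n) : V -> R := dil (a * 2 ^+ i) (psi i).
(** A row and, next, a column of kernels: synthesis sends a family to one function, analysis one
    function to a family. The singleton ['I_1] brings both under the theory of matrix kernels. *)
Definition synthesis_kernel (a : R) n (psi : 'I_n -> V -> R) (j : 'I_1) (i : 'I_n) : V -> R := scaled a psi i.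
Definition analysis_kernel (a : R) n (psi : 'I_n -> V -> R) (i : 'I_n) (j : 'I_1) : V -> R := scaled a psi i.

Section scaled_families.
Variables (A a : R) (n : nat) (psi : 'I_n -> V -> R).
Hypotheses (A0 : 0 < A) (a0 : 0 < a) (Hpsi : forall i, lp_kernel A (psi i)).

Let r (i : 'I_n) : R := a * 2 ^+ i.
Let r0 i : 0 < r i. Proof. by rewrite mulr_gt0// exprn_gt0. Qed.

Lemma bL1_scaled i : bL1 (scaled a psi i).
Proof. by apply: bL1_dil; [exact: r0|by have [] := Hpsi i]. Qed.

Lemma scaled_flip i : flip (scaled a psi i) = scaled a (fun i => flip (psi i)) i.
Proof. by apply/funext => x; rewrite /flip /scaled /dil /flip scalerN. Qed.

Let moment i : (nint mu (fun x => l1norm x * `|scaled a psi i x|)%R <= (A / r i)%:E)%E.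
Proof.
have [[mp _ _] _ h _ _] := Hpsi i.
rewrite /scaled nint_l1norm_dil ?r0// [A / r i]mulrC EFinM; apply: lee_wpmul2l => //.
by rewrite lee_fin invr_ge0 ltW// r0.
Qed.

Let modulus i z : (nint mu (fun x => `|scaled a psi i (x - z) - scaled a psi i x|)%R <=
  ((A * r i) * l1norm z)%:E)%E.
Proof.
have [[mp _ _] _ _ h _] := Hpsi i.
rewrite /scaled nint_shift_dil ?r0//; apply: le_trans (h _) _.
by rewrite l1normZ gtr0_norm ?r0// mulrA.
Qed.

Let mean i : \int[mu]_x scaled a psi i x = 0.
Proof. by have [[_ _ Ip] _ _ _ h] := Hpsi i; rewrite Rintegral_dil ?r0. Qed.

Let flip_moment i : (nint mu (fun x => l1norm x * `|flip (scaled a psi i) x|)%R <= (A / r i)%:E)%E.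
Proof.
have ml := measurable_l1norm (R := R) (N := N); have [mp _ _] := bL1_scaled i.
apply: le_trans (moment i); rewrite -(nint_flip (u := fun x => l1norm x * `|scaled a psi i x|))/=.
- rewrite le_eqVlt; apply/orP; left; apply/eqP; apply: eq_integral => x _.
  by rewrite /= l1normN.
- by msr.
- by move=> x; rewrite mulr_ge0 ?l1norm_ge0.
Qed.

Let flip_modulus i z : (nint mu (fun x => `|flip (scaled a psi i) (x - z) - flip (scaled a psi i) x|)%R <=
  ((A * r i) * l1norm z)%:E)%E.
Proof.
rewrite scaled_flip; have [Hp _ _ h _] := lp_kernel_flip (Hpsi i); have [mp _ _] := Hp.
rewrite /scaled nint_shift_dil ?r0//; apply: le_trans (h _) _.
by rewrite l1normZ gtr0_norm ?r0// mulrA.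
Qed.

Let flip_mean i : \int[mu]_x flip (scaled a psi i) x = 0.
Proof.
have [_ _ Ip] := bL1_scaled i; have := Rintegral_reflect 0 Ip; rewrite mean => <-.
by apply: eq_Rintegral => x _; rewrite /flip sub0r.
Qed.

(** Since r i / r k = 2^(i-k), this is A^2 2^(-|i-k|). *)
Let overlap i k : R := A ^+ 2 * Num.min (r i / r k) (r k / r i).

Let ratio_gt0 i k : 0 < r i / r k. Proof. by rewrite divr_gt0 ?r0. Qed.

Let overlap_ge0 i k : 0 <= overlap i k.
Proof. by rewrite mulr_ge0 ?sqr_ge0// le_min !ltW. Qed.

(** The mean zero of the kernel of higher frequency, whose first moment is small, is played against
    the smoothness of the kernel of lower frequency. *)
Let nint_overlap i k :
  (nint mu (fun x => `|conv (flip (scaled a psi i)) (scaled a psi k) x|)%R <= (overlap i k)%:E)%E.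
Proof.
have H1 := bL1_flip (bL1_scaled i); have H2 := bL1_scaled k.
rewrite /overlap minEle; case: ifP => _; last first.
  have := nint_conv_cancel (ltW (mulr_gt0 A0 (r0 k))) H1 H2 (flip_mean i) (flip_moment i) (modulus k).
  by move/le_trans; apply; rewrite lee_fin le_eqVlt; apply/orP; left; apply/eqP; field; rewrite gt_eqF// r0.
have := nint_conv_cancel (ltW (mulr_gt0 A0 (r0 i))) H2 H1 (mean k) (moment k) (flip_modulus i).
rewrite convC//; move/le_trans; apply; rewrite lee_fin le_eqVlt; apply/orP; left; apply/eqP; field.
by rewrite gt_eqF// r0.
Qed.

Let sum_overlap i : \sum_k overlap i k <= 4 * A ^+ 2.
Proof.
rewrite -mulr_sumr mulrC ler_wpM2r ?sqr_ge0//.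
have h1 : \sum_(k < n) (r k / r i <= 1)%R%:R * (r k / r i) <= 2.
  have := @sum_geometric_trunc_up R n 2 (a / r i) 1.
  rewrite ltr1n ltW ?divr_gt0 ?r0// ler01 => /(_ isT isT isT).
  rewrite (_ : 1 / (1 - 2^-1) = 2); last by field.
  apply: le_trans; rewrite le_eqVlt; apply/orP; left; apply/eqP; apply: eq_bigr => k _.
  by rewrite (_ : r k / r i = a / r i * 2 ^+ k)// /r; ring.
have h2 : \sum_(k < n) (r i / r k <= 1)%R%:R * (r i / r k) <= 2.
  have := @sum_geometric_trunc R n 2^-1 (r i / a) 1.
  rewrite invr_ge0 ler0n invf_lt1 ?ltr1n//= ltW ?divr_gt0 ?r0// ler01 => /(_ isT isT isT).
  rewrite (_ : 1 / (1 - 2^-1) = 2); last by field.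
  apply: le_trans; rewrite le_eqVlt; apply/orP; left; apply/eqP; apply: eq_bigr => k _.
  rewrite (_ : r i / r k = r i / a * 2^-1 ^+ k)// {2}/r invfM exprVn; ring.
apply: (@le_trans _ _ (\sum_(k < n) ((r k / r i <= 1)%R%:R * (r k / r i) +
    (r i / r k <= 1)%R%:R * (r i / r k)))); last first.
  by rewrite big_split/= (_ : 4 = 2 + 2); [exact: lerD|ring].
apply: ler_sum => k _; case: (leP (r k / r i) 1) => h.
  by rewrite mul1r ge_min (_ : (r k / r i <= _ + _)%R = true) ?orbT// lerDl mulr_ge0// ltW.
rewrite mul0r add0r (_ : (r i / r k <= 1)%R = true).
  by rewrite mul1r ge_min lexx.
by rewrite -(invf_div (r k)) invf_le1 ?ltW.
Qed.

(** Expanding the square and moving one kernel across the pairing leaves convolutions of scale i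
    reflected with scale k, of L^1 norm at most [overlap i k]. The matrix is symmetric and its rows
    sum to at most 4 A^2. *)
Lemma synthesis_L2 : L2_bounded (synthesis_kernel a psi) (4 * A ^+ 2).
Proof.
move=> g Hg.
have B1 j : bL1 (vconv (synthesis_kernel a psi) g j).
  by apply: bL1_vconv => // ? i; exact: bL1_scaled.
have B2 : bL1 (fun x => \sum_i g i x ^+ 2) by apply: bL1_sum => i; exact: bL1_sqr.
rewrite !nint_bL1//; try by move=> x; exact: sumsq_ge0.
2: by apply: bL1_sum => j; exact: bL1_sqr.
rewrite -EFinM lee_fin.
have Bik i k : bL1 (fun x => conv (scaled a psi i) (g i) x * conv (scaled a psi k) (g k) x).
  by apply: bL1_mul; apply: bL1_conv => //; exact: bL1_scaled.
have -> : \int[mu]_x (\sum_j vconv (synthesis_kernel a psi) g j x ^+ 2) =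
    \sum_i \sum_k \int[mu]_x (conv (scaled a psi i) (g i) x * conv (scaled a psi k) (g k) x).
  transitivity (\int[mu]_x (\sum_i \sum_k (conv (scaled a psi i) (g i) x * conv (scaled a psi k) (g k) x))).
    apply: eq_Rintegral => x _; rewrite big_ord1 expr2 mulr_suml; apply: eq_bigr => i _.
    by rewrite mulr_sumr.
  rewrite Rintegral_sum; last first.
    by move=> i; have [] : bL1 (fun x => \sum_k (conv (scaled a psi i) (g i) x * conv (scaled a psi k) (g k) x))
      by exact: bL1_sum.
  by apply: eq_bigr => i _; rewrite Rintegral_sum// => k; have [] := Bik i k.
rewrite Rintegral_sum; last by move=> i; have [] := bL1_sqr (Hg i).
pose S i := \int[mu]_x (g i x ^+ 2).
apply: (@le_trans _ _ (\sum_i \sum_k overlap i k / 2 * (S i + S k))).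
  apply: ler_sum => i _; apply: ler_sum => k _.
  rewrite conv_adjoint//; [|exact: bL1_scaled|exact: bL1_conv (bL1_scaled k) (Hg k)].
  rewrite convA//; [|exact/bL1_flip/bL1_scaled|exact: bL1_scaled].
  apply: le_trans (ler_norm _) _; apply: pairing_bound => //.
  by apply: bL1_conv; [exact/bL1_flip/bL1_scaled|exact: bL1_scaled].
have -> : \sum_i \sum_k overlap i k / 2 * (S i + S k) = \sum_i (\sum_k overlap i k) * S i.
  have e1 : \sum_i \sum_k overlap i k / 2 * S k = \sum_i (\sum_k overlap i k) / 2 * S i.
    rewrite exchange_big; apply: eq_bigr => i _; rewrite mulr_suml mulr_suml; apply: eq_bigr => k _.
    by rewrite /overlap minC.
  have e2 : \sum_i \sum_k overlap i k / 2 * S i = \sum_i (\sum_k overlap i k) / 2 * S i.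
    by apply: eq_bigr => i _; rewrite mulr_suml mulr_suml.
  transitivity (\sum_i \sum_k overlap i k / 2 * S i + \sum_i \sum_k overlap i k / 2 * S k).
    rewrite -big_split; apply: eq_bigr => i _; rewrite -big_split; apply: eq_bigr => k _.
    by rewrite mulrDr.
  rewrite e1 e2 -big_split; apply: eq_bigr => i _ /=.
  by move: (\sum_k _) (S i) => X Y; field.
rewrite mulr_sumr; apply: ler_sum => i _; apply: ler_wpM2r; last exact: sum_overlap.
by apply: Rintegral_ge0 => x _; exact: sqr_ge0.
Qed.

(** If r |y| <= 1 the modulus of continuity suffices. Otherwise both x and x - y have norm at least
    |y| in the region of integration, and the first moment gives 1 / (r |y|). *)
Lemma scaled_far_diff i y :
  (nint mu (fun x => (2 * l1norm y <= l1norm x)%R%:R *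
     `|scaled a psi i (x - y) - scaled a psi i x|)%R <=
   (2 * A * ((r i * l1norm y <= 1)%R%:R * (r i * l1norm y) +
             ((r i * l1norm y)^-1 <= 1)%R%:R * (r i * l1norm y)^-1))%:E)%E.
Proof.
have ml := measurable_l1norm (R := R) (N := N); have [mp _ _] := bL1_scaled i.
have mb : measurable_fun setT (fun x : V => (2 * l1norm y <= l1norm x)%R%:R : R).
  by apply: measurable_fun_bool; apply: measurable_fun_ler => //; exact: measurable_cst.
set t := r i * l1norm y.
have t0 : 0 <= t by rewrite mulr_ge0 ?l1norm_ge0// ltW ?r0.
have [t1|t1] := leP t 1.
  apply: (@le_trans _ _ (nint mu (fun x => `|scaled a psi i (x - y) - scaled a psi i x|)%R)).
    apply: le_nint; try by msr.
      by move=> x; rewrite mulr_ge0.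
    by move=> x; rewrite ler_piMl// lern1 leq_b1.
  apply: le_trans (modulus i y) _; rewrite lee_fin mul1r -mulrA -/t mulrDr.
  apply: (@le_trans _ _ (2 * A * t)); first by rewrite -[leRHS]mulrA ler_peMl ?ler1n// mulr_ge0// ltW.
  by rewrite lerDl !mulr_ge0 ?invr_ge0 ?(ltW A0).
have tp : 0 < t by rewrite (lt_trans _ t1).
have y0 : 0 < l1norm y by move: tp; rewrite /t pmulr_rgt0 ?r0.
rewrite mul0r add0r invf_le1// (ltW t1) mul1r.
pose c := (l1norm y)^-1.
have c0 : 0 <= c by rewrite invr_ge0 l1norm_ge0.
apply: (@le_trans _ _ (nint mu (fun x => c * (l1norm (x - y) * `|scaled a psi i (x - y)|) +
    c * (l1norm x * `|scaled a psi i x|))%R)).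
  apply: le_nint; try by msr.
    by move=> x; rewrite mulr_ge0.
  move=> x; case: (boolP (2 * l1norm y <= l1norm x)) => h; last first.
    by rewrite mul0r addr_ge0// mulr_ge0// mulr_ge0 ?l1norm_ge0.
  rewrite mul1r; apply: le_trans (ler_normB _ _) _; rewrite !mulrA.
  apply: lerD; apply: ler_peMl => //; rewrite mulrC ler_pdivlMr// mul1r.
    have := l1normD (x - y) y; rewrite subrK; move: h; lra.
  move: h y0; lra.
have Hu : measurable_fun setT (fun x => l1norm x * `|scaled a psi i x|) by msr.
have u0 x : 0 <= l1norm x * `|scaled a psi i x| by rewrite mulr_ge0 ?l1norm_ge0.
rewrite nintD; first last.
- by move=> x; rewrite mulr_ge0.
- by move=> x; rewrite mulr_ge0.
- by msr.
- by msr.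
rewrite !nintZ//; last by msr.
rewrite (nint_shift y Hu u0) -ge0_muleDl ?lee_fin// -EFinD.
apply: (@le_trans _ _ ((c + c)%:E * (A / r i)%:E)%E).
  by apply: lee_wpmul2l; [rewrite lee_fin addr_ge0|exact: moment].
rewrite -EFinM lee_fin le_eqVlt; apply/orP; left; apply/eqP; rewrite /c /t; field.
by rewrite !gt_eqF ?r0.
Qed.

Lemma sum_far_diff y : \sum_i (2 * A * ((r i * l1norm y <= 1)%R%:R * (r i * l1norm y) +
   ((r i * l1norm y)^-1 <= 1)%R%:R * (r i * l1norm y)^-1)) <= 8 * A.
Proof.
rewrite -mulr_sumr (_ : 8 * A = 2 * A * 4); last by ring.
apply: ler_wpM2l; first by rewrite mulr_ge0// ltW.
rewrite big_split/= (_ : 4 = 2 + 2); last by ring.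
have l0 := l1norm_ge0 y; apply: lerD.
  have := @sum_geometric_trunc_up R n 2 (a * l1norm y) 1.
  rewrite ltr1n ler01 mulr_ge0 ?(ltW a0)// => /(_ isT isT isT).
  rewrite (_ : 1 / (1 - 2^-1) = 2); last by field.
  apply: le_trans; rewrite le_eqVlt; apply/orP; left; apply/eqP; apply: eq_bigr => k _.
  by rewrite (_ : r k * l1norm y = a * l1norm y * 2 ^+ k)// /r; ring.
have := @sum_geometric_trunc R n 2^-1 (a * l1norm y)^-1 1.
rewrite invr_ge0 ler0n invf_lt1 ?ltr1n//= invr_ge0 mulr_ge0 ?(ltW a0)// ler01 => /(_ isT isT isT).
rewrite (_ : 1 / (1 - 2^-1) = 2); last by field.
apply: le_trans; rewrite le_eqVlt; apply/orP; left; apply/eqP; apply: eq_bigr => k _.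
by rewrite (_ : (r k * l1norm y)^-1 = (a * l1norm y)^-1 * 2^-1 ^+ k)// /r !invfM exprVn; ring.
Qed.

Let sum_scaled_far_diff y :
  (nint mu (fun x => (2 * l1norm y <= l1norm x)%R%:R *
     \sum_i `|scaled a psi i (x - y) - scaled a psi i x|)%R <= (8 * A)%:E)%E.
Proof.
have ml := measurable_l1norm (R := R) (N := N).
have mb : measurable_fun setT (fun x : V => (2 * l1norm y <= l1norm x)%R%:R : R).
  by apply: measurable_fun_bool; apply: measurable_fun_ler => //; exact: measurable_cst.
under eq_fun do rewrite mulr_sumr.
rewrite nint_sum; first last.
- by move=> i x; rewrite mulr_ge0.
- by move=> i; have [mp _ _] := bL1_scaled i; msr.
apply: (@le_trans _ _ (8 * A)%:E) => //.
apply: le_trans (_ : _ <= (\sum_i (2 * A * ((r i * l1norm y <= 1)%R%:R * (r i * l1norm y) +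
   ((r i * l1norm y)^-1 <= 1)%R%:R * (r i * l1norm y)^-1)))%:E)%E _; last first.
  by rewrite lee_fin; exact: sum_far_diff.
by rewrite -sumEFin; apply: lee_sum => i _; exact: scaled_far_diff.
Qed.

Lemma synthesis_hormander : hormander_bounded (synthesis_kernel a psi) (8 * A).
Proof.
move=> y; apply: le_trans (sum_scaled_far_diff y).
rewrite le_eqVlt; apply/orP; left; apply/eqP; congr nint; apply/funext => x.
by rewrite /far_diff /kernel_diff big_ord1.
Qed.

Lemma analysis_hormander : hormander_bounded (analysis_kernel a psi) (8 * A).
Proof.
move=> y; apply: le_trans (sum_scaled_far_diff y).
rewrite le_eqVlt; apply/orP; left; apply/eqP; congr nint; apply/funext => x.
by rewrite /far_diff /kernel_diff; congr (_ * _); apply: eq_bigr => i _; rewrite big_ord1.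
Qed.

End scaled_families.

End littlewood_paley_kernels.

(** * Square function bounds for all exponents *)

Section littlewood_paley_bounds.
Context {R : realType} {N : nat}.
Local Notation V := 'rV[R]_N.
Local Notation mu := (lebesgue_rV R N).

Lemma Lp_bounded_le (I J : finType) (K : J -> I -> V -> R) p C C' : C <= C' ->
  Lp_bounded K p C -> Lp_bounded K p C'.
Proof.
move=> CC' HC g Hg cg; apply: le_trans (HC g Hg cg) _; apply: lee_wpmul2r.
  by apply: nint_ge0 => x; exact: powR_ge0.
by rewrite lee_fin.
Qed.

Lemma Lp_bounded2 (I J : finType) (K : J -> I -> V -> R) C :
  L2_bounded K C -> Lp_bounded K 2 C.
Proof.
move=> HC g Hg _.
have E (T : finType) (h : T -> V -> R) :
    nint mu (fun x => vabs h x `^ 2) = nint mu (fun x => \sum_i h i x ^+ 2).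
  by apply: eq_integral => x _; rewrite powR_mulrn ?vnorm_ge0// sqr_vnorm.
by rewrite !E; exact: HC.
Qed.

Section families.
Variables (A a : R) (n : nat) (psi : 'I_n -> V -> R).
Hypotheses (A0 : 0 < A) (a0 : 0 < a) (Hpsi : forall i, lp_kernel A (psi i)).
Hypothesis N0 : (0 < N)%N.

Let phi i := flip (psi i).
Let Hphi i : lp_kernel A (phi i). Proof. exact: lp_kernel_flip. Qed.

Lemma transpose_analysis : transpose_kernel (analysis_kernel a psi) = synthesis_kernel a phi.
Proof. by apply/funext => j; apply/funext => i; exact: scaled_flip. Qed.

Lemma transpose_synthesis : transpose_kernel (synthesis_kernel a psi) = analysis_kernel a phi.
Proof. by apply/funext => j; apply/funext => i; exact: scaled_flip. Qed.

Let H4 : 0 < 4 * A ^+ 2. Proof. by rewrite mulr_gt0// exprn_gt0. Qed.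
Let H8 : 0 <= 8 * A. Proof. by rewrite mulr_ge0// ltW. Qed.

Lemma analysis_L2 : L2_bounded (analysis_kernel a psi) (4 * A ^+ 2).
Proof.
apply: L2_bounded_dual => //; first by move=> ? ?; exact: (bL1_scaled a0 Hpsi).
by rewrite transpose_analysis; exact: synthesis_L2.
Qed.

Lemma synthesis_lt2 p : 1 < p -> p < 2 ->
  Lp_bounded (synthesis_kernel a psi) p (@marcinkiewicz_const R N p (8 * A) (4 * A ^+ 2)).
Proof.
move=> p1 p2 g Hg cg; have HK j i : bL1 (synthesis_kernel a psi j i) by exact: (bL1_scaled a0 Hpsi).
exact: (strong_type_lt2_aux HK N0 p1 p2 H8 (ltW H4) (synthesis_L2 A0 a0 Hpsi) (synthesis_hormander A0 a0 Hpsi) Hg cg).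
Qed.

Lemma analysis_lt2 p : 1 < p -> p < 2 ->
  Lp_bounded (analysis_kernel a psi) p (@marcinkiewicz_const R N p (8 * A) (4 * A ^+ 2)).
Proof.
move=> p1 p2 g Hg cg; have HK j i : bL1 (analysis_kernel a psi j i) by exact: (bL1_scaled a0 Hpsi).
exact: (strong_type_lt2_aux HK N0 p1 p2 H8 (ltW H4) analysis_L2 (analysis_hormander A0 a0 Hpsi) Hg cg).
Qed.

End families.

(** Transposition exchanges analysis and synthesis and reflects the kernels, which [lp_kernel]
    tolerates. For p > 2 each of the two bounds thus rests on the other one at p / (p - 1) < 2. *)
Theorem littlewood_paley_bounds (p A : R) : (0 < N)%N -> 1 < p -> 0 < A ->
  exists C, 0 < C /\ forall n (a : R) (psi : 'I_n -> V -> R), 0 < a ->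
    (forall i, lp_kernel A (psi i)) ->
    Lp_bounded (synthesis_kernel a psi) p C /\ Lp_bounded (analysis_kernel a psi) p C.
Proof.
move=> N0 p1 A0.
have key q : 1 < q -> q < 2 -> exists C, 0 < C /\
    forall n (a : R) (psi : 'I_n -> V -> R), 0 < a -> (forall i, lp_kernel A (psi i)) ->
    Lp_bounded (synthesis_kernel a psi) q C /\ Lp_bounded (analysis_kernel a psi) q C.
  move=> q1 q2; pose c := @marcinkiewicz_const R N q (8 * A) (4 * A ^+ 2).
  exists (`|c| + 1); split; first by rewrite ltr_wpDl.
  have cc : c <= `|c| + 1 by rewrite (le_trans (ler_norm _))// lerDl.
  move=> n a psi a0 H; split; apply: (Lp_bounded_le cc).
    exact: synthesis_lt2.
  exact: analysis_lt2.
case: (ltgtP p 2) => [p2|p2|p2]; first exact: key.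
- have pm : 0 < p - 1 by rewrite subr_gt0.
  have q1 : 1 < p / (p - 1) by rewrite ltr_pdivlMr// mul1r ltrBlDr ltrDl.
  have q2 : p / (p - 1) < 2 by rewrite ltr_pdivrMr//; move: p2; lra.
  have [C [C0 HC]] := key _ q1 q2.
  exists (`|dual_const p C| + 1); split; first by rewrite ltr_wpDl.
  have cc : dual_const p C <= `|dual_const p C| + 1 by rewrite (le_trans (ler_norm _))// lerDl.
  move=> n a psi a0 H.
  have [h1 h2] := HC n a (fun i => flip (psi i)) a0 (fun i => lp_kernel_flip (H i)).
  split; apply: (Lp_bounded_le cc).
    have HK j i : bL1 (synthesis_kernel a psi j i) by exact: (bL1_scaled a0 H).
    apply: (Lp_bounded_dual HK p2 C0); rewrite (transpose_synthesis a psi); exact: h2.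
  have HK j i : bL1 (analysis_kernel a psi j i) by exact: (bL1_scaled a0 H).
  apply: (Lp_bounded_dual HK p2 C0); rewrite (transpose_analysis a psi); exact: h1.
- exists (4 * A ^+ 2); split; first by rewrite mulr_gt0// exprn_gt0.
  move=> n a psi a0 H; rewrite p2; split; apply: Lp_bounded2.
    exact: synthesis_L2.
  exact: analysis_L2.
Qed.

End littlewood_paley_bounds.

(** * Jensen's inequality *)

Section jensen.
Context {R : realType}.

(** The graph of the p-th power lies above its tangent at b. This is Young's inequality for a and
    b^(p-1); Jensen's inequality follows by averaging it with b the mean. *)
Lemma powR_tangent (a b p : R) : 0 <= a -> 0 <= b -> 1 < p ->
  p * b `^ (p - 1) * a <= a `^ p + (p - 1) * b `^ p.
Proof.
move=> a0 b0 p1; have p0 : 0 < p by rewrite (lt_trans _ p1).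
have pm : 0 < p - 1 by rewrite subr_gt0.
have := @conjugate_powR R a (b `^ (p - 1)) p (p / (p - 1)) a0 (powR_ge0 _ _) p0.
rewrite divr_gt0// => /(_ isT).
have -> : p^-1 + (p / (p - 1))^-1 = 1 by rewrite invf_div; field; rewrite gt_eqF.
move=> /(_ erefl); rewrite -powRrM (_ : (p - 1) * (p / (p - 1)) = p); last first.
  by field; rewrite gt_eqF.
rewrite -(ler_pM2l p0) mulrDr (_ : p * (b `^ p / (p / (p - 1))) = (p - 1) * b `^ p); last first.
  by field; rewrite !gt_eqF.
rewrite (_ : p * (a `^ p / p) = a `^ p); last by field; rewrite gt_eqF.
by rewrite [a * _]mulrC mulrA.
Qed.

Lemma powR_tangent_sub (a b p : R) : 0 <= a -> 0 <= b -> 1 < p ->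
  b `^ p + p * b `^ (p - 1) * (a - b) <= a `^ p.
Proof.
move=> a0 b0 p1; have := powR_tangent a0 b0 p1.
have p0 : 0 < p by rewrite (lt_trans _ p1).
have -> : p * b `^ (p - 1) * (a - b) = p * b `^ (p - 1) * a - p * b `^ p.
  by rewrite -(mulr_powRB1 b0 p0); ring.
move: (p * _ * a) (a `^ p) (b `^ p) => x y z; lra.
Qed.

Lemma powR_mean_le (I : finType) (w a : I -> R) p : 1 < p ->
  (forall i, 0 <= w i) -> (forall i, 0 <= a i) -> \sum_i w i = 1 ->
  (\sum_i w i * a i) `^ p <= \sum_i w i * a i `^ p.
Proof.
move=> p1 w0 a0 w1; set b := \sum_i w i * a i.
have b0 : 0 <= b by apply: sumr_ge0 => i _; exact: mulr_ge0.
apply: (@le_trans _ _ (\sum_i w i * (b `^ p + p * b `^ (p - 1) * (a i - b)))); last first.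
  by apply: ler_sum => i _; apply: ler_wpM2l => //; exact: powR_tangent_sub.
have -> : \sum_i w i * (b `^ p + p * b `^ (p - 1) * (a i - b)) =
    b `^ p * (\sum_i w i) + p * b `^ (p - 1) * (\sum_i w i * a i - b * \sum_i w i).
  rewrite mulrBr !mulr_sumr -sumrB -big_split/=; apply: eq_bigr => i _; ring.
by rewrite w1 -/b !mulr1 subrr mulr0 addr0.
Qed.

Lemma powR_sum_le (I : finType) (a : I -> R) p : 1 < p -> (forall i, 0 <= a i) ->
  (\sum_i a i) `^ p <= #|I|%:R `^ (p - 1) * \sum_i a i `^ p.
Proof.
move=> p1 a0; have p0 : 0 < p by rewrite (lt_trans _ p1).
have [I0|I0] := posnP #|I|.
  have E (i : I) : False by have := fintype0 i; rewrite I0 => /(_ erefl).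
  by rewrite !big1 ?powR0 ?gt_eqF ?mulr0// => i; have := E i.
have c0 : 0 < #|I|%:R :> R by rewrite ltr0n.
have := @powR_mean_le I (fun=> #|I|%:R^-1) (fun i => #|I|%:R * a i) p p1.
have e1 : \sum_(i : I) #|I|%:R^-1 = 1 :> R.
  by rewrite sumr_const -(mulr_natl (#|I|%:R^-1 : R)) mulfV ?gt_eqF.
rewrite e1 => H.
have -> : \sum_i a i = \sum_i #|I|%:R^-1 * (#|I|%:R * a i).
  by apply: eq_bigr => i _; rewrite mulrA mulVf ?mul1r// gt_eqF.
apply: le_trans (H _ _ erefl) _.
- by move=> i; rewrite invr_ge0 ltW.
- by move=> i; rewrite mulr_ge0 ?(ltW c0).
rewrite mulr_sumr; apply: ler_sum => i _; rewrite powRM ?(ltW c0)// mulrA ler_wpM2r ?powR_ge0//.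
rewrite -[X in _ * X](mulr_powRB1 (ltW c0) p0) mulrA mulVf ?mul1r// gt_eqF//.
Qed.

Lemma powRD_le (a b p : R) : 1 < p -> 0 <= a -> 0 <= b ->
  (a + b) `^ p <= 2 `^ (p - 1) * (a `^ p + b `^ p).
Proof.
move=> p1 a0 b0; have := @powR_sum_le 'I_2 (fun i => if i == ord0 then a else b) p p1.
by rewrite !big_ord_recl !big_ord0 !addr0 card_ord/=; apply => i; case: ifP.
Qed.

End jensen.

Section integral_jensen.
Context {R : realType} d (T : measurableType d) (m : {measure set T -> \bar R}).

(** The tangent inequality at b = B / c is integrated against k. The mass of k only has to be
    bounded by c, so no normalisation is required. *)
Lemma powR_Rintegral_le (k g : T -> R) (c p : R) : 1 < p -> 0 < c ->
  measurable_fun setT k -> measurable_fun setT g ->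
  (forall x, 0 <= k x) -> (forall x, 0 <= g x) ->
  (nint m k <= c%:E)%E -> m.-integrable setT (EFin \o (fun x => k x * g x)) ->
  (((\int[m]_x (k x * g x)) `^ p)%:E <= (c `^ (p - 1))%:E * nint m (fun x => k x * g x `^ p)%R)%E.
Proof.
move=> p1 c0 mk mg k0 g0 hc Ikg; have p0 : 0 < p by rewrite (lt_trans _ p1).
set B := \int[m]_x (k x * g x).
have B0 : 0 <= B by apply: Rintegral_ge0 => x _; exact: mulr_ge0.
pose b := B / c.
have b0 : 0 <= b by rewrite divr_ge0// ltW.
have EB : nint m (fun x => k x * g x) = B%:E.
  by rewrite nint_Rintegral// => x; exact: mulr_ge0.
have h : ((p * b `^ (p - 1) * B)%:E <=
    nint m (fun x => k x * g x `^ p)%R + ((p - 1) * b `^ p * c)%:E)%E.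
  apply: (@le_trans _ _ (nint m (fun x => k x * g x `^ p)%R + ((p - 1) * b `^ p)%:E * nint m k)%E).
    have pm : 0 <= (p - 1) * b `^ p by rewrite mulr_ge0 ?powR_ge0// subr_ge0 ltW.
    have pb : 0 <= p * b `^ (p - 1) by rewrite mulr_ge0 ?powR_ge0// ltW.
    have n1 x : 0 <= k x * g x by exact: mulr_ge0.
    have n2 x : 0 <= k x * g x `^ p by rewrite mulr_ge0 ?powR_ge0.
    have n3 x : 0 <= (p - 1) * b `^ p * k x by exact: mulr_ge0.
    have n4 x : 0 <= p * b `^ (p - 1) * (k x * g x) by exact: mulr_ge0.
    have m1 : measurable_fun setT (fun x => k x * g x) by msr.
    have m2 : measurable_fun setT (fun x => k x * g x `^ p) by msr.
    have m3 : measurable_fun setT (fun x => (p - 1) * b `^ p * k x) by msr.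
    have m4 : measurable_fun setT (fun x => p * b `^ (p - 1) * (k x * g x)) by msr.
    rewrite EFinM -EB -(nintZ m m1 pb n1) -(nintZ m mk pm k0) -(nintD m m2 m3 n2 n3).
    apply: le_nint => //.
      by apply: measurable_funD.
    move=> x; have := powR_tangent (g0 x) b0 p1.
    rewrite -subr_ge0 => h; rewrite -subr_ge0.
    rewrite (_ : _ - _ = k x * (g x `^ p + (p - 1) * b `^ p - p * b `^ (p - 1) * g x)); last by ring.
    exact: mulr_ge0.
  apply: leeD2l; rewrite (EFinM _ c); apply: lee_wpmul2l => //.
  by rewrite lee_fin mulr_ge0 ?powR_ge0// subr_ge0 ltW.
have hb : B = b * c by rewrite /b divfK// gt_eqF.
have e1 : p * b `^ (p - 1) * B = p * (b `^ p * c).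
  by rewrite hb -(mulr_powRB1 b0 p0); ring.
rewrite hb powRM ?(ltW c0)// -[c `^ p](mulr_powRB1 (ltW c0) p0) mulrA mulrC.
rewrite (EFinM (c `^ (p - 1))); apply: lee_wpmul2l; first by rewrite lee_fin powR_ge0.
move: h; rewrite e1; case: (nint m _) => [r| |]; rewrite ?leey// -?EFinD ?lee_fin.
- by rewrite -!mulrA; move: (b `^ p * c) => z; lra.
Qed.

End integral_jensen.

Section measurability_of_continuous.
Context {R : realType} {N : nat}.
Local Notation V := 'rV[R]_N.

(** f is the pointwise limit of its values at the corners of dyadic cells, and these are functions
    of the cell alone. *)
Lemma scont_measurable (f : V -> R) : scont f -> measurable_fun setT f.
Proof.
move=> cf; pose r k : R := 2 ^+ k.
have r0 k : 0 < r k by rewrite exprn_gt0.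
pose corner k (c : 'rV[int]_N) : V := \row_i ((c 0 i)%:~R / r k).
pose F k x := f (corner k (cell (r k) x)).
apply: (@measurable_fun_cvg _ _ _ setT F).
  move=> k; exact: (measurable_cell_fun (fun c => f (corner k c)) (r0 k)).
move=> x _; apply: cf => i; apply/cvgrPdist_le => e e0.
have : (fun k => (r k)^-1 : R) @ \oo --> (0 : R).
  rewrite (_ : (fun k => _) = (fun k => (2^-1) ^+ k)); last first.
    by apply/funext => k; rewrite exprVn.
  by apply: cvg_expr; rewrite ger0_norm ?invr_ge0// invf_lt1 ?ltr1n.
move=> /cvgr0Pnorm_le/(_ _ e0); apply: filterS => k.
rewrite ger0_norm ?invr_ge0 ?(ltW (r0 k))//; apply: le_trans.
rewrite !mxE (_ : x 0 i - _ = (r k * x 0 i - (Num.floor (r k * x 0 i))%:~R) / r k); last first.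
  by field; rewrite gt_eqF.
rewrite normrM [X in _ * X]ger0_norm ?invr_ge0 ?(ltW (r0 k))// ler_piMl ?invr_ge0 ?(ltW (r0 k))//.
have := floor_le (r k * x 0 i); have := floorD1_gt (r k * x 0 i); rewrite intrD.
by move=> h1 h2; rewrite ler_norml; apply/andP; split; lra.
Qed.

End measurability_of_continuous.

(** * Schwartz functions *)

Section euclidean_and_l1_norms.
Context {R : realType} {N : nat}.
Local Notation V := 'rV[R]_N.
Implicit Types x y : V.

Lemma enorm_ge0 x : 0 <= enorm x.
Proof. exact: sqrtr_ge0. Qed.

Lemma enorm_le_l1norm x : enorm x <= l1norm x.
Proof. exact: (vnorm_le_sum (fun i => x 0 i)). Qed.

Lemma l1norm_le_enorm x : l1norm x <= N%:R * enorm x.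
Proof.
apply: (@le_trans _ _ (\sum_(i < N) enorm x)).
  by apply: ler_sum => i _; exact: (ler_vnorm (fun i => x 0 i)).
by rewrite sumr_const card_ord -(mulr_natl (enorm x)).
Qed.

Lemma l1norm0_eq x : l1norm x = 0 -> x = 0.
Proof.
move=> h; apply/rowP => i; apply/eqP; rewrite mxE -normr_le0 -h.
exact: ler_coord_l1norm.
Qed.

Lemma l1norm_delta i : l1norm (delta_mx 0 i : V) = 1.
Proof.
rewrite /l1norm (bigD1 i)//= big1 ?addr0 => [|j ji]; first by rewrite mxE !eqxx normr1.
by rewrite mxE eqxx (negbTE ji) normr0.
Qed.

(* Dominates Schwartz functions; integrable for [k = 2 * N]. *)
Definition decay (k : nat) x : R := (1 + l1norm x) ^- k.

Lemma decay_gt0 k x : 0 < decay k x.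
Proof. by rewrite invr_gt0 exprn_gt0// ltr_wpDr// l1norm_ge0. Qed.

Lemma decay_le1 k x : decay k x <= 1.
Proof. by rewrite invf_le1 ?exprn_gt0 ?exprn_ege1 ?ltr_wpDr ?lerDl ?l1norm_ge0. Qed.

Lemma decayS k x : l1norm x * decay k.+1 x <= decay k x.
Proof.
have h : 0 < 1 + l1norm x by rewrite ltr_wpDr// l1norm_ge0.
rewrite /decay exprS invfM mulrA ler_piMl ?invr_ge0 ?exprn_ge0 ?(ltW h)//.
by rewrite ler_pdivrMr// mul1r lerDr.
Qed.

Lemma decay_leS k x : decay k.+1 x <= decay k x.
Proof.
have h : 0 < 1 + l1norm x by rewrite ltr_wpDr// l1norm_ge0.
by rewrite /decay exprS invfM ler_piMl ?invr_ge0 ?exprn_ge0 ?(ltW h)// invf_le1 ?lerDl ?l1norm_ge0.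
Qed.

Lemma decay_shift k x y : l1norm (x - y) <= 2 -> decay k y <= 3 ^+ k * decay k x.
Proof.
move=> h; have hx : 0 < 1 + l1norm x by rewrite ltr_wpDr// l1norm_ge0.
have hy : 0 < 1 + l1norm y by rewrite ltr_wpDr// l1norm_ge0.
rewrite /decay -!exprVn -exprMn lerXn2r ?nnegrE ?invr_ge0 ?mulr_ge0 ?invr_ge0 ?(ltW hx) ?(ltW hy)//.
rewrite -[leLHS]mul1r ler_pdivrMr// mulrAC ler_pdivlMr// mul1r.
have := l1normD (x - y) y; rewrite subrK; have := l1norm_ge0 y; lra.
Qed.

Lemma scont_l1norm : scont (@l1norm R N).
Proof.
apply: scont_sum => i u x ux; apply: cvg_norm; exact: ux.
Qed.

Lemma scont_decay k : scont (decay k).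
Proof.
move=> u x ux; have h : (1 + l1norm x) ^+ k != 0.
  by rewrite gt_eqF// exprn_gt0// ltr_wpDr// l1norm_ge0.
apply: cvgV => //; have := scont_l1norm ux => h1.
elim: k {h} => [|k IH]; first by rewrite (_ : (fun _ => _) = fun=> 1); [exact: cvg_cst|apply/funext => n; rewrite expr0].
under eq_fun do rewrite exprS; rewrite exprS; apply: cvgM => //.
by apply: cvgD => //; exact: cvg_cst.
Qed.

Lemma measurable_decay k : measurable_fun setT (decay k).
Proof. by apply: scont_measurable; exact: scont_decay. Qed.

End euclidean_and_l1_norms.

Section integrability_of_decay.
Context {R : realType} {N : nat}.
Local Notation V := 'rV[R]_N.
Local Notation mu := (lebesgue_rV R N).
Local Notation leb := (@lebesgue_measure R).

Lemma nint_oneDsqrV : (nint leb (fun a : measurableTypeR R => (oneDsqr (a : R))^-1)%R < +oo)%E.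
Proof.
rewrite /nint (@ge0_symfun_integralT R (fun a => (oneDsqr a)^-1)).
- rewrite (_ : [set x | _] = `[0, +oo[%classic); last first.
    by apply/seteqP; split => x/=; rewrite in_itv/= andbT.
  by rewrite integral0y_oneDsqr -EFinM ltry.
- by move=> x; rewrite invr_ge0 addr_ge0// sqr_ge0.
- exact: continuous_oneDsqrV.
- by move=> x /=; rewrite /oneDsqr sqrrN.
Qed.

(** The power 2 N is enough because (1 + |x|)^(2N) dominates the product of the factors 1 + x_i^2,
    whose inverse is integrable coordinate by coordinate. *)
Lemma bL1_decay : bL1 (@decay R N (2 * N)).
Proof.
have mW := @measurable_decay R N (2 * N).
have W0 x := ltW (@decay_gt0 R N (2 * N) x).
split => //; first by exists 1 => x; rewrite ger0_norm// decay_le1.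
apply/integrable_nintP => //; under eq_fun do rewrite ger0_norm//.
have mu1 : measurable_fun setT (fun a : measurableTypeR R => (oneDsqr (a : R))^-1).
  apply: continuous_measurable_fun; exact: continuous_oneDsqrV.
have u0 (a : R) : 0 <= (oneDsqr a)^-1 by rewrite invr_ge0 addr_ge0// sqr_ge0.
apply: (@le_lt_trans _ _ (nint mu (fun x : V => \prod_(i < N) (1 + x 0 i ^+ 2)^-1))).
  apply: le_nint => //.
    apply: measurable_fun_bigprod => i.
    apply: (measurableT_comp mu1); exact: measurable_rV_coord.
  move=> x; rewrite prodfV lef_pV2 ?posrE ?exprn_gt0 ?ltr_wpDr ?l1norm_ge0//; last first.
    by apply: prodr_gt0 => i _; rewrite ltr_wpDr// sqr_ge0.
  rewrite exprM -[X in _ ^+ X]card_ord -prodr_const; apply: ler_prod => i _.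
  rewrite addr_ge0 ?sqr_ge0//=.
  apply: (@le_trans _ _ ((1 + `|x 0 i|) ^+ 2)).
    by rewrite sqrrD expr1n mul1r -normrX [`|_ ^+ 2|]ger0_norm ?sqr_ge0// lerD2r lerDl mulrn_wge0.
  by rewrite lerXn2r ?nnegrE ?addr_ge0 ?l1norm_ge0// lerD2l ler_coord_l1norm.
rewrite /nint (@integral_prod_rV R N (fun a : measurableTypeR R => (oneDsqr (a : R))^-1))//.
elim: (index_enum _) => [|i s IH]; first by rewrite big_nil ltry.
rewrite big_cons lte_mul_pinfty//.
  by apply: integral_ge0 => a _; rewrite lee_fin.
by rewrite ge0_fin_numE ?nint_oneDsqrV// integral_ge0// => a _; rewrite lee_fin.
Qed.

Lemma bL1_le_decay (u : V -> R) C : measurable_fun setT u ->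
  (forall x, `|u x| <= C * decay (2 * N) x) -> bL1 u.
Proof.
move=> mu1 h; apply: (@bL1_dominated _ _ u _ mu1 (bL1Z C bL1_decay)) => x.
exact: le_trans (h x) (ler_norm _).
Qed.

Definition decay_mass : R := \int[mu]_x decay (2 * N) x.

Lemma decay_mass_ge0 : 0 <= decay_mass.
Proof. by apply: Rintegral_ge0 => x _; exact/ltW/decay_gt0. Qed.

Lemma nint_le_decay (u : V -> R) C : measurable_fun setT u -> 0 <= C ->
  (forall x, 0 <= u x) -> (forall x, u x <= C * decay (2 * N) x) ->
  (nint mu u <= (C * decay_mass)%:E)%E.
Proof.
move=> mu1 C0 u0 h; have W0 x := ltW (@decay_gt0 R N (2 * N) x).
apply: (@le_trans _ _ (nint mu (fun x => C * decay (2 * N) x))).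
  by apply: le_nint => //; apply: measurable_funM => //; exact: measurable_decay.
rewrite nintZ//; last exact: measurable_decay.
by rewrite EFinM nint_Rintegral//; have [] := bL1_decay.
Qed.

(** The increment is assumed only for |z| <= 1. For |z| > 1 the triangle inequality gives twice the
    mass, which is at most 2 B |z| times the mass of the weight: hence the factor 2. *)
Lemma lp_kernel_decay (psi : V -> R) B : 0 <= B -> scont psi ->
  (forall x, `|psi x| <= B * decay (2 * N).+1 x) ->
  (forall x z, l1norm z <= 1 -> `|psi (x - z) - psi x| <= B * l1norm z * decay (2 * N) x) ->
  \int[mu]_x psi x = 0 -> lp_kernel (2 * B * decay_mass) psi.
Proof.
move=> B0 cpsi hpsi hz int0; have mpsi := scont_measurable cpsi.
have ml := measurable_l1norm (R:=R)(N:=N).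
have h1 x : `|psi x| <= B * decay (2 * N) x.
  by rewrite (le_trans (hpsi x))// ler_wpM2l// decay_leS.
have H : bL1 psi by apply: bL1_le_decay h1.
have M0 : 0 <= B * decay_mass by rewrite mulr_ge0// decay_mass_ge0.
have MM : B * decay_mass <= 2 * B * decay_mass by rewrite -mulrA ler_peMl// ler1n.
have hn : (nint mu (fun x => `|psi x|)%R <= (B * decay_mass)%:E)%E by apply: nint_le_decay => //; msr.
split => //.
- by apply: le_trans hn _; rewrite lee_fin.
- apply: (@le_trans _ _ (B * decay_mass)%:E); last by rewrite lee_fin.
  apply: nint_le_decay => //; first by msr.
    by move=> x; rewrite mulr_ge0// l1norm_ge0.
  move=> x; apply: (@le_trans _ _ (l1norm x * (B * decay (2 * N).+1 x))).
    by rewrite ler_wpM2l// l1norm_ge0.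
  by rewrite mulrCA ler_wpM2l// decayS.
- move=> z; have [z1|z1] := lerP (l1norm z) 1.
    apply: (@le_trans _ _ ((B * l1norm z) * decay_mass)%:E).
      by apply: nint_le_decay; [msr|rewrite mulr_ge0// l1norm_ge0|move=> x|move=> x; exact: hz].
    rewrite lee_fin mulrAC; apply: ler_wpM2r => //; exact: l1norm_ge0.
  apply: (@le_trans _ _ (nint mu (fun x => `|psi (x - z)| + `|psi x|)%R)).
    by apply: le_nint; [msr|msr|move=> x|move=> x; rewrite ler_normB].
  rewrite nintD//; [|msr|msr].
  rewrite (@nint_shift _ _ z (fun x => `|psi x|))//; last by msr.
  apply: le_trans (leeD hn hn) _; rewrite -EFinD lee_fin.
  rewrite (_ : _ + _ = 2 * B * decay_mass); last by ring.
  by rewrite ler_peMr ?(ltW z1)// -mulrA mulr_ge0.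
Qed.

End integrability_of_decay.

Section schwartz_functions.
Context {R : realType} {N : nat}.
Local Notation V := 'rV[R]_N.
Local Notation mu := (lebesgue_rV R N).
Implicit Types (u : V -> R) (x y z : V).

Lemma coord_cvg_cvg (v : nat -> V) x : coord_cvg v x -> v n @[n --> \oo] --> x.
Proof.
move=> vx; apply/cvg_ballP => e e0.
have : \forall n \near \oo, forall i : 'I_N, `|x 0 i - v n 0 i| < e.
  apply: filter_forall => i; have /cvgrPdist_lt := vx i; exact.
apply: filterS => n h; split=> // i j; rewrite (ord1 i); exact: h.
Qed.

Lemma differentiable_scont u : (forall x, differentiable u x) -> scont u.
Proof.
move=> du v x /coord_cvg_cvg vx.
exact: (cvg_comp _ _ vx (differentiable_continuous (du x))).
Qed.

Definition partial i u : V -> R := fun x => 'D_(delta_mx 0 i) u x.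

Lemma schwartz_scont u s : schwartz_real u -> scont (partials s u).
Proof. by move=> [du _]; exact: differentiable_scont. Qed.

Lemma schwartz_partial u i : schwartz_real u -> schwartz_real (partial i u).
Proof.
have E s : partials s (partial i u) = partials (rcons s i) u by rewrite /partials foldr_rcons.
move=> [du bu]; split => [s x|s k]; first by rewrite E; exact: du.
by have [M h] := bu (rcons s i) k; exists M => x; rewrite E.
Qed.

Lemma schwartz_decay u k : schwartz_real u ->
  exists C, 0 <= C /\ forall x, `|u x| <= C * decay k x.
Proof.
move=> [_ bu]; have [M hM] := bu [::] k; exists ((1 + N%:R) ^+ k * `|M|).
split=> [|x]; first by rewrite mulr_ge0// exprn_ge0// addr_ge0.
have h : 0 < 1 + l1norm x by rewrite ltr_wpDr// l1norm_ge0.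
rewrite /decay ler_pdivlMr ?exprn_gt0// mulrC.
apply: (@le_trans _ _ ((1 + N%:R) ^+ k * ((1 + enorm x) ^+ k * `|u x|))).
  rewrite mulrA -exprMn; apply: ler_wpM2r => //.
  rewrite lerXn2r ?nnegrE ?mulr_ge0 ?addr_ge0 ?enorm_ge0 ?l1norm_ge0//.
  rewrite mulrDl mul1r mulrDr mulr1 -addrA lerD2l.
  rewrite (le_trans (l1norm_le_enorm x))//.
  have := enorm_ge0 x; have : 0 <= N%:R :> R by []; lra.
rewrite ler_wpM2l ?exprn_ge0 ?addr_ge0//.
exact: le_trans (hM x) (ler_norm _).
Qed.

Lemma schwartz_bL1 u : schwartz_real u -> bL1 u.
Proof.
move=> Su; have [C [_ h]] := schwartz_decay (2 * N) Su.
by apply: bL1_le_decay h; apply: scont_measurable; exact: (@schwartz_scont u [::]).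
Qed.

Lemma differentiable_dirE u x z : differentiable u x ->
  'D_z u x = \sum_i z 0 i * partial i u x.
Proof.
move=> du; rewrite deriveE// {1}(row_sum_delta z) linear_sum; apply: eq_bigr => i _.
by rewrite linearZ /= /partial deriveE.
Qed.

Lemma is_derive_line u x z (t : R) : differentiable u (x + t *: z) ->
  is_derive t 1 (fun t => u (x + t *: z)) ('D_z u (x + t *: z)).
Proof.
move=> du.
have E : (fun h : R => h^-1 *: (((fun t => u (x + t *: z)) \o shift t) (h *: (1 : R)) - u (x + t *: z))) =
   (fun h : R => h^-1 *: ((u \o shift (x + t *: z)) (h *: z) - u (x + t *: z))).
  apply/funext => h /=; rewrite /shift/=; congr (_ *: (u _ - _)).
  by rewrite [h *: 1]mulr1 scalerDl addrCA addrA.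
by split; [rewrite /derivable E; exact: diff_derivable|rewrite /derive E].
Qed.

Lemma mvt_line u x z : (forall y, differentiable u y) ->
  exists2 c : R, 0 <= c <= 1 & u (x + z) - u x = \sum_i z 0 i * partial i u (x + c *: z).
Proof.
move=> du; pose g (t : R) := u (x + t *: z).
have dg (t : R) : is_derive t 1 g ('D_z u (x + t *: z)) by apply: is_derive_line.
have cg : {within `[0, 1], continuous g}.
  apply: continuous_subspaceT => t; apply: differentiable_continuous.
  by apply/derivable1_diffP; case: (dg t).
have [c] := @MVT_segment _ g _ 0 1 ler01 (fun t _ => dg t) cg.
rewrite in_itv/= => c01; rewrite /g subr0 mulr1 scale1r scale0r addr0 => h.
by exists c => //; rewrite h differentiable_dirE.
Qed.

Lemma abs_sum_coord z (b : 'I_N -> R) (B : R) : (forall i, `|b i| <= B) ->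
  `|\sum_i z 0 i * b i| <= l1norm z * B.
Proof.
move=> h; rewrite (le_trans (ler_norm_sum _ _ _))// mulr_suml; apply: ler_sum => i _.
by rewrite normrM ler_wpM2l.
Qed.

Lemma uniform_bound (F : 'I_N -> R -> Prop) :
  (forall i (a b : R), a <= b -> F i a -> F i b) -> (forall i, exists C, 0 <= C /\ F i C) ->
  exists C, 0 <= C /\ forall i, F i C.
Proof.
move=> mF /choice[C hC]; exists (\sum_i C i); split.
  by apply: sumr_ge0 => i _; have [] := hC i.
move=> i; have [_ h] := hC i; apply: mF h; rewrite (bigD1 i)//= lerDl.
by apply: sumr_ge0 => j _; have [] := hC j.
Qed.

Lemma schwartz_partials_decay u k : schwartz_real u ->
  exists C, 0 <= C /\ forall i x, `|partial i u x| <= C * decay k x.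
Proof.
move=> Su; apply: (@uniform_bound (fun i C => forall x, `|partial i u x| <= C * decay k x)).
  by move=> i a b ab h x; rewrite (le_trans (h x))// ler_wpM2r// ltW// decay_gt0.
by move=> i; exact/schwartz_decay/schwartz_partial.
Qed.

(** The decaying bound is limited to |z| <= 2 so that the intermediate point of the mean value
    theorem has a weight comparable to that of x; the bound without decay holds for every z. *)
Lemma schwartz_increment u k : schwartz_real u -> exists C, 0 <= C /\
  (forall x z, l1norm z <= 2 -> `|u (x + z) - u x| <= C * l1norm z * decay k x) /\
  (forall x z, `|u (x + z) - u x| <= C * l1norm z).
Proof.
move=> Su; have [C [C0 hC]] := schwartz_partials_decay k Su; have [du _] := Su.
have k1 : 1 <= 3 ^+ k :> R by rewrite exprn_ege1// ler1n.
exists (3 ^+ k * C); split; first by rewrite mulr_ge0// (le_trans _ k1).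
split=> x z; last first.
  have [c c01 ->] := mvt_line x z (du [::]); rewrite mulrC; apply: abs_sum_coord => i.
  apply: le_trans (hC i _) _; apply: (@le_trans _ _ (C * 1)).
    by rewrite ler_wpM2l// decay_le1.
  by rewrite mulr1 ler_peMl.
move=> z2; have [c /andP[c0 c1] ->] := mvt_line x z (du [::]).
rewrite -[leRHS]mulrA [leRHS]mulrCA; apply: abs_sum_coord => i.
apply: le_trans (hC i _) _; rewrite [3 ^+ k * C]mulrC -mulrA ler_wpM2l//.
apply: decay_shift; rewrite opprD addNKr l1normN l1normZ ger0_norm//.
by apply: le_trans z2; rewrite ler_piMl// l1norm_ge0.
Qed.

Lemma schwartz_taylor2 u : schwartz_real u -> exists C, 0 <= C /\
  forall x z, `|u (x + z) - u x - \sum_i z 0 i * partial i u x| <= C * l1norm z ^+ 2.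
Proof.
move=> Su; have [du _] := Su.
have [C [C0 hC]] : exists C, 0 <= C /\ forall i x z,
    `|partial i u (x + z) - partial i u x| <= C * l1norm z.
  apply: (@uniform_bound (fun i C => forall x z, `|partial i u (x + z) - partial i u x| <= C * l1norm z)).
    by move=> i a b ab h x z; rewrite (le_trans (h x z))// ler_wpM2r// l1norm_ge0.
  by move=> i; have [C [C0 [_ h]]] := schwartz_increment 0 (schwartz_partial i Su); exists C.
exists C; split=> // x z; have [c /andP[c0 c1] ->] := mvt_line x z (du [::]).
rewrite -sumrB; under eq_bigr do rewrite -mulrBr.
rewrite expr2 mulrCA; apply: abs_sum_coord => i; apply: le_trans (hC i x _) _.
by rewrite l1normZ ger0_norm// ler_wpM2l// ler_piMl// l1norm_ge0.
Qed.

(** The mean value theorem in direction v is applied to y -> u (y - z) - u y, and then the increment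
    bound in direction z to each partial derivative of u. *)
Lemma schwartz_second_difference u k : schwartz_real u -> exists C, 0 <= C /\
  forall x v z, l1norm v <= 2 -> l1norm z <= 2 ->
   `|(u (x - z + v) - u (x - z)) - (u (x + v) - u x)| <= C * l1norm v * l1norm z * decay k x.
Proof.
move=> Su; have [du _] := Su.
have [C [C0 hC]] : exists C, 0 <= C /\ forall i x z, l1norm z <= 2 ->
    `|partial i u (x + z) - partial i u x| <= C * l1norm z * decay k x.
  apply: (@uniform_bound (fun i C => forall x z, l1norm z <= 2 ->
      `|partial i u (x + z) - partial i u x| <= C * l1norm z * decay k x)).
    move=> i a b ab h x z z2; rewrite (le_trans (h x z z2))// ler_wpM2r ?(ltW (decay_gt0 _ _))//.
    by rewrite ler_wpM2r// l1norm_ge0.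
  by move=> i; have [C [C0 [h _]]] := schwartz_increment k (schwartz_partial i Su); exists C.
exists (3 ^+ k * C); split; first by rewrite mulr_ge0// exprn_ge0.
move=> x v z v2 z2; pose w y := u (y - z) - u y.
have dsh y : differentiable (fun y => u (y - z)) y.
  apply: differentiable_comp => //; last exact: (du [::]).
have dw y : differentiable w y.
  apply: differentiableB; [exact: dsh|exact: (du [::])].
have [c /andP[c0 c1]] := mvt_line x v dw.
rewrite /w (_ : u (x + v - z) - u (x + v) - (u (x - z) - u x) =
  (u (x - z + v) - u (x - z)) - (u (x + v) - u x)); last first.
  by rewrite [x - z + v]addrAC; move: (u _) (u _) (u _) (u _) => a b e f; lra.
move=> ->; set y := x + c *: v.
have -> : 3 ^+ k * C * l1norm v * l1norm z * decay k x =
  l1norm v * (C * l1norm z * (3 ^+ k * decay k x)) by ring.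
apply: abs_sum_coord => i.
have -> : partial i (fun y => u (y - z) - u y) y = partial i u (y + - z) - partial i u y.
  rewrite /partial deriveB; first last.
  - exact/diff_derivable/(du [::]).
  - exact/diff_derivable/dsh.
  congr (_ - _); rewrite /derive.
  rewrite (_ : (fun h : R => h^-1 *: (((fun y => u (y - z)) \o shift y) (h *: delta_mx 0 i) - u (y - z))) =
    (fun h : R => h^-1 *: ((u \o shift (y - z)) (h *: delta_mx 0 i) - u (y - z))))//.
  by apply/funext => h; congr (_ *: (u _ - _)); rewrite /= (addrA _ y).
apply: le_trans (hC i y (- z) _) _; first by rewrite l1normN.
rewrite l1normN ler_wpM2l ?mulr_ge0 ?l1norm_ge0//; apply: decay_shift.
rewrite /y opprD addNKr l1normN l1normZ ger0_norm//.
by apply: le_trans v2; rewrite ler_piMl// l1norm_ge0.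
Qed.

End schwartz_functions.

(** * Fourier uniqueness *)

Section sinc.
Context {R : realType}.
Implicit Types t x : R.

Lemma prod_le1 I (r : seq I) (F : I -> R) : (forall i, 0 <= F i <= 1) ->
  \prod_(i <- r) F i <= 1.
Proof.
move=> h; elim: r => [|i r IH]; first by rewrite big_nil.
have /andP[h0 h1] := h i; rewrite big_cons mulr_ile1// prodr_ge0// => j _.
by have /andP[] := h j.
Qed.

Lemma sin_mvt x : exists2 c : R, 0 <= c <= 1 & sin x = x * cos (c * x).
Proof.
have dl t : is_derive t 1 (fun s : R => s * x) x.
  by apply: is_derive_eq; rewrite scaler0 add0r [_ *: _]mulr1.
have dg t : is_derive t 1 (fun s : R => sin (s * x)) (cos (t * x) * x).
  exact: (@is_derive1_comp R (@sin R) (fun s : R => s * x) t _ _ (is_derive_sin (t * x)) (dl t)).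
have cg : {within `[0, 1], continuous (fun s : R => sin (s * x))}.
  apply: continuous_subspaceT => t; apply: differentiable_continuous.
  by apply/derivable1_diffP; case: (dg t).
have [c] := @MVT_segment _ _ _ 0 1 ler01 (fun t _ => dg t) cg.
rewrite in_itv/= => c01; rewrite mul1r mul0r sin0 !subr0 mulr1 => h.
by exists c => //; rewrite h mulrC.
Qed.

(** Viete's partial products for sin t / t. A function whose transform vanishes is annihilated by
    all products of cosines, hence in the limit by the Fejer kernel; uniqueness follows without an
    inversion formula. *)
Definition viete n t : R := \prod_(k < n) cos (t / 2 ^+ k.+1).

Lemma sin_viete n t : sin t = 2 ^+ n * sin (t / 2 ^+ n) * viete n t.
Proof.
elim: n => [|n IH]; first by rewrite /viete big_ord0 expr0 divr1 mul1r mulr1.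
rewrite IH /viete big_ord_recr/= (_ : t / 2 ^+ n = t / 2 ^+ n.+1 + t / 2 ^+ n.+1); last first.
  by rewrite exprS; field; rewrite expf_neq0.
rewrite sinD exprS; ring.
Qed.

Lemma viete_le1 n t : `|viete n t| <= 1.
Proof.
by rewrite /viete normr_prod; apply: prod_le1 => k; rewrite normr_ge0/= cos_max.
Qed.

Definition sinc t : R := if t == 0 then 1 else sin t / t.

Lemma viete_cvg t : viete n t @[n --> \oo] --> sinc t.
Proof.
rewrite /sinc; case: eqVneq => [->|t0].
  apply: cvg_near_cst; near=> n; rewrite /viete big1// => k _.
  by rewrite mul0r cos0.
have /choice[c hc] n : exists c : R, 0 <= c <= 1 /\
    2 ^+ n * sin (t / 2 ^+ n) = t * cos (c * (t / 2 ^+ n)).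
  have [c c01 ->] := sin_mvt (t / 2 ^+ n); exists c; split=> //.
  by field; rewrite expf_neq0.
have geo : (fun n => `|t| / 2 ^+ n) @ \oo --> (0 : R).
  rewrite -[X in _ --> X](mulr0 `|t|); apply: cvgMr.
  rewrite (_ : (fun n => _) = (fun n => (2^-1) ^+ n)); last first.
    by apply/funext => k; rewrite exprVn.
  by apply: cvg_expr; rewrite ger0_norm ?invr_ge0// invf_lt1 ?ltr1n.
have cv : (fun n => t * cos (c n * (t / 2 ^+ n))) @ \oo --> t.
  rewrite -[X in _ --> X]mulr1; apply: cvgMr; rewrite -[X in _ --> X]cos0.
  apply: continuous_cvg; first exact: continuous_cos.
  apply/norm_cvg0P; apply: (squeeze_cvgr _ (cvg_cst 0) geo); near=> n.
  have [/andP[c0 c1] _] := hc n.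
  rewrite normr_ge0/= normrM ger0_norm// normrM [`|_^-1|]ger0_norm ?invr_ge0 ?exprn_ge0//.
  by rewrite ler_piMl// divr_ge0// exprn_ge0.
have E n : t * cos (c n * (t / 2 ^+ n)) * viete n t = sin t.
  by have [_ <-] := hc n; rewrite -sin_viete.
have cvV := cvgV t0 cv.
apply: (@cvg_trans _ ((fun n => sin t * (t * cos (c n * (t / 2 ^+ n)))^-1) @ \oo)); last first.
  by apply: cvgM; [exact: cvg_cst|exact: cvV].
apply: near_eq_cvg; near=> n.
have h : t * cos (c n * (t / 2 ^+ n)) != 0 by near: n; apply: cvgr_neq0 t0; exact: cv.
by rewrite -(E n) mulrAC mulfV// mul1r.
Unshelve. all: by end_near. Qed.

Lemma sinc_le1 t : `|sinc t| <= 1.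
Proof.
have := @viete_cvg t => /cvg_norm h.
rewrite -(cvg_lim (@Rhausdorff R) h); apply: limr_le; first exact: cvgP h.
by apply: nearW => n; exact: viete_le1.
Qed.

Lemma sinc_sqr_le t : sinc t ^+ 2 <= 2 * (1 + t ^+ 2)^-1.
Proof.
rewrite ler_pdivlMr ?ltr_wpDr ?sqr_ge0// mulrDr mulr1.
have h1 : sinc t ^+ 2 <= 1 by rewrite -[_ ^+ 2]ger0_norm ?sqr_ge0// normrX expr_le1// sinc_le1.
suff h2 : sinc t ^+ 2 * t ^+ 2 <= 1 by move: (_ * _) h2 => z; lra.
rewrite -exprMn /sinc; case: eqVneq => [->|t0]; first by rewrite mulr0 expr0n.
rewrite divfK// -[_ ^+ 2]ger0_norm ?sqr_ge0// normrX expr_le1//; exact: sin_max.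
Qed.

(** Only serves to show that the Fejer kernel has positive mass. *)
Lemma sinc_ge t : `|t| <= 1 -> cos 1 <= sinc t.
Proof.
move=> t1; rewrite /sinc; case: eqVneq => [_|t0]; first exact: cos_le1.
have [c /andP[c0 c1] ->] := sin_mvt t; rewrite mulrAC mulfV// mul1r -[leRHS]cos_norm.
have p2 : 2 <= (pi : R) by exact: pi_ge2.
have h : `|c * t| <= 1 by rewrite normrM ger0_norm// mulr_ile1.
have m1 : `|c * t| \in `[0, (pi : R)] by rewrite in_itv/= normr_ge0/=; lra.
have m2 : 1 \in `[0, (pi : R)] by rewrite in_itv/=; apply/andP; split; lra.
by rewrite leNgt (ltr_cos m2 m1) -leNgt.
Qed.

Lemma measurable_viete n : measurable_fun setT (viete n : measurableTypeR R -> R).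
Proof.
apply: measurable_fun_bigprod => k; apply: continuous_measurable_fun => t.
apply: (@continuous_comp _ _ _ (fun s : R => s / 2 ^+ k.+1) cos); last exact: continuous_cos.
by apply: cvgMl; exact: cvg_id.
Qed.

Lemma measurable_sinc : measurable_fun setT (sinc : measurableTypeR R -> R).
Proof.
apply: (@measurable_fun_cvg _ _ _ setT (fun n => viete n : measurableTypeR R -> R)).
  by move=> n; exact: measurable_viete.
by move=> t _; exact: viete_cvg.
Qed.

End sinc.

Section fejer_kernel.
Context {R : realType} {N : nat}.
Local Notation V := 'rV[R]_N.
Local Notation mu := (lebesgue_rV R N).
Local Notation leb := (@lebesgue_measure R).

(** Squaring makes the kernel nonnegative and, unlike sinc itself, integrable. *)
Definition fejer (x : V) : R := \prod_(i < N) sinc (x 0 i) ^+ 2.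

Lemma fejer_ge0 x : 0 <= fejer x.
Proof. by apply: prodr_ge0 => i _; exact: sqr_ge0. Qed.

Lemma fejer_le1 x : fejer x <= 1.
Proof.
apply: prod_le1 => i; rewrite sqr_ge0/= -[_ ^+ 2]ger0_norm ?sqr_ge0// normrX expr_le1//.
exact: sinc_le1.
Qed.

Let msq : measurable_fun setT (fun a : measurableTypeR R => sinc (a : R) ^+ 2).
Proof. by apply: measurable_funX; exact: measurable_sinc. Qed.

Lemma measurable_fejer : measurable_fun setT fejer.
Proof.
apply: measurable_fun_bigprod => i; apply: (measurableT_comp msq).
exact: measurable_rV_coord.
Qed.

Let I1 : \bar R := (\int[leb]_a (sinc (a : R) ^+ 2)%:E)%E.

Let I1_gt0 : (0 < I1)%E.
Proof.
pose A : set (measurableTypeR R) := [set` `[(-1 : R), 1]].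
have mA : measurable A by exact: measurable_itv.
have c1 : 0 < cos 1 :> R := cos1_gt0 R.
have mi : measurable_fun setT (\1_A : measurableTypeR R -> R) by exact: measurable_indic.
apply: (@lt_le_trans _ _ (nint leb (fun a : measurableTypeR R => cos 1 ^+ 2 * \1_A a)%R)).
  rewrite (nintZ leb mi)//; last by rewrite exprn_ge0// ltW.
  rewrite mule_gt0// ?lte_fin ?exprn_gt0//.
  apply: (@lt_le_trans _ _ (leb A)); last by rewrite /nint integral_indic// setIT.
  have -> : leb A = 2%:E.
    apply: etrans (lebesgue_measure_itv `[(-1 : R), 1]) _.
    have h : -1 < 1 :> R by lra.
    by rewrite /= lte_fin h -EFinD opprK.
  by rewrite lte_fin.
apply: le_nint => //; first by apply: measurable_funM => //; exact: measurable_cst.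
  by move=> a; rewrite mulr_ge0// exprn_ge0// ltW.
move=> a; rewrite indicE; case: (boolP (a \in A)) => [|_]; last by rewrite mulr0 sqr_ge0.
rewrite inE /A/= in_itv/= -ler_norml => a1.
by rewrite mulr1 lerXn2r ?nnegrE ?(ltW c1) ?(le_trans (ltW c1) (sinc_ge a1)) ?sinc_ge.
Qed.

Let I1_fin : (I1 < +oo)%E.
Proof.
have mo : measurable_fun setT (fun a : measurableTypeR R => (oneDsqr (a : R))^-1).
  apply: continuous_measurable_fun; exact: continuous_oneDsqrV.
apply: (@le_lt_trans _ _ (nint leb (fun a : measurableTypeR R => 2 * (oneDsqr (a : R))^-1)%R)).
  apply: le_nint => //.
  - by apply: measurable_funM => //; exact: measurable_cst.
  - by move=> a; exact: sqr_ge0.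
  - by move=> a; exact: sinc_sqr_le.
have u0 (a : measurableTypeR R) : 0 <= (oneDsqr (a : R))^-1 :> R.
  by rewrite invr_ge0 addr_ge0// sqr_ge0.
rewrite (nintZ leb mo (ler0n _ _) u0) lte_mul_pinfty//; exact: nint_oneDsqrV.
Qed.

Let nint_fejer : nint mu fejer = (\prod_(i < N) I1)%E.
Proof. by rewrite /nint (@integral_prod_rV R N (fun a : measurableTypeR R => sinc (a : R) ^+ 2))// => a; exact: sqr_ge0. Qed.

Lemma bL1_fejer : bL1 fejer.
Proof.
split; first exact: measurable_fejer.
  by exists 1 => x; rewrite ger0_norm ?fejer_ge0// fejer_le1.
apply/integrable_nintP; first exact: measurable_fejer.
under eq_fun do rewrite ger0_norm ?fejer_ge0//; rewrite nint_fejer.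
elim: (index_enum _) => [|i s IH]; first by rewrite big_nil ltry.
rewrite big_cons; move: IH I1_gt0 I1_fin; case: I1 => [x| |]// IH x0 _.
by apply: lte_mul_pinfty => //; exact: ltW.
Qed.

Lemma Rintegral_fejer_gt0 : 0 < \int[mu]_x fejer x.
Proof.
rewrite -lte_fin nint_Rintegral; [|exact: fejer_ge0|by have [] := bL1_fejer].
rewrite nint_fejer; elim: (index_enum _) => [|i s IH]; first by rewrite big_nil lte01.
rewrite big_cons; exact: mule_gt0 I1_gt0 IH.
Qed.

End fejer_kernel.

Section fourier_uniqueness.
Context {R : realType} {N : nat}.
Local Notation V := 'rV[R]_N.
Local Notation mu := (lebesgue_rV R N).
Implicit Types (g k w : V -> R) (x xi : V).

(** The transform of a real function, split into cosine and sine parts so that all integrals stay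
    real. *)
Definition fcos g xi : R := \int[mu]_x (g x * cos (dotv x xi)).
Definition fsin g xi : R := \int[mu]_x (g x * sin (dotv x xi)).

Lemma dotvDr x xi z : dotv x (xi + z) = dotv x xi + dotv x z.
Proof. by rewrite /dotv -big_split/=; apply: eq_bigr => i _; rewrite mxE mulrDr. Qed.

Lemma dotvDl x y xi : dotv (x + y) xi = dotv x xi + dotv y xi.
Proof. by rewrite /dotv -big_split/=; apply: eq_bigr => i _; rewrite mxE mulrDl. Qed.

Lemma dotvZr x c xi : dotv x (c *: xi) = c * dotv x xi.
Proof. by rewrite /dotv mulr_sumr; apply: eq_bigr => i _; rewrite mxE mulrCA. Qed.

Lemma dotvNr x xi : dotv x (- xi) = - dotv x xi.
Proof. by rewrite -scaleN1r dotvZr mulN1r. Qed.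

Lemma dotvZl x c xi : dotv (c *: x) xi = c * dotv x xi.
Proof. by rewrite /dotv mulr_sumr; apply: eq_bigr => i _; rewrite mxE mulrA. Qed.

Lemma dotv_delta x a i : dotv x (a *: delta_mx 0 i) = a * x 0 i.
Proof.
rewrite dotvZr /dotv (bigD1 i)//= big1 ?addr0 => [|j ji].
  by rewrite mxE !eqxx mulr1.
by rewrite mxE eqxx (negbTE ji) mulr0.
Qed.

Lemma scont_dotv xi : scont (fun x => dotv x xi).
Proof. by apply: scont_sum => i u x ux; apply: cvgMl; exact: ux. Qed.

Lemma scont_cos_dotv xi : scont (fun x => cos (dotv x xi)).
Proof. exact: (@scont_comp _ _ (@cos R) (fun x => dotv x xi) (@continuous_cos R) (@scont_dotv xi)). Qed.

Lemma scont_sin_dotv xi : scont (fun x => sin (dotv x xi)).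
Proof. exact: (@scont_comp _ _ (@sin R) (fun x => dotv x xi) (@continuous_sin R) (@scont_dotv xi)). Qed.

Lemma bL1_cos g xi : bL1 g -> bL1 (fun x => g x * cos (dotv x xi)).
Proof.
move=> Hg; rewrite (_ : (fun x => _) = (fun x => cos (dotv x xi) * g x)); last first.
  by apply/funext => x; rewrite mulrC.
apply: (bL1M (M := 1) Hg) => [|x]; last exact: cos_max.
by apply: scont_measurable; exact: scont_cos_dotv.
Qed.

Lemma bL1_sin g xi : bL1 g -> bL1 (fun x => g x * sin (dotv x xi)).
Proof.
move=> Hg; rewrite (_ : (fun x => _) = (fun x => sin (dotv x xi) * g x)); last first.
  by apply/funext => x; rewrite mulrC.
apply: (bL1M (M := 1) Hg) => [|x]; last exact: sin_max.
by apply: scont_measurable; exact: scont_sin_dotv.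
Qed.

Lemma RintegralD_bL1 g k : bL1 g -> bL1 k ->
  \int[mu]_x (g x + k x) = \int[mu]_x g x + \int[mu]_x k x.
Proof. by move=> [_ _ Ig] [_ _ Ik]; exact: RintegralD. Qed.

Lemma RintegralB_bL1 g k : bL1 g -> bL1 k ->
  \int[mu]_x (g x - k x) = \int[mu]_x g x - \int[mu]_x k x.
Proof. by move=> [_ _ Ig] [_ _ Ik]; exact: RintegralB. Qed.

Lemma RintegralZ_bL1 c g : bL1 g -> \int[mu]_x (c * g x) = c * \int[mu]_x g x.
Proof. by move=> [_ _ Ig]; exact: RintegralZl. Qed.

Definition fourier_null g := forall xi, fcos g xi = 0 /\ fsin g xi = 0.

(** By the addition formulas, multiplication by a cosine averages the transform over two shifted
    frequencies. *)
Lemma fourier_null_cos g a i : bL1 g -> fourier_null g ->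
  bL1 (fun x => g x * cos (a * x 0 i)) /\ fourier_null (fun x => g x * cos (a * x 0 i)).
Proof.
move=> Hg ng; have E x : a * x 0 i = dotv x (a *: delta_mx 0 i) by rewrite dotv_delta.
split; first by under eq_fun do rewrite E; exact: bL1_cos.
move=> xi; pose z := a *: (delta_mx 0 i : V).
have [c1 s1] := ng (xi + z); have [c2 s2] := ng (xi - z).
split.
  rewrite /fcos (_ : (fun x => _) = (fun x => 2^-1 * (g x * cos (dotv x (xi + z)) + g x * cos (dotv x (xi - z))))).
    rewrite RintegralZ_bL1 ?RintegralD_bL1; try by do ?apply: bL1D; exact: bL1_cos.
    by move: c1 c2; rewrite /fcos => -> ->; rewrite addr0 mulr0.
  apply/funext => x; rewrite E -/z !dotvDr dotvNr cosD cosB; by field.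
rewrite /fsin (_ : (fun x => _) = (fun x => 2^-1 * (g x * sin (dotv x (xi + z)) + g x * sin (dotv x (xi - z))))).
  rewrite RintegralZ_bL1 ?RintegralD_bL1; try by do ?apply: bL1D; exact: bL1_sin.
  by move: s1 s2; rewrite /fsin => -> ->; rewrite addr0 mulr0.
apply/funext => x; rewrite E -/z !dotvDr dotvNr sinD sinB; by field.
Qed.

Lemma fourier_null_prod g J (r : seq J) (a : J -> R) (c : J -> 'I_N) : bL1 g -> fourier_null g ->
  bL1 (fun x => g x * \prod_(j <- r) cos (a j * x 0 (c j))) /\
  fourier_null (fun x => g x * \prod_(j <- r) cos (a j * x 0 (c j))).
Proof.
move=> Hg ng; elim: r => [|j r [IH1 IH2]].
  by under eq_fun do rewrite big_nil mulr1.
under eq_fun do rewrite big_cons mulrCA [_ * _]mulrC.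
exact: fourier_null_cos.
Qed.

(** The square of a product of cosines, evaluated at frequency 0, integrates to 0 against g; since
    |P n| <= 1, the function |g| dominates the passage to sinc squared. *)
Lemma fourier_null_fejer g l : bL1 g -> fourier_null g ->
  \int[mu]_x (g x * fejer (l *: x)) = 0.
Proof.
move=> Hg ng; have [mg _ Ig] := Hg.
pose P n x : R := \prod_(i < N) viete n (l * x 0 i).
have PE n x : P n x = \prod_(j : 'I_N * 'I_n) cos (l / 2 ^+ j.2.+1 * x 0 j.1).
  transitivity (\prod_(i < N) \prod_(k < n) cos (l / 2 ^+ k.+1 * x 0 i)).
    by apply: eq_bigr => i _; apply: eq_bigr => k _; rewrite mulrAC.
  by rewrite pair_bigA.
have P1 n x : `|P n x| <= 1.
  by rewrite /P normr_prod; apply: prod_le1 => i; rewrite normr_ge0/= viete_le1.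
have hP n : bL1 (fun x => g x * (P n x * P n x)) /\ \int[mu]_x (g x * (P n x * P n x)) = 0.
  have [H1 n1] := @fourier_null_prod g _ (index_enum ('I_N * 'I_n)%type)
     (fun j => l / 2 ^+ (nat_of_ord j.2).+1) (fun j => j.1) Hg ng.
  have [H2 n2] := @fourier_null_prod _ _ (index_enum ('I_N * 'I_n)%type)
     (fun j => l / 2 ^+ (nat_of_ord j.2).+1) (fun j => j.1) H1 n1.
  have E : (fun x => g x * (P n x * P n x)) = (fun x =>
     g x * (\prod_(j : 'I_N * 'I_n) cos (l / 2 ^+ j.2.+1 * x 0 j.1)) *
     (\prod_(j : 'I_N * 'I_n) cos (l / 2 ^+ j.2.+1 * x 0 j.1))).
    by apply/funext => x; rewrite !PE mulrA.
  rewrite E; split=> //; have [+ _] := n2 0; rewrite /fcos => <-.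
  by apply: eq_Rintegral => x _; rewrite -(scale0r 0) dotvZr mul0r cos0 mulr1.
have cv : \int[mu]_x (g x * (P n x * P n x)) @[n --> \oo] --> \int[mu]_x (g x * fejer (l *: x)).
  apply: (@dominated_Rintegral _ _ _ mu (fun n x => g x * (P n x * P n x)) _ (fun x => `|g x|)).
  - by move=> n; have [[]] := hP n.
  - apply: measurable_funM => //; apply: (measurableT_comp measurable_fejer).
    exact: measurable_scale_rV.
  - move=> x; apply: cvgMr; rewrite /fejer.
    have -> : \prod_(i < N) sinc ((l *: x) 0 i) ^+ 2 =
       (\prod_(i < N) sinc (l * x 0 i)) * (\prod_(i < N) sinc (l * x 0 i)).
      by rewrite -big_split/=; apply: eq_bigr => i _; rewrite mxE expr2.
    have h : P n x @[n --> \oo] --> \prod_(i < N) sinc (l * x 0 i).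
      rewrite /P; elim: (index_enum _) => [|i s IH].
        by under eq_fun do rewrite big_nil; rewrite big_nil; exact: cvg_cst.
      under eq_fun do rewrite big_cons; rewrite big_cons; apply: cvgM => //.
      exact: viete_cvg.
    exact: cvgM.
  - exact: integrableR_norm.
  - move=> n x; rewrite normrM ler_piMr// normrM mulr_ile1//.
have := cv; under eq_fun do rewrite (hP _).2.
by move=> h; apply: (cvg_unique _ h (cvg_cst 0)).
Qed.

(** The Fejer kernel is concentrated at the origin: in the limit the vanishing integrals become g 0
    times its positive mass. *)
Lemma fourier_null_eq0 g : bL1 g -> scont g -> fourier_null g -> g 0 = 0.
Proof.
move=> Hg cg ng; have [mg _ Ig] := Hg; have [M [M0 gM]] := bL1_bound Hg.
have mF := @measurable_fejer R N.
have h n : \int[mu]_x (g (n.+1%:R^-1 *: x) * fejer x) = 0.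
  have l0 : n.+1%:R != 0 :> R by rewrite pnatr_eq0.
  have := fourier_null_fejer n.+1%:R Hg ng.
  rewrite (@Rintegral_affine _ _ n.+1%:R^-1 0 (fun x => g x * fejer (n.+1%:R *: x))) ?invr_eq0//.
    move/eqP; rewrite mulf_eq0 expf_eq0 normr_eq0 invr_eq0 (negbTE l0) andbF/= => /eqP <-.
    by apply: eq_Rintegral => x _; rewrite addr0 scalerA mulfV// scale1r.
  have [] // : bL1 (fun x => g x * fejer (n.+1%:R *: x)).
  under eq_fun do rewrite mulrC; apply: (bL1M (M := 1) Hg).
    by apply: (measurableT_comp mF); exact: measurable_scale_rV.
  by move=> x; rewrite ger0_norm ?fejer_ge0// fejer_le1.
have cv : \int[mu]_x (g (n.+1%:R^-1 *: x) * fejer x) @[n --> \oo] --> \int[mu]_x (g 0 * fejer x).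
  apply: (@dominated_Rintegral _ _ _ mu (fun n x => g (n.+1%:R^-1 *: x) * fejer x) _ (fun x => M * fejer x)).
  - by move=> n; apply: measurable_funM => //; apply: (measurableT_comp mg); exact: measurable_scale_rV.
  - by apply: measurable_funM => //; exact: measurable_cst.
  - move=> x; apply: cvgMl; apply: cg => i; rewrite mxE.
    rewrite (_ : (fun _ => _) = (fun n => n.+1%:R^-1 * x 0 i)); last by apply/funext => n; rewrite mxE.
    by rewrite -[X in _ --> X](mul0r (x 0 i)); apply: cvgMl; exact: cvg_harmonic.
  - by apply: integrableRZ; have [] := @bL1_fejer R N.
  - by move=> n x; rewrite normrM [`|fejer x|]ger0_norm ?fejer_ge0// ler_wpM2r ?fejer_ge0.
have : \int[mu]_x (g 0 * fejer x) = 0.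
  by have := cv; under eq_fun do rewrite h; move=> h'; apply: (cvg_unique _ h' (cvg_cst 0)).
rewrite RintegralZ_bL1; last exact: bL1_fejer.
by move/eqP; rewrite mulf_eq0 (gt_eqF (@Rintegral_fejer_gt0 R N)) orbF => /eqP.
Qed.

Lemma fourier_null_shift g b : bL1 g -> fourier_null g -> fourier_null (fun x => g (x - b)).
Proof.
move=> Hg ng xi; have [c0 s0] := ng xi.
have Hc := bL1_cos xi Hg; have Hs := bL1_sin xi Hg.
have E h : bL1 h -> \int[mu]_x h (x - b) = \int[mu]_x h x.
  by move=> [_ _ Ih]; exact: Rintegral_shift.
split.
  rewrite /fcos (_ : (fun x => _) = (fun x => (fun y => cos (dotv b xi) * (g y * cos (dotv y xi)) -
      sin (dotv b xi) * (g y * sin (dotv y xi))) (x - b))); last first.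
    apply/funext => x /=; rewrite (_ : dotv x xi = dotv (x - b) xi + dotv b xi) ?cosD; [ring|by rewrite -dotvDl subrK].
  rewrite (E (fun y => cos (dotv b xi) * (g y * cos (dotv y xi)) -
      sin (dotv b xi) * (g y * sin (dotv y xi)))); last by apply: bL1B; exact: bL1Z.
  rewrite RintegralB_bL1 ?RintegralZ_bL1//; try exact: bL1Z.
  by move: c0 s0; rewrite /fcos /fsin => -> ->; rewrite !mulr0 subr0.
rewrite /fsin (_ : (fun x => _) = (fun x => (fun y => cos (dotv b xi) * (g y * sin (dotv y xi)) +
      sin (dotv b xi) * (g y * cos (dotv y xi))) (x - b))); last first.
  apply/funext => x /=; rewrite (_ : dotv x xi = dotv (x - b) xi + dotv b xi) ?sinD; [ring|by rewrite -dotvDl subrK].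
rewrite (E (fun y => cos (dotv b xi) * (g y * sin (dotv y xi)) +
      sin (dotv b xi) * (g y * cos (dotv y xi)))); last by apply: bL1D; exact: bL1Z.
rewrite RintegralD_bL1 ?RintegralZ_bL1//; try exact: bL1Z.
by move: c0 s0; rewrite /fcos /fsin => -> ->; rewrite !mulr0 addr0.
Qed.

Theorem fourier_uniqueness g k : bL1 g -> bL1 k -> scont g -> scont k ->
  (forall xi, fcos g xi = fcos k xi) -> (forall xi, fsin g xi = fsin k xi) ->
  forall x, g x = k x.
Proof.
move=> Hg Hk cg ck hc hs x.
have H : bL1 (fun y => g y - k y) by exact: bL1B.
have n0 : fourier_null (fun y => g y - k y).
  move=> xi; split.
    rewrite /fcos; under eq_Rintegral do rewrite mulrBl.
    rewrite RintegralB_bL1; [|exact: bL1_cos|exact: bL1_cos].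
    by have := hc xi; rewrite /fcos => ->; rewrite subrr.
  rewrite /fsin; under eq_Rintegral do rewrite mulrBl.
  rewrite RintegralB_bL1; [|exact: bL1_sin|exact: bL1_sin].
  by have := hs xi; rewrite /fsin => ->; rewrite subrr.
have c : scont (fun y => g y - k y) by apply: scontB.
have c2 : scont (fun y => g (y - - x) - k (y - - x)) by exact: (@scont_shift _ _ (fun y => g y - k y) (- x) c).
have := fourier_null_eq0 (bL1_shift (- x) H) c2 (fourier_null_shift (- x) H n0).
by rewrite opprK add0r => /eqP; rewrite subr_eq0 => /eqP.
Qed.

End fourier_uniqueness.

(** * Rules for the Fourier transform *)

Section fourier_transform_rules.
Context {R : realType} {N : nat}.
Local Notation V := 'rV[R]_N.
Local Notation mu := (lebesgue_rV R N).
Implicit Types (g k : V -> R) (x xi : V).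

Lemma fcos_dil c k xi : 0 < c -> bL1 k -> fcos (dil c k) xi = fcos k (c^-1 *: xi).
Proof.
move=> c0 Hk; have [_ _ Ik] := bL1_cos (c^-1 *: xi) Hk.
rewrite {2}/fcos -(Rintegral_dil c0 Ik); apply: eq_Rintegral => x _.
by rewrite /dil dotvZl dotvZr mulrA [c * _]mulrA mulfV ?gt_eqF// mul1r.
Qed.

Lemma fsin_dil c k xi : 0 < c -> bL1 k -> fsin (dil c k) xi = fsin k (c^-1 *: xi).
Proof.
move=> c0 Hk; have [_ _ Ik] := bL1_sin (c^-1 *: xi) Hk.
rewrite {2}/fsin -(Rintegral_dil c0 Ik); apply: eq_Rintegral => x _.
by rewrite /dil dotvZl dotvZr mulrA [c * _]mulrA mulfV ?gt_eqF// mul1r.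
Qed.

Lemma fcosN k xi : fcos k (- xi) = fcos k xi.
Proof. by apply: eq_Rintegral => x _; rewrite dotvNr cosN. Qed.

Lemma fsinN k xi : bL1 k -> fsin k (- xi) = - fsin k xi.
Proof.
move=> Hk; rewrite /fsin -mulN1r -RintegralZ_bL1; last exact: bL1_sin.
by apply: eq_Rintegral => x _; rewrite dotvNr sinN mulrN mulN1r.
Qed.

Lemma fcosD g k xi : bL1 g -> bL1 k -> fcos (fun x => g x + k x) xi = fcos g xi + fcos k xi.
Proof.
move=> Hg Hk; rewrite /fcos -RintegralD_bL1; [|exact: bL1_cos|exact: bL1_cos].
by apply: eq_Rintegral => x _; rewrite mulrDl.
Qed.

Lemma fsinD g k xi : bL1 g -> bL1 k -> fsin (fun x => g x + k x) xi = fsin g xi + fsin k xi.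
Proof.
move=> Hg Hk; rewrite /fsin -RintegralD_bL1; [|exact: bL1_sin|exact: bL1_sin].
by apply: eq_Rintegral => x _; rewrite mulrDl.
Qed.

Lemma fcosB g k xi : bL1 g -> bL1 k -> fcos (fun x => g x - k x) xi = fcos g xi - fcos k xi.
Proof.
move=> Hg Hk; rewrite /fcos -RintegralB_bL1; [|exact: bL1_cos|exact: bL1_cos].
by apply: eq_Rintegral => x _; rewrite mulrBl.
Qed.

Lemma fsinB g k xi : bL1 g -> bL1 k -> fsin (fun x => g x - k x) xi = fsin g xi - fsin k xi.
Proof.
move=> Hg Hk; rewrite /fsin -RintegralB_bL1; [|exact: bL1_sin|exact: bL1_sin].
by apply: eq_Rintegral => x _; rewrite mulrBl.
Qed.

Lemma fsin_even k xi : bL1 k -> (forall x, k (- x) = k x) -> fsin k xi = 0.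
Proof.
move=> Hk ek; have [_ _ Is] := bL1_sin xi Hk.
have : fsin k xi = - fsin k xi.
  rewrite -fsinN// /fsin -[LHS](Rintegral_reflect 0 Is); apply: eq_Rintegral => x _.
  by rewrite sub0r ek -scaleN1r dotvZl mulN1r dotvNr.
by move=> h; lra.
Qed.

Lemma Rintegral_conv g k : bL1 g -> bL1 k ->
  \int[mu]_x conv g k x = (\int[mu]_x g x) * \int[mu]_x k x.
Proof.
move=> Hg Hk; have [mg _ Ig] := Hg; have [mk _ Ik] := Hk.
have mg' : measurable_fun setT (fun x => `|g x|) by msr.
have mk' : measurable_fun setT (fun x => `|k x|) by msr.
rewrite /conv (@Rfubini _ _ _ V V mu mu (fun x y => g (x - y) * k y)).
- transitivity (\int[mu]_y ((\int[mu]_x g x) * k y)); last exact: RintegralZ_bL1.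
  apply: eq_Rintegral => y _; under eq_Rintegral do rewrite mulrC.
  rewrite RintegralZ_bL1; last exact: bL1_shift.
  by rewrite Rintegral_shift// mulrC.
- exact: measurable_conv_integrand.
- under eq_integral => x _.
    rewrite (_ : nint _ _ = nint mu (fun y => `|g (x - y)| * `|k y|)%R); last first.
      by apply: eq_integral => y _; rewrite normrM.
    over.
  rewrite (nint_conv_integrand mg' mk')// lte_mul_pinfty ?bL1_nint//; first exact: nint_ge0.
  by rewrite ge0_fin_numE ?bL1_nint//; exact: nint_ge0.
- by move=> x; have [] := bL1_conv_integrand x Hg Hk.
- move=> y; rewrite (_ : _ \o _ = EFin \o (fun x => k y * g (x - y))).
    by apply: integrableRZ; have [] := bL1_shift y Hg.
  by apply/funext => x /=; rewrite mulrC.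
Qed.

Lemma fcos_conv g k xi : bL1 g -> bL1 k ->
  fcos (conv g k) xi = fcos g xi * fcos k xi - fsin g xi * fsin k xi.
Proof.
move=> Hg Hk; have gc := bL1_cos xi Hg; have gs := bL1_sin xi Hg.
have kc := bL1_cos xi Hk; have ks := bL1_sin xi Hk.
rewrite /fcos /fsin -!Rintegral_conv// -RintegralB_bL1; try exact: bL1_conv.
apply: eq_Rintegral => x _; rewrite /conv mulrC -RintegralZ_bL1; last exact: bL1_conv_integrand.
rewrite -RintegralB_bL1; try exact: bL1_conv_integrand.
- apply: eq_Rintegral => y _.
  rewrite (_ : dotv x xi = dotv (x - y) xi + dotv y xi) ?cosD; [ring|by rewrite -dotvDl subrK].
- exact: (bL1_conv_integrand x gc kc).
- exact: (bL1_conv_integrand x gs ks).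
Qed.

Lemma fsin_conv g k xi : bL1 g -> bL1 k ->
  fsin (conv g k) xi = fsin g xi * fcos k xi + fcos g xi * fsin k xi.
Proof.
move=> Hg Hk; have gc := bL1_cos xi Hg; have gs := bL1_sin xi Hg.
have kc := bL1_cos xi Hk; have ks := bL1_sin xi Hk.
rewrite /fcos /fsin -!Rintegral_conv// -RintegralD_bL1; try exact: bL1_conv.
apply: eq_Rintegral => x _; rewrite /conv mulrC -RintegralZ_bL1; last exact: bL1_conv_integrand.
rewrite -RintegralD_bL1; try exact: bL1_conv_integrand.
- apply: eq_Rintegral => y _.
  rewrite (_ : dotv x xi = dotv (x - y) xi + dotv y xi) ?sinD; [ring|by rewrite -dotvDl subrK].
- exact: (bL1_conv_integrand x gs kc).
- exact: (bL1_conv_integrand x gc ks).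
Qed.

Lemma fourier_ReIm (f : V -> R[i]) xi : bL1 (fun x => complex.Re (f x)) ->
  bL1 (fun x => complex.Im (f x)) ->
  complex.Re (fourier f xi) = fcos (fun x => complex.Re (f x)) xi + fsin (fun x => complex.Im (f x)) xi /\
  complex.Im (fourier f xi) = fcos (fun x => complex.Im (f x)) xi - fsin (fun x => complex.Re (f x)) xi.
Proof.
move=> Hr Hi; have Hrc := bL1_cos xi Hr; have Hrs := bL1_sin xi Hr.
have Hic := bL1_cos xi Hi; have His := bL1_sin xi Hi.
split; rewrite /fourier /cintegral /cis /=.
  rewrite /fcos /fsin -RintegralD_bL1//; apply: eq_Rintegral => x _.
  by case: (f x) => a b /=; rewrite cosN sinN mulrN opprK.
rewrite /fcos /fsin -RintegralB_bL1//; apply: eq_Rintegral => x _.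
by case: (f x) => a b /=; rewrite cosN sinN mulrN addrC.
Qed.

Lemma conv_dil c g k : 0 < c -> bL1 g -> bL1 k ->
  conv (dil c g) (dil c k) = dil c (conv g k).
Proof.
move=> c0 Hg Hk; apply/funext => x.
have -> : dil c (conv g k) x = c ^+ N * \int[mu]_y (g (c *: x - y) * k y) by [].
rewrite /conv -(Rintegral_dil c0 (k := fun y => g (c *: x - y) * k y)); last first.
  by have [] := bL1_conv_integrand (c *: x) Hg Hk.
rewrite -RintegralZ_bL1; last by apply: bL1_dil => //; exact: bL1_conv_integrand.
by apply: eq_Rintegral => y _; rewrite /dil scalerBr; ring.
Qed.

End fourier_transform_rules.

(** * Telescoping and reproducing formulas for [eta] *)

Section littlewood_paley_structure.
Context {R : realType} {N : nat}.
Local Notation V := 'rV[R]_N.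
Local Notation mu := (lebesgue_rV R N).

Lemma enormZ c (x : V) : enorm (c *: x) = `|c| * enorm x.
Proof.
rewrite /enorm -sqrtr_sqr -sqrtrM ?sqr_ge0//; congr Num.sqrt.
by rewrite mulr_sumr; apply: eq_bigr => i _; rewrite mxE exprMn.
Qed.

(** phi is the real part of eta0; its transform is still 1 on the unit ball and 0 outside the ball
    of radius 2, as both sets are symmetric. All identities are verified on the Fourier side and
    transferred by uniqueness. *)
Theorem littlewood_paley_structure (eta : V -> R) : littlewood_paley eta ->
  exists phi : V -> R, [/\ schwartz_real phi, \int[mu]_x phi x = 1,
    eta = (fun x => phi x - dil 2^-1 phi x),
    \int[mu]_x eta x = 0 &
    forall x, eta x = conv (dil 2^-1 eta) eta x + conv eta eta x + conv (dil 2 eta) eta x].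
Proof.
move=> [Seta eeta [eta0 [[Sr Si] h1 h2 hF]]].
pose phi x := complex.Re (eta0 x); pose b x := complex.Im (eta0 x).
have Hphi : bL1 phi := schwartz_bL1 Sr; have Hb : bL1 b := schwartz_bL1 Si.
have Heta : bL1 eta := schwartz_bL1 Seta.
have ceta : scont eta := @schwartz_scont _ _ _ [::] Seta.
have cphi : scont phi := @schwartz_scont _ _ _ [::] Sr.
have FI xi := fourier_ReIm xi Hphi Hb.
have eN xi : enorm (- xi : V) = enorm xi by rewrite -scaleN1r enormZ normrN1 mul1r.
have Cphi xi : fcos phi xi = 2^-1 * (complex.Re (fourier eta0 xi) + complex.Re (fourier eta0 (- xi))).
  by rewrite !(FI _).1 fcosN fsinN//; field.
have Sphi xi : fsin phi xi = 2^-1 * (complex.Im (fourier eta0 (- xi)) - complex.Im (fourier eta0 xi)).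
  by rewrite !(FI _).2 fcosN fsinN//; field.
have C1 xi : enorm xi <= 1 -> fcos phi xi = 1 by move=> h; rewrite Cphi !h1 ?eN//=; field.
have S1 xi : enorm xi <= 1 -> fsin phi xi = 0 by move=> h; rewrite Sphi !h1 ?eN//= subrr mulr0.
have C2 xi : 2 <= enorm xi -> fcos phi xi = 0 by move=> h; rewrite Cphi !h2 ?eN//= addr0 mulr0.
have S2 xi : 2 <= enorm xi -> fsin phi xi = 0 by move=> h; rewrite Sphi !h2 ?eN//= subrr mulr0.
have H0 : bL1 (fun _ : V => 0 : R) by exact: bL10.
have FE xi := @fourier_ReIm _ _ (fun x => (eta x)%:C%C) xi Heta H0.
have Z (xi : V) : fcos (fun=> 0) xi = 0 :> R /\ fsin (fun=> 0) xi = 0 :> R.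
  by split; rewrite /fcos /fsin; under eq_Rintegral do rewrite mul0r; rewrite Rintegral_cst ?mul0r.
have Se xi : fsin eta xi = 0 by exact: fsin_even.
have Ce xi : fcos eta xi = fcos phi xi - fcos phi (2 *: xi).
  have E x : complex.Re (fourier (fun x => (eta x)%:C%C) x) = fcos eta x.
    by rewrite (FE x).1 (Z x).2 addr0.
  have E2 x : fcos eta x = complex.Re (fourier eta0 x) - complex.Re (fourier eta0 (2 *: x)).
    by rewrite -E hF; case: (fourier eta0 x) => ? ?; case: (fourier eta0 (2 *: x)).
  have n2 : - (2 *: xi) = 2 *: - xi by rewrite scalerN.
  rewrite !Cphi n2.
  have e1 := E2 xi; have := E2 (- xi); rewrite fcosN => e2.
  by move: (fcos eta xi) (complex.Re _) (complex.Re _) (complex.Re _) (complex.Re _) e1 e2 => a0 a1 a2 a3 a4; lra.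
have Ss xi : fsin phi xi - fsin phi (2 *: xi) = 0.
  have E x : complex.Im (fourier (fun x => (eta x)%:C%C) x) = 0.
    by rewrite (FE x).2 (Z x).1 Se subr0.
  have E2 x : 0 = complex.Im (fourier eta0 x) - complex.Im (fourier eta0 (2 *: x)).
    by rewrite -(E x) hF; case: (fourier eta0 x) => ? ?; case: (fourier eta0 (2 *: x)).
  have n2 : - (2 *: xi) = 2 *: - xi by rewrite scalerN.
  rewrite !Sphi n2.
  have := E2 xi; have := E2 (- xi).
  move: (complex.Im _) (complex.Im _) (complex.Im _) (complex.Im _) => a1 a2 a3 a4; lra.
have h20 : 0 < 2^-1 :> R by rewrite invr_gt0.
exists phi; split => //.
- have := C1 0; rewrite /enorm big1 ?sqrtr0 => [/(_ ler01) <-|i _]; last by rewrite mxE expr0n.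
  by apply: eq_Rintegral => x _; rewrite -(scale0r 0) dotvZr mul0r cos0 mulr1.
- apply/funext; apply: fourier_uniqueness => //.
  + by apply: bL1B => //; exact: bL1_dil.
  + by apply: scontB => //; exact: scont_dil.
  + by move=> xi; rewrite fcosB ?fcos_dil ?invrK//; exact: bL1_dil.
  + by move=> xi; rewrite fsinB ?fsin_dil ?invrK ?Ss ?Se//; exact: bL1_dil.
- have := Ce 0; rewrite scaler0 subrr => <-.
  by apply: eq_Rintegral => x _; rewrite -(scale0r 0) dotvZr mul0r cos0 mulr1.
have Hd c : 0 < c -> bL1 (conv (dil c eta) eta) by move=> c0; apply: bL1_conv => //; exact: bL1_dil.
have He : bL1 (conv eta eta) by exact: bL1_conv.
have cc k : scont k -> bL1 k -> scont (conv k eta).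
  by move=> ck [mk bk _]; apply: scont_conv => //; have [] := Heta.
apply: fourier_uniqueness => //.
- by do 2?apply: bL1D => //; exact: Hd.
- apply: scontD; [apply: scontD|]; apply: cc => //; try (by apply: scont_dil); by apply: bL1_dil.
- move=> xi; rewrite !fcosD ?fcos_conv ?fcos_dil ?fsin_dil ?invrK ?Se//; try (by apply: Hd); try (by apply: bL1_dil); last first.
    by apply: bL1D => //; exact: Hd.
  rewrite !mulr0 !subr0 -!mulrDl.
  have [z|nz] := eqVneq (fcos eta xi) 0; first by rewrite z mulr0.
  have x2 : enorm xi <= 2.
    rewrite leNgt; apply: contra nz => h; rewrite Ce !C2 ?subrr ?(ltW h)// enormZ ger0_norm//.
    by have := enorm_ge0 xi; lra.
  have x1 : 2^-1 <= enorm xi.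
    rewrite leNgt; apply: contra nz => h; rewrite Ce !C1 ?subrr// ?enormZ ?ger0_norm//; lra.
  (* For 1/2 <= |xi| <= 2 the transforms of the three neighbours telescope to that of phi at xi / 2
     minus that at 4 xi, which is 1 - 0. *)
  rewrite !Ce !scalerA mulfV ?pnatr_eq0// scale1r.
  rewrite [X in X * _](_ : _ = fcos phi (2^-1 *: xi) - fcos phi ((2 * 2) *: xi)); last by ring.
  by rewrite (C1 (2^-1 *: xi)) ?(C2 ((2 * 2) *: xi)) ?subr0 ?mul1r// enormZ ger0_norm//; lra.
- move=> xi; rewrite !fsinD ?fsin_conv ?fcos_dil ?fsin_dil ?invrK ?Se//; try (by apply: Hd); try (by apply: bL1_dil); last first.
    by apply: bL1D => //; exact: Hd.
  by rewrite !mulr0 !mul0r !addr0.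
Qed.

End littlewood_paley_structure.

(** * Littlewood-Paley pieces *)

Section lp_kernel_members.
Context {R : realType} {N : nat}.
Local Notation V := 'rV[R]_N.
Local Notation mu := (lebesgue_rV R N).
Implicit Types (eta psi : V -> R) (x v z : V).

Lemma lp_kernel_le A B psi : A <= B -> lp_kernel A psi -> lp_kernel B psi.
Proof.
move=> AB [H h1 h2 h3 h4]; split=> //.
- by apply: le_trans h1 _; rewrite lee_fin.
- by apply: le_trans h2 _; rewrite lee_fin.
- by move=> z; apply: le_trans (h3 z) _; rewrite lee_fin ler_wpM2r// l1norm_ge0.
Qed.

(** Dividing by |v| keeps the kernels in one class [lp_kernel A] as v tends to 0; for v = 0 the
    kernel is 0. *)
Definition difference_kernel eta v x : R := (l1norm v)^-1 * (eta (x + v) - eta x).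
(** The kernel that trades one derivative: increments of F integrated against [eta] are averages of
    the partial derivatives of F integrated against these. It has mean zero when [eta] is even. *)
Definition moment_kernel eta (i : 'I_N) x : R := - x 0 i * eta x.

Lemma scont_shiftD eta v : scont eta -> scont (fun x => eta (x + v)).
Proof. by move=> c; have := @scont_shift _ _ eta (- v) c; under eq_fun do rewrite opprK. Qed.

Lemma bL1_shiftD eta v : bL1 eta -> bL1 (fun x => eta (x + v)).
Proof. by move=> c; have := bL1_shift (- v) c; under eq_fun do rewrite opprK. Qed.

(** The range |v| <= 2 is the one that occurs: scales with t |h| <= 1, multiplied by a neighbour
    factor of at most 2. *)
Lemma difference_kernel_lp eta : schwartz_real eta -> exists A, 0 <= A /\
  forall v, l1norm v <= 2 -> lp_kernel A (difference_kernel eta v).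
Proof.
move=> Se; have [C1 [C10 [h1 _]]] := schwartz_increment (2 * N).+1 Se.
have [C2 [C20 h2]] := schwartz_second_difference (2 * N) Se.
have He := schwartz_bL1 Se; have ce : scont eta := @schwartz_scont _ _ _ [::] Se.
exists (2 * (C1 + C2) * @decay_mass R N); split.
  by rewrite mulr_ge0 ?decay_mass_ge0// mulr_ge0// addr_ge0.
move=> v v2; have l0 := l1norm_ge0 v.
have l1 : (l1norm v)^-1 * l1norm v <= 1.
  by have [->|n0] := eqVneq (l1norm v) 0; [rewrite mulr0|rewrite mulVf].
have li : 0 <= (l1norm v)^-1 by rewrite invr_ge0.
have ab (u B : R) : 0 <= B -> `|u| <= l1norm v * B -> `|(l1norm v)^-1 * u| <= B.
  move=> B0 h; rewrite normrM (ger0_norm li).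
  apply: (@le_trans _ _ ((l1norm v)^-1 * (l1norm v * B))); first exact: ler_wpM2l.
  by rewrite mulrA ler_piMl.
have d0 k x : 0 <= decay k x :> R by exact/ltW/decay_gt0.
apply: lp_kernel_decay; first by rewrite addr_ge0.
- by apply: scontZ; apply: scontB => //; exact: scont_shiftD.
- move=> x; apply: ab; first by rewrite mulr_ge0// addr_ge0.
  apply: le_trans (h1 x v v2) _; rewrite [C1 * _]mulrC -mulrA ler_wpM2l// ler_wpM2r// lerDl//.
- move=> x z z1; rewrite /difference_kernel -mulrBr; apply: ab.
    by rewrite !mulr_ge0 ?addr_ge0 ?l1norm_ge0.
  have z2 : l1norm z <= 2 by rewrite (le_trans z1)// ler1n.
  apply: le_trans (h2 x v z v2 z2) _.
  rewrite [C2 * _]mulrC -!mulrA ler_wpM2l// ler_wpM2r ?mulr_ge0 ?l1norm_ge0// lerDr//.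
- rewrite RintegralZ_bL1; last by apply: bL1B => //; exact: bL1_shiftD.
  rewrite RintegralB_bL1//; last exact: bL1_shiftD.
  have [_ _ Ie] := He; have := Rintegral_shift (- v) Ie.
  by under eq_Rintegral do rewrite opprK; move=> ->; rewrite subrr mulr0.
Qed.

Lemma moment_kernel_lp eta : schwartz_real eta -> (forall x, eta (- x) = eta x) ->
  exists A, 0 <= A /\ forall i, lp_kernel A (moment_kernel eta i).
Proof.
move=> Se ev; have [C1 [C10 [h1 _]]] := schwartz_increment (2 * N).+1 Se.
have [C2 [C20 h2]] := schwartz_decay (2 * N).+2 Se.
have ce : scont eta := @schwartz_scont _ _ _ [::] Se.
exists (2 * (C1 + C2) * @decay_mass R N); split.
  by rewrite mulr_ge0 ?decay_mass_ge0// mulr_ge0// addr_ge0.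
move=> i; have d0 k x : 0 <= decay k x :> R by exact/ltW/decay_gt0.
have cz : scont (moment_kernel eta i).
  by apply: scontM => //; move=> u x ux; apply: cvgN; exact: ux.
have b1 x : `|moment_kernel eta i x| <= C2 * decay (2 * N).+1 x.
  rewrite /moment_kernel normrM normrN; apply: (@le_trans _ _ (l1norm x * (C2 * decay (2 * N).+2 x))).
    by apply: ler_pM => //; exact: ler_coord_l1norm.
  by rewrite mulrCA ler_wpM2l// decayS.
have b2 x : `|moment_kernel eta i x| <= C2 * decay (2 * N) x.
  by apply: le_trans (b1 x) _; rewrite ler_wpM2l// decay_leS.
apply: lp_kernel_decay => //; first by rewrite addr_ge0.
- by move=> x; apply: le_trans (b1 x) _; rewrite ler_wpM2r// lerDr.
- move=> x z z1.
  have -> : moment_kernel eta i (x - z) - moment_kernel eta i x =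
    - (x 0 i - z 0 i) * (eta (x + - z) - eta x) + z 0 i * eta x.
    by rewrite /moment_kernel !mxE; ring.
  apply: le_trans (ler_normD _ _) _.
  have -> : (C1 + C2) * l1norm z * decay (2 * N) x =
    C1 * l1norm z * decay (2 * N) x + l1norm z * (C2 * decay (2 * N) x) by ring.
  apply: lerD.
    rewrite normrM normrN; apply: (@le_trans _ _ ((1 + l1norm x) * (C1 * l1norm z * decay (2 * N).+1 x))).
      apply: ler_pM => //.
        rewrite (le_trans (ler_normB _ _))// addrC lerD ?ler_coord_l1norm//.
        by rewrite (le_trans (ler_coord_l1norm _ _)).
      by rewrite -(l1normN z); apply: h1; rewrite l1normN (le_trans z1)// ler1n.
    have hx : 1 + l1norm x != 0 by rewrite gt_eqF// ltr_wpDr// l1norm_ge0.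
    by rewrite mulrCA ler_wpM2l ?mulr_ge0 ?l1norm_ge0// /decay exprS invfM mulrA mulfV// mul1r.
  rewrite normrM; apply: ler_pM => //; first exact: ler_coord_l1norm.
  by apply: le_trans (h2 x) _; rewrite ler_wpM2l// (le_trans (decay_leS _ _))// decay_leS.
- have Hz : bL1 (moment_kernel eta i) by apply: (bL1_le_decay (scont_measurable cz) b2).
  have [_ _ Iz] := Hz; have := Rintegral_reflect 0 Iz.
  under eq_Rintegral => x _.
    rewrite (_ : moment_kernel eta i (0 - x) = -1 * moment_kernel eta i x); last first.
      by rewrite /moment_kernel sub0r ev mxE; ring.
    over.
  rewrite RintegralZ_bL1// => h; lra.
Qed.

Lemma schwartz_lp_kernel eta : schwartz_real eta -> \int[mu]_x eta x = 0 ->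
  exists A, 0 <= A /\ lp_kernel A eta.
Proof.
move=> Se i0; have [C1 [C10 [h1 _]]] := schwartz_increment (2 * N) Se.
have [C2 [C20 h2]] := schwartz_decay (2 * N).+1 Se.
have ce : scont eta := @schwartz_scont _ _ _ [::] Se.
have d0 k x : 0 <= decay k x :> R by exact/ltW/decay_gt0.
exists (2 * (C1 + C2) * @decay_mass R N); split.
  by rewrite mulr_ge0 ?decay_mass_ge0// mulr_ge0// addr_ge0.
apply: lp_kernel_decay => //; first by rewrite addr_ge0.
- by move=> x; apply: le_trans (h2 x) _; rewrite ler_wpM2r// lerDr.
- move=> x z z1; rewrite -(l1normN z); apply: le_trans (h1 x (- z) _) _.
    by rewrite l1normN (le_trans z1)// ler1n.
  by rewrite ler_wpM2r// ler_wpM2r ?l1norm_ge0// lerDl.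
Qed.

End lp_kernel_members.

Section kernel_bounds.
Context {R : realType} {N : nat}.
Local Notation V := 'rV[R]_N.
Local Notation mu := (lebesgue_rV R N).

Lemma vnorm_ord1 (b : 'I_1 -> R) : vnorm b = `|b ord0|.
Proof. by rewrite /vnorm big_ord1 sqrtr_sqr. Qed.

Lemma vnorm_le (I : finType) (a b : I -> R) c : 0 <= c ->
  (forall i, `|a i| <= c * `|b i|) -> vnorm a <= c * vnorm b.
Proof.
move=> c0 h; rewrite -vnormZ//; apply: ler_wsqrtr; apply: ler_sum => i _.
rewrite -[leLHS]ger0_norm ?sqr_ge0// -[leRHS]ger0_norm ?sqr_ge0// !normrX.
by rewrite lerXn2r ?nnegrE// normrM (ger0_norm c0).
Qed.

(** The square function bounds with the singleton index set removed. *)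
Lemma kernel_bounds (p A : R) : (0 < N)%N -> 1 < p -> 0 < A ->
  exists C, 0 < C /\ forall n (a : R) (psi : 'I_n -> V -> R), 0 < a ->
    (forall i, lp_kernel A (psi i)) ->
    (forall G : 'I_n -> V -> R, (forall i, bL1 (G i)) -> (forall i, scont (G i)) ->
      (nint mu (fun x => `|\sum_(i < n) conv (dil (a * 2 ^+ i) (psi i)) (G i) x| `^ p)%R <=
       C%:E * nint mu (fun x => vabs G x `^ p)%R)%E) /\
    (forall f : V -> R, bL1 f -> scont f ->
      (nint mu (fun x => vabs (fun i : 'I_n => conv (dil (a * 2 ^+ i) (psi i)) f) x `^ p)%R <=
       C%:E * nint mu (fun x => `|f x| `^ p)%R)%E).
Proof.
move=> N0 p1 A0; have [C [C0 h]] := @littlewood_paley_bounds R N p A N0 p1 A0.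
exists C; split=> // n a psi a0 H; have [h1 h2] := h n a psi a0 H; split.
  move=> G HG cG; have := h1 G HG cG.
  have -> // : nint mu (fun x => vabs (vconv (synthesis_kernel a psi) G) x `^ p) =
      nint mu (fun x => `|\sum_(i < n) conv (dil (a * 2 ^+ i) (psi i)) (G i) x| `^ p).
  by apply: eq_integral => x _; rewrite /vabs vnorm_ord1.
move=> f Hf cf; have := h2 (fun=> f) (fun=> Hf) (fun=> cf).
have -> : nint mu (fun x => vabs (fun _ : 'I_1 => f) x `^ p) = nint mu (fun x => `|f x| `^ p).
  by apply: eq_integral => x _; rewrite /vabs vnorm_ord1.
have -> // : nint mu (fun x => vabs (vconv (analysis_kernel a psi) (fun=> f)) x `^ p) =
    nint mu (fun x => vabs (fun i : 'I_n => conv (dil (a * 2 ^+ i) (psi i)) f) x `^ p).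
apply: eq_integral => x _.
have e (i : 'I_n) : vconv (analysis_kernel a psi) (fun=> f) i x = conv (dil (a * 2 ^+ i) (psi i)) f x.
  by rewrite /vconv big_ord1.
rewrite /vabs /vnorm (eq_bigr (fun i : 'I_n => conv (dil (a * 2 ^+ i) (psi i)) f x ^+ 2))//.
by move=> i _; rewrite e.
Qed.

Lemma nint_powR_sum_le (I : finType) (F : I -> V -> R) p (X : \bar R) : 1 < p -> (0 <= X)%E ->
  (forall i, measurable_fun setT (F i)) -> (forall i x, 0 <= F i x) ->
  (forall i, (nint mu (fun x => F i x `^ p)%R <= X)%E) ->
  (nint mu (fun x => (\sum_i F i x) `^ p)%R <= (#|I|%:R `^ p)%:E * X)%E.
Proof.
move=> p1 X0 mF F0 hX; have p0 : 0 < p by rewrite (lt_trans _ p1).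
have mFp i : measurable_fun setT (fun x => F i x `^ p) by msr.
apply: (@le_trans _ _ (nint mu (fun x => #|I|%:R `^ (p - 1) * \sum_i F i x `^ p)%R)).
  apply: le_nint => //.
  - by apply: measurable_fun_powR; apply: measurable_fun_bigsum.
  - by apply: measurable_funM; [exact: measurable_cst|apply: measurable_fun_bigsum].
  - by move=> x; exact: powR_ge0.
  - by move=> x; apply: powR_sum_le.
rewrite nintZ ?powR_ge0//; [|by apply: measurable_fun_bigsum|by move=> x; apply: sumr_ge0 => i _; exact: powR_ge0].
rewrite nint_sum//; last by move=> i x; exact: powR_ge0.
rewrite -(mulr_powRB1 (ler0n _ _) p0) mulrC EFinM -muleA; apply: lee_wpmul2l.
  by rewrite lee_fin powR_ge0.
apply: (@le_trans _ _ (\sum_(i : I) X)%E); first by apply: lee_sum => i _.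
by rewrite sumr_const mule_natl.
Qed.

End kernel_bounds.

Section littlewood_paley_pieces.
Context {R : realType} {N : nat}.
Local Notation V := 'rV[R]_N.
Local Notation mu := (lebesgue_rV R N).
Implicit Types (f g : V -> R) (x h : V).

(** The factor |c h| is attached to g and not to the kernel, so that the kernel stays in a fixed
    class while the gain becomes a weight on the pieces. *)
Lemma conv_difference eta c g h x : 0 < c -> bL1 eta -> bL1 g ->
  conv (dil c eta) g (x + h) - conv (dil c eta) g x =
  conv (dil c (difference_kernel eta (c *: h))) (fun y => l1norm (c *: h) * g y) x.
Proof.
move=> c0 He Hg; have Hd := bL1_dil c0 He.
rewrite /conv -RintegralB_bL1; try exact: bL1_conv_integrand.
apply: eq_Rintegral => y _; rewrite /dil /difference_kernel.
rewrite (_ : c *: (x + h - y) = c *: (x - y) + c *: h); last by rewrite -scalerDr addrAC.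
have [l0|l0] := eqVneq (l1norm (c *: h)) 0.
  by rewrite l0 (l1norm0_eq l0) addr0 !subrr !(mulr0, mul0r).
by field.
Qed.

Lemma conv_telescope eta phi a n f x : 0 < a -> bL1 phi -> bL1 f ->
  eta = (fun x => phi x - dil 2^-1 phi x) ->
  \sum_(i < n) conv (dil (a * 2 ^+ i) eta) f x =
  conv (dil (a * 2 ^+ n / 2) phi) f x - conv (dil (a / 2) phi) f x.
Proof.
move=> a0 Hphi Hf eE; have t0 k : 0 < a * 2 ^+ k by rewrite mulr_gt0// exprn_gt0.
have E c : 0 < c -> conv (dil c eta) f x = conv (dil c phi) f x - conv (dil (c / 2) phi) f x.
  move=> c0; have c2 : 0 < c / 2 by rewrite divr_gt0.
  rewrite -convBl; [|exact: bL1_dil|exact: bL1_dil|by []].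
  by congr (conv _ _ _); apply/funext => y; rewrite -dilM /dil eE mulrBr.
elim: n => [|n IH]; first by rewrite big_ord0 expr0 mulr1 subrr.
rewrite big_ord_recr/= IH E// (_ : a * 2 ^+ n.+1 / 2 = a * 2 ^+ n); first by ring.
by rewrite exprS; field.
Qed.

(** The reproducing formula for [eta], dilated by c; the factors 2^-1 2^e with e < 3 are 1/2, 1 and
    2. *)
Lemma conv_reproduce eta c f x : 0 < c -> bL1 eta -> bL1 f ->
  (forall x, eta x = conv (dil 2^-1 eta) eta x + conv eta eta x + conv (dil 2 eta) eta x) ->
  conv (dil c eta) f x = \sum_(e < 3) conv (dil (c * (2^-1 * 2 ^+ e)) eta) (conv (dil c eta) f) x.
Proof.
move=> c0 He Hf eE; have Hc := bL1_dil c0 He.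
have H2 : bL1 (dil 2 eta) by exact: bL1_dil.
have H2i : bL1 (dil 2^-1 eta) by apply: bL1_dil.
have Hd d : 0 < d -> bL1 (dil (c * d) eta) by move=> d0; apply: bL1_dil => //; exact: mulr_gt0.
have E : dil c eta = fun y => conv (dil (c * 2^-1) eta) (dil c eta) y +
    conv (dil c eta) (dil c eta) y + conv (dil (c * 2) eta) (dil c eta) y.
  apply/funext => y; rewrite -!dilM !conv_dil// /dil eE; ring.
rewrite {1}E !big_ord_recl big_ord0 addr0 expr0 expr1 mulr1 mulVf// mulr1 /= (_ : 2^-1 * 2 ^+ _ = 2); last first.
  by rewrite /bump/= expr2 mulrA mulVf// mul1r.
have Hi : bL1 (dil (c * 2^-1) eta) by apply: Hd.
have Hm : bL1 (dil (c * 2) eta) by apply: Hd.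
rewrite !convDl ?convA//; try exact: bL1_conv; last by apply: bL1D; exact: bL1_conv.
by rewrite addrA.
Qed.

Lemma approximate_identity (phi f : V -> R) (c : nat -> R) x : bL1 phi -> bL1 f -> scont f ->
  (forall n, 0 < c n) -> (fun n => (c n)^-1) @ \oo --> (0 : R) -> \int[mu]_y phi y = 1 ->
  conv (dil (c n) phi) f x @[n --> \oo] --> f x.
Proof.
move=> Hphi Hf cf c0 ci i1; have [mphi _ Iphi] := Hphi; have [mf _ _] := Hf.
have [M [M0 fM]] := bL1_bound Hf.
have Hk n : bL1 (fun y => f (x - (c n)^-1 *: y) * phi y).
  apply: (bL1M (M := M) Hphi) => [|y]; last exact: fM.
  have := bL1_affine (c := - (c n)^-1) x _ Hf; rewrite oppr_eq0 invr_eq0 gt_eqF// => /(_ isT) [m _ _].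
  by under eq_fun do rewrite addrC -scaleNr.
have E n : conv (dil (c n) phi) f x = \int[mu]_y (f (x - (c n)^-1 *: y) * phi y).
  rewrite convC//; last exact: bL1_dil.
  have [_ _ Ik] := Hk n; rewrite -(Rintegral_dil (c0 n) Ik); apply: eq_Rintegral => y _.
  by rewrite /dil scalerA mulVf ?gt_eqF// scale1r mulrCA.
rewrite (_ : (fun n => _) = (fun n => \int[mu]_y (f (x - (c n)^-1 *: y) * phi y))); last first.
  by apply/funext => n; exact: E.
have -> : f x = \int[mu]_y (f x * phi y) by rewrite RintegralZ_bL1// i1 mulr1.
apply: (@dominated_Rintegral _ _ _ mu (fun n y => f (x - (c n)^-1 *: y) * phi y) _ (fun y => M * `|phi y|)).
- by move=> n; have [] := Hk n.
- by apply: measurable_funM => //; exact: measurable_cst.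
- move=> y; apply: cvgMl; apply: cf => i.
  rewrite (_ : (fun n => _) = (fun n => x 0 i - (c n)^-1 * y 0 i)); last by apply/funext => n; rewrite !mxE.
  rewrite -[X in _ --> X](subr0 (x 0 i)); apply: cvgB; first exact: cvg_cst.
  by rewrite -(mul0r (y 0 i)); apply: cvgMl.
- by apply: integrableRZ; exact: integrableR_norm.
- by move=> n y; rewrite normrM ler_wpM2r.
Qed.

(** The supremum of the dilated kernel is at most c^N times that of phi, and N > 0. *)
Lemma dil_vanish (phi f : V -> R) (c : nat -> R) x : (0 < N)%N -> bL1 phi -> bL1 f ->
  (forall n, 0 < c n) -> c @ \oo --> (0 : R) ->
  conv (dil (c n) phi) f x @[n --> \oo] --> (0 : R).
Proof.
move=> N0 Hphi Hf c0 cc; have [M [M0 hM]] := bL1_bound Hphi.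
have [mphi _ _] := Hphi; have [mf _ If] := Hf.
have If' := integrableR_norm If.
pose I := \int[mu]_y `|f y|.
have bd n : `|conv (dil (c n) phi) f x| <= c n ^+ N * (M * I).
  rewrite -lee_fin; apply: le_trans (abs_conv_le _ _ mf) _; first exact: measurable_dil.
  have cn0 : 0 <= c n ^+ N by rewrite exprn_ge0// ltW.
  rewrite EFinM (EFinM M) /I nint_Rintegral// -!nintZ ?(ltW M0)//; try (by msr); last first.
  - by move=> y; rewrite mulr_ge0// ltW.
  apply: le_nint.
  - by have md := measurable_dil (c n) mphi; msr.
  - by msr.
  - by move=> y; rewrite mulr_ge0.
  - move=> y; rewrite mulrA; apply: ler_wpM2r => //.
    by rewrite /dil normrM (ger0_norm cn0) ler_wpM2l.
apply/norm_cvg0P.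
have lim0 : (fun n => c n ^+ N * (M * I)) @ \oo --> (0 : R).
  rewrite -(mul0r (M * I)); apply: cvgMl; move: N0; case: (N) => // n _.
  elim: n => [|n IH]; first by under eq_fun do rewrite expr1.
  by under eq_fun do rewrite exprS; rewrite -(mulr0 0); apply: cvgM.
apply: (squeeze_cvgr _ (cvg_cst 0) lim0); near=> n; rewrite normr_ge0/=; exact: bd.
Unshelve. all: by end_near. Qed.

End littlewood_paley_pieces.

Lemma nint_shift_powR (R : realType) (N : nat) (p : R) (h : 'rV[R]_N) (k : 'rV[R]_N -> R) :
  measurable_fun setT k ->
  nint (lebesgue_rV R N) (fun x => `|k (x + h)| `^ p) = nint (lebesgue_rV R N) (fun x => `|k x| `^ p).
Proof.
move=> mk; have m : measurable_fun setT (fun x => `|k x| `^ p).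
  by apply: measurable_fun_powR; exact: measurable_fun_normr.
rewrite -(nint_shift (- h) m (fun x => powR_ge0 _ _)); apply: eq_integral => x _.
by rewrite opprK.
Qed.

Section difference_bound.
Context {R : realType} {N : nat}.
Local Notation V := 'rV[R]_N.
Local Notation mu := (lebesgue_rV R N).
Variables (eta : V -> R) (p : R).
Hypotheses (N0 : (0 < N)%N) (p1 : 1 < p).
Hypotheses (Seta : schwartz_real eta) (eta_mean : \int[mu]_x eta x = 0).
Hypothesis eta_reproduce : forall x,
  eta x = conv (dil 2^-1 eta) eta x + conv eta eta x + conv (dil 2 eta) eta x.

(** With a = 2^-J and n = 2 J + 1 the scales are 2^j for |j| <= J, the window used throughout for
    the full sum over j. *)
Definition weighted_pieces n a r (f : V -> R) (i : 'I_n) (x : V) : R :=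
  (a * 2 ^+ i) `^ r * conv (dil (a * 2 ^+ i) eta) f x.

(** The difference falls on the outer copy of [eta] in the reproducing formula, so the pieces of f
    remain. If t |h| <= 1 the difference kernel yields t |h| <= (t |h|)^r, by r <= 1; if t |h| > 1
    the two translates are estimated separately and 1 <= (t |h|)^r, by r >= 0. *)
Lemma difference_bound : exists C, 0 < C /\ forall n a f h r,
  0 < a -> bL1 f -> scont f -> 0 <= r <= 1 ->
  (nint mu (fun x => `|\sum_(i < n) (conv (dil (a * 2 ^+ i) eta) f (x + h) -
                                     conv (dil (a * 2 ^+ i) eta) f x)| `^ p)%R <=
   (C * (l1norm h `^ r) `^ p)%:E *
   nint mu (fun x => vabs (@weighted_pieces n a r f) x `^ p)%R)%E.
Proof.
have p0 : 0 < p by rewrite (lt_trans _ p1).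
have [A1 [A10 K1]] := schwartz_lp_kernel Seta eta_mean.
have [A2 [A20 K2]] := difference_kernel_lp Seta.
have He : bL1 eta := schwartz_bL1 Seta.
have ce : scont eta := @schwartz_scont _ _ _ [::] Seta.
pose A := A1 + A2 + 1.
have A0 : 0 < A by rewrite ltr_wpDl// addr_ge0.
have {}K1 : lp_kernel A eta by apply: lp_kernel_le K1; rewrite /A -addrA lerDl addr_ge0.
have {}K2 v : l1norm v <= 2 -> lp_kernel A (difference_kernel eta v).
  by move=> /K2; apply: lp_kernel_le; rewrite /A addrAC lerDr addr_ge0.
have [C0 [C00 KB]] := @kernel_bounds R N p A N0 p1 A0.
(* Three neighbours, each with a low part and two translates of a high part, give 9 functions; the
   factor 2 bounds the neighbour dilations. *)
exists (9 `^ p * (C0 * 2 `^ p)); split.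
  by rewrite !mulr_gt0// powR_gt0.
move=> n a f h r a0 Hf cf /andP[r0 r1].
pose t (i : 'I_n) := a * 2 ^+ i.
have t0 i : 0 < t i by rewrite mulr_gt0// exprn_gt0.
pose g (i : 'I_n) := conv (dil (t i) eta) f.
have Hg i : bL1 (g i) by apply: bL1_conv => //; exact: bL1_dil.
have sg i : scont (g i).
  have [mk bk _] := bL1_dil (t0 i) He; have [_ _ If] := Hf.
  by apply: scont_conv => //; exact: scont_dil.
pose l := l1norm h; have l0 : 0 <= l by exact: l1norm_ge0.
pose D := @weighted_pieces n a r f.
set X := nint mu (fun x => vabs D x `^ p).
have X0 : (0 <= X)%E by apply: nint_ge0 => x; exact: powR_ge0.
pose c (e : 'I_3) : R := 2^-1 * 2 ^+ e.
have c0 e : 0 < c e by rewrite mulr_gt0// ?invr_gt0// exprn_gt0.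
have c2 e : c e <= 2.
  have h3 : 2 ^+ e <= 2 ^+ 2 :> R by rewrite ler_weXn2l ?ler1n// -ltnS.
  by rewrite /c ler_pdivrMl// -expr2.
pose low i := t i * l <= 1.
(* At high scales [psi] is filled up with [eta]. The weight [wl] vanishes there, and all members are
   admissible kernels. *)
pose psi e i := if low i then difference_kernel eta ((t i * c e) *: h) else eta.
have l1c e i : l1norm ((t i * c e) *: h) = t i * c e * l.
  by rewrite l1normZ ger0_norm// mulr_ge0// ltW.
have Hpsi e i : lp_kernel A (psi e i).
  rewrite /psi; case: ifP => // lowi; apply: K2; rewrite l1c mulrAC.
  by rewrite -[leRHS]mul1r ler_pM// ?mulr_ge0// ltW.
have HK e i : bL1 (dil (t i * c e) (psi e i)).
  by have [H _ _ _ _] := Hpsi e i; apply: bL1_dil => //; exact: mulr_gt0.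
have HK' e i : bL1 (dil (t i * c e) eta) by apply: bL1_dil => //; exact: mulr_gt0.
pose wl e i : R := (low i)%:R * (t i * c e * l).
pose wh i : R := (~~ low i)%:R.
pose GL e i y := wl e i * g i y.
pose GH i y := wh i * g i y.
have HGL e i : bL1 (GL e i) by exact: bL1Z.
have HGH i : bL1 (GH i) by exact: bL1Z.
have sGL e i : scont (GL e i) by exact: scontZ.
have sGH i : scont (GH i) by exact: scontZ.
have tc e (i : 'I_n) : a * c e * 2 ^+ i = t i * c e by rewrite mulrAC.
have ac e : 0 < a * c e by exact: mulr_gt0.
pose L e x := \sum_(i < n) conv (dil (a * c e * 2 ^+ i) (psi e i)) (GL e i) x.
pose H e x := \sum_(i < n) conv (dil (a * c e * 2 ^+ i) eta) (GH i) x.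
have split_i i x : g i (x + h) - g i x = \sum_(e < 3)
    (conv (dil (a * c e * 2 ^+ i) (psi e i)) (GL e i) x +
     (conv (dil (a * c e * 2 ^+ i) eta) (GH i) (x + h) -
      conv (dil (a * c e * 2 ^+ i) eta) (GH i) x)).
  have E y : g i y = \sum_(e < 3) conv (dil (t i * c e) eta) (g i) y.
    by rewrite /g; apply: conv_reproduce.
  rewrite !E -sumrB; apply: eq_bigr => e _.
  rewrite !tc /GL /GH !convZr// /wl /wh /psi.
  case: ifP => lowi; rewrite /= ?mul0r ?subr0 ?add0r ?addr0 ?mul1r//.
  rewrite (conv_difference _ _ (mulr_gt0 (t0 i) (c0 e)) He (Hg i)) convZr ?l1c//.
  by have := HK e i; rewrite /psi lowi.
have rpow i : (t i * l) `^ r = t i `^ r * l `^ r by rewrite powRM// ltW.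
have Dg i x : `|D i x| = t i `^ r * `|g i x| by rewrite /D /weighted_pieces normrM ger0_norm ?powR_ge0.
have lr0 : 0 <= l `^ r by exact: powR_ge0.
have vL e x : vabs (GL e) x <= 2 * l `^ r * vabs D x.
  apply: vnorm_le => [|i]; first by rewrite mulr_ge0.
  rewrite Dg /GL normrM mulrA; apply: ler_wpM2r => //.
  have tl0 : 0 <= t i * l by rewrite mulr_ge0// ltW.
  have w0 : 0 <= t i * c e * l by rewrite !mulr_ge0// ltW.
  rewrite /wl; case: (boolP (low i)) => lowi; last by rewrite mul0r normr0 !mulr_ge0// powR_ge0.
  rewrite mul1r ger0_norm//.
  have -> : 2 * l `^ r * t i `^ r = 2 * (t i * l) `^ r by rewrite rpow; ring.
  rewrite mulrAC mulrC ler_pM// ?(ltW (c0 e))//.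
  have [->|tl] := eqVneq (t i * l) 0; first exact: powR_ge0.
  by rewrite -[leLHS]powRr1//; apply: ger_powR => //; rewrite lt_neqAle eq_sym tl tl0.
have vH x : vabs GH x <= 2 * l `^ r * vabs D x.
  apply: vnorm_le => [|i]; first by rewrite mulr_ge0.
  rewrite Dg /GH normrM mulrA; apply: ler_wpM2r => //.
  rewrite /wh; case: (boolP (low i)) => lowi /=; first by rewrite normr0 !mulr_ge0// powR_ge0.
  rewrite normr1; have -> : 2 * l `^ r * t i `^ r = 2 * (t i * l) `^ r by rewrite rpow; ring.
  have tl : 1 <= t i * l by rewrite ltW// ltNge.
  apply: (@le_trans _ _ (2 * 1)); first by rewrite mulr1 ler1n.
  rewrite ler_wpM2l// -[leLHS](powRr0 (t i * l)).
  by apply: ler_powR.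
pose Y := ((C0 * (2 * l `^ r) `^ p)%:E * X)%E.
have mD : measurable_fun setT (vabs D).
  apply: measurable_vabs => i; have [mg _ _] := Hg i; apply: measurable_funM => //.
have vY (G : 'I_n -> V -> R) : (forall i, bL1 (G i)) -> (forall x, vabs G x <= 2 * l `^ r * vabs D x) ->
    (C0%:E * nint mu (fun x => vabs G x `^ p)%R <= Y)%E.
  move=> HG hG; rewrite /Y EFinM -muleA; apply: lee_wpmul2l; first by rewrite lee_fin ltW.
  have mG : measurable_fun setT (vabs G) by apply: measurable_vabs => i; have [] := HG i.
  rewrite -nintZ ?powR_ge0//; [|by msr|by move=> x; exact: powR_ge0].
  apply: le_nint; [by msr|by msr|by move=> x; exact: powR_ge0|move=> x].
  rewrite -powRM ?vnorm_ge0 ?mulr_ge0//; apply: ge0_ler_powR => //; rewrite ?nnegrE ?vnorm_ge0 ?mulr_ge0 ?vnorm_ge0//.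
  exact: ltW.
have mL e : measurable_fun setT (L e).
  by apply: measurable_fun_bigsum => i; rewrite tc; have [] := bL1_conv (HK e i) (HGL e i).
have mH e : measurable_fun setT (H e).
  by apply: measurable_fun_bigsum => i; rewrite tc; have [] := bL1_conv (HK' e i) (HGH i).
pose F (q : 'I_3 * 'I_3) x : R := match nat_of_ord q.2 with
  | 0 => `|L q.1 x| | 1 => `|H q.1 (x + h)| | _ => `|H q.1 x| end.
have mHh e : measurable_fun setT (fun x : V => H e (x + h)).
  by have := mH e; move: (H e) => k mk; msr.
have mF q : measurable_fun setT (F q).
  by rewrite /F; case: (nat_of_ord q.2) => [|[|_]]; apply: measurable_fun_normr.
have F0 q x : 0 <= F q x by rewrite /F; case: (nat_of_ord q.2) => [|[|_]].
have hH e : (nint mu (fun x => `|H e x| `^ p)%R <= Y)%E.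
  have [KS _] := KB n (a * c e) (fun=> eta) (ac e) (fun=> K1).
  exact: le_trans (KS GH HGH sGH) (vY GH HGH vH).
have hF q : (nint mu (fun x => F q x `^ p)%R <= Y)%E.
  rewrite /F; case: (nat_of_ord q.2) => [|[|_]]; last exact: hH.
    have [KS _] := KB n (a * c q.1) (psi q.1) (ac q.1) (Hpsi q.1).
    exact: le_trans (KS (GL q.1) (HGL q.1) (sGL q.1)) (vY (GL q.1) (HGL q.1) (vL q.1)).
  apply: le_trans (hH q.1).
  rewrite le_eqVlt; apply/orP; left; apply/eqP; exact: (nint_shift_powR p h (mH q.1)).
have Y0 : (0 <= Y)%E by rewrite mule_ge0// lee_fin mulr_ge0 ?powR_ge0// ltW.
have := @nint_powR_sum_le _ _ _ F p Y p1 Y0 mF F0 hF.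
rewrite card_prod !card_ord => hsum.
apply: (@le_trans _ _ (nint mu (fun x => (\sum_q F q x) `^ p)%R)).
  apply: le_nint.
  - apply: measurable_fun_powR; apply: measurable_fun_normr; apply: measurable_fun_bigsum => i.
    have [mg _ _] := Hg i; apply: measurable_funB => //.
    by move: mg; rewrite /g/=; move: (conv _ _) => k mk; msr.
  - by apply: measurable_fun_powR; exact: measurable_fun_bigsum.
  - by move=> x; exact: powR_ge0.
  - move=> x; apply: ge0_ler_powR; rewrite ?nnegrE ?sumr_ge0 ?(ltW p0)//.
    rewrite (eq_bigr _ (fun i _ => split_i i x)) exchange_big/=.
    have -> : \sum_q F q x = \sum_(e < 3) \sum_(k < 3) F (e, k) x.
      by rewrite pair_bigA/=; apply: eq_bigr => -[].
    apply: le_trans (ler_norm_sum _ _ _) _; apply: ler_sum => e _.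
    rewrite !big_ord_recl big_ord0 addr0 /F/= big_split/= sumrB -/(L e x).
    rewrite (le_trans (ler_normD _ _))// lerD2l.
    exact: ler_normB.
apply: le_trans hsum _; rewrite /Y muleA -EFinM powRM ?powR_ge0//.
by rewrite [X in (X%:E * _)%E](_ : _ = 9 `^ p * (C0 * 2 `^ p) * (l `^ r) `^ p)//; rewrite -!mulrA.
Qed.

Variable phi : V -> R.
Hypotheses (Hphi : bL1 phi) (phi_mean : \int[mu]_x phi x = 1).
Hypothesis eta_phi : eta = (fun x => phi x - dil 2^-1 phi x).

Lemma cvg_invX2 : (fun J => (2 ^+ J)^-1 : R) @ \oo --> (0 : R).
Proof.
rewrite (_ : (fun n => _) = (fun n => (2^-1) ^+ n)); last first.
  by apply/funext => k; rewrite exprVn.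
by apply: cvg_expr; rewrite ger0_norm ?invr_ge0// invf_lt1 ?ltr1n.
Qed.

(** Telescoping leaves a bump at frequency 2^J, an approximate identity, minus one at frequency 2^-J
    / 2, which tends to 0 pointwise. *)
Lemma sum_pieces_cvg (f : V -> R) x : bL1 f -> scont f ->
  \sum_(i < (2 * J).+1) conv (dil ((2 ^+ J)^-1 * 2 ^+ i) eta) f x @[J --> \oo] --> f x.
Proof.
move=> Hf cf; pose c J : R := 2 ^+ J.
have c0 J : 0 < c J by rewrite exprn_gt0.
have E J : \sum_(i < (2 * J).+1) conv (dil ((2 ^+ J)^-1 * 2 ^+ i) eta) f x =
    conv (dil (c J) phi) f x - conv (dil ((2 ^+ J)^-1 / 2) phi) f x.
  have a0 : 0 < (2 ^+ J)^-1 :> R by rewrite invr_gt0; exact: c0.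
  have -> : c J = (2 ^+ J)^-1 * 2 ^+ (2 * J).+1 / 2.
    by rewrite exprS mul2n -addnn exprD /c; field; rewrite gt_eqF// exprn_gt0.
  exact: (conv_telescope _ _ a0 Hphi Hf eta_phi).
rewrite (_ : (fun J => _) = (fun J => conv (dil (c J) phi) f x - conv (dil ((2 ^+ J)^-1 / 2) phi) f x)); last first.
  by apply/funext.
rewrite -[X in _ --> X]subr0; apply: cvgB.
  by apply: approximate_identity => //; exact: cvg_invX2.
apply: dil_vanish => //.
by rewrite -(mul0r 2^-1); apply: cvgMl; exact: cvg_invX2.
Qed.

Lemma increment_bound : exists C, 0 < C /\ forall f h r B,
  bL1 f -> scont f -> 0 <= r <= 1 ->
  (forall J, (nint mu (fun x => vabs (@weighted_pieces (2 * J).+1 (2 ^+ J)^-1 r f) x `^ p)%R <= B)%E) ->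
  (nint mu (fun x => `|f (x + h) - f x| `^ p)%R <= (C * (l1norm h `^ r) `^ p)%:E * B)%E.
Proof.
have p0 : 0 < p by rewrite (lt_trans _ p1).
have [C [C0 HC]] := difference_bound; exists C; split=> // f h r B Hf cf r01 HB.
have He : bL1 eta := schwartz_bL1 Seta.
pose s J x := \sum_(i < (2 * J).+1) conv (dil ((2 ^+ J)^-1 * 2 ^+ i) eta) f x.
have ms J : measurable_fun setT (s J).
  apply: measurable_fun_bigsum => i.
  have t0 : 0 < (2 ^+ J)^-1 * 2 ^+ i :> R by rewrite mulr_gt0 ?invr_gt0 ?exprn_gt0.
  by have [] := bL1_conv (bL1_dil t0 He) Hf.
apply: (@nint_le_lim _ _ _ mu (fun J x => `|s J (x + h) - s J x| `^ p)).
- by move=> J; have := ms J; move: (s J) => k mk; msr.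
- by move=> J x; exact: powR_ge0.
- move=> x; apply: cvg_powR => //; apply: cvg_norm; apply: cvgB; exact: sum_pieces_cvg.
- apply: nearW => J; rewrite /s; under [X in nint _ X]eq_fun do rewrite -sumrB.
  apply: le_trans (HC _ _ f h r _ Hf cf r01) _; first by rewrite invr_gt0 exprn_gt0.
  by apply: lee_wpmul2l => //; rewrite lee_fin mulr_ge0 ?powR_ge0// ltW.
Qed.

End difference_bound.

(** * Gagliardo integrals and increments *)

Section dyadic_shells.
Context {R : realType} {N : nat}.
Local Notation V := 'rV[R]_N.
Local Notation mu := (lebesgue_rV R N).

Lemma ln2_ge : 2^-1 <= ln 2 :> R.
Proof.
have h : expR (2^-1 : R) <= 2.
  rewrite -[leLHS]invrK -expRN invf_ple ?posrE ?expR_gt0//.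
  by have := expR_ge1Dx (- 2^-1 : R); lra.
by rewrite -[leLHS]expRK ler_ln ?posrE ?expR_gt0.
Qed.

Lemma powR2_ge (a : R) : 0 <= a -> 1 + a / 2 <= 2 `^ a.
Proof.
move=> a0; rewrite /powR pnatr_eq0/=; apply: le_trans (expR_ge1Dx _).
by rewrite lerD2l ler_wpM2l// ln2_ge.
Qed.

(** A geometric series of ratio 2^-a costs 1 / a as a tends to 0. This is where 1 / (s - r) and 1 /
    (t - s) come from. *)
Lemma inv_1_powR2_le (a M : R) : 0 < a -> a <= M -> (1 - 2 `^ (- a))^-1 <= (2 + M) / a.
Proof.
move=> a0 aM; have h := powR2_ge (ltW a0).
have p0 : 0 < 1 + a / 2 by rewrite ltr_wpDr// divr_ge0// ltW.
have q : 2 `^ (- a) <= (1 + a / 2)^-1.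
  by rewrite powRN lef_pV2// posrE powR_gt0.
have e : 1 - (1 + a / 2)^-1 = a / (2 + a) by field; rewrite !gt_eqF//; lra.
have d0 : 0 < a / (2 + a) by rewrite divr_gt0//; lra.
have h2 : a / (2 + a) <= 1 - 2 `^ (- a) by rewrite -e; lra.
apply: (@le_trans _ _ (a / (2 + a))^-1); first by rewrite lef_pV2// posrE (lt_le_trans d0).
rewrite invf_div ler_pM2r ?invr_gt0//; lra.
Qed.

Lemma powR2N_lt1 (a : R) : 0 < a -> 0 <= 2 `^ (- a) < 1.
Proof.
move=> a0; rewrite powR_ge0/= powRN invf_lt1 ?powR_gt0//.
apply: lt_le_trans (powR2_ge (ltW a0)); rewrite ltrDl divr_gt0//.
Qed.

(** Sums shell by shell over an increasing exhaustion; it serves both for shells that shrink to the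
    origin and for shells that grow to infinity. *)
Lemma nint_exhaust (w : V -> R) (E : nat -> V -> bool) (F : V -> bool) (T c : R) :
  0 <= c < 1 -> 0 <= T -> measurable_fun setT w -> (forall x, 0 <= w x) ->
  (forall n, measurable_fun setT (fun x => (E n x)%:R : R)) ->
  measurable_fun setT (fun x => (F x)%:R : R) ->
  (forall x, E 0 x = false) -> (forall n x, E n x -> F x) ->
  (forall x, F x -> \forall n \near \oo, E n x) ->
  (forall n, (nint mu (fun x => (E n.+1 x && ~~ E n x)%:R * w x)%R <= (T * c ^+ n)%:E)%E) ->
  (nint mu (fun x => (F x)%:R * w x)%R <= (T / (1 - c))%:E)%E.
Proof.
move=> c01 T0 mw w0 mE mF E0 EF FE hS; have /andP[c0 _] := c01.
have mEw n : measurable_fun setT (fun x => (E n x)%:R * w x) by apply: measurable_funM.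
have n0 n x : 0 <= (E n x)%:R * w x by rewrite mulr_ge0.
have bd n : (nint mu (fun x => (E n x)%:R * w x)%R <= (\sum_(k < n) T * c ^+ k)%:E)%E.
  elim: n => [|n IH].
    rewrite big_ord0 /nint; under eq_integral do rewrite E0 mul0r.
    by rewrite integral0.
  have mS : measurable_fun setT (fun x => (E n.+1 x && ~~ E n x)%:R : R).
    rewrite (_ : (fun x => _) = (fun x => (E n.+1 x)%:R * (1 - (E n x)%:R))).
      by apply: measurable_funM => //; apply: measurable_funB => //; exact: measurable_cst.
    by apply/funext => x; case: (E n.+1 x); case: (E n x) => /=; rewrite ?subrr ?subr0 ?mulr0 ?mulr1 ?mul0r.
  have mSw : measurable_fun setT (fun x => (E n.+1 x && ~~ E n x)%:R * w x) by apply: measurable_funM.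
  have s0 x : 0 <= (E n.+1 x && ~~ E n x)%:R * w x by rewrite mulr_ge0.
  apply: (@le_trans _ _ (nint mu (fun x => (E n x)%:R * w x + (E n.+1 x && ~~ E n x)%:R * w x)%R)).
    apply: le_nint => //; first by apply: measurable_funD.
    move=> x; rewrite -mulrDl; apply: ler_wpM2r => //.
    by case: (E n x); case: (E n.+1 x); rewrite /= ?addr0 ?add0r.
  by rewrite nintD// big_ord_recr/= EFinD; apply: leeD.
apply: (@nint_le_lim _ _ _ mu (fun n x => (E n x)%:R * w x)) => //.
- move=> x; apply: cvgMl; case: (boolP (F x)) => Fx.
    by apply: cvg_near_cst; apply: filterS (FE x Fx) => n ->.
  rewrite (_ : (fun n => _) = (fun=> 0)); first exact: cvg_cst.
  by apply/funext => n; case: (boolP (E n x)) => // /EF; rewrite (negbTE Fx).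
- apply: nearW => n; apply: le_trans (bd n) _; rewrite lee_fin.
  exact: sum_geometric_le.
Qed.

Definition unit_ball_mass : R := fine (nint mu (fun x => (l1norm x <= 1)%R%:R)).

Lemma measurable_ball (rho : R) : measurable_fun setT (fun x : V => (l1norm x <= rho)%R%:R : R).
Proof.
apply: measurable_fun_bool; apply: measurable_fun_ler; first exact: measurable_l1norm.
exact: measurable_cst.
Qed.

Lemma measurable_ballC (rho : R) : measurable_fun setT (fun x : V => (rho < l1norm x)%R%:R : R).
Proof.
apply: measurable_fun_bool; apply: measurable_fun_ltr; last exact: measurable_l1norm.
exact: measurable_cst.
Qed.

Lemma unit_ball_mass_ge0 : 0 <= unit_ball_mass.
Proof. by apply: fine_ge0; apply: nint_ge0 => x. Qed.

Lemma nint_ball (rho : R) : 0 < rho ->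
  nint mu (fun x => (l1norm x <= rho)%R%:R) = (rho ^+ N * unit_ball_mass)%:E.
Proof.
move=> r0; rewrite (@nint_affine _ _ rho 0 _ (lt0r_neq0 r0) (measurable_ball rho))// gtr0_norm// EFinM.
congr (_ * _)%E; rewrite /unit_ball_mass fineK; last first.
  by rewrite ge0_fin_numE ?nint_ball_fin//; apply: nint_ge0.
apply: eq_integral => x _; rewrite addr0 l1normZ gtr0_norm//.
by rewrite -[X in (_ <= X)%R]mulr1 ler_pM2l.
Qed.

Lemma measurable_l1norm_powR (a : R) : measurable_fun setT (fun x : V => l1norm x `^ a).
Proof. by apply: measurable_fun_powR; exact: measurable_l1norm. Qed.

Lemma powR2X (a : R) n : ((2 ^+ n)^-1 : R) `^ a = (2 `^ (- a)) ^+ n.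
Proof.
by rewrite -[2 ^+ n]powR_mulrn// -powRN -powRrM -[RHS]powR_mulrn ?powR_ge0// -powRrM; congr powR; ring.
Qed.

(** On the shell 2^-(n+1) < |x| <= 2^-n the integrand is at most 2^((n+1)N) 2^(-na), and the measure
    is at most 2^(-nN) times that of the unit ball. *)
Lemma nint_near_origin (a : R) : 0 < a ->
  (nint mu (fun x => (0 < l1norm x <= 1)%R%:R * l1norm x `^ (a - N%:R))%R <=
   (2 ^+ N * unit_ball_mass / (1 - 2 `^ (- a)))%:E)%E.
Proof.
move=> a0; have b0 := unit_ball_mass_ge0.
have mand (rho : R) : measurable_fun setT (fun x : V => (rho < l1norm x <= 1)%R%:R : R).
  rewrite (_ : (fun x => _) = (fun x => (rho < l1norm x)%R%:R * (l1norm x <= 1)%R%:R)).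
    by apply: measurable_funM; [exact: measurable_ballC|exact: measurable_ball].
  by apply/funext => x; rewrite -natrM mulnb.
apply: (@nint_exhaust _ (fun n x => (2 ^+ n)^-1 < l1norm x <= 1)).
- exact: powR2N_lt1.
- by rewrite mulr_ge0// exprn_ge0.
- exact: measurable_l1norm_powR.
- by move=> x; exact: powR_ge0.
- by move=> n; exact: mand.
- exact: mand.
- by move=> x; rewrite expr0 invr1; case: ltP => //= h; apply/negbTE; rewrite -ltNge.
- by move=> n x /andP[h ->]; rewrite andbT (lt_trans _ h)// invr_gt0 exprn_gt0.
- move=> x /andP[x0 x1]; have := @cvg_invX2 R => /cvgrPdist_lt/(_ _ x0).
  by apply: filterS => n; rewrite sub0r normrN ger0_norm ?invr_ge0 ?exprn_ge0// x1 andbT.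
- move=> n; pose rho : R := (2 ^+ n)^-1; have r0 : 0 < rho by rewrite invr_gt0 exprn_gt0.
  pose K : R := (2 / rho) ^+ N * rho `^ a.
  have K0 : 0 <= K by rewrite mulr_ge0 ?powR_ge0// exprn_ge0// divr_ge0// ltW.
  apply: (@le_trans _ _ (nint mu (fun x => K * (l1norm x <= rho)%R%:R)%R)).
    apply: le_nint.
    - apply: measurable_funM; last exact: measurable_l1norm_powR.
      rewrite (_ : (fun x => _) = (fun x : V => ((2 ^+ n.+1)^-1 < l1norm x <= 1)%R%:R * (1 - ((2 ^+ n)^-1 < l1norm x <= 1)%R%:R))).
        by apply: measurable_funM => //; apply: measurable_funB => //; exact: measurable_cst.
      by apply/funext => x; case: (_ < _ <= _); case: (_ < _ <= _) => /=; rewrite ?subrr ?subr0 ?mulr0 ?mulr1 ?mul0r.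
    - by apply: measurable_funM; [exact: measurable_cst|exact: measurable_ball].
    - by move=> x; rewrite mulr_ge0 ?powR_ge0.
    - move=> x; case: (boolP (_ && ~~ _)) => [/andP[/andP[h1 h2]]|_]; last by rewrite mul0r mulr_ge0.
      rewrite h2 andbT -leNgt -/rho => h3; rewrite mul1r h3 mulr1.
      have x0 : 0 < l1norm x by rewrite (lt_trans _ h1)// invr_gt0 exprn_gt0.
      rewrite powRB ?(gt_eqF x0) ?implybT//.
      have h1' : rho / 2 <= l1norm x.
        by rewrite /rho -invfM -exprSr ltW.
      rewrite mulrC powR_mulrn ?(ltW x0)// /K; apply: ler_pM => //.
      - by rewrite invr_ge0 exprn_ge0// ltW.
      - exact: powR_ge0.
      - rewrite -exprVn lerXn2r ?nnegrE ?invr_ge0 ?divr_ge0 ?(ltW x0) ?(ltW r0)//.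
        by rewrite -[leRHS]invf_div lef_pV2// ?posrE// divr_gt0.
      - by apply: ge0_ler_powR; rewrite ?nnegrE ?(ltW x0) ?(ltW r0) ?(ltW a0).
  rewrite nintZ//; last exact: measurable_ball.
  rewrite nint_ball// -EFinM lee_fin /K (_ : rho `^ a = (2 `^ (- a)) ^+ n); last exact: powR2X.
  rewrite (_ : (2 / rho) ^+ N * 2 `^ (- a) ^+ n * (rho ^+ N * unit_ball_mass) = 2 ^+ N * unit_ball_mass * 2 `^ (- a) ^+ n * ((rho^-1) ^+ N * rho ^+ N)); last first.
    by rewrite exprMn; ring.
  by rewrite -exprMn mulVf ?expr1n ?mulr1// gt_eqF.
Qed.

Lemma nint_far_from_origin (a : R) : 0 < a ->
  (nint mu (fun x => (1 < l1norm x)%R%:R * l1norm x `^ (- (N%:R + a)))%R <=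
   (2 ^+ N * unit_ball_mass / (1 - 2 `^ (- a)))%:E)%E.
Proof.
move=> a0; have b0 := unit_ball_mass_ge0.
have mand (rho : R) : measurable_fun setT (fun x : V => (1 < l1norm x <= rho)%R%:R : R).
  rewrite (_ : (fun x => _) = (fun x => (1 < l1norm x)%R%:R * (l1norm x <= rho)%R%:R)).
    by apply: measurable_funM; [exact: measurable_ballC|exact: measurable_ball].
  by apply/funext => x; rewrite -natrM mulnb.
apply: (@nint_exhaust _ (fun n x => 1 < l1norm x <= 2 ^+ n)).
- exact: powR2N_lt1.
- by rewrite mulr_ge0// exprn_ge0.
- exact: measurable_l1norm_powR.
- by move=> x; exact: powR_ge0.
- by move=> n; exact: mand.
- exact: measurable_ballC.
- by move=> x; rewrite expr0; case: ltP => //= h; apply/negbTE; rewrite -ltNge.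
- by move=> n x /andP[].
- move=> x x1; have x0 : 0 < l1norm x by rewrite (lt_trans _ x1).
  have i0 : 0 < (l1norm x)^-1 by rewrite invr_gt0.
  have := @cvg_invX2 R => /cvgrPdist_lt/(_ _ i0); apply: filterS => n.
  rewrite sub0r normrN ger0_norm ?invr_ge0 ?exprn_ge0// ltf_pV2 ?posrE ?exprn_gt0// x1/=.
  exact: ltW.
- move=> n; pose rho : R := 2 ^+ n; have r0 : 0 < rho by rewrite exprn_gt0.
  pose K : R := (rho^-1) ^+ N * (rho^-1) `^ a.
  have K0 : 0 <= K by rewrite mulr_ge0 ?powR_ge0// exprn_ge0// invr_ge0 ltW.
  apply: (@le_trans _ _ (nint mu (fun x => K * (l1norm x <= 2 * rho)%R%:R)%R)).
    apply: le_nint.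
    - apply: measurable_funM; last exact: measurable_l1norm_powR.
      rewrite (_ : (fun x => _) = (fun x : V => (1 < l1norm x <= 2 ^+ n.+1)%R%:R * (1 - (1 < l1norm x <= 2 ^+ n)%R%:R))).
        by apply: measurable_funM => //; apply: measurable_funB => //; exact: measurable_cst.
      by apply/funext => x; case: (_ < _ <= _); case: (_ < _ <= _) => /=; rewrite ?subrr ?subr0 ?mulr0 ?mulr1 ?mul0r.
    - by apply: measurable_funM; [exact: measurable_cst|exact: measurable_ball].
    - by move=> x; rewrite mulr_ge0 ?powR_ge0.
    - move=> x; case: (boolP (_ && ~~ _)) => [/andP[/andP[h1 h2]]|_]; last by rewrite mul0r mulr_ge0.
      rewrite h1/= -ltNge -/rho => h3; rewrite mul1r /rho -exprS h2 mulr1 -/rho.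
      have x0 : 0 < l1norm x by rewrite (lt_trans _ h1).
      rewrite opprD powRD ?(gt_eqF x0) ?implybT// !powRN powR_mulrn ?(ltW x0)// /K; apply: ler_pM => //.
      - by rewrite invr_ge0 exprn_ge0// ltW.
      - by rewrite invr_ge0 powR_ge0.
      - by rewrite -exprVn lerXn2r ?nnegrE ?invr_ge0 ?(ltW x0) ?(ltW r0)// lef_pV2// ?posrE// ltW.
      - rewrite (_ : rho^-1 `^ a = rho `^ (- a)); last first.
          by rewrite -[rho^-1]powR_inv1 ?(ltW r0)// -powRrM mulN1r.
        rewrite powRN lef_pV2 ?posrE ?powR_gt0//.
        by apply: ge0_ler_powR; rewrite ?nnegrE ?(ltW x0) ?(ltW r0) ?(ltW a0) ?(ltW h3).
  rewrite nintZ//; last exact: measurable_ball.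
  rewrite nint_ball ?mulr_gt0// -EFinM lee_fin /K (_ : rho^-1 `^ a = (2 `^ (- a)) ^+ n); last exact: powR2X.
  rewrite (_ : (rho^-1) ^+ N * 2 `^ (- a) ^+ n * ((2 * rho) ^+ N * unit_ball_mass) = 2 ^+ N * unit_ball_mass * 2 `^ (- a) ^+ n * ((rho^-1) ^+ N * rho ^+ N)); last first.
    by rewrite exprMn; ring.
  by rewrite -exprMn mulVf ?expr1n ?mulr1// gt_eqF.
Qed.

End dyadic_shells.

Section fractional_seminorm.
Context {R : realType} {N : nat}.
Local Notation V := 'rV[R]_N.
Local Notation mu := (lebesgue_rV R N).

Definition increment (p : R) (f : V -> R) (h : V) : \bar R :=
  nint mu (fun x => `|f (x + h) - f x| `^ p).

Lemma increment_ge0 p f h : (0 <= increment p f h)%E.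
Proof. by apply: nint_ge0 => x; exact: powR_ge0. Qed.

Lemma increment0 p f : 0 < p -> increment p f 0 = 0%E.
Proof.
move=> p0; rewrite /increment /nint; under eq_integral do rewrite addr0 subrr normr0 powR0 ?gt_eqF//.
exact: integral0.
Qed.

Lemma measurable_increment p f : measurable_fun setT f -> measurable_fun setT (increment p f).
Proof.
move=> mf; apply: (@measurable_nint _ _ _ V V mu (fun h x => `|f (x + h) - f x| `^ p)).
  by apply: measurable_fun_powR; apply: measurable_fun_normr; msr.
by move=> h x; exact: powR_ge0.
Qed.

(** The Gagliardo integral in the variable h = x - y with the l1 norm in the weight; a is N + s p in
    all uses. *)
Definition fractional (a p : R) (f : V -> R) : \bar R :=
  (\int[mu]_h ((l1norm h `^ (- a))%:E * increment p f h))%E.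

(* The weight splits at [l1norm h = 1]: the larger exponent is used near the
   origin and the smaller one at infinity. *)
Lemma fractional_le (p r s t br bt K : R) f : (0 < N)%N -> 1 < p ->
  0 <= r -> r < s -> s < t -> t <= 1 -> 0 <= K -> 0 <= br -> 0 <= bt ->
  measurable_fun setT f ->
  (forall h, (increment p f h <= (K * (l1norm h `^ r) `^ p * br)%:E)%E) ->
  (forall h, (increment p f h <= (K * (l1norm h `^ t) `^ p * bt)%:E)%E) ->
  (fractional (N%:R + s * p) p f <=
   (K * (2 ^+ N * @unit_ball_mass R N * (2 + p)) * (br / (s - r) + bt / (t - s)))%:E)%E.
Proof.
move=> N0 p1 r0 rs st t1 K0 br0 bt0 mf hr ht.
have p0 : 0 < p by rewrite (lt_trans _ p1).
have b0 := @unit_ball_mass_ge0 R N.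
have a1 : 0 < (t - s) * p by rewrite mulr_gt0// subr_gt0.
have a2 : 0 < (s - r) * p by rewrite mulr_gt0// subr_gt0.
pose u1 (h : V) : R := (0 < l1norm h <= 1)%R%:R * l1norm h `^ ((t - s) * p - N%:R).
pose u2 (h : V) : R := (1 < l1norm h)%R%:R * l1norm h `^ (- (N%:R + (s - r) * p)).
have m1 : measurable_fun setT u1.
  apply: measurable_funM; last exact: measurable_l1norm_powR.
  rewrite (_ : (fun x => _) = (fun x : V => (0 < l1norm x)%R%:R * (l1norm x <= 1)%R%:R)).
    by apply: measurable_funM; [exact: measurable_ballC|exact: measurable_ball].
  by apply/funext => x; rewrite -natrM mulnb.
have m2 : measurable_fun setT u2.
  by apply: measurable_funM; [exact: measurable_ballC|exact: measurable_l1norm_powR].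
have u10 h : 0 <= u1 h by rewrite mulr_ge0 ?powR_ge0.
have u20 h : 0 <= u2 h by rewrite mulr_ge0 ?powR_ge0.
have pw h : ((l1norm h `^ (- (N%:R + s * p)))%:E * increment p f h <=
    (K * bt * u1 h + K * br * u2 h)%:E)%E.
  have l0 := l1norm_ge0 h.
  have [z|nz] := eqVneq (l1norm h) 0.
    rewrite (l1norm0_eq z) increment0// mule0 lee_fin addr_ge0// mulr_ge0// mulr_ge0//.
  have lp : 0 < l1norm h by rewrite lt_neqAle eq_sym nz l0.
  have w0 : 0 <= l1norm h `^ (- (N%:R + s * p)) by exact: powR_ge0.
  have [le1|gt1] := lerP (l1norm h) 1.
    rewrite /u1 /u2 lp le1 ltNge le1/= mul0r mulr0 addr0 mul1r.
    apply: (@le_trans _ _ ((l1norm h `^ (- (N%:R + s * p)))%:E * (K * (l1norm h `^ t) `^ p * bt)%:E)%E).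
      by apply: lee_wpmul2l; [rewrite lee_fin|exact: ht].
    rewrite -EFinM lee_fin (_ : (t - s) * p - N%:R = - (N%:R + s * p) + t * p); last by ring.
    rewrite [l1norm h `^ (_ + _)]powRD ?nz ?implybT// -powRrM.
    by rewrite le_eqVlt; apply/orP; left; apply/eqP; ring.
  have nle : (l1norm h <= 1) = false by rewrite leNgt gt1.
  rewrite /u1 /u2 lp gt1 nle/= mul0r mulr0 add0r mul1r.
  apply: (@le_trans _ _ ((l1norm h `^ (- (N%:R + s * p)))%:E * (K * (l1norm h `^ r) `^ p * br)%:E)%E).
    by apply: lee_wpmul2l; [rewrite lee_fin|exact: hr].
  rewrite -EFinM lee_fin (_ : - (N%:R + (s - r) * p) = - (N%:R + s * p) + r * p); last by ring.
  rewrite [l1norm h `^ (_ + _)]powRD ?nz ?implybT// -powRrM.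
  by rewrite le_eqVlt; apply/orP; left; apply/eqP; ring.
have Kt0 : 0 <= K * bt by exact: mulr_ge0.
have Kr0 : 0 <= K * br by exact: mulr_ge0.
apply: (@le_trans _ _ (nint mu (fun h => K * bt * u1 h + K * br * u2 h)%R)).
  apply: ge0_le_integral => //.
  - move=> h _; apply: mule_ge0; [by rewrite lee_fin powR_ge0|exact: increment_ge0].
  - apply: emeasurable_funM; last exact: measurable_increment.
    by apply/measurable_EFinP; exact: measurable_l1norm_powR.
  - apply/measurable_EFinP; apply: measurable_funD; apply: measurable_funM => //; exact: measurable_cst.
have n1 h : 0 <= K * bt * u1 h by exact: mulr_ge0.
have n2 h : 0 <= K * br * u2 h by exact: mulr_ge0.
have mm1 : measurable_fun setT (fun h => K * bt * u1 h) by apply: measurable_funM => //; exact: measurable_cst.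
have mm2 : measurable_fun setT (fun h => K * br * u2 h) by apply: measurable_funM => //; exact: measurable_cst.
rewrite (nintD mu mm1 mm2 n1 n2) (nintZ mu m1 Kt0 u10) (nintZ mu m2 Kr0 u20).
have h1 := @nint_near_origin R N _ a1; have h2 := @nint_far_from_origin R N _ a2.
set c := 2 ^+ N * unit_ball_mass in h1 h2 *.
have c0 : 0 <= c by rewrite mulr_ge0// exprn_ge0.
have tsp : (t - s) * p <= p by rewrite ler_piMl ?(ltW p0)//; lra.
have srp : (s - r) * p <= p by rewrite ler_piMl ?(ltW p0)//; lra.
have q1 := inv_1_powR2_le a1 tsp; have q2 := inv_1_powR2_le a2 srp.
(* The exponents are (t - s) p and (s - r) p; their factor p is dropped because p > 1. *)
have d1 (d : R) : 0 < d -> c * ((2 + p) / (d * p)) <= c * (2 + p) / d.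
  move=> d0; rewrite -mulrA; apply: ler_wpM2l => //; apply: ler_wpM2l; first by rewrite addr_ge0// ltW.
  by rewrite lef_pV2 ?posrE ?mulr_gt0// ler_peMr// ltW.
apply: (@le_trans _ _ ((K * bt) * (c * (2 + p) / (t - s)) + (K * br) * (c * (2 + p) / (s - r)))%:E).
  rewrite EFinD !(EFinM (K * _)); apply: leeD; apply: lee_wpmul2l; rewrite ?lee_fin//.
    apply: le_trans h1 _; rewrite lee_fin; apply: le_trans (d1 _ _); last by rewrite subr_gt0.
    exact: ler_wpM2l.
  apply: le_trans h2 _; rewrite lee_fin; apply: le_trans (d1 _ _); last by rewrite subr_gt0.
  exact: ler_wpM2l.
by rewrite lee_fin le_eqVlt; apply/orP; left; apply/eqP; ring.
Qed.

Lemma double_integral_shift (F : V -> V -> R) : measurable_fun setT (fun q : V * V => F q.1 q.2) ->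
  (forall x y, 0 <= F x y) ->
  (\int[mu]_y nint mu (F^~ y) = \int[mu]_h nint mu (fun y => F (y + h) y)%R)%E.
Proof.
move=> mF F0.
transitivity (\int[mu]_y nint mu (fun h => F (y + h) y)%R)%E.
  apply: eq_integral => y _.
  have my : measurable_fun setT (fun h => F (y + h) y).
    apply: (measurable_uncurry_comp mF); last exact: measurable_cst.
    by apply: measurable_rVD; [exact: measurable_cst|exact: measurable_id].
  rewrite -(nint_shift y my (fun h => F0 _ _)); apply: eq_integral => x _.
  by rewrite addrC subrK.
apply: (@tonelli _ _ _ V V mu mu (fun y h => F (y + h) y)) => //.
apply: (measurable_uncurry_comp mF); last exact: measurable_fst.
by apply: measurable_rVD; [exact: measurable_fst|exact: measurable_snd].
Qed.

End fractional_seminorm.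

(** * Averaged increments *)

Section smoothing.
Context {R : realType} {N : nat}.
Local Notation V := 'rV[R]_N.
Local Notation mu := (lebesgue_rV R N).
Implicit Types (f k u : V -> R) (x y z : V).

(** Difference quotients have integral 0 by translation invariance, and they converge under a
    decaying majorant. *)
Lemma partial_mean u i : schwartz_real u -> \int[mu]_x partial i u x = 0.
Proof.
move=> Su; have Hu := schwartz_bL1 Su.
have [C1 [C10 [h1 _]]] := schwartz_increment (2 * N) Su.
have [C2 [C20 h2]] := schwartz_taylor2 Su.
pose e n : V := n.+1%:R^-1 *: delta_mx 0 i.
have le n : l1norm (e n) = n.+1%:R^-1 by rewrite l1normZ l1norm_delta mulr1 ger0_norm ?invr_ge0.
have n0 n : n.+1%:R != 0 :> R by rewrite pnatr_eq0.
pose v n x := n.+1%:R * (u (x + e n) - u x).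
have Hv n : bL1 (v n) by apply: bL1Z; apply: bL1B => //; exact: bL1_shiftD.
have iv n : \int[mu]_x v n x = 0.
  rewrite RintegralZ_bL1; last by apply: bL1B => //; exact: bL1_shiftD.
  rewrite RintegralB_bL1//; last exact: bL1_shiftD.
  have [_ _ Iu] := Hu; have := Rintegral_shift (- e n) Iu.
  by under eq_Rintegral do rewrite opprK; move=> ->; rewrite subrr mulr0.
have mp : measurable_fun setT (partial i u).
  by apply: scont_measurable; exact: (@schwartz_scont _ _ _ [::] (schwartz_partial i Su)).
have cv : \int[mu]_x v n x @[n --> \oo] --> \int[mu]_x partial i u x.
  apply: (@dominated_Rintegral _ _ _ mu v _ (fun x => C1 * decay (2 * N) x)) => //.
  - by move=> n; have [] := Hv n.
  - move=> x; apply/cvgrPdist_le => d d0.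
    have : (fun n => C2 * n.+1%:R^-1) @ \oo --> (0 : R).
      by rewrite -(mulr0 C2); apply: cvgMr; exact: cvg_harmonic.
    move=> /cvgr0Pnorm_le/(_ _ d0); apply: filterS => n.
    rewrite ger0_norm ?mulr_ge0 ?invr_ge0//; apply: le_trans.
    have := h2 x (e n); rewrite le.
    have -> : \sum_j e n 0 j * partial j u x = n.+1%:R^-1 * partial i u x.
      rewrite (bigD1 i)//= big1 ?addr0 => [|j ji]; rewrite !mxE ?eqxx ?(negbTE ji) ?mulr1// mulr0 mul0r//.
    move=> h; rewrite distrC /v.
    have -> : n.+1%:R * (u (x + e n) - u x) - partial i u x =
        n.+1%:R * (u (x + e n) - u x - n.+1%:R^-1 * partial i u x).
      by rewrite [RHS]mulrBr mulrA mulfV// mul1r.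
    rewrite normrM ger0_norm//; apply: (@le_trans _ _ (n.+1%:R * (C2 * n.+1%:R^-1 ^+ 2))).
      exact: ler_wpM2l.
    by rewrite mulrCA expr2 (mulrA n.+1%:R) mulfV// mul1r.
  - by apply: integrableRZ; have [] := @bL1_decay R N.
  - move=> n x; have e2 : l1norm (e n) <= 2.
      rewrite le; apply: (@le_trans _ _ 1); last by rewrite ler1n.
      by rewrite invf_le1 ?ltr0n// ler1n.
    rewrite /v normrM ger0_norm//; apply: (@le_trans _ _ (n.+1%:R * (C1 * l1norm (e n) * decay (2 * N) x))).
      by rewrite ler_wpM2l//; exact: h1.
    by rewrite le [C1 / _]mulrC !mulrA mulfV// mul1r.
by have := cv; under eq_fun do rewrite iv; move=> h; apply: (cvg_unique _ h (cvg_cst 0)).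
Qed.

Lemma conv_dilE k f c x : 0 < c -> bL1 k -> bL1 f ->
  bL1 (fun y => f (x - c^-1 *: y) * k y) /\
  conv (dil c k) f x = \int[mu]_y (f (x - c^-1 *: y) * k y).
Proof.
move=> c0 Hk Hf; have [M [M0 fM]] := bL1_bound Hf.
have Hi : bL1 (fun y => f (x - c^-1 *: y) * k y).
  apply: (bL1M (M := M) Hk) => [|y]; last exact: fM.
  have := bL1_affine (c := - c^-1) x _ Hf; rewrite oppr_eq0 invr_eq0 gt_eqF// => /(_ isT) [m _ _].
  by under eq_fun do rewrite addrC -scaleNr.
split=> //; rewrite convC//; last exact: bL1_dil.
have [_ _ Ik] := Hi; rewrite -(Rintegral_dil c0 Ik); apply: eq_Rintegral => y _.
by rewrite /dil scalerA mulVf ?gt_eqF// scale1r mulrCA.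
Qed.

Variables (p : R) (M : nat).
Hypothesis p1 : 1 < p.
Hypothesis HM : (2 * N <= M)%N.

(** The average of the increments over |h| ~ 1/c. A polynomially decaying weight in place of an
    indicator dominates every Schwartz kernel at frequency c. *)
Definition smoothed (c : R) f : \bar R :=
  (\int[mu]_h ((dil c (decay M) h)%:E * increment p f h))%E.

Lemma decay_le_decay x : decay M x <= decay (2 * N) x.
Proof.
rewrite /decay lef_pV2 ?posrE ?exprn_gt0 ?ltr_wpDr ?l1norm_ge0//.
by rewrite ler_weXn2l// lerDl l1norm_ge0.
Qed.

Lemma dil_decay_ge0 c x : 0 <= c -> 0 <= dil c (decay M) x.
Proof. by move=> c0; rewrite mulr_ge0 ?exprn_ge0// ltW// decay_gt0. Qed.

Lemma measurable_dil_decay c : measurable_fun setT (dil c (@decay R N M)).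
Proof. by apply: measurable_dil; exact: measurable_decay. Qed.

Lemma incrementN f h : measurable_fun setT f -> increment p f (- h) = increment p f h.
Proof.
move=> mf; have m : measurable_fun setT (fun x => `|f (x + h) - f x| `^ p).
  by apply: measurable_fun_powR; apply: measurable_fun_normr; msr.
rewrite /increment -(nint_shift h m (fun x => powR_ge0 _ _)); apply: eq_integral => x _.
by rewrite subrK distrC.
Qed.

(** The left-hand function is the integral of f (x - y) - f x against the dilated kernel, so
    Jensen's inequality applies. With mean 1 it is the error of a mollification, with mean 0 a
    derivative of it. *)
Lemma smoothing_error k C : 0 <= C -> measurable_fun setT k -> (forall x, `|k x| <= C * decay M x) ->
  exists B, 0 < B /\ forall c f, 0 < c -> bL1 f ->
  (nint mu (fun x => `|conv (dil c k) f x - (\int[mu]_y k y) * f x| `^ p)%R <= B%:E * smoothed c f)%E.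
Proof.
move=> C0 mk hk; have p0 : 0 < p by rewrite (lt_trans _ p1).
have Hk : bL1 k.
  apply: (@bL1_le_decay _ _ k C mk) => x; apply: le_trans (hk x) _.
  by rewrite ler_wpM2l// decay_le_decay.
pose m : R := \int[mu]_x `|k x| + 1.
have m0 : 0 < m by rewrite ltr_wpDl// Rintegral_ge0.
exists (m `^ (p - 1) * (C + 1)); split; first by rewrite mulr_gt0 ?powR_gt0// ltr_wpDl.
move=> c f c0 Hf; have [mf _ If] := Hf; have Hkc := bL1_dil c0 Hk; have [mkc _ Ikc] := Hkc.
have [Mf [Mf0 fM]] := bL1_bound Hf.
have mdf : measurable_fun setT (fun q : V * V => f (q.1 - q.2) - f q.1) by msr.
have Hd x : bL1 (fun y => dil c k y * (f (x - y) - f x)).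
  have md : measurable_fun setT (fun y => f (x - y) - f x).
    by apply: measurable_funB; [have [] := bL1_reflect x Hf|exact: measurable_cst].
  under eq_fun do rewrite mulrC; apply: (bL1M (M := Mf + Mf) Hkc md) => y.
  by rewrite (le_trans (ler_normB _ _))// lerD.
have E x : conv (dil c k) f x - (\int[mu]_y k y) * f x = \int[mu]_y (dil c k y * (f (x - y) - f x)).
  rewrite convC// /conv -[\int[mu]_y k y](@Rintegral_dil _ _ c)//; last by have [] := Hk.
  rewrite mulrC -RintegralZ_bL1// -RintegralB_bL1; last 2 first.
  - exact: bL1_conv_integrand.
  - exact: bL1Z.
  by apply: eq_Rintegral => y _; ring.
have nkc : (nint mu (fun y => `|dil c k y|)%R <= m%:E)%E.
  rewrite nint_norm_dil// nint_bL1; [|exact: bL1_norm|by []].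
  by rewrite lee_fin lerDl.
pose Q x y := `|dil c k y| * `|f (x - y) - f x| `^ p.
have mQ : measurable_fun setT (fun q : V * V => Q q.1 q.2).
  apply: measurable_funM; last by apply: measurable_fun_powR; exact: measurable_fun_normr.
  by apply: measurable_fun_normr; msr.
have Q0 x y : 0 <= Q x y by rewrite mulr_ge0 ?powR_ge0.
have pt x : ((`|conv (dil c k) f x - (\int[mu]_y k y) * f x| `^ p)%:E <=
    (m `^ (p - 1))%:E * nint mu (Q x))%E.
  have HdA : bL1 (fun y => `|dil c k y| * `|f (x - y) - f x|).
    by have := bL1_norm (Hd x); under eq_fun do rewrite normrM.
  have [_ _ IdA] := HdA.
  apply: (@le_trans _ _ ((\int[mu]_y (`|dil c k y| * `|f (x - y) - f x|)) `^ p)%:E).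
    rewrite lee_fin E; apply: ge0_ler_powR; rewrite ?nnegrE ?(ltW p0)//.
      by apply: Rintegral_ge0 => y _; rewrite mulr_ge0.
    rewrite -lee_fin; apply: le_trans (abs_Rintegral_le _ _) _; first by have [] := Hd x.
    rewrite nint_Rintegral//.
    by rewrite le_eqVlt; apply/orP; left; apply/eqP; apply: eq_integral => y _; rewrite normrM.
  apply: (powR_Rintegral_le p1 m0) => //.
  - exact: measurable_fun_normr.
  - apply: measurable_fun_normr; apply: measurable_funB; last exact: measurable_cst.
    by have [] := bL1_reflect x Hf.
have cm0 : (0 <= (m `^ (p - 1))%:E)%E by rewrite lee_fin powR_ge0.
have mconv : measurable_fun setT (fun x => `|conv (dil c k) f x - (\int[mu]_y k y) * f x| `^ p).
  apply: measurable_fun_powR; apply: measurable_fun_normr; apply: measurable_funB.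
    by have [] := bL1_conv Hkc Hf.
  by apply: measurable_funM => //; exact: measurable_cst.
have mN : measurable_fun setT (fun x => nint mu (Q x)) by exact: measurable_nint.
apply: (@le_trans _ _ ((m `^ (p - 1))%:E * \int[mu]_x nint mu (Q x))%E).
  rewrite -ge0_integralZl//; last by move=> x _; exact: nint_ge0.
  apply: ge0_le_integral => //; first exact/measurable_EFinP.
  by apply: emeasurable_funM => //; exact: measurable_cst.
rewrite EFinM -muleA; apply: lee_wpmul2l => //.
rewrite (@tonelli _ _ _ V V mu mu Q)//.
have mI := measurable_increment p mf.
have i0 h := @increment_ge0 R N p f h.
rewrite /smoothed -ge0_integralZl//; last 3 first.
- by apply: emeasurable_funM => //; apply/measurable_EFinP; exact: measurable_dil_decay.
- by move=> h _; apply: mule_ge0 => //; rewrite lee_fin dil_decay_ge0// ltW.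
- by rewrite lee_fin addr_ge0.
apply: ge0_le_integral.
- exact: measurableT.
- by move=> y _; apply: nint_ge0.
- exact: (@measurable_nint _ _ _ V V mu (fun y x => Q x y) (measurable_uncurry_comp mQ (measurable_snd) (measurable_fst)) (fun y x => Q0 x y)).
- apply: emeasurable_funM; first exact: measurable_cst.
  by apply: emeasurable_funM => //; apply/measurable_EFinP; exact: measurable_dil_decay.
move=> y _; have my : measurable_fun setT (fun x => `|f (x + - y) - f x| `^ p).
  by apply: measurable_fun_powR; apply: measurable_fun_normr; msr.
rewrite (@nintZ _ _ _ mu _ (fun x => `|f (x + - y) - f x| `^ p))//.
rewrite -/(increment p f (- y)) incrementN// muleA; apply: lee_wpmul2r => //.
rewrite -EFinM lee_fin /dil normrM (ger0_norm (exprn_ge0 _ (ltW c0))) mulrCA ler_wpM2l ?exprn_ge0 ?(ltW c0)//.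
apply: le_trans (hk _) _; apply: ler_wpM2r; first exact/ltW/decay_gt0.
by rewrite lerDl.
Qed.

(** The constant depends on c and f. This is harmless: it only multiplies an error that vanishes in
    the limit of Riemann sums. *)
Lemma conv_taylor phi c f : 0 < c -> schwartz_real phi -> bL1 f ->
  exists C, 0 <= C /\ forall x z, `|conv (dil c phi) f (x + z) - conv (dil c phi) f x -
     \sum_i z 0 i * (c * conv (dil c (partial i phi)) f x)| <= C * l1norm z ^+ 2.
Proof.
move=> c0 Sphi Hf; have [C [C0 hC]] := schwartz_taylor2 Sphi.
have Hp := bL1_dil c0 (schwartz_bL1 Sphi).
have Hpi i := bL1_dil c0 (schwartz_bL1 (schwartz_partial i Sphi)).
have [mf _ If] := Hf.
exists (c ^+ N * C * c ^+ 2 * \int[mu]_y `|f y|); split.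
  by rewrite !mulr_ge0 ?exprn_ge0 ?(ltW c0)// Rintegral_ge0.
move=> x z.
pose D y := dil c phi (x + z - y) - dil c phi (x - y) - \sum_i z 0 i * (c * dil c (partial i phi) (x - y)).
have b1 := bL1_conv_integrand (x + z) Hp Hf; have b2 := bL1_conv_integrand x Hp Hf.
have b3 i := bL1_conv_integrand x (Hpi i) Hf.
have b4 : bL1 (fun y => \sum_i z 0 i * (c * (dil c (partial i phi) (x - y) * f y))).
  by apply: bL1_sum => i; do 2 apply: bL1Z; exact: b3.
have -> : conv (dil c phi) f (x + z) - conv (dil c phi) f x -
     \sum_i z 0 i * (c * conv (dil c (partial i phi)) f x) = \int[mu]_y (D y * f y).
  have -> : \sum_i z 0 i * (c * conv (dil c (partial i phi)) f x) =
      \int[mu]_y (\sum_i z 0 i * (c * (dil c (partial i phi) (x - y) * f y))).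
    rewrite Rintegral_sum; last by move=> i; do 2 apply: integrableRZ; have [] := b3 i.
    apply: eq_bigr => i _; rewrite RintegralZ_bL1; last by apply: bL1Z; exact: b3.
    by rewrite RintegralZ_bL1; last exact: b3.
  rewrite /conv -RintegralB_bL1// -RintegralB_bL1//; last exact: bL1B.
  apply: eq_Rintegral => y _; rewrite /D !mulrBl; congr (_ - _).
  by rewrite mulr_suml; apply: eq_bigr => i _; rewrite !mulrA.
have DB y : `|D y| <= c ^+ N * C * c ^+ 2 * l1norm z ^+ 2.
  have -> : D y = c ^+ N * (phi (c *: (x - y) + c *: z) - phi (c *: (x - y)) -
      \sum_i (c *: z) 0 i * partial i phi (c *: (x - y))).
    rewrite /D /dil !mulrBr mulr_sumr; congr (_ * phi _ - _ - _).
      by rewrite -scalerDr addrAC.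
    by apply: eq_bigr => i _; rewrite !mxE; ring.
  have cN : 0 <= c ^+ N by rewrite exprn_ge0// ltW.
  rewrite normrM (ger0_norm cN) -!mulrA; apply: ler_wpM2l => //.
  apply: le_trans (hC _ _) _; rewrite l1normZ (gtr0_norm c0).
  by rewrite le_eqVlt; apply/orP; left; apply/eqP; ring.
have HDf : bL1 (fun y => D y * f y).
  rewrite (_ : (fun y => _) = (fun y => dil c phi (x + z - y) * f y - dil c phi (x - y) * f y -
     \sum_i z 0 i * (c * (dil c (partial i phi) (x - y) * f y)))).
    by apply: bL1B => //; exact: bL1B.
  apply/funext => y; rewrite /D !mulrBl; congr (_ - _).
  by rewrite mulr_suml; apply: eq_bigr => i _; rewrite !mulrA.
have [mDf _ _] := HDf.
rewrite -lee_fin; apply: le_trans (abs_Rintegral_le _ mDf) _.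
rewrite mulrAC EFinM nint_Rintegral//; last exact: integrableR_norm.
have q0 : 0 <= c ^+ N * C * c ^+ 2 * l1norm z ^+ 2.
  by rewrite !mulr_ge0 ?exprn_ge0 ?(ltW c0) ?l1norm_ge0.
have mn : measurable_fun setT (fun y => `|f y|) by msr.
rewrite -nintZ//; apply: le_nint => //.
- exact: measurable_fun_normr.
- by apply: measurable_funM => //; exact: measurable_cst.
- by move=> y; rewrite normrM; apply: ler_wpM2r.
Qed.

(* Riemann sums for [F(x - z) - F(x) = - \int_0^1 z . grad F(x - s z) ds]. *)
Lemma riemann_increment (F : V -> R) (G : 'I_N -> V -> R) C n x z : 0 <= C ->
  (forall x z, `|F (x + z) - F x - \sum_i z 0 i * G i x| <= C * l1norm z ^+ 2) ->
  `|F (x - z) - F x + \sum_(m < n.+1) n.+1%:R^-1 * (\sum_i z 0 i * G i (x - (m.+1%:R / n.+1%:R) *: z))| <=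
    C * l1norm z ^+ 2 / n.+1%:R.
Proof.
move=> C0 H; set q : R := n.+1%:R; have q0 : 0 < q by rewrite ltr0n.
pose X (m : nat) := x - (m%:R / q) *: z.
have X0 : X 0 = x by rewrite /X mul0r scale0r subr0.
have Xn : X n.+1 = x - z by rewrite /X mulfV ?gt_eqF// scale1r.
have -> : F (x - z) - F x = \sum_(m < n.+1) (F (X m.+1) - F (X m)).
  rewrite -Xn -{1}X0; elim: (n.+1) => [|k IH]; first by rewrite big_ord0 subrr.
  by rewrite big_ord_recr/= -IH; ring.
rewrite -big_split/=; apply: le_trans (ler_norm_sum _ _ _) _.
apply: (@le_trans _ _ (\sum_(m < n.+1) C * (q^-1 * l1norm z) ^+ 2)).
  apply: ler_sum => m _; have h := H (X m.+1) (q^-1 *: z).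
  have e1 : X m.+1 + q^-1 *: z = X m.
    by apply/rowP => j; rewrite !mxE -natr1; field; rewrite gt_eqF.
  have e2 : \sum_i (q^-1 *: z) 0 i * G i (X m.+1) = q^-1 * \sum_i z 0 i * G i (X m.+1).
    by rewrite mulr_sumr; apply: eq_bigr => i _; rewrite mxE mulrA.
  have qi : 0 <= q^-1 by rewrite invr_ge0 ltW.
  rewrite e1 e2 l1normZ (ger0_norm qi) in h; rewrite -[leLHS]normrN; apply: le_trans h.
  by rewrite le_eqVlt; apply/orP; left; apply/eqP; congr (`|_|); rewrite /X; ring.
rewrite sumr_const card_ord -(mulr_natl (C * _)) -/q le_eqVlt; apply/orP; left; apply/eqP.
by field; rewrite gt_eqF.
Qed.

End smoothing.

(** * Frequencies below a threshold *)

Section low_frequency_bound.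
Context {R : realType} {N : nat}.
Local Notation V := 'rV[R]_N.
Local Notation mu := (lebesgue_rV R N).

Lemma vnorm_sum (I : finType) J (s : seq J) (a : J -> I -> R) :
  vnorm (fun i => \sum_(j <- s) a j i) <= \sum_(j <- s) vnorm (a j).
Proof.
elim: s => [|j s IH].
  rewrite big_nil (_ : vnorm _ = 0)//; rewrite /vnorm big1 ?sqrtr0// => i _.
  by rewrite big_nil expr0n.
rewrite big_cons (_ : vnorm _ = vnorm (fun i => a j i + \sum_(j <- s) a j i)).
  by apply: le_trans (vnorm_triangle _ _) _; rewrite lerD2l.
by rewrite /vnorm; congr Num.sqrt; apply: eq_bigr => i _; rewrite big_cons.
Qed.

Lemma cvg_vnorm (I : finType) (u : nat -> I -> R) (v : I -> R) :
  (forall i, u n i @[n --> \oo] --> v i) -> vnorm (u n) @[n --> \oo] --> vnorm v.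
Proof.
move=> uv; rewrite /vnorm; apply: continuous_cvg; first exact: sqrt_continuous.
elim: (index_enum I) => [|i s IH].
  by under eq_fun do rewrite big_nil; rewrite big_nil; exact: cvg_cst.
under eq_fun do rewrite big_cons; rewrite big_cons; apply: cvgD => //.
by rewrite expr2; under eq_fun do rewrite expr2; apply: cvgM.
Qed.

(** Convexity loses no constant, so a bound for the summands survives the refinement of Riemann
    sums. *)
Lemma nint_powR_mean_le n (F : 'I_n.+1 -> V -> R) p (X : \bar R) : 1 < p -> (0 <= X)%E ->
  (forall i, measurable_fun setT (F i)) -> (forall i x, 0 <= F i x) ->
  (forall i, (nint mu (fun x => F i x `^ p)%R <= X)%E) ->
  (nint mu (fun x => (\sum_i n.+1%:R^-1 * F i x) `^ p)%R <= X)%E.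
Proof.
move=> p1 X0 mF F0 hX; have q0 : 0 < n.+1%:R :> R by rewrite ltr0n.
have qi : 0 <= n.+1%:R^-1 :> R by rewrite invr_ge0 ltW.
have mFp i : measurable_fun setT (fun x => F i x `^ p) by apply: measurable_fun_powR.
have mFq i : measurable_fun setT (fun x => n.+1%:R^-1 * F i x `^ p).
  by apply: measurable_funM => //; exact: measurable_cst.
have e1 : \sum_(i < n.+1) n.+1%:R^-1 = 1 :> R.
  by rewrite sumr_const card_ord -(mulr_natl (n.+1%:R^-1 : R)) mulfV ?gt_eqF.
apply: (@le_trans _ _ (nint mu (fun x => \sum_i n.+1%:R^-1 * F i x `^ p)%R)).
  apply: le_nint.
  - apply: measurable_fun_powR; apply: measurable_fun_bigsum => i.
    by apply: measurable_funM => //; exact: measurable_cst.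
  - exact: measurable_fun_bigsum.
  - by move=> x; exact: powR_ge0.
  - by move=> x; apply: powR_mean_le.
rewrite nint_sum//; last by move=> i x; rewrite mulr_ge0// powR_ge0.
apply: (@le_trans _ _ (\sum_(i < n.+1) n.+1%:R^-1%:E * X)%E).
  apply: lee_sum => i _; rewrite nintZ//; last by move=> x; exact: powR_ge0.
  by apply: lee_wpmul2l; rewrite ?lee_fin.
rewrite -ge0_sume_distrl; last by move=> i _; rewrite lee_fin.
by rewrite sumEFin e1 mul1e.
Qed.

Variables (eta phi : V -> R) (p : R) (M : nat).
Hypotheses (N0 : (0 < N)%N) (p1 : 1 < p) (HM : (2 * N <= M)%N).
Hypotheses (Seta : schwartz_real eta) (eta_mean : \int[mu]_x eta x = 0).
Hypothesis eta_even : forall x, eta (- x) = eta x.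
Hypotheses (Sphi : schwartz_real phi) (phi_mean : \int[mu]_x phi x = 1).

(** As [eta] has mean zero, the right-hand side integrates t (F (x - y/t) - F x) against eta y. The
    increment is minus the integral of (y/t) . G along the segment: t cancels, and the node
    (m+1)/(n+1) turns into a dilation of the moment kernel by its inverse. Right end points keep
    these dilations finite. *)
Lemma riemann_cvg (F : V -> R) (G : 'I_N -> V -> R) C t x : 0 < t -> 0 <= C ->
  bL1 F -> (forall l, bL1 (G l)) ->
  (forall x z, `|F (x + z) - F x - \sum_i z 0 i * G i x| <= C * l1norm z ^+ 2) ->
  \sum_(m < n.+1) n.+1%:R^-1 *
    (\sum_l conv (dil (t * (n.+1%:R / m.+1%:R)) (moment_kernel eta l)) (G l) x) @[n --> \oo]
  --> t * conv (dil t eta) F x.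
Proof.
move=> t0 C0 HF HG H; have He := schwartz_bL1 Seta.
have ceta : scont eta := @schwartz_scont _ _ _ [::] Seta.
have [A [_ KM]] := moment_kernel_lp Seta eta_even.
have Hz l : bL1 (moment_kernel eta l) by have [] := KM l.
have [Ce [Ce0 he]] := schwartz_decay (2 * N).+2 Seta.
have ml := measurable_l1norm (R:=R)(N:=N).
have me := scont_measurable ceta.
have H2 : bL1 (fun y => l1norm y ^+ 2 * `|eta y|).
  apply: (@bL1_le_decay _ _ _ Ce) => [|y].
    by apply: measurable_funM; [exact: measurable_funX|exact: measurable_fun_normr].
  rewrite ger0_norm ?mulr_ge0 ?l1norm_ge0//.
  apply: (@le_trans _ _ (l1norm y ^+ 2 * (Ce * decay (2 * N).+2 y))); first by rewrite ler_wpM2l// sqr_ge0.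
  rewrite mulrCA ler_wpM2l// expr2 -mulrA.
  apply: le_trans (decayS (2 * N) y); apply: ler_wpM2l; first exact: l1norm_ge0.
  exact: decayS.
pose I2 := \int[mu]_y (l1norm y ^+ 2 * `|eta y|).
pose K := t * (C * t^-1 ^+ 2) * I2.
have ti : 0 <= t^-1 by rewrite invr_ge0 ltW.
have bd n : `|\sum_(m < n.+1) n.+1%:R^-1 *
    (\sum_l conv (dil (t * (n.+1%:R / m.+1%:R)) (moment_kernel eta l)) (G l) x) -
    t * conv (dil t eta) F x| <= K * n.+1%:R^-1.
  set q : R := n.+1%:R; have q0 : 0 < q by rewrite ltr0n.
  have [b1 ->] := conv_dilE x t0 He HF.
  pose s (m : 'I_n.+1) : R := t * (q / m.+1%:R).
  have s0 m : 0 < s m by rewrite mulr_gt0// divr_gt0// ltr0n.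
  have b2 m l := (conv_dilE x (s0 m) (Hz l) (HG l)).1.
  have e2 m l := (conv_dilE x (s0 m) (Hz l) (HG l)).2.
  pose J1 y := t * (F (x - t^-1 *: y) * eta y - F x * eta y).
  have HJ1 : bL1 J1 by apply: bL1Z; apply: bL1B => //; exact: bL1Z.
  pose J2 y := \sum_(m < n.+1) q^-1 * \sum_l (G l (x - (s m)^-1 *: y) * moment_kernel eta l y).
  have HJ2 : bL1 J2 by apply: bL1_sum => m; apply: bL1Z; apply: bL1_sum => l; exact: b2.
  have E1 : t * \int[mu]_y (F (x - t^-1 *: y) * eta y) = \int[mu]_y J1 y.
    rewrite RintegralZ_bL1 ?RintegralB_bL1 ?RintegralZ_bL1 ?eta_mean ?mulr0 ?subr0//; first exact: bL1Z.
    by apply: bL1B => //; exact: bL1Z.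
  have E2 : \sum_(m < n.+1) q^-1 * (\sum_l conv (dil (s m) (moment_kernel eta l)) (G l) x) = \int[mu]_y J2 y.
    rewrite Rintegral_sum; last first.
      by move=> m; have [] // : bL1 (fun y => q^-1 * \sum_l (G l (x - (s m)^-1 *: y) * moment_kernel eta l y));
         apply: bL1Z; apply: bL1_sum => l; exact: b2.
    apply: eq_bigr => m _; rewrite RintegralZ_bL1; last by apply: bL1_sum => l; exact: b2.
    rewrite Rintegral_sum; last by move=> l; have [] := b2 m l.
    by congr (_ * _); apply: eq_bigr => l _; rewrite e2.
  rewrite E1 E2 distrC -RintegralB_bL1//.
  have HJ : bL1 (fun y => J1 y - J2 y) by exact: bL1B.
  have k0 : 0 <= t * (C * t^-1 ^+ 2) / q.
    by rewrite !mulr_ge0 ?invr_ge0 ?sqr_ge0 ?(ltW t0) ?(ltW q0)// exprn_ge0.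
  have pt y : `|J1 y - J2 y| <= t * (C * t^-1 ^+ 2) / q * (l1norm y ^+ 2 * `|eta y|).
    pose z := t^-1 *: y.
    have -> : J1 y - J2 y = t * eta y * (F (x - z) - F x +
        \sum_(m < n.+1) n.+1%:R^-1 * (\sum_i z 0 i * G i (x - (m.+1%:R / n.+1%:R) *: z))).
      rewrite mulrDr; congr (_ + _); first by rewrite /J1 -/z; ring.
      rewrite /J2 -sumrN mulr_sumr; apply: eq_bigr => m _.
      rewrite -mulrN -sumrN -/q mulrCA; congr (_ * _); rewrite mulr_sumr; apply: eq_bigr => l _.
      have -> : (s m)^-1 *: y = (m.+1%:R / q) *: z.
        by rewrite /z scalerA /s; congr (_ *: _); field; rewrite !gt_eqF ?ltr0n.
      by rewrite /moment_kernel !mxE; field; rewrite gt_eqF.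
    rewrite normrM normrM (gtr0_norm t0).
    apply: (@le_trans _ _ (t * `|eta y| * (C * l1norm z ^+ 2 / q))).
      by apply: ler_wpM2l; [rewrite mulr_ge0// ltW|exact: (riemann_increment n x z C0 H)].
    rewrite /z l1normZ (ger0_norm ti) le_eqVlt; apply/orP; left; apply/eqP; ring.
  have [mJ _ _] := HJ; have [m2 _ Iy2] := H2.
  rewrite -lee_fin; apply: le_trans (abs_Rintegral_le _ mJ) _.
  have -> : K / q = t * (C * t^-1 ^+ 2) / q * I2 by rewrite /K; ring.
  have z0 y : 0 <= l1norm y ^+ 2 * `|eta y| by rewrite mulr_ge0// sqr_ge0.
  rewrite EFinM /I2 nint_Rintegral// -nintZ//; apply: le_nint => //.
  - exact: measurable_fun_normr.
  - by apply: measurable_funM => //; exact: measurable_cst.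
apply/cvgrPdist_le => d d0.
have : (fun n => K * n.+1%:R^-1) @ \oo --> (0 : R).
  by rewrite -(mulr0 K); apply: cvgMr; exact: cvg_harmonic.
move=> /cvgr0Pnorm_le/(_ _ d0); apply: filterS => n h.
by rewrite distrC; apply: le_trans (bd n) (le_trans (ler_norm _) h).
Qed.

(** f is split into f - F and F with F its mollification at frequency c. For f - F the weight is at
    most c and the mollification error is small; for F the weight is exchanged for derivatives of F,
    which cost c as well. *)
Lemma low_frequency_bound : exists C, 0 < C /\ forall n (a c : R) (f : V -> R), 0 < a -> 0 < c ->
  (forall i : 'I_n, a * 2 ^+ i <= c) -> bL1 f -> scont f ->
  (nint mu (fun x => vabs (fun (i : 'I_n) x => (a * 2 ^+ i) * conv (dil (a * 2 ^+ i) eta) f x) x `^ p)%R <=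
   (C * c `^ p)%:E * smoothed p M c f)%E.
Proof.
have p0 : 0 < p by rewrite (lt_trans _ p1).
have [A1 [A10 K1]] := schwartz_lp_kernel Seta eta_mean.
have [A2 [A20 K2]] := moment_kernel_lp Seta eta_even.
have He : bL1 eta := schwartz_bL1 Seta.
have ceta : scont eta := @schwartz_scont _ _ _ [::] Seta.
have Hphi := schwartz_bL1 Sphi.
have cphi : scont phi := @schwartz_scont _ _ _ [::] Sphi.
pose A := A1 + A2 + 1.
have A0 : 0 < A by rewrite ltr_wpDl// addr_ge0.
have {}K1 : lp_kernel A eta by apply: lp_kernel_le K1; rewrite /A -addrA lerDl addr_ge0.
have {}K2 l : lp_kernel A (moment_kernel eta l).
  by apply: lp_kernel_le (K2 l); rewrite /A addrAC lerDr addr_ge0.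
have [C0 [C00 KB]] := @kernel_bounds R N p A N0 p1 A0.
have [D0 [D00 hD]] := schwartz_decay M Sphi.
have [B1 [B10 hB1]] := @smoothing_error R N p M p1 HM phi D0 D00 (scont_measurable cphi) hD.
have Spi i := schwartz_partial i Sphi.
have cpi i : scont (partial i phi) := @schwartz_scont _ _ _ [::] (Spi i).
have [B2 [B20 hB2]] : exists B2, 0 <= B2 /\ forall i : 'I_N, forall c f, 0 < c -> bL1 f ->
    (nint mu (fun x => `|conv (dil c (partial i phi)) f x| `^ p)%R <= B2%:E * smoothed p M c f)%E.
  apply: (@uniform_bound R N (fun i B => forall c f, 0 < c -> bL1 f ->
    (nint mu (fun x => `|conv (dil c (partial i phi)) f x| `^ p)%R <= B%:E * smoothed p M c f)%E)).
    move=> i a b ab h c f c0 Hf; apply: le_trans (h c f c0 Hf) _.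
    apply: lee_wpmul2r; last by rewrite lee_fin.
    apply: integral_ge0 => y _; apply: mule_ge0; last exact: increment_ge0.
    by rewrite lee_fin; apply: dil_decay_ge0; exact: ltW.
  move=> i; have [Di [Di0 hDi]] := schwartz_decay M (Spi i).
  have [B [B0 hB]] := @smoothing_error R N p M p1 HM _ Di Di0 (scont_measurable (cpi i)) hDi.
  exists B; split; first exact: ltW.
  move=> c f c0 Hf; apply: le_trans (hB c f c0 Hf); rewrite (partial_mean i Sphi).
  rewrite le_eqVlt; apply/orP; left; apply/eqP; apply: eq_integral => x _.
  by rewrite mul0r subr0.
pose Ctot := 2 `^ (p - 1) * (C0 * B1 + N%:R `^ p * (C0 * B2)).
have Ct0 : 0 <= C0 * B1 by rewrite mulr_ge0// ltW.
have Ct1 : 0 <= N%:R `^ p * (C0 * B2) by rewrite !mulr_ge0 ?powR_ge0// ltW.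
exists (Ctot + 1); split.
  by rewrite ltr_wpDl// mulr_ge0 ?powR_ge0// addr_ge0.
move=> n a c f a0 c0 hac Hf cf; have [mf _ If] := Hf.
set W := smoothed p M c f.
have W0 : (0 <= W)%E.
  apply: integral_ge0 => y _; apply: mule_ge0; last exact: increment_ge0.
  by rewrite lee_fin; apply: dil_decay_ge0; exact: ltW.
pose t (i : 'I_n) := a * 2 ^+ i.
have t0 i : 0 < t i by rewrite mulr_gt0// exprn_gt0.
have Hpc : bL1 (dil c phi) by exact: bL1_dil.
have cpc : scont (dil c phi) by exact: scont_dil.
pose F := conv (dil c phi) f; pose G (l : 'I_N) x := c * conv (dil c (partial l phi)) f x.
have HF : bL1 F by exact: bL1_conv.
have sF : scont F by have [m b _] := Hpc; exact: scont_conv.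
have Hpl l : bL1 (dil c (partial l phi)) by apply: bL1_dil => //; exact: schwartz_bL1.
have HG l : bL1 (G l) by apply: bL1Z; exact: bL1_conv.
have sG l : scont (G l).
  by apply: scontZ; have [m b _] := Hpl l; apply: scont_conv => //; exact: scont_dil.
have nF : (nint mu (fun x => `|f x - F x| `^ p)%R <= B1%:E * W)%E.
  have := hB1 c f c0 Hf; rewrite phi_mean; apply: le_trans.
  by rewrite le_eqVlt; apply/orP; left; apply/eqP; apply: eq_integral => x _; rewrite mul1r distrC.
have cp0 : 0 <= c `^ p by exact: powR_ge0.
have nG l : (nint mu (fun x => `|G l x| `^ p)%R <= (c `^ p * B2)%:E * W)%E.
  have [mc _ _] := bL1_conv (Hpl l) Hf.
  have mcp : measurable_fun setT (fun x => `|conv (dil c (partial l phi)) f x| `^ p).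
    by apply: measurable_fun_powR; exact: measurable_fun_normr.
  apply: (@le_trans _ _ (nint mu (fun x => c `^ p * `|conv (dil c (partial l phi)) f x| `^ p)%R)).
    rewrite le_eqVlt; apply/orP; left; apply/eqP; apply: eq_integral => x _.
    by rewrite /G normrM (gtr0_norm c0) powRM// ltW.
  rewrite nintZ//.
  by rewrite EFinM -muleA; apply: lee_wpmul2l; [rewrite lee_fin|exact: hB2].
pose P (i : 'I_n) x := t i * conv (dil (t i) eta) (fun y => f y - F y) x.
pose Q (i : 'I_n) x := t i * conv (dil (t i) eta) F x.
have HfF : bL1 (fun y => f y - F y) by exact: bL1B.
have cfF : scont (fun y => f y - F y) by apply: scontB.
have Hd i : bL1 (dil (t i) eta) by exact: bL1_dil.
have mP : measurable_fun setT (vabs P).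
  by apply: measurable_vabs => i; have [] := bL1Z (t i) (bL1_conv (Hd i) HfF).
have mQ : measurable_fun setT (vabs Q).
  by apply: measurable_vabs => i; have [] := bL1Z (t i) (bL1_conv (Hd i) HF).
have nP : (nint mu (fun x => vabs P x `^ p)%R <= (c `^ p * (C0 * B1))%:E * W)%E.
  have [_ KA] := KB n a (fun=> eta) a0 (fun=> K1); have h := KA _ HfF cfF.
  set T := vabs (fun i : 'I_n => conv (dil (a * 2 ^+ i) eta) (fun y => f y - F y)) in h *.
  have mT : measurable_fun setT T.
    by apply: measurable_vabs => i; have [] := bL1_conv (Hd i) HfF.
  have mTp : measurable_fun setT (fun x => T x `^ p) by exact: measurable_fun_powR.
  apply: (@le_trans _ _ (nint mu (fun x => c `^ p * T x `^ p)%R)).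
    apply: le_nint.
    - exact: measurable_fun_powR.
    - by apply: measurable_funM => //; exact: measurable_cst.
    - by move=> x; exact: powR_ge0.
    - move=> x; rewrite -powRM ?(ltW c0) ?vnorm_ge0//.
      apply: ge0_ler_powR; rewrite ?nnegrE ?mulr_ge0 ?vnorm_ge0 ?(ltW p0) ?(ltW c0)//.
      apply: vnorm_le; first exact: ltW.
      by move=> i; rewrite /P normrM (gtr0_norm (t0 i)); apply: ler_wpM2r => //; exact: hac.
  rewrite (nintZ mu mTp cp0)//; last by move=> x; exact: powR_ge0.
  rewrite EFinM -muleA; apply: lee_wpmul2l; first by rewrite lee_fin.
  apply: le_trans h _; rewrite EFinM -muleA; apply: lee_wpmul2l => //.
  by rewrite lee_fin ltW.
pose XN := ((N%:R `^ p * (C0 * (c `^ p * B2)))%:E * W)%E.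
have XN0 : (0 <= XN)%E.
  by apply: mule_ge0 => //; rewrite lee_fin !mulr_ge0 ?powR_ge0// ltW.
have nQ : (nint mu (fun x => vabs Q x `^ p)%R <= XN)%E.
  have [Ct [Ct00 hT]] := conv_taylor c0 Sphi Hf.
  (* For a fixed node m the kernels form a dyadic family again, started at a (k+1)/(m+1); the
     constant of [kernel_bounds] does not see the starting point. *)
  pose v k (m : 'I_k.+1) (l : 'I_N) := fun i : 'I_n =>
    conv (dil (a * (k.+1%:R / m.+1%:R) * 2 ^+ i) (moment_kernel eta l)) (G l).
  have s0 k (m : 'I_k.+1) : 0 < a * (k.+1%:R / m.+1%:R) by rewrite mulr_gt0// divr_gt0// ltr0n.
  have Hv k m l i : bL1 (@v k m l i).
    apply: bL1_conv => //; apply: bL1_dil; first by rewrite mulr_gt0// exprn_gt0.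
    by have [] := K2 l.
  have mv k m l : measurable_fun setT (vabs (@v k m l)).
    by apply: measurable_vabs => i; have [] := Hv k m l i.
  have nv k m l : (nint mu (fun x => vabs (@v k m l) x `^ p)%R <= (C0 * (c `^ p * B2))%:E * W)%E.
    have [_ KA] := KB n _ (fun=> moment_kernel eta l) (s0 k m) (fun=> K2 l).
    apply: le_trans (KA _ (HG l) (sG l)) _; rewrite EFinM -muleA; apply: lee_wpmul2l => //.
    by rewrite lee_fin ltW.
  pose U k x := vnorm (fun i : 'I_n => \sum_(m < k.+1) k.+1%:R^-1 * (\sum_l @v k m l i x)).
  have mU k : measurable_fun setT (U k).
    apply: (@measurable_vabs _ _ _ (fun (i : 'I_n) x => \sum_(m < k.+1) k.+1%:R^-1 * (\sum_l @v k m l i x))) => i.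
    apply: measurable_fun_bigsum => m; apply: measurable_funM; first exact: measurable_cst.
    by apply: measurable_fun_bigsum => l; have [] := Hv k m l i.
  (* The bound for the Riemann sums is uniform in the number of nodes, so Fatou's lemma applies. *)
  apply: (@nint_le_lim _ _ _ mu (fun k x => U k x `^ p)).
  - by move=> k; exact: measurable_fun_powR.
  - by move=> k x; exact: powR_ge0.
  - move=> x; apply: cvg_powR => // [k|]; first exact: vnorm_ge0.
    apply: cvg_vnorm => i.
    have := @riemann_cvg F G Ct (t i) x (t0 i) Ct00 HF HG hT.
    rewrite (_ : (fun k => \sum_(m < k.+1) k.+1%:R^-1 * _) =
      (fun k => \sum_(m < k.+1) k.+1%:R^-1 * (\sum_l @v k m l i x)))//.
    apply/funext => k; apply: eq_bigr => m _; congr (_ * _); apply: eq_bigr => l _.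
    by rewrite /v /t mulrAC.
  - apply: nearW => k.
    pose S (m : 'I_k.+1) x := \sum_l vabs (@v k m l) x.
    have mS m : measurable_fun setT (S m) by exact: measurable_fun_bigsum.
    have S0 m x : 0 <= S m x by apply: sumr_ge0 => l _; exact: vnorm_ge0.
    have nS m : (nint mu (fun x => S m x `^ p)%R <= XN)%E.
      have Z0 : (0 <= (C0 * (c `^ p * B2))%:E * W)%E.
        by apply: mule_ge0 => //; rewrite lee_fin !mulr_ge0// ltW.
      have := @nint_powR_sum_le R N _ (fun l : 'I_N => vabs (@v k m l)) p _ p1 Z0 (mv k m)
        (fun l x => vnorm_ge0 _) (nv k m).
      by rewrite card_ord => hS; rewrite /XN EFinM -muleA; exact: hS.
    apply: le_trans (nint_powR_mean_le p1 XN0 mS S0 nS); apply: le_nint.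
    + exact: measurable_fun_powR.
    + apply: measurable_fun_powR; apply: measurable_fun_bigsum => m.
      by apply: measurable_funM => //; exact: measurable_cst.
    + by move=> x; exact: powR_ge0.
    + have qi : 0 <= k.+1%:R^-1 :> R by rewrite invr_ge0.
      move=> x; apply: ge0_ler_powR; rewrite ?nnegrE ?vnorm_ge0 ?(ltW p0)//.
        by apply: sumr_ge0 => m _; rewrite mulr_ge0.
      apply: le_trans (vnorm_sum _ _) _; apply: ler_sum => m _.
      rewrite vnormZ//; apply: ler_wpM2l => //; exact: vnorm_sum.
have PQ (i : 'I_n) x : (a * 2 ^+ i) * conv (dil (a * 2 ^+ i) eta) f x = P i x + Q i x.
  by rewrite /P /Q -/(t i) convBr//; ring.
have h2 : 0 <= 2 `^ (p - 1) :> R by exact: powR_ge0.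
have mPp : measurable_fun setT (fun x => vabs P x `^ p) by exact: measurable_fun_powR.
have mQp : measurable_fun setT (fun x => vabs Q x `^ p) by exact: measurable_fun_powR.
apply: (@le_trans _ _ (nint mu (fun x => 2 `^ (p - 1) * (vabs P x `^ p + vabs Q x `^ p))%R)).
  apply: le_nint.
  - apply: measurable_fun_powR; apply: measurable_vabs => i.
    by have [] := bL1Z (a * 2 ^+ i) (bL1_conv (Hd i) Hf).
  - exact: (measurable_funM (measurable_cst _) (measurable_funD mPp mQp)).
  - by move=> x; exact: powR_ge0.
  - move=> x; apply: le_trans (powRD_le p1 (vnorm_ge0 _) (vnorm_ge0 _)).
    apply: ge0_ler_powR; rewrite ?nnegrE ?addr_ge0 ?vnorm_ge0 ?(ltW p0)//.
    apply: le_trans (vnorm_triangle _ _); rewrite /vabs /vnorm.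
    by rewrite (eq_bigr (fun i => (P i x + Q i x) ^+ 2))// => i _; rewrite PQ.
have nP0 x : 0 <= vabs P x `^ p by exact: powR_ge0.
have nQ0 x : 0 <= vabs Q x `^ p by exact: powR_ge0.
rewrite (nintZ mu (measurable_funD mPp mQp) h2 (fun x => addr_ge0 (nP0 x) (nQ0 x))) (nintD mu mPp mQp nP0 nQ0).
apply: (@le_trans _ _ ((2 `^ (p - 1))%:E * ((c `^ p * (C0 * B1))%:E * W + XN))%E).
  by apply: lee_wpmul2l; [rewrite lee_fin|apply: leeD].
rewrite /XN -ge0_muleDl ?lee_fin; first last.
- by rewrite !mulr_ge0 ?powR_ge0// ltW.
- by rewrite mulr_ge0.
rewrite muleA -EFinD -EFinM; apply: lee_wpmul2r => //; rewrite lee_fin /Ctot mulrDl mul1r.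
apply: ler_wpDr => //; rewrite le_eqVlt; apply/orP; left; apply/eqP; ring.
Qed.

End low_frequency_bound.

(** * Comparison of averaged increments at different scales *)

Section scaling_of_smoothed.
Context {R : realType} {N : nat}.
Local Notation V := 'rV[R]_N.
Local Notation mu := (lebesgue_rV R N).
Variables (p : R) (M : nat).
Hypothesis p1 : 1 < p.
Implicit Types (f : V -> R) (h : V).

Let p0 : 0 < p. Proof. by rewrite (lt_trans _ p1). Qed.

Lemma mule2_ereal (x : \bar R) : (0 <= x)%E -> (x + x = 2%:E * x)%E.
Proof.
move=> x0; rewrite (_ : 2%:E = (1%:E + 1%:E)%E :> \bar R); last by rewrite -EFinD.
by rewrite ge0_muleDl ?lee_fin// !mul1e.
Qed.

Lemma increment_double f h : measurable_fun setT f ->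
  (increment p f (2 *: h) <= (2 `^ p)%:E * increment p f h)%E.
Proof.
move=> mf; have mD : measurable_fun setT (fun x : V => f (x + h) - f x).
  by apply: measurable_funB => //; msr.
have mDp : measurable_fun setT (fun x : V => `|f (x + h) - f x| `^ p).
  by apply: measurable_fun_powR; exact: measurable_fun_normr.
have mDh : measurable_fun setT (fun x : V => `|f (x + h + h) - f (x + h)| `^ p).
  by apply: measurable_fun_powR; apply: measurable_fun_normr; msr.
have sh : nint mu (fun x => `|f (x + h + h) - f (x + h)| `^ p) = increment p f h.
  exact: (nint_shift_powR p h mD).
have q0 : 0 <= 2 `^ (p - 1) :> R by exact: powR_ge0.
apply: (@le_trans _ _ (nint mu (fun x => 2 `^ (p - 1) *
    (`|f (x + h + h) - f (x + h)| `^ p + `|f (x + h) - f x| `^ p))%R)).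
  apply: le_nint.
  - by apply: measurable_fun_powR; apply: measurable_fun_normr; msr.
  - by apply: measurable_funM; [exact: measurable_cst|exact: measurable_funD].
  - by move=> x; exact: powR_ge0.
  - move=> x; apply: le_trans (powRD_le p1 (normr_ge0 _) (normr_ge0 _)).
    apply: ge0_ler_powR; rewrite ?nnegrE ?addr_ge0 ?(ltW p0)//.
    have -> : f (x + 2 *: h) - f x = (f (x + h + h) - f (x + h)) + (f (x + h) - f x).
      have e2 : x + 2 *: h = x + h + h.
        by rewrite -addrA; congr (_ + _); rewrite (_ : 2 = 1 + 1)// scalerDl scale1r.
      by rewrite e2 addrA subrK.
    exact: ler_normD.
have n1 x : 0 <= `|f (x + h + h) - f (x + h)| `^ p by exact: powR_ge0.
have n2 x : 0 <= `|f (x + h) - f x| `^ p by exact: powR_ge0.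
rewrite (nintZ mu (measurable_funD mDh mDp) q0 (fun x => addr_ge0 (n1 x) (n2 x))) (nintD mu mDh mDp n1 n2).
rewrite sh -/(increment p f h) (mule2_ereal (increment_ge0 p f h)) muleA -EFinM.
by rewrite mulrC mulr_powRB1.
Qed.

Lemma smoothed_ge0 c f : 0 <= c -> (0 <= smoothed p M c f)%E.
Proof.
move=> c0; apply: integral_ge0 => y _; apply: mule_ge0; last exact: increment_ge0.
by rewrite lee_fin; exact: dil_decay_ge0.
Qed.

Lemma measurable_smoothed_integrand c f : measurable_fun setT f ->
  measurable_fun setT (fun h => (dil c (decay M) h)%:E * increment p f h)%E.
Proof.
move=> mf; apply: emeasurable_funM; last exact: measurable_increment.
by apply/measurable_EFinP; exact: measurable_dil_decay.
Qed.

(** Substituting 2 h for h turns the weight at scale c into the weight at scale 2 c. *)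
Lemma smoothed_double c f : 0 < c -> measurable_fun setT f ->
  (smoothed p M c f <= (2 `^ p)%:E * smoothed p M (2 * c) f)%E.
Proof.
move=> c0 mf; have m1 := measurable_smoothed_integrand c mf.
have m2 := measurable_smoothed_integrand (2 * c) mf.
have n1 h : (0 <= (dil c (decay M) h)%:E * increment p f h)%E.
  by apply: mule_ge0; [rewrite lee_fin; apply: dil_decay_ge0; exact: ltW|exact: increment_ge0].
have c20 : 0 <= 2 * c by rewrite mulr_ge0// ltW.
have n2 h : (0 <= (dil (2 * c) (decay M) h)%:E * increment p f h)%E.
  by apply: mule_ge0; [rewrite lee_fin; exact: dil_decay_ge0|exact: increment_ge0].
have z2 : 2 != 0 :> R by rewrite pnatr_eq0.
rewrite /smoothed (@ge0_integral_affine R N 2 0 _ z2 m1 n1) (ger0_norm (ler0n R 2)).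
have ma : measurable_fun setT (fun h : V => 2 *: h + 0 : V).
  by apply: measurable_rVD; [exact: measurable_scale_rV|exact: measurable_cst].
have m3 : measurable_fun setT (fun h => (dil c (decay M) (2 *: h + 0)%R)%:E * increment p f (2 *: h + 0)%R)%E.
  exact: (measurableT_comp m1 ma).
have q1 : (0 <= (2 ^+ N)%:E :> \bar R)%E by rewrite lee_fin exprn_ge0.
have q2 : (0 <= (2 `^ p)%:E :> \bar R)%E by rewrite lee_fin powR_ge0.
rewrite -(@ge0_integralZl _ _ R mu setT measurableT _ m3 _ (fun h _ => n1 (2 *: h + 0)%R) q1).
rewrite -(@ge0_integralZl _ _ R mu setT measurableT _ m2 _ (fun h _ => n2 h) q2).
apply: ge0_le_integral.
- exact: measurableT.
- by move=> h _; apply: mule_ge0 => //; rewrite lee_fin exprn_ge0.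
- by apply: emeasurable_funM; [exact: measurable_cst|exact: m3].
- by apply: emeasurable_funM; [exact: measurable_cst|exact: m2].
- move=> h _; rewrite addr0 muleA -EFinM.
  have -> : 2 ^+ N * dil c (decay M) (2 *: h) = dil (2 * c) (decay M) h.
    by rewrite /dil scalerA [2 * c]mulrC exprMn; ring.
  rewrite muleCA; apply: lee_wpmul2l; first by rewrite lee_fin; exact: dil_decay_ge0.
  exact: increment_double.
Qed.

Lemma smoothed_iter l c f : 0 < c -> measurable_fun setT f ->
  (smoothed p M c f <= ((2 `^ p) ^+ l)%:E * smoothed p M (2 ^+ l * c) f)%E.
Proof.
move=> c0 mf; elim: l => [|l IH]; first by rewrite !expr0 mul1r mul1e.
apply: le_trans IH _; rewrite exprSr EFinM -muleA; apply: lee_wpmul2l.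
  by rewrite lee_fin exprn_ge0// powR_ge0.
rewrite exprS -mulrA; apply: smoothed_double => //.
by rewrite mulr_gt0// exprn_gt0.
Qed.

(** T^q (1 + T)^-M is at most T if T <= 1 and at most 1/T if T > 1; the two truncated geometric
    series have sum at most 2 each. *)
Lemma sum_scales L (tau q : R) : 0 < tau -> 1 <= q -> q + 1 <= M%:R ->
  \sum_(l < L) (2 ^+ l * tau) `^ q * (1 + 2 ^+ l * tau) ^- M <= 4.
Proof.
move=> t0 q1 qM.
have pt T : 0 < T -> T `^ q * (1 + T) ^- M <= (T <= 1)%R%:R * T + (T^-1 <= 1)%R%:R * T^-1.
  move=> T0; have T1 : 0 < 1 + T by rewrite addr_gt0.
  have i1 : 0 <= (1 + T) ^- M by rewrite invr_ge0 exprn_ge0// ltW.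
  have [le1|gt1] := lerP T 1.
    rewrite mul1r -[leLHS]addr0; apply: lerD; last by rewrite mulr_ge0// invr_ge0 ltW.
    rewrite -[leRHS]mulr1; apply: ler_pM => //; first exact: powR_ge0.
      by rewrite -[leRHS]powRr1 ?(ltW T0)//; apply: ger_powR => //; rewrite T0.
    by rewrite invf_le1 ?exprn_gt0// exprn_ege1// lerDl ltW.
  rewrite mul0r add0r invf_le1// (ltW gt1) mul1r.
  apply: (@le_trans _ _ (T `^ q * T ^- M)).
    apply: ler_wpM2l; first exact: powR_ge0.
    by rewrite lef_pV2 ?posrE ?exprn_gt0// lerXn2r ?nnegrE ?(ltW T0) ?(ltW T1)// lerDr.
  rewrite ler_pdivrMr ?exprn_gt0// mulrC ler_pdivlMr// -powR_mulrn ?(ltW T0)//.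
  rewrite -[X in _ * X <= _]powRr1 ?(ltW T0)// -powRD ?(gt_eqF T0) ?implybT//.
  by apply: ler_powR => //; exact: ltW.
have c2 : 0 <= (2^-1 : R) < 1 by apply/andP; split; lra.
apply: (@le_trans _ _ (\sum_(l < L) ((tau * 2 ^+ l <= 1)%R%:R * (tau * 2 ^+ l) +
    (tau^-1 * 2^-1 ^+ l <= 1)%R%:R * (tau^-1 * 2^-1 ^+ l)))).
  apply: ler_sum => l _; have := pt _ (mulr_gt0 (exprn_gt0 l (ltr0n _ 2)) t0).
  by rewrite invfM [2 ^+ l * tau]mulrC [_^-1 * tau^-1]mulrC exprVn.
rewrite big_split/=.
have h1 := @sum_geometric_trunc_up R L 2 tau 1 (ltr1n _ 2) (ltW t0) ler01.
have ti : 0 <= tau^-1 by rewrite invr_ge0 ltW.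
have h2 := @sum_geometric_trunc R L 2^-1 tau^-1 1 c2 ti ler01.
by apply: le_trans (lerD h1 h2) _; rewrite le_eqVlt; apply/orP; left; apply/eqP; field.
Qed.

(** L is about 1/d, the number of octaves over which a factor 2^(l d) stays bounded; the two-sided
    bound on L d fixes it within a factor 2. *)
Lemma natural_scale (d : R) : 0 < d -> d <= 1 ->
  exists L : nat, [/\ (0 < L)%N, 1 <= L%:R * d, L%:R * d <= 2 & forall l, (l < L)%N -> l%:R * d <= 1].
Proof.
move=> d0 d1; have i0 : 0 <= d^-1 by rewrite invr_ge0 ltW.
have /andP[h1 h2] := truncn_itv i0; set L := (Num.truncn d^-1).+1.
exists L; split => //.
- by rewrite -ler_pdivrMr// mul1r ltW.
- rewrite /L -natr1 mulrDl mul1r; move: h1; rewrite -(ler_pM2r d0) mulVf ?gt_eqF//.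
  by move=> h; rewrite (_ : 2 = 1 + 1)// lerD.
- move=> l lL; rewrite -ler_pdivlMr// mul1r; apply: le_trans h1.
  by rewrite ler_nat -ltnS.
Qed.

(** For l < L one has l (1 - s) <= 1, so after the weight 2^(lsp) the l doublings lose at most 2^p.
    The L dilated decay weights, so weighted, add up to at most 4 c^(-sp) |h|^(-N-sp), and L >= 1/(1
    - s) yields the gain. *)
Lemma smoothed_le_fractional s c f : (0 < N)%N -> N%:R + p + 1 <= M%:R -> 0 <= s -> s < 1 -> 0 < c ->
  measurable_fun setT f ->
  (smoothed p M c f <= (4 * 2 `^ p * (1 - s) * c `^ (- (s * p)))%:E * fractional (N%:R + s * p) p f)%E.
Proof.
move=> N0 hM s0 s1 c0 mf; set W := smoothed p M c f; set X := fractional _ p f.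
have d0 : 0 < 1 - s by rewrite subr_gt0.
have d1 : 1 - s <= 1 by rewrite lerBlDr lerDl.
have [L [L0 Ld _ hL]] := natural_scale d0 d1.
pose w l : R := (2 ^+ l) `^ (s * p).
have w0 l : 0 <= w l by exact: powR_ge0.
have cl l : 0 < 2 ^+ l * c by rewrite mulr_gt0// exprn_gt0.
have W0 : (0 <= W)%E by apply: smoothed_ge0; exact: ltW.
have X0 : (0 <= X)%E.
  by apply: integral_ge0 => h _; apply: mule_ge0; [rewrite lee_fin powR_ge0|exact: increment_ge0].
have h1 (l : 'I_L) : ((2 `^ (- p))%:E * W <= (w l)%:E * smoothed p M (2 ^+ l * c) f)%E.
  have hl := smoothed_iter l c0 mf.
  apply: (@le_trans _ _ ((2 `^ (- p))%:E * (((2 `^ p) ^+ l)%:E * smoothed p M (2 ^+ l * c) f))%E).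
    by apply: lee_wpmul2l => //; rewrite lee_fin powR_ge0.
  rewrite muleA -EFinM; apply: lee_wpmul2r; first by apply: smoothed_ge0; exact: ltW.
  rewrite lee_fin /w -[(2 `^ p) ^+ l]powR_mulrn ?powR_ge0// -[2 ^+ l]powR_mulrn// -!powRrM.
  rewrite -powRD ?pnatr_eq0 ?implybT//; apply: ler_powR; first by rewrite ler1n.
  have := hL l (ltn_ord l); rewrite -(ler_pM2l p0) mulr1 => h.
  by rewrite addrC -[leRHS]opprK -lerBrDr opprK; move: h; rewrite mulrBr mulr1 !mulrBr; lra.
have h2 : ((L%:R * 2 `^ (- p))%:E * W <= \sum_(l < L) (w l)%:E * smoothed p M (2 ^+ l * c) f)%E.
  apply: (@le_trans _ _ (\sum_(l < L) (2 `^ (- p))%:E * W)%E); last by apply: lee_sum => l _; exact: h1.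
  rewrite -ge0_sume_distrl; last by move=> l _; rewrite lee_fin powR_ge0.
  by rewrite sumEFin sumr_const card_ord -(mulr_natl (2 `^ (- p))).
pose k h : R := \sum_(l < L) w l * dil (2 ^+ l * c) (decay M) h.
have k0 l h : 0 <= w l * dil (2 ^+ l * c) (decay M) h.
  by apply: mulr_ge0 => //; apply: dil_decay_ge0; exact: ltW.
have mi := measurable_increment p mf.
have h3 : (\sum_(l < L) (w l)%:E * smoothed p M (2 ^+ l * c) f = \int[mu]_h ((k h)%:E * increment p f h))%E.
  have e l : ((w l)%:E * smoothed p M (2 ^+ l * c) f =
      \int[mu]_h ((w l)%:E * ((dil (2 ^+ l * c) (decay M) h)%:E * increment p f h)))%E.
    have nl h : setT h -> (0 <= (dil (2 ^+ l * c) (decay M) h)%:E * increment p f h)%E.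
      by move=> _; apply: mule_ge0; [rewrite lee_fin; apply: dil_decay_ge0; exact: ltW|exact: increment_ge0].
    have ql : (0 <= (w l)%:E)%E by rewrite lee_fin.
    by rewrite /smoothed -(@ge0_integralZl _ _ R mu setT measurableT _ (measurable_smoothed_integrand _ mf) _ nl ql).
  rewrite (eq_bigr _ (fun (l : 'I_L) _ => e l)).
  rewrite -(ge0_integral_sum mu measurableT (f := fun (l : 'I_L) h =>
      (w l)%:E * ((dil (2 ^+ l * c) (decay M) h)%:E * increment p f h))%E); first last.
  - move=> l h _; apply: mule_ge0; first by rewrite lee_fin.
    apply: mule_ge0; last exact: increment_ge0.
    by rewrite lee_fin; apply: dil_decay_ge0; exact: ltW.
  - by move=> l; apply: emeasurable_funM; [exact: measurable_cst|exact: measurable_smoothed_integrand].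
  apply: eq_integral => h _; rewrite /k -sumEFin ge0_sume_distrl; last by move=> l _; rewrite lee_fin.
  by apply: eq_bigr => l _; rewrite muleA -EFinM.
have h4 : (\int[mu]_h ((k h)%:E * increment p f h) <= (4 * c `^ (- (s * p)))%:E * X)%E.
  have mX : measurable_fun setT (fun h => (l1norm h `^ (- (N%:R + s * p)))%:E * increment p f h)%E.
    by apply: emeasurable_funM => //; apply/measurable_EFinP; exact: measurable_l1norm_powR.
  have nX h : setT h -> (0 <= (l1norm h `^ (- (N%:R + s * p)))%:E * increment p f h)%E.
    by move=> _; apply: mule_ge0; [rewrite lee_fin powR_ge0|exact: increment_ge0].
  have q4 : (0 <= (4 * c `^ (- (s * p)))%:E)%E by rewrite lee_fin mulr_ge0// powR_ge0.
  rewrite /X /fractional -(@ge0_integralZl _ _ R mu setT measurableT _ mX _ nX q4).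
  apply: ge0_le_integral.
  - exact: measurableT.
  - by move=> h _; apply: mule_ge0; [rewrite lee_fin sumr_ge0|exact: increment_ge0].
  - apply: emeasurable_funM => //; apply/measurable_EFinP; apply: measurable_fun_bigsum => l.
    by apply: measurable_funM; [exact: measurable_cst|exact: measurable_dil_decay].
  - apply: emeasurable_funM; first exact: measurable_cst.
    by apply: emeasurable_funM => //; apply/measurable_EFinP; exact: measurable_l1norm_powR.
  move=> h _; rewrite muleA -EFinM.
  have [z|nz] := eqVneq (l1norm h) 0; first by rewrite (l1norm0_eq z) increment0// !mule0.
  have lp : 0 < l1norm h by rewrite lt_neqAle eq_sym nz l1norm_ge0.
  apply: lee_wpmul2r; first exact: increment_ge0.
  rewrite lee_fin /k; pose q := N%:R + s * p.
  have q1 : 1 <= q by rewrite /q ler_wpDr ?ler1n// mulr_ge0// ltW.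
  have qM : q + 1 <= M%:R.
    by apply: le_trans hM; rewrite lerD2r lerD2l ler_piMl// ltW.
  have t0 : 0 < c * l1norm h by exact: mulr_gt0.
  have E (l : 'I_L) : w l * dil (2 ^+ l * c) (decay M) h =
      c `^ (- (s * p)) * l1norm h `^ (- q) *
      ((2 ^+ l * (c * l1norm h)) `^ q * (1 + 2 ^+ l * (c * l1norm h)) ^- M).
    have x0 : 0 < 2 ^+ l :> R by rewrite exprn_gt0.
    have dE : dil (2 ^+ l * c) (decay M) h = (2 ^+ l * c) ^+ N * (1 + 2 ^+ l * (c * l1norm h)) ^- M.
      by rewrite /dil /decay l1normZ (gtr0_norm (cl l)) [in RHS]mulrA.
    have pN y : 0 < y -> y `^ q = y ^+ N * y `^ (s * p).
      by move=> y0; rewrite /q powRD ?(gt_eqF y0) ?implybT// powR_mulrn ?(ltW y0).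
    have e : (2 ^+ l) `^ (s * p) * (2 ^+ l * c) ^+ N =
        c `^ (- (s * p)) * l1norm h `^ (- q) * (2 ^+ l * (c * l1norm h)) `^ q.
      rewrite (powRM _ (ltW x0) (ltW t0)) (powRM _ (ltW c0) (ltW lp)) (pN _ x0) (pN _ c0) exprMn !powRN.
      have nc : c `^ (s * p) != 0 by rewrite gt_eqF// powR_gt0.
      have nl : l1norm h `^ q != 0 by rewrite gt_eqF// powR_gt0.
      by field; rewrite nc nl.
    rewrite dE /w (mulrA ((2 ^+ l) `^ (s * p))) e; exact: esym (mulrA _ _ _).
  rewrite (eq_bigr _ (fun l _ => E l)) -mulr_sumr.
  apply: (@le_trans _ _ (c `^ (- (s * p)) * l1norm h `^ (- q) * 4)).
    by apply: ler_wpM2l; [rewrite mulr_ge0 ?powR_ge0|exact: sum_scales].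
  by rewrite le_eqVlt; apply/orP; left; apply/eqP; rewrite /q; ring.
have h5 : ((L%:R * 2 `^ (- p))%:E * W <= (4 * c `^ (- (s * p)))%:E * X)%E.
  by apply: le_trans h2 _; rewrite h3.
have L0' : 0 < L%:R :> R by rewrite ltr0n.
have g0 : 0 < L%:R * 2 `^ (- p) :> R by rewrite mulr_gt0// powR_gt0.
have -> : W = ((L%:R * 2 `^ (- p))^-1%:E * ((L%:R * 2 `^ (- p))%:E * W))%E.
  by rewrite muleA -EFinM mulVf ?gt_eqF// mul1e.
apply: (@le_trans _ _ ((L%:R * 2 `^ (- p))^-1%:E * ((4 * c `^ (- (s * p)))%:E * X))%E).
  by apply: lee_wpmul2l => //; rewrite lee_fin invr_ge0 ltW.
rewrite muleA -EFinM; apply: lee_wpmul2r => //; rewrite lee_fin.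
rewrite (_ : 4 * 2 `^ p * (1 - s) * c `^ (- (s * p)) = ((1 - s) * 2 `^ p) * (4 * c `^ (- (s * p)))); last by ring.
apply: ler_wpM2r; first by rewrite mulr_ge0// powR_ge0.
rewrite powRN invfM invrK; apply: ler_wpM2r; first exact: powR_ge0.
by rewrite -[leLHS]mul1r ler_pdivrMr// mulrC.
Qed.

End scaling_of_smoothed.

(** * Decomposition into frequency blocks *)

Section block_decomposition.
Context {R : realType} {N : nat}.
Local Notation V := 'rV[R]_N.
Local Notation mu := (lebesgue_rV R N).

(** Minkowski's inequality in p-th powers, from convexity with the weights u i / S. *)
Lemma nint_powR_weighted_le n (F : 'I_n -> V -> R) (u : 'I_n -> R) p (X : \bar R) : 1 < p ->
  (0 <= X)%E -> (forall i, 0 < u i) ->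
  (forall i, measurable_fun setT (F i)) -> (forall i x, 0 <= F i x) ->
  (forall i, (nint mu (fun x => F i x `^ p)%R <= (u i `^ p)%:E * X)%E) ->
  (nint mu (fun x => (\sum_i F i x) `^ p)%R <= ((\sum_i u i) `^ p)%:E * X)%E.
Proof.
move=> p1 X0 u0 mF F0 hX; have p0 : 0 < p by rewrite (lt_trans _ p1).
case: n F u u0 mF F0 hX => [|n] F u u0 mF F0 hX.
  rewrite big_ord0 powR0 ?gt_eqF// mul0e /nint.
  by under eq_integral do rewrite big_ord0 powR0 ?gt_eqF//; rewrite integral0.
set S := \sum_i u i.
have S0 : 0 < S.
  by rewrite /S big_ord_recl ltr_wpDr// sumr_ge0// => i _; exact: ltW.
pose w i := u i / S; pose a i x := S / u i * F i x.
have w0 i : 0 <= w i by rewrite divr_ge0// ltW.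
have a0 i x : 0 <= a i x by rewrite mulr_ge0// divr_ge0// ltW.
have w1 : \sum_i w i = 1 by rewrite -mulr_suml mulfV// gt_eqF.
have mFp i : measurable_fun setT (fun x => F i x `^ p) by exact: measurable_fun_powR.
pose c i := w i * (S / u i) `^ p.
have c0 i : 0 <= c i by rewrite mulr_ge0// powR_ge0.
have mcF i : measurable_fun setT (fun x => c i * F i x `^ p).
  by apply: measurable_funM => //; exact: measurable_cst.
have cF0 i x : 0 <= c i * F i x `^ p by rewrite mulr_ge0// powR_ge0.
apply: (@le_trans _ _ (nint mu (fun x => \sum_i c i * F i x `^ p)%R)).
  apply: le_nint.
  - by apply: measurable_fun_powR; exact: measurable_fun_bigsum.
  - exact: measurable_fun_bigsum.
  - by move=> x; exact: powR_ge0.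
  - move=> x; have := powR_mean_le p1 w0 (a0^~ x) w1.
    have -> : \sum_i w i * a i x = \sum_i F i x.
      by apply: eq_bigr => i _; rewrite /w /a; field; rewrite !gt_eqF.
    move=> h; apply: le_trans h _; rewrite le_eqVlt; apply/orP; left; apply/eqP.
    apply: eq_bigr => i _; rewrite /a /c powRM ?mulrA//.
    by rewrite divr_ge0// ltW.
rewrite nint_sum//.
have e i : c i * u i `^ p = w i * S `^ p.
  rewrite /c -mulrA -powRM ?divfK ?gt_eqF// ?divr_ge0// ltW//.
apply: (@le_trans _ _ (\sum_i ((w i * S `^ p)%:E * X))%E).
  apply: lee_sum => i _; rewrite nintZ//; last by move=> x; exact: powR_ge0.
  by rewrite -e (EFinM (c i)) -muleA; apply: lee_wpmul2l; [rewrite lee_fin|exact: hX].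
rewrite -ge0_sume_distrl; last by move=> i _; rewrite lee_fin mulr_ge0// powR_ge0.
by rewrite sumEFin -mulr_suml w1 mul1r.
Qed.

Lemma vnorm_ord_le (w : nat -> R) n m : (n <= m)%N ->
  vnorm (fun i : 'I_n => w i) <= vnorm (fun i : 'I_m => w i).
Proof.
move=> nm; rewrite /vnorm; apply: ler_wsqrtr.
rewrite (big_ord_widen m (fun i => w i ^+ 2) nm) big_mkcond/=; apply: ler_sum => i _.
by case: ifP => // _; exact: sqr_ge0.
Qed.

Lemma vnorm_ord_split (w : nat -> R) n m : (n <= m)%N ->
  vnorm (fun i : 'I_m => w i) <= vnorm (fun i : 'I_n => w i) + vnorm (fun i : 'I_m => (n <= i)%N%:R * w i).
Proof.
move=> nm.
have -> : vnorm (fun i : 'I_n => w i) = vnorm (fun i : 'I_m => (i < n)%N%:R * w i).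
  rewrite /vnorm (big_ord_widen m (fun i => w i ^+ 2) nm) big_mkcond/=; congr Num.sqrt.
  by apply: eq_bigr => i _; case: ifP; rewrite ?mul1r// mul0r expr0n.
apply: le_trans (vnorm_triangle _ _); rewrite /vnorm le_eqVlt; apply/orP; left; apply/eqP; congr Num.sqrt.
by apply: eq_bigr => i _; case: ltnP; rewrite /= ?mul1r mul0r ?addr0 ?add0r.
Qed.

(** On the right the m-th block is extended down to the lowest scale, because only sums over all
    scales below a threshold are controlled. *)
Lemma vnorm_ord_blocks (w v : nat -> R) (rho : nat -> R) D K : (forall m, 0 <= rho m) ->
  (forall m i, (m * D <= i)%N -> `|w i| <= rho m * `|v i|) ->
  vnorm (fun i : 'I_(K * D) => w i) <= \sum_(m < K) rho m * vnorm (fun i : 'I_(m.+1 * D) => v i).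
Proof.
move=> r0 h; elim: K => [|K IH]; first by rewrite big_ord0 /vnorm mul0n big_ord0 sqrtr0.
rewrite big_ord_recr/=; apply: le_trans (vnorm_ord_split w (n := K * D) _) _.
  by rewrite leq_mul2r leqnSn orbT.
apply: lerD => //; apply: vnorm_le => // i; case: (leqP (K * D) i) => hi.
  by rewrite mul1r; exact: h.
by rewrite mul0r normr0 mulr_ge0.
Qed.

Variables (eta phi : V -> R) (p : R).
Hypotheses (N0 : (0 < N)%N) (p1 : 1 < p).
Hypotheses (Seta : schwartz_real eta) (eta_mean : \int[mu]_x eta x = 0).
Hypothesis eta_even : forall x, eta (- x) = eta x.
Hypotheses (Sphi : schwartz_real phi) (phi_mean : \int[mu]_x phi x = 1).

Let p0 : 0 < p. Proof. by rewrite (lt_trans _ p1). Qed.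

(** At scales at most 1 the weight (a 2^i)^r is at most 1, uniformly in r >= 0, and the plain square
    function bound suffices. *)
Lemma low_pieces_bound : exists C, 0 < C /\ forall n a r (f : V -> R), 0 < a -> 0 <= r ->
  (forall i : 'I_n, a * 2 ^+ i <= 1) -> bL1 f -> scont f ->
  (nint mu (fun x => vabs (@weighted_pieces R N eta n a r f) x `^ p)%R <=
   C%:E * nint mu (fun x => `|f x| `^ p)%R)%E.
Proof.
have [A1 [A10 K1]] := schwartz_lp_kernel Seta eta_mean.
have A0 : 0 < A1 + 1 by rewrite ltr_wpDl.
have {}K1 : lp_kernel (A1 + 1) eta by apply: lp_kernel_le K1; rewrite lerDl.
have [C0 [C00 KB]] := @kernel_bounds R N p _ N0 p1 A0.
exists C0; split=> // n a r f a0 r0 ha Hf cf.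
have He := schwartz_bL1 Seta.
have t0 (i : 'I_n) : 0 < a * 2 ^+ i by rewrite mulr_gt0// exprn_gt0.
have Hg i := bL1_conv (bL1_dil (t0 i) He) Hf.
have [_ KA] := KB n a (fun=> eta) a0 (fun=> K1).
apply: le_trans (KA f Hf cf); apply: le_nint.
- by apply: measurable_fun_powR; apply: measurable_vabs => i; have [] := bL1Z ((a * 2 ^+ i) `^ r) (Hg i).
- by apply: measurable_fun_powR; apply: measurable_vabs => i; have [] := Hg i.
- by move=> x; exact: powR_ge0.
- move=> x; apply: ge0_ler_powR; rewrite ?nnegrE ?vnorm_ge0 ?(ltW p0)//.
  rewrite -[leRHS]mul1r; apply: vnorm_le => // i; rewrite normrM ger0_norm ?powR_ge0//.
  apply: ler_wpM2r => //; have [->|rn] := eqVneq r 0; first by rewrite powRr0.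
  have e1 : 1 `^ r = 1 :> R by rewrite powR1.
  rewrite -[leRHS]e1; apply: ge0_ler_powR; rewrite ?nnegrE ?(ltW (t0 i)) ?ha//.
Qed.

(** Blocks have D scales with D (1 - s) between 1 and 2. On block m the weight t^r is at most
    2^(-mD(1-r)) t, and the sum with weight t is bounded with c at the top of the block. *)
Lemma high_pieces_bound (Lam : R) : 1 < Lam -> exists C, 0 < C /\ forall n s r (f : V -> R),
  0 <= s -> s < 1 -> Lam * (1 - s) <= 1 - r -> bL1 f -> scont f ->
  (nint mu (fun x => vabs (@weighted_pieces R N eta n 2 r f) x `^ p)%R <=
   (C * (1 - s))%:E * fractional (N%:R + s * p) p f)%E.
Proof.
move=> L1; have [M0 hM0] : exists M0 : nat, p <= M0%:R.
  by exists (Num.truncn p).+1; have /andP[_ h] := truncn_itv (ltW p0); exact: ltW.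
(* Large enough both for an integrable weight and for N + p + 1 <= M, which [smoothed_le_fractional]
   requires. *)
pose M := (2 * N + M0 + 1)%N.
have HM : (2 * N <= M)%N by rewrite /M -addnA leq_addr.
have HM2 : N%:R + p + 1 <= M%:R :> R.
  have hN : N%:R <= (2 * N)%:R :> R by rewrite ler_nat leq_pmull.
  by rewrite /M (natrD _ (2 * N + M0)) (natrD _ (2 * N)); apply: lerD => //; apply: lerD.
have [C1 [C10 hC1]] := @low_frequency_bound R N eta phi p M N0 p1 HM Seta eta_mean eta_even Sphi phi_mean.
(* The ratio of the series over blocks: 2^(-mD(1-r)) from the weight times 2^((m+1)D(1-s)) from the
   top scale is at most 4 th^m, by 1 - r >= Lam (1 - s) and 1 <= D (1 - s) <= 2. *)
pose th : R := 2 `^ (- (Lam - 1)).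
have /andP[th0' th1] : 0 <= th < 1 by apply: powR2N_lt1; rewrite subr_gt0.
have th0 : 0 < th by rewrite powR_gt0.
pose B := C1 * (4 * 2 `^ p) * 4 `^ p.
have B0 : 0 < B by rewrite !mulr_gt0 ?powR_gt0.
exists ((1 - th)^-1 `^ p * B); split.
  by rewrite mulr_gt0// powR_gt0// invr_gt0 subr_gt0.
move=> n s r f s0 s1 hr Hf cf; have [mf _ _] := Hf.
have He := schwartz_bL1 Seta.
set d := 1 - s in hr *; have d0 : 0 < d by rewrite subr_gt0.
have d1 : d <= 1 by rewrite lerBlDr lerDl.
have [D [D0 Dd1 Dd2 _]] := natural_scale d0 d1.
set X := fractional _ p f.
have X0 : (0 <= X)%E.
  by apply: integral_ge0 => h _; apply: mule_ge0; [rewrite lee_fin powR_ge0|exact: increment_ge0].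
pose t i : R := 2 * 2 ^+ i.
have t0 i : 0 < t i by rewrite mulr_gt0// exprn_gt0.
pose g i := conv (dil (t i) eta) f.
have Hg i : bL1 (g i) := bL1_conv (bL1_dil (t0 i) He) Hf.
pose w x i := t i `^ r * g i x; pose v x i := t i * g i x.
pose rho m : R := (2 ^+ (m * D)) `^ (- (1 - r)).
have rho0 m : 0 < rho m by rewrite powR_gt0// exprn_gt0.
have dec x m i : (m * D <= i)%N -> `|w x i| <= rho m * `|v x i|.
  move=> mi; rewrite /w /v (normrM (t i `^ r)) (normrM (t i)) (ger0_norm (powR_ge0 _ _)) (gtr0_norm (t0 i)) mulrA.
  apply: ler_wpM2r => //.
  have -> : t i `^ r = t i `^ (- (1 - r)) * t i.
    rewrite -[X in _ * X]powRr1 ?(ltW (t0 i))// -powRD ?(gt_eqF (t0 i)) ?implybT//; congr powR; ring.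
  apply: ler_wpM2r; first exact: ltW.
  have r1 : 0 <= 1 - r by apply: le_trans hr; rewrite mulr_ge0 ?(ltW d0)// ltW// (lt_trans _ L1).
  rewrite /rho !powRN lef_pV2 ?posrE ?powR_gt0 ?exprn_gt0//.
  apply: ge0_ler_powR; rewrite ?nnegrE ?exprn_ge0 ?(ltW (t0 i))//.
  by rewrite /t -exprS ler_weXn2l ?ler1n// leqW.
pose T m x := vnorm (fun i : 'I_(m.+1 * D) => v x i).
have mT m : measurable_fun setT (T m).
  apply: (@measurable_vabs _ _ _ (fun (i : 'I_(m.+1 * D)) x => v x i)) => i.
  by have [] := bL1Z (t i) (Hg i).
pose F (m : 'I_n) x := rho m * T m x.
have mF m : measurable_fun setT (F m) by apply: measurable_funM => //; exact: measurable_cst.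
have F0 m x : 0 <= F m x by rewrite mulr_ge0 ?vnorm_ge0// ltW.
have XB0 : (0 <= (B * d)%:E * X)%E by apply: mule_ge0 => //; rewrite lee_fin mulr_ge0// ltW.
have nT (m : nat) : (nint mu (fun x => T m x `^ p)%R <= ((B / 4 `^ p * d) * (2 ^+ (m.+1 * D)) `^ (d * p))%:E * X)%E.
  pose c : R := 2 ^+ (m.+1 * D); have c0 : 0 < c by rewrite exprn_gt0.
  have hc (i : 'I_(m.+1 * D)) : 2 * 2 ^+ i <= c by rewrite -exprS ler_weXn2l ?ler1n.
  apply: le_trans (hC1 _ 2 c f _ c0 hc Hf cf) _ => //.
  have h := smoothed_le_fractional p1 N0 HM2 s0 s1 c0 mf.
  apply: (@le_trans _ _ ((C1 * c `^ p)%:E * ((4 * 2 `^ p * (1 - s) * c `^ (- (s * p)))%:E * X))%E).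
    by apply: lee_wpmul2l => //; rewrite lee_fin mulr_ge0 ?powR_ge0// ltW.
  rewrite muleA -EFinM; apply: lee_wpmul2r => //; rewrite lee_fin -/d -/c.
  have -> : c `^ (d * p) = c `^ p * c `^ (- (s * p)).
    rewrite -powRD ?(gt_eqF c0) ?implybT//; congr powR; rewrite /d; ring.
  have f4 : 4 `^ p != 0 :> R by rewrite gt_eqF// powR_gt0.
  rewrite /B le_eqVlt; apply/orP; left; apply/eqP; field; exact: f4.
have nF (m : 'I_n) : (nint mu (fun x => F m x `^ p)%R <= ((th ^+ m) `^ p)%:E * ((B * d)%:E * X))%E.
  have mTp : measurable_fun setT (fun x => T m x `^ p) by exact: measurable_fun_powR.
  have rp0 : 0 <= rho m `^ p by exact: powR_ge0.
  apply: (@le_trans _ _ (nint mu (fun x => rho m `^ p * T m x `^ p)%R)).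
    rewrite le_eqVlt; apply/orP; left; apply/eqP; apply: eq_integral => x _.
    by rewrite /F powRM ?vnorm_ge0// ltW.
  rewrite (nintZ mu mTp rp0 (fun x => powR_ge0 _ _)).
  apply: (@le_trans _ _ ((rho m `^ p)%:E * (((B / 4 `^ p * d) * (2 ^+ (m.+1 * D)) `^ (d * p))%:E * X))%E).
    by apply: lee_wpmul2l.
  rewrite !muleA -!EFinM; apply: lee_wpmul2r => //; rewrite lee_fin.
  have f4 : 0 < 4 `^ p :> R by rewrite powR_gt0.
  suff h : rho m `^ p * (2 ^+ (m.+1 * D)) `^ (d * p) <= (th ^+ m) `^ p * 4 `^ p.
    have -> : rho m `^ p * (B / 4 `^ p * d * (2 ^+ (m.+1 * D)) `^ (d * p)) =
      (rho m `^ p * (2 ^+ (m.+1 * D)) `^ (d * p)) * (B / 4 `^ p * d) by ring.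
    have -> : (th ^+ m) `^ p * (B * d) = ((th ^+ m) `^ p * 4 `^ p) * (B / 4 `^ p * d).
      by field; rewrite gt_eqF.
    apply: ler_wpM2r => //; apply: mulr_ge0; last exact: ltW.
    by apply: divr_ge0; exact: ltW.
  rewrite /rho /th -![2 ^+ _]powR_mulrn// -[(2 `^ (- (Lam - 1))) ^+ m]powR_mulrn ?powR_ge0//.
  have -> : 4 = 2 `^ 2%:R :> R by rewrite powR_mulrn// expr2 -natrM.
  have pD (y z : R) : 2 `^ y * 2 `^ z = 2 `^ (y + z) :> R by rewrite powRD// pnatr_eq0 implybT.
  rewrite -!powRrM !pD; apply: ler_powR; first by rewrite ler1n.
  rewrite !natrM -natr1.
  have h1 : m%:R * D%:R * (Lam * d) <= m%:R * D%:R * (1 - r) by rewrite ler_wpM2l// mulr_ge0.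
  have h2 : m%:R * (Lam - 1) * 1 <= m%:R * (Lam - 1) * (D%:R * d).
    by apply: ler_wpM2l => //; rewrite mulr_ge0// subr_ge0 ltW.
  rewrite [X in X + _ <= _](_ : _ = - (m%:R * D%:R * (1 - r)) * p); last by ring.
  rewrite [X in _ + X <= _](_ : _ = (m%:R * (D%:R * d) + D%:R * d) * p); last by ring.
  rewrite [leRHS](_ : _ = (- (m%:R * (Lam - 1) * 1) + 2) * p); last by ring.
  rewrite -mulrDl; apply: ler_wpM2r; first exact: ltW.
  move: h1 h2; rewrite [m%:R * D%:R * (Lam * d)](_ : _ = m%:R * (Lam - 1) * (D%:R * d) + m%:R * (D%:R * d)); last by ring.
  move: (m%:R * (Lam - 1) * (D%:R * d)) (m%:R * (D%:R * d)) (m%:R * D%:R * (1 - r)) (m%:R * (Lam - 1) * 1) (D%:R * d) Dd2 => x1 x2 x3 x4 x5; lra.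
have nsum := nint_powR_weighted_le p1 XB0 (fun m : 'I_n => exprn_gt0 m th0) mF F0 nF.
apply: (@le_trans _ _ (nint mu (fun x => (\sum_(m < n) F m x) `^ p)%R)).
  apply: le_nint.
  - by apply: measurable_fun_powR; apply: measurable_vabs => i; have [] := bL1Z (t i `^ r) (Hg i).
  - by apply: measurable_fun_powR; exact: measurable_fun_bigsum.
  - by move=> x; exact: powR_ge0.
  - move=> x; apply: ge0_ler_powR; rewrite ?nnegrE ?vnorm_ge0 ?(ltW p0)//.
      by apply: sumr_ge0 => m _.
    (* As D > 0, n blocks of length D contain the first n scales. *)
    apply: (@le_trans _ _ (vnorm (fun i : 'I_(n * D) => w x i))).
      by apply: (vnorm_ord_le (w x)); exact: leq_pmulr.
    by apply: vnorm_ord_blocks => m; [exact: ltW|exact: dec].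
apply: le_trans nsum _; rewrite muleA -EFinM; apply: lee_wpmul2r => //; rewrite lee_fin mulrA.
apply: ler_wpM2r; first exact: ltW.
apply: ler_wpM2r; first exact: ltW.
have s0' : 0 <= \sum_(m < n) th ^+ m by apply: sumr_ge0 => m _; rewrite exprn_ge0.
apply: ge0_ler_powR; rewrite ?nnegrE ?(ltW p0)// ?invr_ge0 ?subr_ge0 ?(ltW th1)//.
have th01 : 0 <= th < 1 by rewrite th0' th1.
have := @sum_geometric_le R n th 1 th01 ler01.
by rewrite mul1r; under eq_bigr do rewrite mul1r.
Qed.

Lemma pieces_bound (Lam : R) : 1 < Lam -> exists C, 0 < C /\ forall J s r (f : V -> R),
  0 <= s -> s < 1 -> 0 <= r -> Lam * (1 - s) <= 1 - r -> bL1 f -> scont f ->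
  (nint mu (fun x => vabs (@weighted_pieces R N eta (2 * J).+1 (2 ^+ J)^-1 r f) x `^ p)%R <=
   C%:E * (nint mu (fun x => `|f x| `^ p)%R + (1 - s)%:E * fractional (N%:R + s * p) p f))%E.
Proof.
move=> L1; have [C1 [C10 h1]] := low_pieces_bound; have [C2 [C20 h2]] := high_pieces_bound L1.
have q0 : 0 < 2 `^ (p - 1) :> R by rewrite powR_gt0.
exists (2 `^ (p - 1) * (C1 + C2)); split; first by rewrite mulr_gt0// addr_gt0.
move=> J s r f s0 s1 r0 hr Hf cf; have He := schwartz_bL1 Seta.
have a0 : 0 < (2 ^+ J)^-1 :> R by rewrite invr_gt0 exprn_gt0.
pose a : R := (2 ^+ J)^-1.
(* The 2 J + 1 scales are the J + 1 values 2^-J, ..., 1 and the J values 2, ..., 2^J. *)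
pose P := @weighted_pieces R N eta J.+1 a r f; pose Q := @weighted_pieces R N eta J 2 r f.
have mW n b : 0 < b -> measurable_fun setT (vabs (@weighted_pieces R N eta n b r f)).
  move=> b0; apply: measurable_vabs => i.
  have t0 : 0 < b * 2 ^+ i by rewrite mulr_gt0// exprn_gt0.
  by have [] := bL1Z ((b * 2 ^+ i) `^ r) (bL1_conv (bL1_dil t0 He) Hf).
have mP := mW J.+1 _ a0; have mQ := mW J 2 (ltr0n R 2).
have mPp : measurable_fun setT (fun x => vabs P x `^ p) by exact: measurable_fun_powR.
have mQp : measurable_fun setT (fun x => vabs Q x `^ p) by exact: measurable_fun_powR.
have split_le x : vabs (@weighted_pieces R N eta (2 * J).+1 a r f) x <= vabs P x + vabs Q x.
  pose w i := (a * 2 ^+ i) `^ r * conv (dil (a * 2 ^+ i) eta) f x.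
  have hJ : (J.+1 <= (2 * J).+1)%N by rewrite ltnS mul2n -addnn leq_addr.
  apply: le_trans (vnorm_ord_split w hJ) _; rewrite lerD2l /vabs /vnorm; apply: ler_wsqrtr.
  rewrite (bigID (fun i : 'I_(2 * J).+1 => (i < J.+1)%N))/= big1 ?add0r => [|i iJ]; last first.
    by rewrite leqNgt iJ/= mul0r expr0n.
  pose e i : R := ((J.+1 <= i)%N%:R * w i) ^+ 2.
  rewrite -(big_mkord (fun i => ~~ (i < J.+1)%N) e) (big_cat_nat (n := J.+1))//=.
  rewrite big_nat_cond big_pred0 ?add0r; last first.
    by move=> i; case: (i < J.+1)%N; rewrite ?andbF.
  rewrite -{1}(add0n J.+1) big_addn (_ : ((2 * J).+1 - J.+1 = J)%N); last first.
    by rewrite subSS mul2n -addnn addnK.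
  rewrite big_mkcond/= big_mkord; apply: ler_sum => k _.
  rewrite -leqNgt leq_addl /e leq_addl mul1r /w /Q /weighted_pieces.
  have -> : a * 2 ^+ (k + J.+1) = 2 * 2 ^+ k.
    by rewrite addnS exprS exprD /a; field; rewrite gt_eqF// exprn_gt0.
  exact: lexx.
have X0 : (0 <= fractional (N%:R + s * p) p f)%E.
  by apply: integral_ge0 => h _; apply: mule_ge0; [rewrite lee_fin powR_ge0|exact: increment_ge0].
have Y0 : (0 <= nint mu (fun x => `|f x| `^ p)%R)%E by apply: nint_ge0 => x; exact: powR_ge0.
have hP : (nint mu (fun x => vabs P x `^ p)%R <= C1%:E * nint mu (fun x => `|f x| `^ p)%R)%E.
  apply: h1 => // i; rewrite /a mulrC ler_pdivrMr ?exprn_gt0// mul1r ler_weXn2l ?ler1n//.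
  by rewrite -ltnS.
have hQ := h2 J s r f s0 s1 hr Hf cf.
apply: (@le_trans _ _ (nint mu (fun x => 2 `^ (p - 1) * (vabs P x `^ p + vabs Q x `^ p))%R)).
  apply: le_nint.
  - by apply: measurable_fun_powR; exact: mW.
  - by apply: measurable_funM; [exact: measurable_cst|exact: (measurable_funD mPp mQp)].
  - by move=> x; exact: powR_ge0.
  - move=> x; apply: le_trans (powRD_le p1 (vnorm_ge0 _) (vnorm_ge0 _)).
    by apply: ge0_ler_powR; rewrite ?nnegrE ?addr_ge0 ?vnorm_ge0 ?(ltW p0)//; exact: split_le.
have nP0 x : 0 <= vabs P x `^ p by exact: powR_ge0.
have nQ0 x : 0 <= vabs Q x `^ p by exact: powR_ge0.
rewrite (nintZ mu (measurable_funD mPp mQp) (ltW q0) (fun x => addr_ge0 (nP0 x) (nQ0 x))) (nintD mu mPp mQp nP0 nQ0).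
rewrite (EFinM (2 `^ (p - 1))) -muleA; apply: lee_wpmul2l; first by rewrite lee_fin ltW.
apply: le_trans (leeD hP hQ) _.
have dX0 : (0 <= (1 - s)%:E * fractional (N%:R + s * p) p f)%E.
  by apply: mule_ge0 => //; rewrite lee_fin subr_ge0 ltW.
rewrite (ge0_muleDr _ Y0 dX0); apply: leeD.
  by apply: lee_wpmul2r => //; rewrite lee_fin lerDl ltW.
rewrite EFinM -muleA; apply: lee_wpmul2r => //.
by rewrite lee_fin lerDr ltW.
Qed.

End block_decomposition.

(** * Roots of extended reals *)

Section extended_powers.
Context {R : realType}.
Local Open Scope ereal_scope.
Implicit Types X Y A : \bar R.

(** Equivalent to a^p + b^p <= (a + b)^p, which holds because the (p-1)-th power is increasing. *)
Lemma powR_subadditive (x y p : R) : (1 < p)%R -> (0 <= x)%R -> (0 <= y)%R ->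
  ((x + y) `^ (1 / p) <= x `^ (1 / p) + y `^ (1 / p))%R.
Proof.
move=> p1 x0 y0; have p0 : (0 < p)%R by rewrite (lt_trans _ p1).
set a := (x `^ (1 / p))%R; set b := (y `^ (1 / p))%R.
have a0 : (0 <= a)%R by exact: powR_ge0.
have b0 : (0 <= b)%R by exact: powR_ge0.
have e z : (0 <= z)%R -> ((z `^ (1 / p)) `^ p = z)%R.
  by move=> z0; rewrite -powRrM div1r mulVf ?gt_eqF// powRr1.
have ab0 : (0 <= a + b)%R by rewrite addr_ge0.
have h : (x + y <= (a + b) `^ p)%R.
  rewrite -[in leLHS](e x)// -[in leLHS](e y)// -/a -/b.
  rewrite -(mulr_powRB1 a0 p0) -(mulr_powRB1 b0 p0) -(mulr_powRB1 ab0 p0) mulrDl.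
  have pm : (0 <= p - 1)%R by rewrite subr_ge0 ltW.
  by apply: lerD; apply: ler_wpM2l => //; apply: ge0_ler_powR; rewrite ?nnegrE// ?lerDl ?lerDr.
have abE : (a + b)%R = (((a + b) `^ p) `^ (1 / p))%R.
  by rewrite -powRrM div1r mulfV ?gt_eqF// powRr1.
rewrite abE; apply: ge0_ler_powR => //; rewrite ?nnegrE ?addr_ge0 ?powR_ge0//.
by rewrite divr_ge0// ltW.
Qed.

(** If X or Y is infinite, so is the right-hand side, as C > 0; otherwise A is finite and the real
    inequality applies. *)
Lemma poweR_inv_le A X Y (C p : R) : (1 < p)%R -> (0 < C)%R -> 0 <= A -> 0 <= X -> 0 <= Y ->
  A <= C%:E * (X + Y) -> A `^ (1 / p) <= (C `^ (1 / p))%:E * (X `^ (1 / p) + Y `^ (1 / p)).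
Proof.
move=> p1 C0 A0 X0 Y0 h; have p0 : (0 < p)%R by rewrite (lt_trans _ p1).
have q0 : (0 < 1 / p)%R by rewrite divr_gt0.
have c0 : 0 < (C `^ (1 / p))%:E by rewrite lte_fin powR_gt0.
have yq : (+oo : \bar R) `^ (1 / p) = +oo by rewrite poweRyr// gt_eqF.
case: X X0 h => [x| |]// X0 h; last first.
  by rewrite yq addye ?gt0_muley ?leey// -ltNye (lt_le_trans _ (poweR_ge0 _ _))// ltNy0.
case: Y Y0 h => [y| |]// Y0 h; last first.
  by rewrite yq addey ?gt0_muley ?leey// -ltNye (lt_le_trans _ (poweR_ge0 _ _))// ltNy0.
move: h; rewrite -EFinD -EFinM; case: A A0 => [z| |]// z0; rewrite ?leye_eq// lee_fin => h.
move: X0 Y0 z0; rewrite !lee_fin => x0 y0 z0.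
apply: (@le_trans _ _ ((C * (x + y)) `^ (1 / p))%R).
  by apply: ge0_ler_powR; rewrite ?nnegrE ?(ltW q0)// mulr_ge0 ?addr_ge0// ltW.
rewrite powRM ?addr_ge0 ?(ltW C0)//; apply: ler_wpM2l; first exact: powR_ge0.
exact: powR_subadditive.
Qed.

End extended_powers.

(** * Complex-valued functions and the full sum over frequencies *)

Section complex_valued.
Context {R : realType} {N : nat}.
Local Notation V := 'rV[R]_N.
Local Notation mu := (lebesgue_rV R N).
Variables (eta : V -> R) (p : R) (f : V -> R[i]).
Hypotheses (p1 : 1 < p) (Seta : schwartz_real eta) (Sf : schwartz f).

Let p0 : 0 < p. Proof. by rewrite (lt_trans _ p1). Qed.
Let q0 : 0 < p / 2. Proof. by rewrite divr_gt0. Qed.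
Let u x := complex.Re (f x).
Let v x := complex.Im (f x).
Let Hu : bL1 u. Proof. by have [h _] := Sf; exact: schwartz_bL1. Qed.
Let Hv : bL1 v. Proof. by have [_ h] := Sf; exact: schwartz_bL1. Qed.
Let He : bL1 eta. Proof. exact: schwartz_bL1. Qed.

Lemma normc_vnorm (z : R[i]) : Normc.normc z = Num.sqrt (complex.Re z ^+ 2 + complex.Im z ^+ 2).
Proof. by case: z. Qed.

Lemma Re_le_normc (z : R[i]) : `|complex.Re z| <= Normc.normc z.
Proof. by rewrite normc_vnorm -sqrtr_sqr; apply: ler_wsqrtr; rewrite lerDl sqr_ge0. Qed.

Lemma Im_le_normc (z : R[i]) : `|complex.Im z| <= Normc.normc z.
Proof. by rewrite normc_vnorm -sqrtr_sqr; apply: ler_wsqrtr; rewrite lerDr sqr_ge0. Qed.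

Lemma normc_le_ReIm (z : R[i]) : Normc.normc z <= `|complex.Re z| + `|complex.Im z|.
Proof.
have h : 0 <= `|complex.Re z| + `|complex.Im z| by rewrite addr_ge0.
rewrite normc_vnorm -[leRHS](ger0_norm h) -sqrtr_sqr; apply: ler_wsqrtr.
have ea : `|complex.Re z| ^+ 2 = complex.Re z ^+ 2 by rewrite real_normK// num_real.
have eb : `|complex.Im z| ^+ 2 = complex.Im z ^+ 2 by rewrite real_normK// num_real.
rewrite sqrrD ea eb addrAC lerDl.
by rewrite mulrn_wge0// mulr_ge0.
Qed.

Lemma normc_ge0' (z : R[i]) : 0 <= Normc.normc z.
Proof. by rewrite normc_vnorm sqrtr_ge0. Qed.

Lemma LP_projection_conv j x : LP_projection eta j f x =
  Complex (conv (dil (2 ^ j) eta) u x) (conv (dil (2 ^ j) eta) v x).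
Proof.
have t0 : 0 < (2 : R) ^ j by rewrite exprz_gt0.
have Hd := bL1_dil t0 He.
rewrite /LP_projection /convolution /cintegral !(convC Hd)//; congr Complex.
  apply: eq_Rintegral => y _; rewrite /u /dil -exprz_exp.
  by case: (f (x - y)) => a b /=; rewrite mulr0 subr0.
apply: eq_Rintegral => y _; rewrite /v /dil -exprz_exp.
by case: (f (x - y)) => a b /=; rewrite mulr0 add0r.
Qed.

Variable s : R.
Hypothesis s0 : 0 <= s.

Definition LP_term (x : V) (j : int) : R :=
  2 `^ (j%:~R * s * 2) * Normc.normc (LP_projection eta j f x) `^ 2.
Definition LP_sum x : \bar R := \esum_(j in [set: int]) (LP_term x j)%:E.

Let wu J := @weighted_pieces R N eta (2 * J).+1 (2 ^+ J)^-1 s u.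
Let wv J := @weighted_pieces R N eta (2 * J).+1 (2 ^+ J)^-1 s v.

Definition LP_partial J x : R := vabs (@wu J) x ^+ 2 + vabs (@wv J) x ^+ 2.

Lemma LP_term_ge0 x j : 0 <= LP_term x j.
Proof. by rewrite mulr_ge0// powR_ge0. Qed.

Lemma LP_term_shift J x (i : 'I_(2 * J).+1) : LP_term x (i%:Z - J%:Z) = @wu J i x ^+ 2 + @wv J i x ^+ 2.
Proof.
have tE : (2 : R) ^ (i%:Z - J%:Z) = (2 ^+ J)^-1 * 2 ^+ i.
  by rewrite expfzDr ?pnatr_eq0// mulrC -invr_expz.
have t0 : 0 < (2 : R) ^ (i%:Z - J%:Z) by rewrite exprz_gt0.
rewrite /LP_term LP_projection_conv powR_mulrn ?normc_ge0'// normc_vnorm sqr_sqrtr ?addr_ge0 ?sqr_ge0//=.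
have -> : 2 `^ ((i%:Z - J%:Z)%:~R * s * 2) = (((2 : R) ^ (i%:Z - J%:Z)) `^ s) ^+ 2.
  move: (i%:Z - J%:Z) => k; rewrite -powR_intmul ?ler0n//.
  by rewrite -[RHS]powR_mulrn ?powR_ge0// -!powRrM mulrA.
by rewrite /wu /wv /weighted_pieces -tE mulrDr !exprMn.
Qed.

Definition window J : seq int := [seq i%:Z - J%:Z | i <- iota 0 (2 * J).+1].

Lemma window_uniq J : uniq (window J).
Proof. by rewrite map_inj_uniq ?iota_uniq// => a b /addIr []. Qed.

Lemma mem_window J (j : int) : (j \in window J) = (`|j| <= J)%N.
Proof.
apply/mapP/idP; first by case=> i; rewrite mem_iota add0n ltnS /= => hi ->; lia.
by move=> h; exists `|(j + J%:Z)%R|%N; [rewrite mem_iota add0n ltnS; lia|lia].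
Qed.

Lemma LP_partialE J x : LP_partial J x = \sum_(j <- window J) LP_term x j.
Proof.
rewrite /window big_map -[iota 0 _]/(index_iota 0 (2 * J).+1) big_mkord.
rewrite (eq_bigr _ (fun i _ => LP_term_shift x i)) big_split/=.
by rewrite /LP_partial /vabs !sqr_vnorm.
Qed.

Lemma LP_partial_ge0 J x : 0 <= LP_partial J x.
Proof. by rewrite addr_ge0// sqr_ge0. Qed.

Lemma LP_partial_le J x : ((LP_partial J x)%:E <= LP_sum x)%E.
Proof.
apply: esum_ge; exists [set` window J].
  by split => //; exact: finite_seq.
by rewrite -fsbig_seq ?window_uniq// LP_partialE sumEFin.
Qed.

Lemma LP_sum_le x (a : \bar R) : (forall J, (LP_partial J x)%:E <= a)%E -> (LP_sum x <= a)%E.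
Proof.
move=> h; apply: ge_ereal_sup => _ [X [finX _] <-].
have [S XS] := (finite_seqP X).1 finX.
pose J := \max_(j <- S) `|j|%N.
apply: le_trans (h J); rewrite LP_partialE -sumEFin (fsbig_seq _ _ (window_uniq J)).
apply: lee_fsum_nneg_subset => //; try exact: finite_seq.
  move=> j; rewrite inE => Xj; rewrite inE/= mem_window /J.
  by apply: (@leq_bigmax_seq _ _ xpredT (fun j : int => `|j|%N)) => //; move: Xj; rewrite XS.
by move=> j _; rewrite lee_fin LP_term_ge0.
Qed.

Let H J x : R := LP_partial J x `^ (p / 2).

Lemma LP_partial_nd x : {homo (fun J => H J x) : a b / (a <= b)%N >-> a <= b}.
Proof.
move=> a b ab; apply: ge0_ler_powR; rewrite ?nnegrE ?LP_partial_ge0 ?(ltW q0)//.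
rewrite -lee_fin !LP_partialE -!sumEFin !(fsbig_seq _ _ (window_uniq _)).
apply: lee_fsum_nneg_subset => //; try exact: finite_seq.
  by move=> j; rewrite !inE/= !mem_window => h; exact: leq_trans h ab.
by move=> j _; rewrite lee_fin LP_term_ge0.
Qed.

(** The unordered sum is a supremum over finite sets of frequencies, and every finite set lies in a
    window. Hence the powers of the window sums increase to that of the full sum, also when it is
    infinite. *)
Lemma LP_partial_cvg x : (fun J => (H J x)%:E) @ \oo --> (LP_sum x `^ (p / 2))%E.
Proof.
have nd : nondecreasing_seq (fun J => (H J x)%:E).
  by move=> a b ab; rewrite lee_fin; exact: LP_partial_nd.
have := ereal_nondecreasing_cvgn nd; set A := ereal_sup _ => cA.
have HA J : ((H J x)%:E <= A)%E by apply: ereal_sup_ubound; exists J.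
have A0 : (0 <= A)%E by apply: le_trans (HA 0%N); rewrite lee_fin powR_ge0.
suff -> : (LP_sum x `^ (p / 2))%E = A by [].
have L0 : (0 <= LP_sum x)%E by apply: esum_ge0 => j _; rewrite lee_fin LP_term_ge0.
apply/eqP; rewrite eq_le; apply/andP; split; last first.
  apply: ge_ereal_sup => _ [J _ <-]; rewrite /H -poweR_EFin.
  apply: gt0_ler_poweR; rewrite ?(ltW q0)//; last exact: LP_partial_le.
  - by rewrite in_itv/= leey andbT lee_fin LP_partial_ge0.
  - by rewrite in_itv/= leey andbT.
case: A A0 HA {cA} => [a| |]// a0 HA; last by rewrite leey.
have h : (LP_sum x <= (a `^ (2 / p))%:E)%E.
  apply: LP_sum_le => J; rewrite lee_fin; have := HA J; rewrite lee_fin /H => hJ.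
  have -> : LP_partial J x = (LP_partial J x `^ (p / 2)) `^ (2 / p).
    rewrite -powRrM (_ : p / 2 * (2 / p) = 1) ?powRr1 ?LP_partial_ge0//.
    by field; rewrite gt_eqF.
  by apply: ge0_ler_powR; rewrite ?nnegrE ?powR_ge0 ?divr_ge0 ?(ltW p0)// -lee_fin.
have -> : a%:E = ((a `^ (2 / p))%:E `^ (p / 2))%E.
  rewrite poweR_EFin -powRrM (_ : 2 / p * (p / 2) = 1) ?powRr1//.
  by field; rewrite gt_eqF.
apply: gt0_ler_poweR; rewrite ?(ltW q0)//.
- by rewrite in_itv/= leey andbT.
- by rewrite in_itv/= leey andbT lee_fin powR_ge0.
Qed.

Let mw g J : bL1 g -> measurable_fun setT (vabs (@weighted_pieces R N eta (2 * J).+1 (2 ^+ J)^-1 s g)).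
Proof.
move=> Hg; apply: measurable_vabs => i.
have t0 : 0 < (2 ^+ J)^-1 * 2 ^+ i :> R by rewrite mulr_gt0 ?invr_gt0 ?exprn_gt0.
by have [] := bL1Z (((2 ^+ J)^-1 * 2 ^+ i) `^ s) (bL1_conv (bL1_dil t0 He) Hg).
Qed.

Let mH J : measurable_fun setT (H J).
Proof.
apply: measurable_fun_powR; apply: measurable_funD; apply: measurable_funX; exact: mw.
Qed.

Definition triebel_integral : \bar R := \int[mu]_x (LP_sum x `^ (p / 2))%E.

Lemma triebelE : triebel_lizorkin eta s p 2 f = (triebel_integral `^ (1 / p))%E.
Proof. by []. Qed.

Lemma triebel_integral_ge0 : (0 <= triebel_integral)%E.
Proof. by apply: integral_ge0 => x _; exact: poweR_ge0. Qed.

Let mS : measurable_fun setT (fun x => LP_sum x `^ (p / 2))%E.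
Proof.
apply: (@emeasurable_fun_cvg _ _ _ setT (fun J x => (H J x)%:E)).
  by move=> J; apply/measurable_EFinP; exact: mH.
by move=> x _; exact: LP_partial_cvg.
Qed.

Let nH J : (nint mu (H J) <= triebel_integral)%E.
Proof.
apply: ge0_le_integral.
- exact: measurableT.
- by move=> x _; rewrite lee_fin powR_ge0.
- by apply/measurable_EFinP; exact: mH.
- exact: mS.
- move=> x _; rewrite /H -poweR_EFin; apply: gt0_ler_poweR; rewrite ?(ltW q0)//; last exact: LP_partial_le.
  + by rewrite in_itv/= leey andbT lee_fin LP_partial_ge0.
  + by rewrite in_itv/= leey andbT; apply: esum_ge0 => j _; rewrite lee_fin LP_term_ge0.
Qed.

Let powR_half (a b : R) : 0 <= a -> a ^+ 2 <= b -> a `^ p <= b `^ (p / 2).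
Proof.
move=> a0 ab; have -> : a `^ p = (a ^+ 2) `^ (p / 2).
  by rewrite -powR_mulrn// -powRrM; congr powR; field.
apply: ge0_ler_powR; rewrite ?nnegrE ?sqr_ge0 ?(ltW q0)//.
by rewrite (le_trans _ ab)// sqr_ge0.
Qed.

Lemma triebel_ge_pieces J : (nint mu (fun x => vabs (@wu J) x `^ p)%R <= triebel_integral)%E /\
  (nint mu (fun x => vabs (@wv J) x `^ p)%R <= triebel_integral)%E.
Proof.
split; apply: le_trans (nH J); apply: le_nint => //.
- by apply: measurable_fun_powR; exact: mw.
- by move=> x; exact: powR_ge0.
- by move=> x; apply: powR_half; [exact: vnorm_ge0|rewrite lerDl sqr_ge0].
- by apply: measurable_fun_powR; exact: mw.
- by move=> x; exact: powR_ge0.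
- by move=> x; apply: powR_half; [exact: vnorm_ge0|rewrite lerDr sqr_ge0].
Qed.

(** The length of a pair is at most the sum of its two entries, whence 2^p; monotone convergence
    over the windows gives the full sum. *)
Lemma triebel_le_pieces (B : \bar R) : (0 <= B)%E ->
  (forall J, (nint mu (fun x => vabs (@wu J) x `^ p)%R <= B)%E) ->
  (forall J, (nint mu (fun x => vabs (@wv J) x `^ p)%R <= B)%E) ->
  (triebel_integral <= (2 `^ p)%:E * B)%E.
Proof.
move=> B0 hu hv.
have hH J : (nint mu (H J) <= (2 `^ p)%:E * B)%E.
  pose F (i : 'I_2) := if i == ord0 then vabs (@wu J) else vabs (@wv J).
  have mF i : measurable_fun setT (F i) by rewrite /F; case: ifP => _; exact: mw.
  have F0 i x : 0 <= F i x by rewrite /F; case: ifP => _; exact: vnorm_ge0.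
  have nF i : (nint mu (fun x => F i x `^ p)%R <= B)%E by rewrite /F; case: ifP => _.
  have := nint_powR_sum_le p1 B0 mF F0 nF; rewrite card_ord; apply: le_trans.
  apply: le_nint => //.
  - by apply: measurable_fun_powR; exact: measurable_fun_bigsum.
  - by move=> x; exact: powR_ge0.
  - move=> x; rewrite !big_ord_recl big_ord0 addr0 /F/=.
    set a := vabs (@wu J) x; set b := vabs (@wv J) x.
    have a0 : 0 <= a by exact: vnorm_ge0.
    have b0 : 0 <= b by exact: vnorm_ge0.
    have -> : (a + b) `^ p = ((a + b) ^+ 2) `^ (p / 2).
      by rewrite -powR_mulrn ?addr_ge0// -powRrM; congr powR; field.
    apply: ge0_ler_powR; rewrite ?nnegrE ?sqr_ge0 ?LP_partial_ge0 ?(ltW q0)//.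
    by rewrite /LP_partial -/a -/b sqrrD addrAC lerDl mulrn_wge0// mulr_ge0.
have cv : (fun J => nint mu (H J)) @ \oo --> triebel_integral.
  have mE J : measurable_fun setT (fun x => (H J x)%:E) by apply/measurable_EFinP; exact: mH.
  have H0 J x : setT x -> (0 <= (H J x)%:E)%E by move=> _; rewrite lee_fin powR_ge0.
  have nd x : setT x -> {homo (fun J => (H J x)%:E) : a b / (a <= b)%N >-> (a <= b)%E}.
    by move=> _ a b ab; rewrite lee_fin; exact: LP_partial_nd.
  have := @cvg_monotone_convergence _ _ R mu setT measurableT (fun J x => (H J x)%:E) mE H0 nd.
  rewrite (_ : (\int[mu]_x limn (fun J => (H J x)%:E))%E = triebel_integral)//.
  by apply: eq_integral => x _; apply/cvg_lim => //; exact: LP_partial_cvg.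
rewrite -(cvg_lim _ cv)//; apply: lime_le; first exact: cvgP cv.
by apply: nearW.
Qed.

End complex_valued.

(** * The Gagliardo integral and its real and imaginary parts *)

Section gagliardo_integrals.
Context {R : realType} {N : nat}.
Local Notation V := 'rV[R]_N.
Local Notation mu := (lebesgue_rV R N).
Variables (p : R) (f : V -> R[i]).
Hypotheses (N0 : (0 < N)%N) (p1 : 1 < p).
Let u x := complex.Re (f x).
Let v x := complex.Im (f x).
Hypotheses (mu0 : measurable_fun setT u) (mv0 : measurable_fun setT v).

Let p0 : 0 < p. Proof. by rewrite (lt_trans _ p1). Qed.

Lemma l1norm_powRN_le (a : R) (h : V) : 0 < a -> l1norm h `^ (- a) <= (enorm h `^ a)^-1.
Proof.
move=> a0; have [l0|l0] := eqVneq (l1norm h) 0.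
  (* A nonzero power of 0 is 0, also for a negative exponent, so the origin is no exception. *)
  by rewrite l0 powR0 ?oppr_eq0 ?gt_eqF// invr_ge0 powR_ge0.
have e0 : 0 < enorm h.
  rewrite lt_neqAle enorm_ge0 andbT eq_sym; apply: contra l0 => /eqP e0.
  by have := l1norm_le_enorm h; rewrite e0 mulr0 => h0; rewrite eq_le h0 l1norm_ge0.
have l1 : 0 < l1norm h := lt_le_trans e0 (enorm_le_l1norm h).
rewrite powRN lef_pV2 ?posrE ?powR_gt0//.
by apply: ge0_ler_powR; rewrite ?nnegrE ?(ltW a0) ?(ltW e0) ?(ltW l1)//; exact: enorm_le_l1norm.
Qed.

Lemma enorm_powRV_le (a : R) (h : V) : 0 < a ->
  (enorm h `^ a)^-1 <= N%:R `^ a * l1norm h `^ (- a).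
Proof.
move=> a0; have [e0|e0] := eqVneq (enorm h) 0.
  by rewrite e0 powR0 ?gt_eqF// invr0 mulr_ge0// powR_ge0.
have e1 : 0 < enorm h by rewrite lt_neqAle eq_sym e0 enorm_ge0.
have l1 : 0 < l1norm h := lt_le_trans e1 (enorm_le_l1norm h).
have N1 : 0 < N%:R `^ a :> R by rewrite powR_gt0 ?ltr0n.
have -> : N%:R `^ a * l1norm h `^ (- a) = (l1norm h `^ a / N%:R `^ a)^-1.
  by rewrite invf_div powRN.
have L0 : 0 < l1norm h `^ a by rewrite powR_gt0.
have q0 : 0 < l1norm h `^ a / N%:R `^ a by rewrite divr_gt0.
have E0 : 0 < enorm h `^ a by rewrite powR_gt0.
rewrite (lef_pV2 E0 q0) ler_pdivrMr// mulrC -powRM ?ler0n ?enorm_ge0//.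
apply: ge0_ler_powR; rewrite ?nnegrE ?(ltW a0) ?l1norm_ge0 ?mulr_ge0 ?enorm_ge0//.
exact: l1norm_le_enorm.
Qed.

Lemma measurable_enorm : measurable_fun setT (@enorm R N).
Proof.
apply: measurable_fun_sqrt; apply: measurable_fun_bigsum => i.
by apply: measurable_funX; exact: measurable_rV_coord.
Qed.

Lemma measurable_normc_powR d (T : measurableType d) (g : T -> R[i]) :
  measurable_fun setT (fun x => complex.Re (g x)) -> measurable_fun setT (fun x => complex.Im (g x)) ->
  measurable_fun setT (fun x => Normc.normc (g x) `^ p).
Proof.
move=> m1 m2; apply: measurable_fun_powR.
rewrite (_ : (fun x => _) = (fun x => Num.sqrt (complex.Re (g x) ^+ 2 + complex.Im (g x) ^+ 2))).
  by apply: measurable_fun_sqrt; apply: measurable_funD; exact: measurable_funX.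
by apply/funext => x; exact: normc_vnorm.
Qed.

Lemma ReB (z w : R[i]) : complex.Re (z - w) = complex.Re z - complex.Re w.
Proof. by case: z w => ? ? [? ?]. Qed.

Lemma ImB (z w : R[i]) : complex.Im (z - w) = complex.Im z - complex.Im w.
Proof. by case: z w => ? ? [? ?]. Qed.

Definition gagliardo_integral (s : R) : \bar R :=
  (\int[mu]_y \int[mu]_x
    (Normc.normc (f x - f y) `^ p / enorm (x - y) `^ (N%:R + s * p))%:E)%E.

Lemma gagliardoE s : gagliardo s p f = (gagliardo_integral s `^ (1 / p))%E.
Proof. by []. Qed.

Lemma gagliardo_integral_ge0 s : (0 <= gagliardo_integral s)%E.
Proof.
apply: integral_ge0 => y _; apply: integral_ge0 => x _.
by rewrite lee_fin mulr_ge0 ?invr_ge0 ?powR_ge0.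
Qed.

Variable s : R.
Hypotheses (s0 : 0 <= s) (s1 : s <= 1).
Local Notation a := (N%:R + s * p).

Let a0 : 0 < a.
Proof. by rewrite ltr_wpDr ?ltr0n// mulr_ge0// ltW. Qed.

Let jump (h x : V) : R := Normc.normc (f (x + h) - f x) `^ p.

Let mjump : measurable_fun setT (fun q : V * V => jump q.1 q.2).
Proof.
have e (g : V -> R) : measurable_fun setT g -> measurable_fun setT (fun q : V * V => g (q.2 + q.1) - g q.2).
  by move=> mg; apply: measurable_funB; [apply: (measurableT_comp mg); apply: measurable_rVD|exact: (measurableT_comp mg)].
apply: measurable_normc_powR.
  by under eq_fun do rewrite ReB; exact: (e _ mu0).
by under eq_fun do rewrite ImB; exact: (e _ mv0).
Qed.

Let mjumph h : measurable_fun setT (jump h).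
Proof. exact: (measurable_uncurry1 h mjump). Qed.

Let jump0 h x : 0 <= jump h x. Proof. exact: powR_ge0. Qed.

Let nj (h : V) : \bar R := nint mu (jump h).

Let mnj : measurable_fun setT nj.
Proof. exact: (@measurable_nint _ _ _ V V mu jump mjump jump0). Qed.

Let nj0 h : (0 <= nj h)%E. Proof. exact: nint_ge0. Qed.

Lemma gagliardo_integral_shift : gagliardo_integral s =
  (\int[mu]_h (((enorm h `^ a)^-1)%:E * nj h))%E.
Proof.
pose F (x y : V) : R := Normc.normc (f x - f y) `^ p / enorm (x - y) `^ a.
have F0 x y : 0 <= F x y by rewrite mulr_ge0 ?invr_ge0 ?powR_ge0.
have mF : measurable_fun setT (fun q : V * V => F q.1 q.2).
  have e (g : V -> R) : measurable_fun setT g -> measurable_fun setT (fun q : V * V => g q.1 - g q.2).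
    by move=> mg; apply: measurable_funB; exact: (measurableT_comp mg).
  apply: measurable_funM.
    apply: measurable_normc_powR.
      by under eq_fun do rewrite ReB; exact: (e _ mu0).
    by under eq_fun do rewrite ImB; exact: (e _ mv0).
  rewrite (_ : (fun q => _) = (fun q : V * V => enorm (q.1 - q.2) `^ (- a))).
    apply: measurable_fun_powR; apply: (measurableT_comp measurable_enorm).
    exact: measurable_rVB.
  by apply/funext => q; rewrite powRN.
rewrite /gagliardo_integral (double_integral_shift mF F0); apply: eq_integral => h _.
have e0 : 0 <= (enorm h `^ a)^-1 by rewrite invr_ge0 powR_ge0.
rewrite -(nintZ mu (mjumph h) e0 (jump0 h)); apply: eq_integral => x _.
by rewrite /F /jump [x + h - x]addrAC subrr add0r mulrC.
Qed.

Let minc (g : V -> R) : measurable_fun setT g ->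
  measurable_fun setT (fun h => (l1norm h `^ (- a))%:E * increment p g h)%E.
Proof.
move=> mg; apply: emeasurable_funM; last exact: measurable_increment.
by apply/measurable_EFinP; exact: measurable_l1norm_powR.
Qed.

Let inc0 (g : V -> R) h : (0 <= (l1norm h `^ (- a))%:E * increment p g h)%E.
Proof. by apply: mule_ge0; [rewrite lee_fin powR_ge0|exact: increment_ge0]. Qed.

Let mweight : measurable_fun setT (fun h => ((enorm h `^ a)^-1)%:E * nj h)%E.
Proof.
apply: emeasurable_funM; last exact: mnj; apply/measurable_EFinP.
rewrite (_ : (fun h => _) = (fun h : V => enorm h `^ (- a))).
  by apply: measurable_fun_powR; exact: measurable_enorm.
by apply/funext => h; rewrite powRN.
Qed.

Let weight0 h : (0 <= ((enorm h `^ a)^-1)%:E * nj h)%E.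
Proof. by apply: mule_ge0 => //; rewrite lee_fin invr_ge0 powR_ge0. Qed.

Let mD (g : V -> R) (h : V) : measurable_fun setT g ->
  measurable_fun setT (fun x : V => `|g (x + h) - g x| `^ p).
Proof.
move=> mg; apply: measurable_fun_powR; apply: measurable_fun_normr; apply: measurable_funB => //.
by apply: (measurableT_comp mg); apply: measurable_rVD; [exact: measurable_id|exact: measurable_cst].
Qed.

Let fractional_le_gagliardo (g : V -> R) : measurable_fun setT g ->
  (forall x y, `|g x - g y| <= Normc.normc (f x - f y)) ->
  (fractional a p g <= gagliardo_integral s)%E.
Proof.
move=> mg hg; rewrite gagliardo_integral_shift /fractional; apply: ge0_le_integral.
- exact: measurableT.
- by move=> h _; exact: inc0.
- exact: minc.
- exact: mweight.
- move=> h _; apply: lee_pmul; [by rewrite lee_fin powR_ge0|exact: increment_ge0|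
    by rewrite lee_fin; exact: l1norm_powRN_le|].
  apply: le_nint; [exact: mD|exact: mjumph|by move=> x; exact: powR_ge0|move=> x].
  by apply: ge0_ler_powR; rewrite ?nnegrE ?(ltW p0) ?normc_ge0'.
Qed.

Lemma fractional_Re_le : (fractional a p u <= gagliardo_integral s)%E.
Proof.
by apply: fractional_le_gagliardo => // x y; rewrite /u -ReB; exact: Re_le_normc.
Qed.

Lemma fractional_Im_le : (fractional a p v <= gagliardo_integral s)%E.
Proof.
by apply: fractional_le_gagliardo => // x y; rewrite /v -ImB; exact: Im_le_normc.
Qed.

(** The l1 norm is at most N times the Euclidean one, and the exponent N + s p is at most N + p,
    which makes the constant independent of s; 2^(p-1) comes from adding real and imaginary
    parts. *)
Lemma gagliardo_le_fractional : (gagliardo_integral s <=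
  (N%:R `^ (N%:R + p) * 2 `^ (p - 1))%:E * (fractional a p u + fractional a p v))%E.
Proof.
have N1 : 1 <= N%:R :> R by rewrite ler1n.
have c0 : 0 <= N%:R `^ (N%:R + p) :> R by exact: powR_ge0.
have d0 : 0 <= 2 `^ (p - 1) :> R by exact: powR_ge0.
have C0 : (0 <= (N%:R `^ (N%:R + p) * 2 `^ (p - 1) : R)%:E)%E by rewrite lee_fin mulr_ge0.
rewrite gagliardo_integral_shift /fractional 
  -(@ge0_integralD _ _ R mu setT measurableT _ _ (fun h _ => inc0 u h) (minc mu0) (fun h _ => inc0 v h) (minc mv0)).
have mS : measurable_fun setT (fun h => (l1norm h `^ (- a))%:E * increment p u h +
  (l1norm h `^ (- a))%:E * increment p v h)%E by apply: emeasurable_funD; exact: minc.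
have S0 h : setT h -> (0 <= (l1norm h `^ (- a))%:E * increment p u h +
  (l1norm h `^ (- a))%:E * increment p v h)%E by move=> _; apply: adde_ge0; exact: inc0.
rewrite -(@ge0_integralZl _ _ R mu setT measurableT _ mS _ S0 C0).
apply: ge0_le_integral.
- exact: measurableT.
- by move=> h _; exact: weight0.
- exact: mweight.
- by apply: emeasurable_funM; [exact: measurable_cst|exact: mS].
- move=> h _; rewrite -ge0_muleDr ?increment_ge0// muleA.
  have w0 : 0 <= l1norm h `^ (- a) by exact: powR_ge0.
  rewrite -EFinM mulrAC EFinM -muleA; apply: lee_pmul => //.
  + by rewrite lee_fin invr_ge0 powR_ge0.
  + rewrite lee_fin (le_trans (enorm_powRV_le h a0))// ler_wpM2r// ler_powR//.
    by rewrite lerD2l ler_piMl// ltW.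
  have mm : measurable_fun setT (fun x : V => `|u (x + h) - u x| `^ p + `|v (x + h) - v x| `^ p).
    by apply: measurable_funD; exact: mD.
  have mm0 (x : V) : 0 <= `|u (x + h) - u x| `^ p + `|v (x + h) - v x| `^ p.
    by rewrite addr_ge0 ?powR_ge0.
  have e1 := nintD mu (@mD u h mu0) (@mD v h mv0) (fun x => powR_ge0 _ _) (fun x => powR_ge0 _ _).
  rewrite /increment -e1 -(nintZ mu mm d0 mm0).
  apply: le_nint; [exact: mjumph|by apply: measurable_funM; [exact: measurable_cst|]|exact: jump0|move=> x].
  apply: le_trans (powRD_le p1 _ _) => //.
  apply: ge0_ler_powR; rewrite ?nnegrE ?(ltW p0) ?normc_ge0' ?addr_ge0//.
  by rewrite /u /v -ReB -ImB; exact: normc_le_ReIm.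
Qed.

End gagliardo_integrals.

Section lebesgue_norms.
Context {R : realType} {N : nat}.
Local Notation V := 'rV[R]_N.
Local Notation mu := (lebesgue_rV R N).
Variables (p : R) (f : V -> R[i]).
Hypothesis (p1 : 1 < p).

Let p0 : 0 < p. Proof. by rewrite (lt_trans _ p1). Qed.

Definition Lp_integral : \bar R := nint mu (fun x => Normc.normc (f x) `^ p).

Lemma LpNormE : LpNorm p f = (Lp_integral `^ (1 / p))%E.
Proof.
rewrite /LpNorm unlock div1r; congr poweR; apply: eq_integral => x _.
by rewrite abse_EFin ger0_norm ?normc_ge0'.
Qed.

Lemma Lp_integral_ge0 : (0 <= Lp_integral)%E.
Proof. by apply: nint_ge0 => x; exact: powR_ge0. Qed.

Hypotheses (mu0 : measurable_fun setT (fun x => complex.Re (f x)))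
  (mv0 : measurable_fun setT (fun x => complex.Im (f x))).

Lemma nint_Re_powR_le : (nint mu (fun x => `|complex.Re (f x)| `^ p)%R <= Lp_integral)%E.
Proof.
apply: le_nint.
- by apply: measurable_fun_powR; exact: measurable_fun_normr.
- exact: measurable_normc_powR.
- by move=> x; exact: powR_ge0.
- by move=> x; apply: ge0_ler_powR; rewrite ?nnegrE ?(ltW p0) ?normc_ge0'//; exact: Re_le_normc.
Qed.

Lemma nint_Im_powR_le : (nint mu (fun x => `|complex.Im (f x)| `^ p)%R <= Lp_integral)%E.
Proof.
apply: le_nint.
- by apply: measurable_fun_powR; exact: measurable_fun_normr.
- exact: measurable_normc_powR.
- by move=> x; exact: powR_ge0.
- by move=> x; apply: ge0_ler_powR; rewrite ?nnegrE ?(ltW p0) ?normc_ge0'//; exact: Im_le_normc.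
Qed.

End lebesgue_norms.

(** * Both inequalities for p-th powers *)

Section integral_comparisons.
Context {R : realType} {N : nat}.
Local Notation V := 'rV[R]_N.
Local Notation mu := (lebesgue_rV R N).
Variables (eta : V -> R) (p : R).
Hypotheses (N0 : (0 < N)%N) (LPeta : littlewood_paley eta) (p1 : 1 < p).

Lemma powR_inv (x q : R) : 0 < x -> x^-1 `^ q = 1 / x `^ q.
Proof. by move=> x0; rewrite -(powR_inv1 (ltW x0)) -powRrM mulN1r powRN div1r. Qed.

Let p0 : 0 < p. Proof. by rewrite (lt_trans _ p1). Qed.

Lemma gagliardo_integral_le : exists C : R, 0 < C /\
  forall r s t (f : V -> R[i]), 0 <= r -> r < s -> s < t -> t <= 1 -> schwartz f ->
  (gagliardo_integral p f s <= C%:E * (((s - r)^-1)%:E * triebel_integral eta p f r +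
     ((t - s)^-1)%:E * triebel_integral eta p f t))%E.
Proof.
have [phi [Sphi phi1 eta_phi eta0 eta_rep]] := littlewood_paley_structure LPeta.
have [Seta _ _] := LPeta.
have [K [K0 hK]] := increment_bound N0 p1 Seta eta0 eta_rep (schwartz_bL1 Sphi) phi1 eta_phi.
pose M := K * (2 ^+ N * @unit_ball_mass R N * (2 + p)).
have M0 : 0 <= M.
  rewrite /M; apply: mulr_ge0; first exact: ltW.
  apply: mulr_ge0; last by rewrite addr_ge0// ltW.
  by apply: mulr_ge0; [exact: exprn_ge0|exact: unit_ball_mass_ge0].
pose c : R := N%:R `^ (N%:R + p) * 2 `^ (p - 1).
have c0 : 0 <= c by rewrite /c mulr_ge0 ?powR_ge0.
have C0 : 0 < c * (M + M) + 1 by rewrite ltr_wpDl// mulr_ge0// addr_ge0.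
exists (c * (M + M) + 1); split=> // r s t f r0 rs st t1 Sf.
have s0 : 0 <= s by rewrite ltW// (le_lt_trans r0).
have s1 : s <= 1 by rewrite ltW// (lt_le_trans st).
have r1 : 0 <= r <= 1 by rewrite r0 (le_trans (ltW rs)).
have t01 : 0 <= t <= 1 by rewrite t1 andbT (le_trans s0)// ltW.
have a0 : 0 < (s - r)^-1 by rewrite invr_gt0 subr_gt0.
have b0 : 0 < (t - s)^-1 by rewrite invr_gt0 subr_gt0.
have tr0 q : (0 <= triebel_integral eta p f q)%E by exact: triebel_integral_ge0.
have hr := @triebel_ge_pieces R N eta p f p1 Seta Sf r r0.
have ht := @triebel_ge_pieces R N eta p f p1 Seta Sf t (andP t01).1.
have [Su Sv] := Sf.
have su := @schwartz_scont _ _ _ [::] Su; have sv := @schwartz_scont _ _ _ [::] Sv.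
have bu := schwartz_bL1 Su; have bv := schwartz_bL1 Sv.
have := tr0 t; have := tr0 r.
(* An infinite integral makes the right-hand side infinite; in the remaining case [fractional_le]
   receives real bounds. *)
case: (triebel_integral eta p f r) hr => [x| |] hr// x0; last first.
  rewrite gt0_muley ?lte_fin// => y0; rewrite addye ?gt0_muley ?lte_fin ?leey//.
  by rewrite -ltNye (lt_le_trans (ltNyr 0))// mule_ge0// lee_fin ltW.
case: (triebel_integral eta p f t) ht => [y| |] ht// y0; last first.
  by rewrite gt0_muley ?lte_fin// addey ?gt0_muley ?lte_fin ?leey.
move: x0 y0; rewrite !lee_fin => x0 y0.
have hg (g : V -> R) : bL1 g -> scont g ->
    (forall J, (nint mu (fun x0 : V => vabs (@weighted_pieces R N eta (2 * J).+1 (2 ^+ J)^-1 r g) x0 `^ p)%R <= x%:E)%E) ->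
    (forall J, (nint mu (fun x0 : V => vabs (@weighted_pieces R N eta (2 * J).+1 (2 ^+ J)^-1 t g) x0 `^ p)%R <= y%:E)%E) ->
    (fractional (N%:R + s * p) p g <= (M * (x / (s - r) + y / (t - s)))%:E)%E.
  move=> bg sg gr gt; apply: fractional_le => //; first exact: ltW.
  - exact: scont_measurable.
  - by move=> h; rewrite EFinM; exact: (hK g h r x%:E bg sg r1 gr).
  - by move=> h; rewrite EFinM; exact: (hK g h t y%:E bg sg t01 gt).
have fu := hg _ bu su (fun J => (hr J).1) (fun J => (ht J).1).
have fv := hg _ bv sv (fun J => (hr J).2) (fun J => (ht J).2).
have := gagliardo_le_fractional N0 p1 (scont_measurable su) (scont_measurable sv) s0 s1.
move/le_trans; apply.
have c0' : (0 <= c%:E)%E by rewrite lee_fin.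
apply: le_trans (lee_wpmul2l c0' (leeD fu fv)) _.
set X := x / (s - r) + y / (t - s).
have X0 : 0 <= X by rewrite addr_ge0// mulr_ge0// ltW.
have -> : (((s - r)^-1)%:E * x%:E + ((t - s)^-1)%:E * y%:E = X%:E)%E.
  by rewrite /X [x / _]mulrC [y / _]mulrC.
apply: (@le_trans _ _ (c * (M * X + M * X))%:E); first by rewrite EFinM.
by rewrite -mulrDl mulrA -EFinM lee_fin ler_wpM2r// lerDl.
Qed.

(** The condition on r is the form in which the exponent rbar enters: 1 - r >= 1 - rbar = Lam (1 -
    s). *)
Lemma triebel_integral_le (Lam : R) : 1 < Lam -> exists C : R, 0 < C /\
  forall s r (f : V -> R[i]), 0 <= s -> s < 1 -> 0 <= r -> Lam * (1 - s) <= 1 - r -> schwartz f ->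
  (triebel_integral eta p f r <= C%:E * (Lp_integral p f + (1 - s)%:E * gagliardo_integral p f s))%E.
Proof.
move=> Lam1; have [phi [Sphi phi1 eta_phi eta0 eta_rep]] := littlewood_paley_structure LPeta.
have [Seta eta_even _] := LPeta.
have [K [K0 hK]] := pieces_bound N0 p1 Seta eta0 eta_even Sphi phi1 Lam1.
exists (2 `^ p * K); split=> [|s r f s0 s1 r0 Lr Sf]; first by rewrite mulr_gt0// powR_gt0.
have [Su Sv] := Sf.
have su := @schwartz_scont _ _ _ [::] Su; have sv := @schwartz_scont _ _ _ [::] Sv.
have bu := schwartz_bL1 Su; have bv := schwartz_bL1 Sv.
have mu0 := scont_measurable su; have mv0 := scont_measurable sv.
have d0 : (0 <= (1 - s)%:E)%E by rewrite lee_fin subr_ge0 ltW.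
have k0 : (0 <= K%:E)%E by rewrite lee_fin ltW.
have B0 : (0 <= K%:E * (Lp_integral p f + (1 - s)%:E * gagliardo_integral p f s))%E.
  apply: mule_ge0 => //; apply: adde_ge0; first exact: Lp_integral_ge0.
  by apply: mule_ge0 => //; exact: gagliardo_integral_ge0.
have hg (g : V -> R) J : bL1 g -> scont g ->
    (nint mu (fun x : V => `|g x| `^ p)%R <= Lp_integral p f)%E ->
    (fractional (N%:R + s * p) p g <= gagliardo_integral p f s)%E ->
    (nint mu (fun x : V => vabs (@weighted_pieces R N eta (2 * J).+1 (2 ^+ J)^-1 r g) x `^ p)%R <=
      K%:E * (Lp_integral p f + (1 - s)%:E * gagliardo_integral p f s))%E.
  move=> bg sg n1 n2; apply: le_trans (hK J s r g s0 s1 r0 Lr bg sg) _.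
  by apply: lee_wpmul2l => //; apply: leeD => //; exact: lee_wpmul2l.
rewrite EFinM -muleA; apply: (triebel_le_pieces p1 Seta Sf r0 B0) => J.
  apply: hg => //; first exact: nint_Re_powR_le.
  exact: fractional_Re_le.
apply: hg => //; first exact: nint_Im_powR_le.
exact: fractional_Im_le.
Qed.

End integral_comparisons.

Theorem theorem1p6 (R : realType) (N : nat) (hN : (1 <= N)%N)
    (eta : 'rV[R]_N -> R) (heta : littlewood_paley eta)
    (p : R) (hp : 1 < p) :
  (exists C : R, 0 < C /\
     forall r s t : R, 0 <= r -> r < s -> s < t -> t <= 1 ->
     forall f : 'rV[R]_N -> R[i], schwartz f ->
     (gagliardo s p f <=
       C%:E * ((1 / (s - r) `^ (1 / p))%:E * triebel_lizorkin eta r p 2 f +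
               (1 / (t - s) `^ (1 / p))%:E * triebel_lizorkin eta t p 2 f))%E)
  /\
  (forall Lambda : R, 1 < Lambda ->
   exists C : R, 0 < C /\
     forall s rbar r : R,
       1 - 1 / (2 * Lambda) <= s -> s < 1 ->
       0 < rbar -> rbar < s -> 1 - rbar = Lambda * (1 - s) ->
       0 <= r -> r <= rbar ->
     forall f : 'rV[R]_N -> R[i], schwartz f ->
     (triebel_lizorkin eta r p 2 f <=
       C%:E * (LpNorm p f + ((1 - s) `^ (1 / p))%:E * gagliardo s p f))%E).
Proof.
split.
  have [C [C0 h]] := gagliardo_integral_le hN heta hp.
  (* Taking p-th roots of the integral estimate turns C into C^(1/p) and 1 / (s - r) into its p-th
     root; subadditivity of the root separates the two terms. *)
  exists (C `^ (1 / p)); split=> [|r s t r0 rs st t1 f Sf]; first exact: powR_gt0.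
  have a0 : 0 < s - r by rewrite subr_gt0.
  have b0 : 0 < t - s by rewrite subr_gt0.
  have tr q : (0 <= triebel_integral eta p f q)%E by exact: triebel_integral_ge0.
  have A0 : (0 <= ((s - r)^-1)%:E)%E by rewrite lee_fin invr_ge0 ltW.
  have B0 : (0 <= ((t - s)^-1)%:E)%E by rewrite lee_fin invr_ge0 ltW.
  have G0 := gagliardo_integral_ge0 p f s.
  rewrite gagliardoE !triebelE -(powR_inv _ a0) -(powR_inv _ b0) -!poweR_EFin.
  rewrite -(poweRM _ A0 (tr r)) -(poweRM _ B0 (tr t)).
  exact: (poweR_inv_le hp C0 G0 (mule_ge0 A0 (tr r)) (mule_ge0 B0 (tr t)) (h r s t f r0 rs st t1 Sf)).
move=> Lam Lam1; have [C [C0 h]] := triebel_integral_le hN heta hp Lam1.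
exists (C `^ (1 / p)); split=> [|s rbar r _ s1 rb0 rbs rbE r0 rrb f Sf]; first exact: powR_gt0.
have s0 : 0 <= s by rewrite ltW// (lt_trans rb0).
have D0 : (0 <= (1 - s)%:E)%E by rewrite lee_fin subr_ge0 ltW.
have G0 := gagliardo_integral_ge0 p f s.
have Lr : Lam * (1 - s) <= 1 - r by rewrite -rbE lerD2l lerN2.
have T0 : (0 <= triebel_integral eta p f r)%E by exact: triebel_integral_ge0.
rewrite gagliardoE triebelE (LpNormE p f) -poweR_EFin -(poweRM _ D0 G0).
exact: (poweR_inv_le hp C0 T0 (Lp_integral_ge0 p f) (mule_ge0 D0 G0) (h s r f s0 s1 r0 Lr Sf)).
Qed.
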